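(* Let $\{\mathbb{X}(p)\}_p$ be independent random variables indexed by primes $p$, where for $p\equiv 2\pmod 3$ or $p=3$, $\mathbb{X}(p)$ takes each of the values $1,\omega_3,\omega_3^2$ with probability $1/3$ (and the value $0$ with probability $0$), and for $p\equiv 1\pmod 3$, $\mathbb{X}(p)=0$ with probability $\frac{2}{p+2}$ and $\mathbb{X}(p)$ takes each of the values $1,\omega_3,\omega_3^2$ with probability $\frac{p}{3(p+2)}$. Let $L(1,\mathbb{X})=\prod_p\left(1-\frac{\mathbb{X}(p)}{p}\right)^{-1}$ (almost surely convergent), and for $\tau>0$ set $$\Phi(\tau)=\mathbb{P}\left(|L(1,\mathbb{X})|>e^\gamma\tau\right),\qquad \Psi(\tau)=\mathbb{P}\left(|L(1,\mathbb{X})|<\left(\frac{\zeta(3)}{e^\gamma}\right)^{1/2}\frac{1}{\tau}\right).$$ Then for large $\tau$, $$\Phi(\tau)=\exp\left(-\frac{2e^{\tau-C_{\max}}}{\tau}\left(1+O(\tau^{-1})\right)\right),\qquad \Psi(\tau)=\exp\left(-\frac{e^{\tau^2-C_{\min}}}{\tau^2}\left(1+O(\tau^{-1})\right)\right),$$ where $$C_{\max}=\frac12\left(\int_0^1 \frac{2e^{2t}-2e^{-t}}{t(e^{2t}+2e^{-t})}\,dt+\int_1^\infty \frac{-6}{t(e^{3t}+2)}\,dt\right)\approx 0.98727,$$ $$C_{\min}=\int_{0}^1 \frac{2e^{t}-2e^{-2t}}{t(e^{-2t}+2e^{t})}\,dt +\int_1^{\infty} \frac{-3e^{-2t}}{t(e^{-2t}+2e^{t})}\,dt\approx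 1.40459.$$
   Context: $\omega_3=e^{2\pi i/3}$; $\gamma$ is the Euler–Mascheroni constant. *)

(* Defs.v *)
From HB Require Import structures.
From mathcomp Require Import all_boot all_order all_algebra.
From mathcomp Require Import all_classical all_reals all_analysis.
From mathcomp Require Import complex.
Set Implicit Arguments. Unset Strict Implicit. Unset Printing Implicit Defensive.
Import Order.TTheory GRing.Theory Num.Theory.
Import numFieldNormedType.Exports.
Local Open Scope classical_set_scope.
Local Open Scope ring_scope.

Definition omega3 {R : realType} : R[i] :=
  Complex (cos (2 * pi / 3)) (sin (2 * pi / 3)).

Definition cmod {R : realType} (z : R[i]) : R := Normc.normc z.

Definition euler_gamma {R : realType} : R :=
  lim ((fun n : nat => \sum_(0 <= k < n) (k.+1%:R : R)^-1 - ln (n%:R : R) : R) @ \oo).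

Definition zeta3 {R : realType} : R :=
  lim ((fun N : nat => \sum_(1 <= n < N) ((n%:R : R) ^+ 3)^-1 : R) @ \oo).

Definition indep_primes {R : realType} d (T : measurableType d)
  (P : probability T R) (X : nat -> T -> R[i]) : Prop :=
  forall (s : seq nat) (v : nat -> R[i]), uniq s -> all prime s ->
    P (\bigcap_(p in [set` s]) (X p @^-1` [set v p])) =
    (\prod_(p <- s) P (X p @^-1` [set v p]))%E.

Definition partialL {R : realType} d (T : measurableType d)
  (X : nat -> T -> R[i]) (N : nat) (w : T) : R :=
  cmod (\prod_(p < N | prime p) (1 - X p w / Complex (p%:R) 0)^-1).

(* |L(1,X)(w)|, as the limit of the partial products; defined as the limsup,
   which coincides with the limit wherever the product converges (a.s.) *)
Definition absL {R : realType} d (T : measurableType d)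
  (X : nat -> T -> R[i]) (w : T) : \bar R :=
  limn_esup (fun N => (partialL X N w)%:E).

Definition Cmax {R : realType} : R :=
  2^-1 * (Rintegral lebesgue_measure `]0, 1]
            (fun t => (2 * expR (2 * t) - 2 * expR (- t)) /
                      (t * (expR (2 * t) + 2 * expR (- t))))
        + Rintegral lebesgue_measure `[1, +oo[
            (fun t => - 6 / (t * (expR (3 * t) + 2)))).

Definition Cmin {R : realType} : R :=
  Rintegral lebesgue_measure `]0, 1]
      (fun t => (2 * expR t - 2 * expR (- 2 * t)) /
                (t * (expR (- 2 * t) + 2 * expR t)))
  + Rintegral lebesgue_measure `[1, +oo[
      (fun t => - 3 * expR (- 2 * t) / (t * (expR (- 2 * t) + 2 * expR t))).

(* Main.v *)
Require Import Defs.
From HB Require Import structures.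
From mathcomp Require Import all_boot all_order all_algebra.
From mathcomp Require Import all_classical all_reals all_analysis measurable_realfun.
From mathcomp Require Import complex ring lra zify.
Import Order.TTheory GRing.Theory Num.Theory.
Import numFieldNormedType.Exports.
Local Open Scope classical_set_scope.
Local Open Scope ring_scope.
Set Implicit Arguments. Unset Strict Implicit. Unset Printing Implicit Defensive.

(** Twice the logarithm of the random Euler product, up to sign, is a sum S of independent
variables indexed by primes. The factor of S at p, tilted by exp (k S), has mean close to
H_p w(k / p), where w(t) = (1 - e^(-3 t)) / (1 + rho e^(-3 t)) and the sum of H_p over p <= y
is c_H (log log y + Gamma) + O(1 / log^2 y). Partial summation gives the derivative of the
log-Laplace transform of S as c_H (log log k + Gamma + C / log k) + O(1 / log^2 k), C being
the regularised integral of w(t) / t, hence the transform itself. Chernoff's bound at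
k = e^(tau - C) gives the upper bounds; tilting at e^(tau - C + B / tau) and Chebyshev's
inequality give the lower ones. Kolmogorov's maximal inequality controls the tail of the
product uniformly, hence the upper limit.

The sharp form of Mertens' theorem comes from the behaviour of zeta on Re s = 1: the inequality
3 + 4 cos + cos 2 >= 0 bounds 1 / zeta polylogarithmically there, so the second derivative of
zeta' / zeta, corrected at its pole, has a Fourier transform which bounds smoothed sums over
primes weighted by log^3 p; two summations by parts remove the weights. Comparing Laplace
transforms with the harmonic series identifies the constant with Euler's. *)

(** * Derivatives, complex numbers and exponentials *)

(** An error O(1 / tau) relative to an exponent of size e^tau / tau requires the mean of the tilted
    sum up to O(1 / log^2 k), one order beyond the term that carries C. With an error O(1 / log) in
    Mertens' theorem C itself would be lost; this is what brings in zeta near the line Re s = 1. No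
    analytic continuation is used: zeta lives on Re s > 1 as a limit of partial sums, all bounds are
    uniform as Re s tends to 1, and the abscissa reaches 1 only inside finite sums over primes. The
    weight log^3 gives the room needed: the Fourier argument controls weighted sums up to O(log),
    and division by log^3 leaves O(1 / log^2). The two tails are instances of one estimate. Up to
    O(1 / p^2), the variable at p takes the values 2 / p and - 1 / p with masses 1 : 2 in the upper
    tail, and 1 / p and - 2 / p with masses 1 : 1/2 in the lower one. Hence rho = 2 or 1/2, and the
    lower tail is read at tau^2 in place of tau. *)

Definition dv {R : realType} (f : R -> R) (x d : R) := is_derive x (1 : R) f d.

Lemma dv_eq {R : realType} (f : R -> R) x d d' : dv f x d -> d = d' -> dv f x d'.
Proof. by move=> ? <-. Qed.

Lemma dv_cst {R : realType} (c x : R) : dv (fun=> c) x 0.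
Proof. exact: is_derive_cst. Qed.

Lemma dv_id {R : realType} (x : R) : dv (fun y => y) x 1.
Proof. exact: is_derive_id. Qed.

Lemma dvD {R : realType} (f g : R -> R) x a b :
  dv f x a -> dv g x b -> dv (fun y => f y + g y) x (a + b).
Proof. by move=> ? ?; exact: is_deriveD. Qed.

Lemma dvN {R : realType} (f : R -> R) x a : dv f x a -> dv (fun y => - f y) x (- a).
Proof. by move=> ?; exact: is_deriveN. Qed.

Lemma dvM {R : realType} (f g : R -> R) x a b :
  dv f x a -> dv g x b -> dv (fun y => f y * g y) x (a * g x + f x * b).
Proof.
move=> df dg; have := is_deriveM df dg.
by move/dv_eq; apply; rewrite addrC [in RHS]mulrC.
Qed.

Lemma dvX {R : realType} (f : R -> R) n x a :
  dv f x a -> dv (fun y => f y ^+ n) x (n%:R * f x ^+ n.-1 * a).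
Proof.
move=> df; elim: n => [|n IH].
  by under [X in dv X]eq_fun do rewrite expr0; apply: dv_eq (dv_cst _ _) _; rewrite !mul0r.
under [X in dv X]eq_fun do rewrite exprS; apply: dv_eq (dvM df IH) _.
by case: n {IH} => [|n] /=; rewrite ?exprS -?natr1; ring.
Qed.

Lemma dvV {R : realType} (f : R -> R) x a : f x != 0 ->
  dv f x a -> dv (fun y => (f y)^-1) x (- (f x ^- 2) * a).
Proof. by move=> f0 df; exact: (is_deriveV f0 df). Qed.

Lemma dv_comp {R : realType} (g f : R -> R) x a b :
  dv g (f x) b -> dv f x a -> dv (fun y => g (f y)) x (b * a).
Proof. by move=> dg df; exact: (is_derive1_comp dg df). Qed.

Lemma dv_exp {R : realType} (f : R -> R) x a :
  dv f x a -> dv (fun y => expR (f y)) x (expR (f x) * a).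
Proof. by apply: dv_comp; exact: is_derive_expR. Qed.

Lemma dv_ln {R : realType} (f : R -> R) x a : 0 < f x ->
  dv f x a -> dv (fun y => ln (f y)) x ((f x)^-1 * a).
Proof. by move=> f0; apply: dv_comp; exact: is_derive1_ln. Qed.

Lemma dv_cos {R : realType} (f : R -> R) x a :
  dv f x a -> dv (fun y => cos (f y)) x (- sin (f x) * a).
Proof. by apply: dv_comp; exact: is_derive_cos. Qed.

Lemma dv_sin {R : realType} (f : R -> R) x a :
  dv f x a -> dv (fun y => sin (f y)) x (cos (f x) * a).
Proof. by apply: dv_comp; exact: is_derive_sin. Qed.

Lemma dv_atan {R : realType} (f : R -> R) x a :
  dv f x a -> dv (fun y => atan (f y)) x ((1 + f x ^+ 2)^-1 * a).
Proof. by apply: dv_comp; exact: is_derive1_atan. Qed.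

Lemma dv_sum {R : realType} I (r : seq I) (P : pred I) (f : I -> R -> R) (d : I -> R) x :
  (forall i, P i -> dv (f i) x (d i)) ->
  dv (fun y => \sum_(i <- r | P i) f i y) x (\sum_(i <- r | P i) d i).
Proof.
move=> H; elim: r => [|i r IH].
  by under [X in dv X]eq_fun do rewrite big_nil; rewrite big_nil; exact: dv_cst.
under [X in dv X]eq_fun do rewrite big_cons; rewrite big_cons.
by case: ifPn => // Pi; apply: dvD IH; exact: H.
Qed.

(** The cases from [@GRing.opp] on catch bodies that appear eta-reduced; the conditions of [dvV] and
    [dv_ln] are left as goals. *)
Ltac dstep := first [apply: dv_id | apply: dv_cst | lazymatch goal with
  | |- dv (fun y => _ + _) _ _ => apply: dvD
  | |- dv (fun y => - _) _ _ => apply: dvN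
  | |- dv (fun y => _ * _) _ _ => apply: dvM
  | |- dv (fun y => _ ^+ _) _ _ => apply: dvX
  | |- dv (fun y => _ ^-1) _ _ => apply: dvV
  | |- dv (fun y => expR _) _ _ => apply: dv_exp
  | |- dv (fun y => ln _) _ _ => apply: dv_ln
  | |- dv (fun y => cos _) _ _ => apply: dv_cos
  | |- dv (fun y => sin _) _ _ => apply: dv_sin
  | |- dv (fun y => atan _) _ _ => apply: dv_atan
  | |- dv (@GRing.opp _) _ _ => apply: (@dvN _ (fun y => y))
  | |- dv (@GRing.inv _) _ _ => apply: (@dvV _ (fun y => y))
  | |- dv (@expR _) _ _ => apply: (@dv_exp _ (fun y => y))
  | |- dv (@ln _) _ _ => apply: (@dv_ln _ (fun y => y))
  | |- dv (@cos _) _ _ => apply: (@dv_cos _ (fun y => y))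
  | |- dv (@sin _) _ _ => apply: (@dv_sin _ (fun y => y))
  | |- dv (@atan _) _ _ => apply: (@dv_atan _ (fun y => y))
  end].

Ltac der := apply: dv_eq; [repeat first [dstep | lazymatch goal with
  | |- dv ( *%R ?c) _ _ => apply: (@dvM _ (fun=> c) (fun y => y))
  | |- dv (+%R ?c) _ _ => apply: (@dvD _ (fun=> c) (fun y => y)) end] | ]; cbv beta.

Lemma dv_continuous {R : realType} (f : R -> R) x d : dv f x d -> {for x, continuous f}.
Proof. by move=> [df _]; apply: differentiable_continuous; exact/derivable1_diffP. Qed.

Lemma dv_within {R : realType} (f df : R -> R) (A : set R) :
  (forall x, A x -> dv f x (df x)) -> {within A, continuous f}.
Proof.
move=> H; apply: continuous_in_subspaceT => x; rewrite inE => Ax.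
exact: dv_continuous (H _ Ax).
Qed.

Lemma dv_MVT {R : realType} (f df : R -> R) a b : a <= b ->
  (forall x, a <= x <= b -> dv f x (df x)) ->
  exists2 c, a <= c <= b & f b - f a = df c * (b - a).
Proof.
move=> ab H; have [] := @MVT_segment R f df a b ab.
- by move=> x; rewrite in_itv/= => /andP[ax xb]; apply: H; rewrite !ltW.
- by apply: (dv_within (df := df)) => x /=; rewrite in_itv/=; exact: H.
- by move=> c; rewrite in_itv/=; exists c.
Qed.

Lemma dv_lipschitz {R : realType} (f df : R -> R) a b M : a <= b ->
  (forall x, a <= x <= b -> dv f x (df x)) ->
  (forall x, a <= x <= b -> `|df x| <= M) ->
  `|f b - f a| <= M * (b - a).
Proof.
move=> ab H HM; have [c cab ->] := dv_MVT ab H.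
by rewrite normrM (ger0_norm (x := b - a)) ?subr_ge0// ler_wpM2r ?subr_ge0 ?HM.
Qed.

Lemma dv_le {R : realType} (f df : R -> R) a b : a <= b ->
  (forall x, a <= x <= b -> dv f x (df x)) ->
  (forall x, a <= x <= b -> 0 <= df x) -> f a <= f b.
Proof.
move=> ab H H0; have [c cab e] := dv_MVT ab H.
by rewrite -subr_ge0 e mulr_ge0 ?subr_ge0 ?H0.
Qed.

Notation Rec := complex.Re.
Notation Imc := complex.Im.

Lemma RecD {R : realType} (x y : R[i]) : Rec (x + y) = Rec x + Rec y.
Proof. by case: x; case: y. Qed.
Lemma ImcD {R : realType} (x y : R[i]) : Imc (x + y) = Imc x + Imc y.
Proof. by case: x; case: y. Qed.
Lemma RecN {R : realType} (x : R[i]) : Rec (- x) = - Rec x.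
Proof. by case: x. Qed.
Lemma ImcN {R : realType} (x : R[i]) : Imc (- x) = - Imc x.
Proof. by case: x. Qed.
Lemma RecM {R : realType} (x y : R[i]) : Rec (x * y) = Rec x * Rec y - Imc x * Imc y.
Proof. by case: x; case: y. Qed.
Lemma ImcM {R : realType} (x y : R[i]) : Imc (x * y) = Rec x * Imc y + Imc x * Rec y.
Proof. by case: x; case: y. Qed.
Lemma Rec_sum {R : realType} I (r : seq I) (P : pred I) (f : I -> R[i]) :
  Rec (\sum_(i <- r | P i) f i) = \sum_(i <- r | P i) Rec (f i).
Proof. exact: (big_morph _ RecD). Qed.
Lemma Imc_sum {R : realType} I (r : seq I) (P : pred I) (f : I -> R[i]) :
  Imc (\sum_(i <- r | P i) f i) = \sum_(i <- r | P i) Imc (f i).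
Proof. exact: (big_morph _ ImcD). Qed.
Definition reimE := (@RecD, @ImcD, @RecN, @ImcN, @RecM, @ImcM).

Lemma eq_cplx {R : realType} (x y : R[i]) : Rec x = Rec y -> Imc x = Imc y -> x = y.
Proof. by case: x; case: y => a b c d /= -> ->. Qed.

Definition rc {R : realType} (x : R) : R[i] := Complex x 0.

Lemma rcD {R : realType} (x y : R) : rc (x + y) = rc x + rc y.
Proof. by apply: eq_cplx; rewrite !reimE /= ?addr0. Qed.
Lemma rcN {R : realType} (x : R) : rc (- x) = - rc x.
Proof. by apply: eq_cplx; rewrite !reimE /= ?oppr0. Qed.
Lemma rcM {R : realType} (x y : R) : rc (x * y) = rc x * rc y.
Proof. by apply: eq_cplx; rewrite !reimE /=; ring. Qed.
Lemma rc1 {R : realType} : rc (1 : R) = 1. Proof. by []. Qed.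
Lemma rc0 {R : realType} : rc (0 : R) = 0. Proof. by []. Qed.
Lemma rcX {R : realType} (x : R) n : rc (x ^+ n) = rc x ^+ n.
Proof. by elim: n => // n IH; rewrite !exprS rcM IH. Qed.
Lemma rc_nat {R : realType} n : rc (n%:R : R) = n%:R.
Proof. by elim: n => // n IH; rewrite -!natr1 rcD IH. Qed.
Lemma rcV {R : realType} (x : R) : rc x^-1 = (rc x)^-1.
Proof.
have [->|x0] := eqVneq x 0; first by rewrite !invr0.
have h : rc x != 0 by apply: contra x0 => /eqP[->].
by apply: (mulfI h); rewrite mulfV// -rcM mulfV.
Qed.
Lemma rc_sum {R : realType} I (r : seq I) (P : pred I) (f : I -> R) :
  rc (\sum_(i <- r | P i) f i) = \sum_(i <- r | P i) rc (f i).
Proof. exact: (big_morph _ (@rcD R)). Qed.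

Lemma cmodE {R : realType} (z : R[i]) : cmod z = Num.sqrt (Rec z ^+ 2 + Imc z ^+ 2).
Proof. by case: z. Qed.
Lemma cmod_ge0 {R : realType} (z : R[i]) : 0 <= cmod z.
Proof. by rewrite cmodE sqrtr_ge0. Qed.
Lemma cmod_sqr {R : realType} (z : R[i]) : cmod z ^+ 2 = Rec z ^+ 2 + Imc z ^+ 2.
Proof. by rewrite cmodE sqr_sqrtr// addr_ge0// sqr_ge0. Qed.
Lemma cmodM {R : realType} (x y : R[i]) : cmod (x * y) = cmod x * cmod y.
Proof. exact: Normc.normcM. Qed.
Lemma cmodD {R : realType} (x y : R[i]) : cmod (x + y) <= cmod x + cmod y.
Proof. exact: le_normcD. Qed.
Lemma cmodN {R : realType} (x : R[i]) : cmod (- x) = cmod x.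
Proof. exact: normcN. Qed.
Lemma cmodB {R : realType} (x y : R[i]) : cmod (x - y) <= cmod x + cmod y.
Proof. by rewrite -(cmodN y) cmodD. Qed.
Lemma cmodV {R : realType} (x : R[i]) : cmod x^-1 = (cmod x)^-1.
Proof. exact: Normc.normcV. Qed.
Lemma cmod0 {R : realType} : cmod (0 : R[i]) = 0. Proof. exact: Normc.normc0. Qed.
Lemma cmod1 {R : realType} : cmod (1 : R[i]) = 1. Proof. exact: Normc.normc1. Qed.
Lemma cmodX {R : realType} (x : R[i]) n : cmod (x ^+ n) = cmod x ^+ n.
Proof. by elim: n => [|n IH]; rewrite ?cmod1// !exprS cmodM IH. Qed.
Lemma cmod_rc {R : realType} (x : R) : cmod (rc x) = `|x|.
Proof. by rewrite cmodE /= expr0n addr0 sqrtr_sqr. Qed.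
Lemma cmod_nat {R : realType} n : cmod (n%:R : R[i]) = n%:R.
Proof. by rewrite -rc_nat cmod_rc ger0_norm. Qed.
Lemma cmod_eq0 {R : realType} (x : R[i]) : (cmod x == 0) = (x == 0).
Proof. by apply/eqP/eqP => [/Normc.eq0_normc//|->]; exact: cmod0. Qed.
Lemma cmod_gt0 {R : realType} (x : R[i]) : (0 < cmod x) = (x != 0).
Proof. by rewrite lt_def cmod_eq0 cmod_ge0 andbT. Qed.
Lemma cmod_sum {R : realType} I (r : seq I) (P : pred I) (f : I -> R[i]) :
  cmod (\sum_(i <- r | P i) f i) <= \sum_(i <- r | P i) cmod (f i).
Proof.
elim/big_ind2 : _ => //; first by rewrite cmod0.
by move=> x a y b xa yb; apply: le_trans (cmodD _ _) _; exact: lerD.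
Qed.
Lemma cmod_prod {R : realType} I (r : seq I) (P : pred I) (f : I -> R[i]) :
  cmod (\prod_(i <- r | P i) f i) = \prod_(i <- r | P i) cmod (f i).
Proof. exact: (big_morph _ (@cmodM R) (@cmod1 R)). Qed.
Lemma cmod_leB {R : realType} (x y : R[i]) : cmod x - cmod y <= cmod (x - y).
Proof. by rewrite lerBlDr; apply: le_trans (cmodD _ _); rewrite subrK. Qed.
Lemma Rec_le {R : realType} (z : R[i]) : `|Rec z| <= cmod z.
Proof.
by rewrite -(@ler_pXn2r _ 2)// ?nnegrE ?cmod_ge0// real_normK ?num_real// cmod_sqr lerDl sqr_ge0.
Qed.
Lemma Imc_le {R : realType} (z : R[i]) : `|Imc z| <= cmod z.
Proof.
by rewrite -(@ler_pXn2r _ 2)// ?nnegrE ?cmod_ge0// real_normK ?num_real// cmod_sqr lerDr sqr_ge0.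
Qed.
Lemma cmod_le_reim {R : realType} (z : R[i]) : cmod z <= `|Rec z| + `|Imc z|.
Proof.
rewrite -(@ler_pXn2r _ 2)// ?nnegrE ?cmod_ge0 ?addr_ge0// cmod_sqr sqrrD !real_normK ?num_real//.
by rewrite -addrA (addrC (_ *+ 2)) addrA lerDl mulrn_wge0// mulr_ge0.
Qed.

Definition cexp {R : realType} (z : R[i]) : R[i] :=
  Complex (expR (Rec z) * cos (Imc z)) (expR (Rec z) * sin (Imc z)).

Lemma cexpD {R : realType} (x y : R[i]) : cexp (x + y) = cexp x * cexp y.
Proof.
by apply: eq_cplx; rewrite /cexp /= !reimE /= expRD ?cosD ?sinD; ring.
Qed.
Lemma cexp0 {R : realType} : cexp (0 : R[i]) = 1.
Proof. by rewrite /cexp /= expR0 cos0 sin0 !mul1r. Qed.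
Lemma cexp_rc {R : realType} (x : R) : cexp (rc x) = rc (expR x).
Proof. by rewrite /cexp /= cos0 sin0 mulr1 mulr0. Qed.
Lemma cmod_cexp {R : realType} (z : R[i]) : cmod (cexp z) = expR (Rec z).
Proof.
by rewrite cmodE /= !exprMn -mulrDr cos2Dsin2 mulr1 sqrtr_sqr ger0_norm ?expR_ge0.
Qed.

Definition dvc {R : realType} (f : R -> R[i]) (x : R) (d : R[i]) :=
  dv (fun y => Rec (f y)) x (Rec d) /\ dv (fun y => Imc (f y)) x (Imc d).

Lemma dvc_eq {R : realType} (f : R -> R[i]) x d d' : dvc f x d -> d = d' -> dvc f x d'.
Proof. by move=> ? <-. Qed.
Lemma dvc_rc {R : realType} (f : R -> R) x d : dv f x d -> dvc (fun y => rc (f y)) x (rc d).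
Proof. by move=> ?; split=> //=; exact: dv_cst. Qed.
Lemma dvc_cst {R : realType} (c : R[i]) x : dvc (fun=> c) x 0.
Proof. by split; exact: dv_cst. Qed.
Lemma dvcD {R : realType} (f g : R -> R[i]) x a b :
  dvc f x a -> dvc g x b -> dvc (fun y => f y + g y) x (a + b).
Proof.
move=> [f1 f2] [g1 g2]; split.
  by under [X in dv X]eq_fun do rewrite RecD; rewrite RecD; exact: dvD.
by under [X in dv X]eq_fun do rewrite ImcD; rewrite ImcD; exact: dvD.
Qed.
Lemma dvcM {R : realType} (f g : R -> R[i]) x a b :
  dvc f x a -> dvc g x b -> dvc (fun y => f y * g y) x (a * g x + f x * b).
Proof.
move=> [f1 f2] [g1 g2]; split.
  under [X in dv X]eq_fun do rewrite RecM; apply: dv_eq.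
    by apply: dvD; [|apply: dvN]; apply: dvM; eassumption.
  by rewrite !reimE; ring.
under [X in dv X]eq_fun do rewrite ImcM; apply: dv_eq.
  by apply: dvD; apply: dvM; eassumption.
by rewrite !reimE; ring.
Qed.
Lemma dvcN {R : realType} (f : R -> R[i]) x a : dvc f x a -> dvc (fun y => - f y) x (- a).
Proof.
move=> [f1 f2]; split.
  by under [X in dv X]eq_fun do rewrite RecN; rewrite RecN; exact: dvN.
by under [X in dv X]eq_fun do rewrite ImcN; rewrite ImcN; exact: dvN.
Qed.
Lemma dvc_sum {R : realType} I (r : seq I) (P : pred I) (f : I -> R -> R[i]) (d : I -> R[i]) x :
  (forall i, P i -> dvc (f i) x (d i)) ->
  dvc (fun y => \sum_(i <- r | P i) f i y) x (\sum_(i <- r | P i) d i).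
Proof.
move=> H; split.
  under [X in dv X]eq_fun do rewrite Rec_sum; rewrite Rec_sum.
  by apply: dv_sum => i /H[].
under [X in dv X]eq_fun do rewrite Imc_sum; rewrite Imc_sum.
by apply: dv_sum => i /H[].
Qed.
Lemma dvc_cexp {R : realType} (f : R -> R[i]) x a :
  dvc f x a -> dvc (fun y => cexp (f y)) x (cexp (f x) * a).
Proof.
move=> [f1 f2]; split.
  by apply: (dv_eq (dvM (dv_exp f1) (dv_cos f2))); rewrite !reimE /=; ring.
by apply: (dv_eq (dvM (dv_exp f1) (dv_sin f2))); rewrite !reimE /=; ring.
Qed.

(** The mean value theorem fails for complex values; applying it to the real and imaginary parts
    separately costs the factor 2. *)
Lemma dvc_lipschitz {R : realType} (f df : R -> R[i]) a b M : a <= b ->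
  (forall x, a <= x <= b -> dvc f x (df x)) ->
  (forall x, a <= x <= b -> cmod (df x) <= M) ->
  cmod (f b - f a) <= 2 * M * (b - a).
Proof.
move=> ab H HM; apply: le_trans (cmod_le_reim _) _.
rewrite mulrAC mulr_natl mulr2n mulrDl (mulrC _ M); apply: lerD; rewrite !reimE.
  apply: (@dv_lipschitz _ (fun y => Rec (f y)) (fun y => Rec (df y))) => // x /[dup] xab /H[]//.
  by move=> _ _; apply: le_trans (Rec_le _) (HM _ xab).
apply: (@dv_lipschitz _ (fun y => Imc (f y)) (fun y => Imc (df y))) => // x /[dup] xab /H[]//.
by move=> _ _; apply: le_trans (Imc_le _) (HM _ xab).
Qed.

(** Convergence is taken componentwise, so that limit arguments take place in [R]. *)
Definition ccv {R : realType} (u : nat -> R[i]) (l : R[i]) :=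
  ((fun n => Rec (u n)) @ \oo --> Rec l) /\ ((fun n => Imc (u n)) @ \oo --> Imc l).

Lemma ccv_cst {R : realType} (l : R[i]) : ccv (fun=> l) l.
Proof. by split; exact: cvg_cst. Qed.
Lemma ccvD {R : realType} (u v : nat -> R[i]) a b :
  ccv u a -> ccv v b -> ccv (fun n => u n + v n) (a + b).
Proof.
move=> [u1 u2] [v1 v2]; split.
  by under eq_fun do rewrite RecD; rewrite RecD; exact: cvgD.
by under eq_fun do rewrite ImcD; rewrite ImcD; exact: cvgD.
Qed.
Lemma ccvN {R : realType} (u : nat -> R[i]) a : ccv u a -> ccv (fun n => - u n) (- a).
Proof.
move=> [u1 u2]; split.
  by under eq_fun do rewrite RecN; rewrite RecN; exact: cvgN.
by under eq_fun do rewrite ImcN; rewrite ImcN; exact: cvgN.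
Qed.
Lemma ccvM {R : realType} (u v : nat -> R[i]) a b :
  ccv u a -> ccv v b -> ccv (fun n => u n * v n) (a * b).
Proof.
move=> [u1 u2] [v1 v2]; split.
  by under eq_fun do rewrite RecM; rewrite RecM; apply: cvgB; exact: cvgM.
by under eq_fun do rewrite ImcM; rewrite ImcM; apply: cvgD; exact: cvgM.
Qed.
Lemma ccv_cmod {R : realType} (u : nat -> R[i]) a : ccv u a -> (fun n => cmod (u n)) @ \oo --> cmod a.
Proof.
move=> [u1 u2]; rewrite cmodE; under eq_fun do rewrite cmodE.
apply: (@cvg_comp _ _ _ (fun n => Rec (u n) ^+ 2 + Imc (u n) ^+ 2) (@Num.sqrt R)); last exact: sqrt_continuous.
by apply: cvgD; under eq_fun do rewrite expr2; rewrite expr2; exact: cvgM.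
Qed.
Lemma ccv_unique {R : realType} (u : nat -> R[i]) a b : ccv u a -> ccv u b -> a = b.
Proof.
move=> [u1 u2] [v1 v2]; apply: eq_cplx.
  exact: (cvg_unique (@Rhausdorff R) u1 v1).
exact: (cvg_unique (@Rhausdorff R) u2 v2).
Qed.
Lemma ccv_le {R : realType} (u : nat -> R[i]) a (M : R) :
  ccv u a -> (\forall n \near \oo, cmod (u n) <= M) -> cmod a <= M.
Proof.
move=> /ccv_cmod h H; rewrite -(cvg_lim (@Rhausdorff R) h).
by apply: limr_le => //; apply/cvg_ex; exists (cmod a).
Qed.
Lemma cvg_dominated {R : realType} (u : nat -> R) a (e : nat -> R) :
  (\forall n \near \oo, `|u n - a| <= e n) -> e @ \oo --> (0 : R) -> u @ \oo --> a.
Proof.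
move=> H e0; apply/subr_cvg0; apply: (@squeeze_cvgr _ _ _ _ (fun n => - e n) e) => //.
  by near=> n; rewrite -ler_norml; near: n.
by rewrite -oppr0; exact: cvgN.
Unshelve. all: by end_near. Qed.

Lemma ccv_squeeze {R : realType} (u : nat -> R[i]) a (e : nat -> R) :
  (\forall n \near \oo, cmod (u n - a) <= e n) -> e @ \oo --> (0 : R) -> ccv u a.
Proof.
move=> H e0; split; apply: cvg_dominated e0; near=> n.
  rewrite -RecN -RecD; apply: le_trans (Rec_le _) _; near: n; exact: H.
rewrite -ImcN -ImcD; apply: le_trans (Imc_le _) _; near: n; exact: H.
Unshelve. all: by end_near. Qed.

Lemma ler_sum_nat_widen {R : realType} (f : nat -> R) m n p : (m <= n <= p)%N ->
  (forall i, (n <= i < p)%N -> 0 <= f i) ->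
  \sum_(m <= i < n) f i <= \sum_(m <= i < p) f i.
Proof.
move=> /andP[mn np] H; rewrite [leRHS](big_cat_nat (n := n))//= lerDl.
by rewrite big_nat_cond sumr_ge0// => i /andP[/H].
Qed.

Lemma ccv_series {R : realType} (f : nat -> R[i]) (g : nat -> R) :
  (forall n, cmod (f n) <= g n) -> cvgn (series g) ->
  exists l, ccv (fun N => \sum_(0 <= n < N) f n) l.
Proof.
move=> H cg.
have cR : cvgn (series (fun n => Rec (f n))).
  apply: normed_cvg; apply: series_le_cvg cg => n; rewrite ?normr_ge0//.
    exact: le_trans (cmod_ge0 _) (H n).
  exact: le_trans (Rec_le _) (H n).
have cI : cvgn (series (fun n => Imc (f n))).
  apply: normed_cvg; apply: series_le_cvg cg => n; rewrite ?normr_ge0//.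
    exact: le_trans (cmod_ge0 _) (H n).
  exact: le_trans (Imc_le _) (H n).
exists (Complex (limn (series (fun n => Rec (f n)))) (limn (series (fun n => Imc (f n))))).
split => /=.
  by under eq_fun do rewrite Rec_sum; exact: cR.
by under eq_fun do rewrite Imc_sum; exact: cI.
Qed.

Lemma ln_nat_ge0 {R : realType} n : 0 <= ln (n%:R : R).
Proof. by case: n => [|n]; [rewrite ln0|rewrite ln_ge0// ler1n]. Qed.

Lemma ln_nat_le {R : realType} m n : (m <= n)%N -> ln (m%:R : R) <= ln n%:R.
Proof.
case: m => [|m] mn; first by rewrite ln0// ln_nat_ge0.
by rewrite ler_ln ?posrE ?ltr0n ?ler_nat// (leq_trans _ mn).
Qed.

Lemma lerXl {R : realType} n (x y : R) : 0 <= x -> x <= y -> x ^+ n <= y ^+ n.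
Proof. by move=> x0 xy; rewrite lerXn2r ?nnegrE// (le_trans x0). Qed.

Lemma invE_ln {R : realType} (y : R) : 0 < y -> y^-1 = expR (- ln y).
Proof. by move=> y0; rewrite expRN lnK ?posrE. Qed.

Lemma expR_ge_pow {R : realType} n (x : R) : 0 <= x -> x ^+ n <= n`!%:R * expR x.
Proof.
move=> x0; case: n => [|n]; first by rewrite expr0 fact0 mul1r -[leLHS]expR0 ler_expR.
rewrite mulrC -ler_pdivrMr ?ltr0n ?fact_gt0//; apply: le_trans (expR_ge1Dxn n x0).
by rewrite lerDr.
Qed.

(** This is x^n <= n! e^x at x = ln y / m. Here and below a real power y^a is written
    [expR (a * ln y)]. *)
Lemma ln_pow_le {R : realType} n m (y : R) : (0 < m)%N -> 1 <= y ->
  ln y ^+ n <= n`!%:R * m%:R ^+ n * expR (ln y / m%:R).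
Proof.
move=> m0 y1; have m0' : (0 : R) < m%:R by rewrite ltr0n.
have := @expR_ge_pow R n (ln y / m%:R) (divr_ge0 (ln_ge0 y1) (ltW m0')).
rewrite expr_div_n ler_pdivrMr ?exprn_gt0// => /le_trans; apply.
by rewrite mulrAC.
Qed.

Ltac pos := first [ done | assumption | (apply: ltW; assumption) | lazymatch goal with
  | |- is_true (0 <= _ + _) => apply: addr_ge0; pos
  | |- is_true (0 <= _ * _) => apply: mulr_ge0; pos
  | |- is_true (0 <= _ ^+ _) => apply: exprn_ge0; pos
  | |- is_true (0 <= _ ^-1) => rewrite invr_ge0; pos
  | |- is_true (0 <= expR _) => exact: expR_ge0
  | |- is_true (0 <= cmod _) => exact: cmod_ge0
  | |- is_true (0 <= `|_|) => exact: normr_ge0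
  | |- is_true (0 <= ln (_%:R)) => exact: ln_nat_ge0
  | |- is_true (0 < _ + _) =>
      first [solve [apply: ltr_pwDl; pos] | solve [apply: ltr_wpDl; pos]]
  | |- is_true (0 < _ * _) => apply: mulr_gt0; pos
  | |- is_true (0 < _ ^+ _) => apply: exprn_gt0; pos
  | |- is_true (0 < _ ^-1) => rewrite invr_gt0; pos
  | |- is_true (0 < expR _) => exact: expR_gt0
  | |- is_true (0 < _%:R) => rewrite ltr0n; first [done | lia]
  end ].

(** * The zeta function near the line Re s = 1 *)

Lemma harmonic_le {R : realType} M : (0 < M)%N ->
  \sum_(1 <= n < M.+1) (n%:R : R)^-1 <= 1 + ln M%:R.
Proof.
elim: M => // -[_ _|M IH _]; first by rewrite big_nat1 ln1 invr1 addr0.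
rewrite big_nat_recr//=; have /= := IH isT; set s := \sum_(1 <= n < M.+2) _ => sM.
have M0 : (0 : R) < M.+2%:R by rewrite ltr0n.
have : ln (1 + - (M.+2%:R)^-1 : R) <= - (M.+2%:R)^-1.
  by apply: le_ln1Dx; rewrite ltrN2 invf_lt1// ltr1n.
have -> : 1 + - (M.+2%:R)^-1 = M.+1%:R / M.+2%:R :> R.
  by move: M0; rewrite -[M.+2%:R]natr1 => M0; field; rewrite gt_eqF.
rewrite ln_div ?posrE ?ltr0n//.
by move: (ln M.+1%:R) (ln M.+2%:R) (M.+2%:R^-1) sM => a b c; lra.
Qed.

(** At u = ln n this is (ln n)^j n^(-s) with s = 1 + z: the pole of zeta sits at z = 0, and the line
    Re s = 1 is Re z = 0. *)
Definition fz {R : realType} (j : nat) (z : R[i]) (u : R) : R[i] :=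
  rc (u ^+ j) * cexp (- (1 + z) * rc u).

(* [- cexp (- z u) * Pz j z u] is the primitive of [u ^+ j * cexp (- z u)]
   that vanishes at infinity. *)
Fixpoint Pz {R : realType} (j : nat) (z : R[i]) (u : R) : R[i] :=
  if j is j'.+1 then (rc (u ^+ j) + j%:R * Pz j' z u) / z else z^-1.

(** With the exponential divided out, this is the identity (e^(- z u) Pz)' = - u^j e^(- z u). *)
Lemma dvc_Pz {R : realType} j (z : R[i]) u : z != 0 ->
  dvc (Pz j z) u (z * Pz j z u - rc (u ^+ j)).
Proof.
move=> z0; elim: j => [|j IH] /=.
  by apply: dvc_eq (dvc_cst _ _) _; rewrite mulfV// expr0 subrr.
apply: dvc_eq.
  apply: dvcM (dvc_cst _ _); apply: dvcD.
    by apply: dvc_rc; repeat dstep.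
  by apply: dvcM (dvc_cst _ _) IH.
by rewrite /= !mulr1 mulr0 addr0 rcM rc_nat rcX; field.
Qed.

Lemma Pz0 {R : realType} j (z : R[i]) : z != 0 -> Pz j z 0 = (j`!)%:R / z ^+ j.+1.
Proof.
move=> z0; elim: j => [|j IH] /=; first by rewrite fact0 expr1 div1r.
by rewrite IH expr0n /= rc0 add0r factS natrM !exprS; field; rewrite expf_neq0 ?z0.
Qed.

Lemma dvc_fz {R : realType} j (z : R[i]) u :
  dvc (fz j z) u ((rc (j%:R * u ^+ j.-1) - (1 + z) * rc (u ^+ j)) * cexp (- (1 + z) * rc u)).
Proof.
apply: dvc_eq.
  apply: dvcM; first by apply: dvc_rc; repeat dstep.
  apply: dvc_cexp; apply: dvcM (dvc_cst _ _) _; apply: dvc_rc; exact: dv_id.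
by cbv beta; rewrite ?rc1 !mulr1; ring.
Qed.

Lemma dvc_ln {R : realType} (F : R -> R[i]) y d : 0 < y ->
  dvc F (ln y) d -> dvc (fun y => F (ln y)) y (rc (y^-1) * d).
Proof.
move=> y0 [F1 F2]; have dl : dv (fun y => ln y) y (y^-1).
  by apply: dv_eq (dv_ln y0 (dv_id y)) _; rewrite mulr1.
split; rewrite !reimE /=.
  by apply: dv_eq (dv_comp F1 dl) _; ring.
by apply: dv_eq (dv_comp F2 dl) _; ring.
Qed.

Lemma cexp_lnV {R : realType} (z : R[i]) (y : R) : 0 < y ->
  cexp (- (1 + z) * rc (ln y)) = rc (y^-1) * cexp (- z * rc (ln y)).
Proof.
move=> y0; rewrite opprD mulrDl cexpD mulN1r -rcN cexp_rc expRN lnK ?posrE//.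
Qed.

Definition Sz {R : realType} (j : nat) (z : R[i]) M : R[i] :=
  \sum_(1 <= n < M) fz j z (ln n%:R).

(** In the variable y = e^u the two terms with [Pz] are minus the integral of (ln y)^j y^(-1-z) over
    [1, M]. The difference of sum and integral is what stays bounded up to Re z = 0. *)
Definition Rm {R : realType} (j : nat) (z : R[i]) M : R[i] :=
  Sz j z M.+1 + cexp (- z * rc (ln M%:R)) * Pz j z (ln M%:R) - Pz j z 0.

Lemma cmod_fz {R : realType} j (z : R[i]) u : 0 <= u ->
  cmod (fz j z u) = u ^+ j * expR (- (1 + Rec z) * u).
Proof.
move=> u0; rewrite cmodM cmod_rc ger0_norm ?exprn_ge0// cmod_cexp; congr (_ * expR _).
by rewrite !reimE /= mulr0 subr0.
Qed.

(** The expression is the derivative in y of (ln y)^j y^(-1-z). The chain rule gives one factor 1 /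
    y, the modulus another, and the logarithms cost y^(1/2). *)
Lemma cmod_dfz {R : realType} j (z : R[i]) y : 1 <= y -> 0 <= Rec z ->
  cmod (rc (y^-1) * ((rc (j%:R * (ln y) ^+ j.-1) - (1 + z) * rc ((ln y) ^+ j)) * cexp (- (1 + z) * rc (ln y))))
  <= 2 * (j`!%:R * 2 ^+ j) * (1 + cmod z) * expR (- (3 / 2) * ln y).
Proof.
move=> y1 x0; have u0 := ln_ge0 y1; set u := ln y in u0 *.
have y0 : 0 < y by apply: lt_le_trans y1.
have -> : y^-1 = expR (- u) by rewrite expRN lnK ?posrE.
rewrite !cmodM cmod_rc (ger0_norm (expR_ge0 _)) cmod_cexp.
have E1 : expR (Rec (- (1 + z) * rc u)) <= expR (- u).
  rewrite ler_expR !reimE /= mulr0 subr0 mulNr lerN2 ler_peMl// lerDl//.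
have E2 : cmod (rc (j%:R * u ^+ j.-1) - (1 + z) * rc (u ^+ j)) <=
          2 * (j`!%:R * 2 ^+ j) * (1 + cmod z) * expR (u / 2).
  apply: le_trans (cmodB _ _) _; rewrite cmodM !cmod_rc !ger0_norm ?mulr_ge0 ?exprn_ge0//.
  have h1 : u ^+ j <= j`!%:R * 2 ^+ j * expR (u / 2) by exact: (@ln_pow_le R j 2).
  have h2 : j%:R * u ^+ j.-1 <= j`!%:R * 2 ^+ j * expR (u / 2).
    case: j {h1} => [|j] /=; first by rewrite mul0r fact0 mul1r expr0 mul1r expR_ge0.
    have h := @ln_pow_le R j 2 y isT y1; rewrite -/u in h.
    rewrite factS natrM -!mulrA ler_wpM2l// (le_trans h)// mulrA ler_wpM2r ?expR_ge0//.
    by rewrite ler_wpM2l// exprS ler_peMl ?exprn_ge0// ler1n.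
  have h3 : cmod (1 + z) <= 1 + cmod z by rewrite -[X in _ <= X + _]cmod1 cmodD.
  have c0 : 0 <= cmod z := cmod_ge0 _.
  set Q := j`!%:R * 2 ^+ j * expR (u / 2) in h1 h2.
  have Q0 : 0 <= Q by rewrite !mulr_ge0 ?exprn_ge0 ?expR_ge0.
  have -> : 2 * (j`!%:R * 2 ^+ j) * (1 + cmod z) * expR (u / 2) = 2 * (1 + cmod z) * Q.
    by rewrite /Q; ring.
  have h4 : cmod (1 + z) * u ^+ j <= (1 + cmod z) * Q.
    by apply: ler_pM => //; [exact: cmod_ge0|exact: exprn_ge0].
  nra.
have -> : expR (- (3 / 2) * u) = expR (- u) * (expR (u / 2) * expR (- u)).
  by rewrite -!expRD; congr expR; field.
rewrite (mulrCA _ (expR (- u))); apply: ler_wpM2l; rewrite ?expR_ge0// mulrA.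
apply: le_trans (ler_pM (cmod_ge0 _) (expR_ge0 _) E2 E1) _.
by rewrite !mulrA.
Qed.

Definition rsq {R : realType} (n : nat) : R := expR (- (1 / 2) * ln n%:R).

Lemma rsq_ge0 {R : realType} n : 0 <= rsq n :> R. Proof. exact: expR_ge0. Qed.

(** Makes sums of n^(-3/2) telescope. The mean value theorem gives half of c^(-3/2) with c <= 2 n,
    and 2^(3/2) is rounded up to 4. *)
Lemma rsq_incr {R : realType} n : (0 < n)%N ->
  expR (- (3 / 2) * ln n%:R) <= 8 * (rsq n - rsq n.+1) :> R.
Proof.
move=> n0; have n0' : (0 : R) < n%:R by rewrite ltr0n.
have [] := @dv_MVT R (fun y => - expR (- (1 / 2) * ln y))
   (fun y => 1 / 2 * expR (- (3 / 2) * ln y)) n%:R n.+1%:R.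
- by rewrite ler_nat.
- move=> y /andP[ny _]; have y0 : 0 < y := lt_le_trans n0' ny.
  der; first exact: y0.
  have -> : expR (- (3 / 2) * ln y) = expR (- (1 / 2) * ln y) * y^-1.
    by rewrite [y^-1]invE_ln// -expRD; congr expR; field.
  by field; rewrite gt_eqF.
move=> c /andP[nc cn]; rewrite -/(rsq n) -/(rsq n.+1) opprK addrC => ->.
have -> : n.+1%:R - n%:R = 1 :> R by rewrite -natr1; ring.
rewrite mulr1.
have c0 : 0 < c := lt_le_trans n0' nc.
have lc : ln c <= ln n%:R + ln 2.
  rewrite -lnM ?posrE// ler_ln ?posrE// ?mulr_gt0//.
  by apply: le_trans cn _; rewrite -natrM ler_nat; lia.
have : expR (- (3 / 2) * ln n%:R) <= 4 * expR (- (3 / 2) * ln c).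
  have -> : (4 : R) = expR (2 * ln 2) by rewrite expRM_natl lnK ?posrE//; ring.
  rewrite -expRD ler_expR.
  have : 0 <= ln 2 :> R by rewrite ln_ge0// ler1n.
  lra.
lra.
Qed.

Lemma Rm_incr {R : realType} j (z : R[i]) n : (0 < n)%N -> z != 0 -> 0 <= Rec z ->
  cmod (Rm j z n.+1 - Rm j z n) <= 64 * (j`!%:R * 2 ^+ j) * (1 + cmod z) * (rsq n - rsq n.+1).
Proof.
move=> n0 z0 x0; have n1 : (1 : R) <= n%:R by rewrite ler1n.
set K := 2 * (j`!%:R * 2 ^+ j) * (1 + cmod z) * expR (- (3 / 2) * ln n%:R).
have K0 : 0 <= K by rewrite !mulr_ge0 ?exprn_ge0 ?expR_ge0 ?addr_ge0 ?cmod_ge0.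
have nn : n%:R <= n.+1%:R :> R by rewrite ler_nat.
have dK (y : R) : n%:R <= y <= n.+1%:R -> cmod (fz j z (ln n.+1%:R) - fz j z (ln y)) <= 2 * K.
  move=> /andP[ny yn]; apply: (@le_trans _ _ (2 * K * (n.+1%:R - y))); last first.
    by have : n.+1%:R = n%:R + 1 :> R by [rewrite -natr1]; nra.
  apply: (@dvc_lipschitz _ (fun y => fz j z (ln y)) (fun y => rc (y^-1) *
    ((rc (j%:R * (ln y) ^+ j.-1) - (1 + z) * rc ((ln y) ^+ j)) * cexp (- (1 + z) * rc (ln y))))) => //.
    move=> w /andP[yw _]; apply: dvc_ln; last exact: dvc_fz.
    by rewrite (lt_le_trans _ yw)// (lt_le_trans _ ny)// ltr0n.
  move=> w /andP[yw _]; have nw := le_trans ny yw.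
  apply: le_trans (cmod_dfz _ _ x0) _; first exact: le_trans n1 nw.
  rewrite ler_wpM2l ?mulr_ge0 ?exprn_ge0 ?expR_ge0 ?addr_ge0 ?cmod_ge0// ler_expR.
  rewrite !mulNr lerN2 ler_wpM2l// ler_ln ?posrE ?ltr0n// (lt_le_trans _ nw)// ltr0n//.
(* With f(y) = [fz j z (ln y)], H has derivative f(n + 1) - f(y), and its increment is f(n + 1)
   minus the integral of f. The Lipschitz bound is thus used twice, for f and then for H. *)
pose H (y : R) := cexp (- z * rc (ln y)) * Pz j z (ln y) + rc y * fz j z (ln n.+1%:R).
have -> : Rm j z n.+1 - Rm j z n = H n.+1%:R - H n%:R.
  rewrite /Rm /Sz big_nat_recr//= /H -natr1 rcD rc1; ring.
apply: (@le_trans _ _ (2 * (2 * K) * (n.+1%:R - n%:R))).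
  apply: (@dvc_lipschitz _ H (fun y => fz j z (ln n.+1%:R) - fz j z (ln y))) => // y.
  move=> /andP[ny yn]; have y0 : 0 < y by rewrite (lt_le_trans _ ny)// ltr0n.
  apply: dvc_eq.
    apply: dvcD; last by apply: dvcM (dvc_cst _ _); apply: dvc_rc; exact: dv_id.
    apply: dvcM; last by apply: dvc_ln => //; exact: dvc_Pz.
    apply: dvc_cexp; apply: dvcM (dvc_cst _ _) _; apply: dvc_rc.
    exact: dv_ln y0 (dv_id y).
  by rewrite /fz (cexp_lnV _ y0) /= rc1 !mulr1; ring.
have -> : n.+1%:R - n%:R = 1 :> R by rewrite -natr1; ring.
rewrite mulr1 /K.
have := @rsq_incr R n n0.
have : 0 <= (j`!%:R * 2 ^+ j) * (1 + cmod z).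
  by rewrite !mulr_ge0 ?exprn_ge0 ?addr_ge0 ?cmod_ge0.
set A := _ * (1 + cmod z); set e := expR _; set d := _ - _ => A0 ed.
have -> : 2 * (2 * (2 * (j`!%:R * 2 ^+ j) * (1 + cmod z) * e)) = 8 * (A * e) by rewrite /A; ring.
have -> : 64 * (j`!%:R * 2 ^+ j) * (1 + cmod z) * d = 8 * (A * (8 * d)) by rewrite /A; ring.
by rewrite ler_pM2l// ler_wpM2l.
Qed.

Lemma Rm_diff {R : realType} j (z : R[i]) N M : (0 < N <= M)%N -> z != 0 -> 0 <= Rec z ->
  cmod (Rm j z M - Rm j z N) <= 64 * (j`!%:R * 2 ^+ j) * (1 + cmod z) * (rsq N - rsq M).
Proof.
move=> /andP[N0 NM] z0 x0; set K := 64 * _ * _.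
have K0 : 0 <= K by rewrite !mulr_ge0 ?exprn_ge0 ?addr_ge0 ?cmod_ge0.
elim: M NM => [|M IH]; first by rewrite leqn0 => /eqP ->; rewrite !subrr cmod0 mulr0.
rewrite leq_eqVlt => /predU1P[->|NM]; first by rewrite !subrr cmod0 mulr0.
have -> : Rm j z M.+1 - Rm j z N = (Rm j z M.+1 - Rm j z M) + (Rm j z M - Rm j z N) by ring.
apply: le_trans (cmodD _ _) _.
have := @Rm_incr R j z M (leq_trans N0 NM) z0 x0; rewrite -/K => h1.
have h2 := IH NM; lra.
Qed.

Lemma cmod_Pz {R : realType} j (z : R[i]) (u : R) : 0 <= u -> z != 0 ->
  cmod (Pz j z u) <= (j.+1`!)%:R * (1 + u) ^+ j * (1 + (cmod z)^-1) ^+ j.+1.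
Proof.
move=> u0 z0; have c0 : 0 < cmod z by rewrite cmod_gt0.
have i0 : 0 < (cmod z)^-1 by rewrite invr_gt0.
have u1 : 1 <= 1 + u by lra.
elim: j => [|j IH] /=.
  by rewrite cmodV expr0 expr1 !mul1r lerDr.
rewrite cmodM cmodV [_ ^+ j.+2]exprSr mulrA; apply: ler_pM; rewrite ?cmod_ge0 ?invr_ge0 ?cmod_ge0 ?lerDr//.
apply: le_trans (cmodD _ _) _; rewrite cmod_rc cmodM cmod_nat ger0_norm ?exprn_ge0//.
set I := (1 + (cmod z)^-1) ^+ j.+1 in IH *.
have I1 : 1 <= I by rewrite exprn_ege1// lerDl ltW.
have h1 : u ^+ j.+1 <= (1 + u) ^+ j.+1 by rewrite lerXn2r ?nnegrE ?lerDr// ltW// (lt_le_trans ltr01).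
have h2 : (1 + u) ^+ j <= (1 + u) ^+ j.+1 by rewrite exprS ler_peMl// exprn_ge0// (le_trans ler01).
have f0 : (1 : R) <= (j.+1`!)%:R by rewrite ler1n fact_gt0.
have E : (j.+2`!)%:R = j.+1%:R * (j.+1`!)%:R + (j.+1`!)%:R :> R.
  by rewrite factS natrM -natr1; ring.
have p0 : 0 <= (1 + u) ^+ j.+1 by rewrite exprn_ge0// (le_trans ler01).
have h3 : cmod (Pz j z u) <= (j.+1)`!%:R * ((1 + u) ^+ j.+1 * I).
  apply: le_trans IH _; rewrite -mulrA ler_wpM2l// ler_wpM2r// (le_trans ler01)//.
rewrite E !mulrDl addrC; apply: lerD.
  by rewrite -!mulrA ler_wpM2l.
rewrite -mulrA; apply: le_trans h1 _.
have : (1 + u) ^+ j.+1 <= (1 + u) ^+ j.+1 * I by rewrite ler_peMr.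
move=> /le_trans; apply; rewrite ler_peMl// mulr_ge0// (le_trans ler01)//.
Qed.

(** Trivial bound |n^(-1-z)| <= 1 / n; it serves for the initial segment in [Rm_bound_log]. *)
Lemma sum_fz_le {R : realType} j (z : R[i]) M : (0 < M)%N -> 0 <= Rec z ->
  cmod (Sz j z M.+1) <= (1 + ln M%:R) ^+ j.+1.
Proof.
move=> M0 x0; have l0 : 0 <= ln (M%:R : R) := ln_nat_ge0 _.
apply: le_trans (cmod_sum _ _ _) _; rewrite exprS.
apply: (@le_trans _ _ (\sum_(1 <= n < M.+1) (n%:R^-1 * (1 + ln M%:R) ^+ j))); last first.
  by rewrite -mulr_suml ler_wpM2r ?exprn_ge0 ?addr_ge0// harmonic_le.
rewrite big_nat_cond [leRHS]big_nat_cond; apply: ler_sum => n /andP[/andP[n0 nM] _].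
have n0' : (0 : R) < n%:R by rewrite ltr0n.
rewrite cmod_fz ?ln_nat_ge0// mulrC; apply: ler_pM; rewrite ?expR_ge0 ?exprn_ge0 ?ln_nat_ge0//.
  rewrite -[leRHS](lnK (x := n%:R^-1)) ?posrE ?invr_gt0// ler_expR lnV ?posrE// mulNr lerN2.
  by rewrite ler_peMl ?ln_nat_ge0// lerDl.
rewrite lerXn2r ?nnegrE ?ln_nat_ge0 ?addr_ge0//.
have := @ln_nat_le R n M nM; lra.
Qed.

Definition lz {R : realType} (z : R[i]) : R := 1 + ln (2 + cmod z).

Lemma lz_ge1 {R : realType} (z : R[i]) : 1 <= lz z.
Proof. by rewrite lerDl ln_ge0// -[leLHS]addr0 lerD ?cmod_ge0// ler1n. Qed.

(** Comparison with M = 1. The growth in z is crude, but the bound does not deteriorate near the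
    pole z = 0. *)
Lemma Rm_bound {R : realType} (j : nat) : exists2 C : R, 0 < C &
  forall (z : R[i]) M, (0 < M)%N -> z != 0 -> 0 <= Rec z ->
  cmod (Rm j z M) <= C * (1 + cmod z).
Proof.
exists (64 * (j`!%:R * 2 ^+ j) + 1); first by rewrite ltr_wpDl// !mulr_ge0 ?exprn_ge0.
move=> z M M0 z0 x0.
have := @Rm_diff R j z 1 M; rewrite M0 => /(_ isT z0 x0).
have -> : Rm j z 1 = fz j z 0.
  rewrite /Rm /Sz big_nat1 ln1 rc0 mulr0 cexp0 mul1r; ring.
have : cmod (fz j z 0) <= 1.
  rewrite cmod_fz// mulr0 expR0 mulr1 expr0n; case: eqP => //=.
have := cmodD (Rm j z M - fz j z 0) (fz j z 0); rewrite subrK.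
have -> : rsq 1 = 1 :> R by rewrite /rsq ln1 mulr0 expR0.
have := @rsq_ge0 R M; set K := 64 * _.
have K0 : 0 <= K by rewrite !mulr_ge0 ?exprn_ge0.
have c0 := cmod_ge0 z => r0 a1 a2 a3.
have : K * (1 + cmod z) * (1 - rsq M) <= K * (1 + cmod z).
  by rewrite ler_piMr ?mulr_ge0 ?addr_ge0// lerBlDr lerDl.
rewrite mulrDl mul1r; lra.
Qed.

(** Away from the pole the linear growth improves to a power of a logarithm. Beyond N of order |z|^2
    the increments of [Rm] add up to (1 + |z|) N^(-1/2) = O(1); up to N the sum is estimated
    trivially by powers of ln N. *)
Lemma Rm_bound_log {R : realType} (j : nat) (c : R) : 0 < c -> exists2 C : R, 0 < C &
  forall (z : R[i]) M, (0 < M)%N -> c <= cmod z -> 0 <= Rec z ->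
  cmod (Rm j z M) <= C * lz z ^+ j.+1.
Proof.
move=> c0; set K := 64 * (j`!%:R * 2 ^+ j) : R.
have K0 : 0 <= K by rewrite !mulr_ge0 ?exprn_ge0.
set L := (j.+1`!)%:R * (1 + c^-1) ^+ j.+1 : R.
have L0 : 0 <= L by rewrite !mulr_ge0 ?exprn_ge0 ?addr_ge0 ?invr_ge0// ltW.
exists (5 ^+ j.+1 + 2 * L * 5 ^+ j + K + 1).
  by pos.
move=> z M M0 cz x0.
have z0 : z != 0 by rewrite -cmod_gt0 (lt_le_trans c0).
have l1 := lz_ge1 z; have z0' : 0 <= cmod z := cmod_ge0 _.
have l0 : 0 <= lz z by apply: le_trans l1.
have PzL u : 0 <= u -> cmod (Pz j z u) <= L * (1 + u) ^+ j.
  move=> u0; apply: le_trans (cmod_Pz _ u0 z0) _.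
  rewrite /L -!mulrA ler_wpM2l// mulrC ler_wpM2r ?exprn_ge0 ?addr_ge0//.
  rewrite lerXn2r ?nnegrE ?addr_ge0 ?invr_ge0 ?(ltW c0)// lerD2l.
  by rewrite lef_pV2 ?posrE// cmod_gt0.
(* The inverse square root [rsq N] is then at most 1 / (1 + |z|), while ln N stays below
   [2 * lz z]. *)
pose N := ((Num.truncn (cmod z)).+3 ^ 2)%N.
have N0 : (0 < N)%N by rewrite expn_gt0.
have /andP[tz1 tz2] := truncn_itv z0'.
have lnN : ln (N%:R : R) <= 2 * lz z.
  rewrite /N natrX lnXn ?ltr0n// -[_ *+ 2]mulr_natl; apply: ler_wpM2l => //.
  have -> : lz z = ln (expR 1 * (2 + cmod z)).
    by rewrite lnM ?posrE ?expR_gt0// ?expRK// ltr_pwDl.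
  rewrite ler_ln ?posrE ?ltr0n ?mulr_gt0 ?expR_gt0 ?ltr_pwDl//.
  have : 2 <= expR 1 :> R by have := expR_ge1Dx (1 : R); lra.
  have -> : (Num.truncn (cmod z)).+3%:R = (Num.truncn (cmod z))%:R + 3 :> R by rewrite -addn3 natrD.
  move=> h; nra.
have small m : (0 < m <= N)%N -> cmod (Rm j z m) <= (5 ^+ j.+1 + 2 * L * 5 ^+ j) * lz z ^+ j.+1.
  move=> /andP[m0 mN].
  have lm : 1 + ln (m%:R : R) <= 5 * lz z.
    have := @ln_nat_le R m N mN; lra.
  have lm0 := @ln_nat_ge0 R m.
  have p1 : (1 + ln (m%:R : R)) ^+ j.+1 <= 5 ^+ j.+1 * lz z ^+ j.+1.
    by rewrite -exprMn; apply: lerXl => //; pos.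
  have p2 : (1 + ln (m%:R : R)) ^+ j <= 5 ^+ j * lz z ^+ j.+1.
    apply: (@le_trans _ _ (5 ^+ j * lz z ^+ j)).
      by rewrite -exprMn; apply: lerXl => //; pos.
    by rewrite ler_wpM2l ?exprn_ge0// exprS ler_peMl// exprn_ge0.
  have a1 := sum_fz_le j m0 x0.
  have a2 := PzL _ lm0.
  have a3 := PzL _ (lexx 0); rewrite addr0 expr1n mulr1 in a3.
  have a4 : cmod (cexp (- z * rc (ln m%:R))) <= 1.
    by rewrite cmod_cexp -[leRHS]expR0 ler_expR !reimE /= mulr0 subr0 mulNr oppr_le0 mulr_ge0.
  have a5 : 1 <= 5 ^+ j * lz z ^+ j.+1 by rewrite mulr_ege1// exprn_ege1// ler1n.
  apply: le_trans (cmodB _ _) _; apply: le_trans (lerD (cmodD _ _) (lexx _)) _.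
  rewrite cmodM.
  have := cmod_ge0 (Pz j z (ln m%:R)); have := cmod_ge0 (cexp (- z * rc (ln m%:R))).
  move: a1 a2 a3 a4 a5 p1 p2; set q := lz z ^+ j.+1; set S := cmod (Sz _ _ _); set P := cmod (Pz j z (ln _)).
  set P0 := cmod (Pz j z 0); set e := cmod (cexp _); set A := (_ + ln _) ^+ _.+1; set B := (_ + ln _) ^+ j.
  set F := 5 ^+ j.+1; set G := 5 ^+ j * q.
  move=> a1 a2 a3 a4 a5 p1 p2 e0 P00.
  have : e * P <= L * G.
    apply: (@le_trans _ _ P); first by rewrite ler_piMl.
    by apply: le_trans a2 _; rewrite ler_wpM2l.
  have : P0 <= L * G by apply: le_trans a3 _; rewrite ler_peMr.
  have -> : (F + 2 * L * 5 ^+ j) * q = F * q + 2 * (L * G) by rewrite /G; ring.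
  lra.
have [MN|NM] := leqP M N.
  apply: le_trans (small M _) _; first by rewrite M0.
  by rewrite ler_wpM2r ?exprn_ge0// -addrA lerDl addr_ge0.
have s := small N; rewrite N0 leqnn in s; have {}s := s isT.
have := @Rm_diff R j z N M; rewrite N0 (ltnW NM) => /(_ isT z0 x0).
have := cmodD (Rm j z M - Rm j z N) (Rm j z N); rewrite subrK.
have : (1 + cmod z) * (rsq N - rsq M) <= 1.
  apply: (@le_trans _ _ ((1 + cmod z) * rsq N)).
    by rewrite ler_wpM2l ?addr_ge0// lerBlDr lerDl rsq_ge0.
  have -> : rsq N = ((Num.truncn (cmod z)).+3%:R)^-1 :> R.
    rewrite /rsq /N natrX lnXn ?ltr0n// -[RHS](lnK (x := _^-1)) ?posrE ?invr_gt0 ?ltr0n//.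
    by rewrite lnV ?posrE ?ltr0n//; congr expR; rewrite -mulr_natl; field.
  rewrite ler_pdivrMr ?ltr0n// mul1r.
  have -> : (Num.truncn (cmod z)).+3%:R = (Num.truncn (cmod z)).+1%:R + 2 :> R by rewrite -natrD addn2.
  lra.
have q1 : 1 <= lz z ^+ j.+1 by rewrite exprn_ege1.
rewrite -/K; move: s; set q := lz z ^+ j.+1 in q1 *; set w := (1 + cmod z) * _.
rewrite -[K * _ * _]mulrA -/w => s1 w1 s2 s3.
have : K * w <= K * q by rewrite ler_wpM2l// (le_trans w1).
have q0 : 0 <= q by apply: le_trans q1.
have -> : (5 ^+ j.+1 + 2 * L * 5 ^+ j + K + 1) * q = (5 ^+ j.+1 + 2 * L * 5 ^+ j) * q + K * q + q by ring.
lra.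
Qed.

Lemma lnR_ge_nat {R : realType} (A : R) : \forall n \near \oo, A <= ln (n%:R : R).
Proof.
near=> n; apply: (@le_trans _ _ (ln (expR A))); first by rewrite expRK.
have : expR A <= n%:R by near: n; apply: nbhs_infty_ger.
move=> h; rewrite ler_ln ?posrE ?expR_gt0//; apply: lt_le_trans h; exact: expR_gt0.
Unshelve. all: by end_near. Qed.

Lemma exp_decay {R : realType} (c : R) j : 0 < c ->
  (fun n : nat => (1 + ln (n%:R : R)) ^+ j * expR (- c * ln n%:R)) @ \oo --> (0 : R).
Proof.
move=> c0; apply/cvgr0Pnorm_le => e e0; near=> n.
have un : (j.+1`!)%:R * expR c / c ^+ j.+1 / e <= ln (n%:R : R) by near: n; exact: lnR_ge_nat.
have u0 : 0 <= 1 + ln (n%:R : R) by rewrite addr_ge0 ?ln_nat_ge0.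
set u := ln _ in u0 un *.
rewrite ger0_norm ?mulr_ge0 ?exprn_ge0 ?expR_ge0//.
have h := @expR_ge_pow R j.+1 (c * (1 + u)) (mulr_ge0 (ltW c0) u0).
have cj : 0 < c ^+ j.+1 by rewrite exprn_gt0.
have f0 : 0 < (j.+1`!)%:R :> R by rewrite ltr0n fact_gt0.
have u1 : 0 < 1 + u by rewrite ltr_pwDl// /u ln_nat_ge0.
rewrite -(ler_pM2r u1) -(ler_pM2r cj) -(ler_pM2l (expR_gt0 (c * u))).
have -> : expR (c * u) * ((1 + u) ^+ j * expR (- c * u) * (1 + u) * c ^+ j.+1) =
   (expR (c * u) * expR (- c * u)) * (c * (1 + u)) ^+ j.+1 by rewrite exprMn [(1 + u) ^+ j.+1]exprS; ring.
rewrite -expRD mulNr subrr expR0 mul1r; apply: le_trans h _.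
rewrite mulrDr mulr1 expRD mulrA mulrC ler_wpM2l ?expR_ge0//.
move: un; rewrite ler_pdivrMr// ler_pdivrMr// => /le_trans; apply.
rewrite [e * _]mulrC ler_wpM2r ?(ltW cj)// ler_wpM2r ?(ltW e0)//; lra.
Unshelve. all: by end_near. Qed.

Lemma Phi_cvg0 {R : realType} j (z : R[i]) : 0 < Rec z ->
  ccv (fun M => cexp (- z * rc (ln M%:R)) * Pz j z (ln M%:R)) 0.
Proof.
move=> x0; have z0 : z != 0 by apply: contraTneq x0 => ->; rewrite ltxx.
set A := (j.+1`!)%:R * (1 + (cmod z)^-1) ^+ j.+1.
apply: (@ccv_squeeze _ _ _ (fun M => A * ((1 + ln (M%:R : R)) ^+ j * expR (- Rec z * ln M%:R)))).
  near=> M; rewrite subr0 cmodM cmod_cexp.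
  have -> : Rec (- z * rc (ln M%:R)) = - Rec z * ln M%:R by rewrite !reimE /=; ring.
  rewrite mulrA [leRHS]mulrC ler_wpM2l ?expR_ge0//.
  by apply: le_trans (cmod_Pz _ (ln_nat_ge0 _) z0) _; rewrite /A mulrAC.
rewrite -(mulr0 A); apply: cvgMr; exact: exp_decay.
Unshelve. all: by end_near. Qed.

Lemma Rec_neq0 {R : realType} (z : R[i]) : 0 < Rec z -> z != 0.
Proof. by move=> x0; apply: contraTneq x0 => ->; rewrite ltxx. Qed.

Lemma Pz_rc {R : realType} j (x u : R) : exists2 v, Pz j (rc x) u = rc v & (0 < x -> 0 <= u -> 0 <= v).
Proof.
elim: j => [|j [v e v0]] /=; first by exists x^-1; rewrite ?rcV// => x0 _; rewrite invr_ge0 ltW.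
exists ((u ^+ j.+1 + j.+1%:R * v) / x).
  by rewrite e rcM rcV rcD rcM rc_nat.
by move=> x0 u0; have := v0 x0 u0 => h; pos.
Qed.

Lemma fz_rc {R : realType} j (x u : R) : fz j (rc x) u = rc (u ^+ j * expR (- (1 + x) * u)).
Proof.
by rewrite /fz -rc1 -rcD -rcN -rcM cexp_rc -rcM.
Qed.

Definition sz {R : realType} (j : nat) (x : R) M : R :=
  \sum_(1 <= n < M) (ln n%:R) ^+ j * expR (- (1 + x) * ln n%:R).

Lemma Sz_rc {R : realType} j (x : R) M : Sz j (rc x) M = rc (sz j x M).
Proof. by rewrite /Sz /sz rc_sum; apply: eq_bigr => n _; rewrite fz_rc. Qed.

Lemma sz_bound {R : realType} j : exists2 C : R, 0 < C & forall (x : R) M, 0 < x ->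
  sz j x M <= C * (1 + x) + j`!%:R / x ^+ j.+1.
Proof.
have [C C0 H] := @Rm_bound R j; exists C => // x [|[|M]] x0; rewrite /sz.
- by rewrite big_geq//; pos.
- by rewrite big_geq//; pos.
have x0' : 0 < Rec (rc x) by [].
have z0 := Rec_neq0 x0'.
have := H (rc x) M.+1 isT z0 (ltW x0').
rewrite /Rm Sz_rc cmod_rc (gtr0_norm x0).
have [v -> v0] := @Pz_rc R j x (ln M.+1%:R).
rewrite -rcN -rcM cexp_rc -rcM Pz0// -rcX -rcV -rc_nat -rcM -rcN -!rcD cmod_rc.
move=> /(le_trans (ler_norm _)).
have : 0 <= expR (- x * ln M.+1%:R) * v.
  by rewrite mulr_ge0 ?expR_ge0 ?v0// ln_nat_ge0.
rewrite /sz; lra.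
Qed.

Lemma sz_cvg {R : realType} j (x : R) : 0 < x -> cvgn (fun M => sz j x M).
Proof.
move=> x0; have [C C0 H] := @sz_bound R j.
apply: nondecreasing_is_cvgn.
  apply/nondecreasing_seqP => -[|n]; rewrite /sz; first by rewrite !big_geq.
  by rewrite [leRHS]big_nat_recr//= lerDl mulr_ge0 ?exprn_ge0 ?expR_ge0 ?ln_nat_ge0.
by exists (C * (1 + x) + j`!%:R / x ^+ j.+1) => _ [n _ <-]; exact: H.
Qed.

Lemma Sz_term_le {R : realType} j (z : R[i]) n :
  cmod (fz j z (ln n%:R)) = (ln n%:R) ^+ j * expR (- (1 + Rec z) * ln n%:R).
Proof. by rewrite cmod_fz// ln_nat_ge0. Qed.

Lemma Sz_ccv {R : realType} j (z : R[i]) : 0 < Rec z -> exists l, ccv (Sz j z) l.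
Proof.
move=> x0; pose f n := if n is 0 then 0 else fz j z (ln (n%:R : R)).
pose g n := if n is 0 then 0 else (ln (n%:R : R)) ^+ j * expR (- (1 + Rec z) * ln n%:R).
have [] := @ccv_series _ f g.
- by case=> [|n]; rewrite ?cmod0// /f /g Sz_term_le.
- have := @sz_cvg _ j _ x0; rewrite (_ : sz j (Rec z) = series g)//.
  apply/funext => M; rewrite /sz /series /=; case: M => [|M]; first by rewrite !big_geq.
  by rewrite [RHS]big_ltn//= add0r; apply: eq_big_nat => -[].
move=> l H; exists l; move: H; rewrite (_ : Sz j z = fun N => \sum_(0 <= n < N) f n)//.
apply/funext => M; rewrite /Sz; case: M => [|M]; first by rewrite !big_geq.
by rewrite [RHS]big_ltn//= add0r; apply: eq_big_nat => -[].
Qed.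

(* [Dz j z] is [(-1)^j zeta^(j) (1 + z)]. *)
Definition Dz {R : realType} j (z : R[i]) : R[i] := xget 0 [set l | ccv (Sz j z) l].

Lemma DzP {R : realType} j (z : R[i]) : 0 < Rec z -> ccv (Sz j z) (Dz j z).
Proof. by move=> /(Sz_ccv j) [l h]; exact: (@xgetPex _ 0 [set l | ccv (Sz j z) l] (ex_intro _ l h)). Qed.

Lemma ccv_shiftS {R : realType} (u : nat -> R[i]) l : ccv u l -> ccv (fun n => u n.+1) l.
Proof. by case=> a b; split; rewrite (cvg_shiftS (fun n => _ (u n))). Qed.

(** Up to sign, a derivative of zeta with its polar part removed. Being the limit of [Rm], it
    inherits bounds that are uniform up to Re z = 0. *)
Definition Az {R : realType} j (z : R[i]) : R[i] := Dz j z - j`!%:R / z ^+ j.+1.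

Lemma RmP {R : realType} j (z : R[i]) : 0 < Rec z -> ccv (Rm j z) (Az j z).
Proof.
move=> x0; rewrite /Rm /Az -Pz0 ?Rec_neq0//.
apply: ccvD; last exact: ccv_cst.
rewrite -[Dz j z]addr0; apply: ccvD; last exact: Phi_cvg0.
exact: ccv_shiftS (DzP _ x0).
Qed.

Lemma Az_bound {R : realType} j : exists2 C : R, 0 < C &
  forall (z : R[i]), 0 < Rec z -> cmod (Az j z) <= C * (1 + cmod z).
Proof.
have [C C0 H] := @Rm_bound R j; exists C => // z x0.
apply: ccv_le (RmP j x0) _; near=> M.
apply: H; [by near: M; exact: nbhs_infty_gt|exact: Rec_neq0|exact: ltW].
Unshelve. all: by end_near. Qed.

Lemma Az_bound_log {R : realType} j (c : R) : 0 < c -> exists2 C : R, 0 < C &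
  forall (z : R[i]), 0 < Rec z -> c <= cmod z -> cmod (Az j z) <= C * lz z ^+ j.+1.
Proof.
move=> c0; have [C C0 H] := @Rm_bound_log R j c c0; exists C => // z x0 cz.
apply: ccv_le (RmP j x0) _; near=> M.
apply: H => //; [by near: M; exact: nbhs_infty_gt|exact: ltW].
Unshelve. all: by end_near. Qed.

(** * Logarithmic derivatives of zeta *)

(** Von Mangoldt's function. Summing over a box of pairs (p, i), of which at most one has p^i = d,
    lets the box be enlarged and sums be exchanged without extracting an exponent. *)
Definition Lam {R : realType} (d : nat) : R :=
  \sum_(1 <= p < d.+1 | prime p) \sum_(1 <= i < d.+1) if d == (p ^ i)%N then ln p%:R else 0.

Lemma Lam_widen {R : realType} d M : (d < M)%N ->
  Lam d = \sum_(1 <= p < M | prime p) \sum_(1 <= i < M) if d == (p ^ i)%N then ln p%:R else 0 :> R.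
Proof.
move=> dM; rewrite /Lam [in RHS](big_cat_nat (n := d.+1))//=.
rewrite [X in _ = _ + X]big_nat_cond [X in _ = _ + X]big1 ?addr0; last first.
  move=> p /andP[/andP[dp _] pp]; rewrite big_nat_cond big1// => i /andP[/andP[i1 _] _].
  case: eqP => // e; move: dp; rewrite e ltnNge; suff -> : (p <= p ^ i)%N by [].
  by case: i i1 {e} => // i _; rewrite expnS leq_pmulr ?expn_gt0 ?prime_gt0.
apply: eq_bigr => p pp; rewrite [in RHS](big_cat_nat (n := d.+1))//=.
rewrite [X in _ = _ + X]big_nat_cond [X in _ = _ + X]big1 ?addr0// => i /andP[/andP[di _] _].
case: eqP => // e; move: di; rewrite e ltnNge; suff -> : (i <= p ^ i)%N by [].
by apply: ltnW; apply: ltn_expl; exact: prime_gt1.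
Qed.

Lemma Lam_ge0 {R : realType} d : 0 <= Lam d :> R.
Proof.
by apply: sumr_ge0 => p _; apply: sumr_ge0 => i _; case: ifP => // _; exact: ln_nat_ge0.
Qed.

Lemma Lam_sum {R : realType} (F : nat -> R) M :
  \sum_(1 <= a < M) Lam a * F a =
  \sum_(1 <= p < M | prime p) \sum_(1 <= i < M) if (p ^ i < M)%N then ln p%:R * F (p ^ i)%N else 0.
Proof.
under eq_big_nat => a /andP[_ aM] do rewrite (Lam_widen aM) big_distrl /=.
rewrite exchange_big_nat /=; apply: eq_bigr => p pp.
under eq_bigr do rewrite big_distrl /=.
rewrite exchange_big_nat /=; apply: eq_big_nat => i /andP[i1 iM].
case: ifPn => pM; last first.
  rewrite big_nat_cond big1// => a /andP[/andP[_ aM] _]; case: eqP => [e|]; last by rewrite mul0r.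
  by move: pM; rewrite -e aM.
rewrite (bigD1_seq (p ^ i)%N)/= ?iota_uniq// ?mem_index_iota ?expn_gt0 ?prime_gt0// eqxx big1 ?addr0// => a.
by move/negbTE => ->; rewrite mul0r.
Qed.

Lemma ln_prod {R : realType} I (r : seq I) (P : pred I) (F : I -> nat) :
  (forall i, P i -> (0 < F i)%N) ->
  ln ((\prod_(i <- r | P i) F i)%N)%:R = \sum_(i <- r | P i) ln (F i)%:R :> R.
Proof.
move=> H; elim: r => [|i r IH]; first by rewrite !big_nil ln1.
rewrite !big_cons; case: ifPn => // Pi; rewrite natrM lnM ?posrE ?ltr0n ?H ?IH//.
by rewrite prodn_cond_gt0.
Qed.

Lemma ln_logn {R : realType} n M : (0 < n < M)%N ->
  ln n%:R = \sum_(1 <= p < M | prime p) (logn p n)%:R * ln p%:R :> R.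
Proof.
move=> /andP[n0 nM]; rewrite -{1}(partnT n0) (widen_partn _ (m := M)) 1?ltnW//.
rewrite ln_prod; last first.
  by case=> [|p] _; rewrite ?expn_gt0// lognE.
rewrite (big_mkcond (fun p => p \in predT)) /= big_ltn//= lognE /= expn0 ln1 add0r.
rewrite big_nat_recr/=; last by lia.
rewrite [in X in _ + X]lognE; case: ifPn => [/and3P[_ _ /(dvdn_leq n0)]|_]; first by rewrite leqNgt nM.
rewrite expn0 ln1 addr0 [RHS]big_mkcond /=; apply: eq_big_nat => p /andP[p0 _].
case: ifPn => pp; first by rewrite natrX lnXn ?ltr0n// mulr_natl.
by rewrite lognE (negbTE pp) /= expn0 ln1.
Qed.

Lemma sum_dvd_logn {R : realType} p n M : prime p -> (0 < n < M)%N ->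
  \sum_(1 <= i < M) (p ^ i %| n)%N%:R = (logn p n)%:R :> R.
Proof.
move=> pp /andP[n0 nM]; have lM : (logn p n < M)%N.
  by apply: leq_ltn_trans nM; apply: ltnW; rewrite ltn_logl.
rewrite (big_cat_nat (n := (logn p n).+1))//=.
rewrite [X in _ + X]big_nat_cond [X in _ + X]big1 ?addr0; last first.
  by move=> i /andP[/andP[li _] _]; rewrite pfactor_dvdn// leqNgt li.
under eq_big_nat => i /andP[_ il] do rewrite pfactor_dvdn// -ltnS il.
by rewrite -natr_sum sum_nat_const_nat subn1 muln1.
Qed.

(** Each prime p contributes ln p once for every power p^i dividing n, that is [logn p n] times. *)
Lemma Lam_dvd {R : realType} n M : (0 < n < M)%N ->
  \sum_(1 <= a < M) Lam a * (a %| n)%N%:R = ln n%:R :> R.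
Proof.
move=> nM; rewrite Lam_sum (ln_logn nM); apply: eq_bigr => p pp.
rewrite -(sum_dvd_logn pp nM) mulr_suml; apply: eq_bigr => i _.
case: ifPn => [_|]; first by rewrite mulrC.
rewrite -leqNgt => Mp; case: (boolP (p ^ i %| n)%N) => [|_]; last by rewrite mul0r.
by case/andP: nM => n0 nM /(dvdn_leq n0); lia.
Qed.

Lemma Lam_le {R : realType} n : Lam n <= ln n%:R :> R.
Proof.
case: n => [|n]; first by rewrite /Lam big_geq// ln_nat_ge0.
rewrite -(@Lam_dvd R n.+1 n.+2); last lia.
rewrite big_nat_recr//= dvdnn mulr1 lerDr.
by rewrite sumr_ge0// => i _; rewrite mulr_ge0 ?Lam_ge0.
Qed.

(** Coefficient of n^(-s) in the product of the partial sums below M of the series of Lambda and of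
    zeta: exactly ln n for n < M, and between 0 and ln n beyond. *)
Definition lamM {R : realType} M n : R := \sum_(1 <= a < M) \sum_(1 <= b < M) Lam a * (a * b == n)%N%:R.

Lemma sum_mul_eq {R : nzRingType} a n M : (0 < a)%N -> (0 < n)%N ->
  \sum_(1 <= b < M) (a * b == n)%N%:R = ((a %| n) && (n %/ a < M))%N%:R :> R.
Proof.
move=> a0 n0; case: (boolP (a %| n)%N) => [/dvdnP[c e]|na] /=.
  move: n0; rewrite e muln_gt0 => /andP[c0 _]; rewrite mulnK//.
  case: ltnP => cM.
    rewrite (bigD1_seq c)/= ?iota_uniq// ?mem_index_iota ?c0// mulnC eqxx big1 ?addr0// => b bc.
    by rewrite mulnC eqn_pmul2r// (negbTE bc).
  rewrite big_nat_cond big1// => b /andP[/andP[_ bM] _].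
  by rewrite mulnC eqn_pmul2r// (ltn_eqF (leq_trans bM cM)).
rewrite big1// => b _; case: eqP => // e; by move: na; rewrite -e dvdn_mulr.
Qed.

Lemma lamM_ge0 {R : realType} M n : 0 <= lamM M n :> R.
Proof. by apply: sumr_ge0 => a _; apply: sumr_ge0 => b _; rewrite mulr_ge0 ?Lam_ge0. Qed.

Lemma lamM_eq {R : realType} M n : (0 < n < M)%N -> lamM M n = ln n%:R :> R.
Proof.
move=> /[dup] nM /andP[n0 nM']; rewrite -(Lam_dvd nM) /lamM; apply: eq_big_nat => a /andP[a0 _].
rewrite -mulr_sumr sum_mul_eq//; case: (boolP (a %| n)%N) => //= _.
by rewrite (leq_ltn_trans (leq_div _ _) nM').
Qed.

Lemma lamM_le {R : realType} M n : (0 < n)%N -> lamM M n <= ln n%:R :> R.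
Proof.
move=> n0; rewrite -(@Lam_dvd R n (maxn M n.+1)); last by rewrite n0 /= leq_max leqnn orbT.
apply: (@le_trans _ _ (\sum_(1 <= a < M) Lam a * (a %| n)%N%:R)).
  rewrite /lamM big_nat_cond [leRHS]big_nat_cond; apply: ler_sum => a /andP[/andP[a0 _] _].
  rewrite -mulr_sumr ler_wpM2l ?Lam_ge0// sum_mul_eq//.
  by case: (a %| n)%N => //=; case: ltnP.
case: M => [|M]; first by rewrite big_geq// sumr_ge0// => a _; rewrite mulr_ge0 ?Lam_ge0.
by apply: ler_sum_nat_widen => [|a _]; rewrite ?mulr_ge0 ?Lam_ge0//= leq_max leqnn.
Qed.

Lemma dirichlet_partial {R : realType} (F : nat -> R[i]) M : (1 < M)%N ->
  \sum_(1 <= a < M) \sum_(1 <= b < M) rc (Lam a) * F (a * b)%N =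
  \sum_(1 <= n < (M * M)%N) rc (lamM M n) * F n.
Proof.
move=> M1; rewrite /lamM.
under [RHS]eq_bigr do rewrite rc_sum big_distrl /=.
rewrite [RHS]exchange_big_nat /=; apply: eq_big_nat => a /andP[a0 aM].
under [RHS]eq_bigr do rewrite rc_sum big_distrl /=.
rewrite [RHS]exchange_big_nat /=; apply: eq_big_nat => b /andP[b0 bM].
rewrite (bigD1_seq (a * b)%N)/= ?iota_uniq// ?mem_index_iota ?muln_gt0 ?a0 ?b0 ?ltn_mul//.
rewrite eqxx mulr1 big1 ?addr0// => n /negbTE nab; by rewrite eq_sym nab mulr0 rc0 mul0r.
Qed.

Definition Zs {R : realType} j (z : R[i]) M : R[i] :=
  \sum_(1 <= a < M) rc (Lam a) * fz j z (ln a%:R).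

(** The truncated product agrees with the partial sum weighted by ln n up to M. The excess is
    supported on M <= n < M^2 with smaller coefficients, so a tail of the convergent series [sz]
    dominates it. *)
Lemma dirichlet_cvg {R : realType} j (z : R[i]) : 0 < Rec z ->
  ccv (fun M => \sum_(1 <= a < M) \sum_(1 <= b < M) rc (Lam a) * fz j z (ln (a * b)%N%:R)) (Dz j.+1 z).
Proof.
move=> x0; pose T M := sz j.+1 (Rec z) (M * M)%N - sz j.+1 (Rec z) M.
have T0 : T @ \oo --> (0 : R).
  have c := @sz_cvg _ j.+1 _ x0; rewrite -[0](subrr (limn (sz j.+1 (Rec z)))).
  apply: cvgB => //; apply: cvg_comp c.
  apply/cvgnyPge => A; near=> n; have h : (A <= n)%N by near: n; exact: nbhs_infty_ge.
  apply: leq_trans h _; case: (n) => // m; exact: leq_pmulr.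
rewrite -[Dz _ _]add0r (_ : (fun M => _) = (fun M => (\sum_(1 <= a < M) \sum_(1 <= b < M)
  rc (Lam a) * fz j z (ln (a * b)%N%:R) - Sz j.+1 z M) + Sz j.+1 z M)); last first.
  by apply/funext => M; rewrite subrK.
apply: ccvD (DzP _ x0); apply: ccv_squeeze T0; near=> M; rewrite subr0.
have M1 : (1 < M)%N by near: M; exact: nbhs_infty_gt.
rewrite (dirichlet_partial (fun n => fz j z (ln n%:R)) M1).
have MM : (M <= M * M)%N by rewrite leq_pmulr// ltnW.
rewrite (big_cat_nat (n := M))//=; last exact: ltnW.
have -> : \sum_(1 <= i < M) rc (lamM M i) * fz j z (ln i%:R) = Sz j.+1 z M.
  apply: eq_big_nat => i iM; rewrite lamM_eq// /fz mulrA -rcM exprS//.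
rewrite /T /sz [X in _ <= X - _](big_cat_nat (n := M))//=; last exact: ltnW.
rewrite addrAC subrr add0r [leRHS]addrAC subrr add0r; apply: le_trans (cmod_sum _ _ _) _.
apply: ler_sum_nat => n /andP[Mn _].
rewrite cmodM cmod_rc ger0_norm ?lamM_ge0// Sz_term_le exprS -mulrA.
rewrite ler_wpM2r ?lamM_le//; [by pos|lia].
Unshelve. all: by end_near. Qed.

Lemma Zs_ccv {R : realType} j (z : R[i]) : 0 < Rec z -> exists l, ccv (Zs j z) l.
Proof.
move=> x0; pose f n := rc (Lam n) * fz j z (ln (n%:R : R)).
pose g n := if n is 0 then 0 else (ln (n%:R : R)) ^+ j.+1 * expR (- (1 + Rec z) * ln n%:R).
have f0 : f 0%N = 0 by rewrite /f /Lam big_geq// rc0 mul0r.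
have [] := @ccv_series _ f g.
- case=> [|n]; first by rewrite f0 cmod0.
  rewrite /f /g cmodM cmod_rc ger0_norm ?Lam_ge0// Sz_term_le exprS -mulrA.
  by rewrite ler_wpM2r ?Lam_le//; pos.
- have := @sz_cvg _ j.+1 _ x0; rewrite (_ : sz j.+1 (Rec z) = series g)//.
  apply/funext => M; rewrite /sz /series /=; case: M => [|M]; first by rewrite !big_geq.
  by rewrite [RHS]big_ltn//= add0r; apply: eq_big_nat => -[].
move=> l H; exists l; move: H; rewrite (_ : Zs j z = fun N => \sum_(0 <= n < N) f n)//.
apply/funext => M; rewrite /Zs; case: M => [|M]; first by rewrite !big_geq.
by rewrite [RHS]big_ltn//= f0 add0r.
Qed.

(* [Zz j z] is [(-1)^(j+1) (zeta'/zeta)^(j) (1 + z)]. *)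
Definition Zz {R : realType} j (z : R[i]) : R[i] := xget 0 [set l | ccv (Zs j z) l].

Lemma ZzP {R : realType} j (z : R[i]) : 0 < Rec z -> ccv (Zs j z) (Zz j z).
Proof. by move=> /(Zs_ccv j) [l h]; exact: (@xgetPex _ 0 [set l | ccv (Zs j z) l] (ex_intro _ l h)). Qed.

Lemma fz_exp {R : realType} j (z : R[i]) u : fz j z u = rc (u ^+ j) * fz 0 z u.
Proof. by rewrite /fz expr0 rc1 mul1r. Qed.

Lemma fz0D {R : realType} (z : R[i]) u v : fz 0 z (u + v) = fz 0 z u * fz 0 z v.
Proof. by rewrite /fz !expr0 rc1 !mul1r rcD mulrDr cexpD. Qed.

Lemma ln_mul_nat {R : realType} a b : (0 < a)%N -> (0 < b)%N ->
  ln (a * b)%N%:R = ln a%:R + ln b%:R :> R.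
Proof. by move=> a0 b0; rewrite natrM lnM ?posrE ?ltr0n. Qed.

(** This identity and the next two are Leibniz' rule for zeta' = (zeta' / zeta) zeta. They are read
    off coefficients by expanding (ln a + ln b)^j, so that no limit has to be differentiated. *)
Lemma Dz1E {R : realType} (z : R[i]) : 0 < Rec z -> Dz 1 z = Zz 0 z * Dz 0 z.
Proof.
move=> x0; apply: ccv_unique (dirichlet_cvg 0 x0) _.
rewrite (_ : (fun M => _) = fun M => Zs 0 z M * Sz 0 z M).
  exact: ccvM (ZzP _ x0) (DzP _ x0).
apply/funext => M; rewrite /Zs /Sz big_distrl /=; apply: eq_big_nat => a /andP[a0 _].
rewrite big_distrr /=; apply: eq_big_nat => b /andP[b0 _].
by rewrite ln_mul_nat// fz0D mulrA.
Qed.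

Lemma Dz2E {R : realType} (z : R[i]) : 0 < Rec z ->
  Dz 2 z = Zz 1 z * Dz 0 z + Zz 0 z * Dz 1 z.
Proof.
move=> x0; apply: ccv_unique (dirichlet_cvg 1 x0) _.
rewrite (_ : (fun M => _) = fun M => Zs 1 z M * Sz 0 z M + Zs 0 z M * Sz 1 z M).
  by apply: ccvD; apply: ccvM (ZzP _ x0) (DzP _ x0).
apply/funext => M; rewrite /Zs /Sz !big_distrl -big_split /=; apply: eq_big_nat => a /andP[a0 _].
rewrite !big_distrr -big_split /=; apply: eq_big_nat => b /andP[b0 _].
rewrite ln_mul_nat// !(fz_exp 1) fz0D !expr1 rcD; ring.
Qed.

Lemma Dz3E {R : realType} (z : R[i]) : 0 < Rec z ->
  Dz 3 z = Zz 2 z * Dz 0 z + 2 * Zz 1 z * Dz 1 z + Zz 0 z * Dz 2 z.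
Proof.
move=> x0; apply: ccv_unique (dirichlet_cvg 2 x0) _.
rewrite (_ : (fun M => _) = fun M => Zs 2 z M * Sz 0 z M + 2 * Zs 1 z M * Sz 1 z M + Zs 0 z M * Sz 2 z M).
  apply: ccvD; last exact: ccvM (ZzP _ x0) (DzP _ x0).
  apply: ccvD; first exact: ccvM (ZzP _ x0) (DzP _ x0).
  by apply: ccvM (DzP _ x0); apply: ccvM (ZzP _ x0); exact: ccv_cst.
apply/funext => M; rewrite /Zs /Sz [2 * _]big_distrr !big_distrl -!big_split /=; apply: eq_big_nat => a /andP[a0 _].
rewrite !big_distrr -!big_split /=; apply: eq_big_nat => b /andP[b0 _].
rewrite ln_mul_nat// !(fz_exp 2) !(fz_exp 1) fz0D !rcX rcD expr1; ring.
Qed.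

Definition thp {R : realType} (n : nat) : R := if prime n then ln n%:R else 0.

Lemma thp_sum {R : realType} (F : nat -> R) M :
  \sum_(1 <= a < M) (Lam a - thp a) * F a =
  \sum_(1 <= p < M | prime p) \sum_(2 <= i < M) if (p ^ i < M)%N then ln p%:R * F (p ^ i)%N else 0.
Proof.
under eq_bigr do rewrite mulrBl.
rewrite big_split /= Lam_sum sumrN.
have -> : \sum_(1 <= a < M) thp a * F a = \sum_(1 <= p < M | prime p) ln p%:R * F p.
  by rewrite [RHS]big_mkcond; apply: eq_bigr => p _; rewrite /thp; case: ifP; rewrite ?mul0r.
rewrite -sumrB big_mkcond [RHS]big_mkcond; apply: eq_big_nat => p /andP[p1 pM].
case: ifPn => // pp.
have M1 : (1 < M)%N by lia.
by rewrite (big_ltn M1) expn1 pM addrAC subrr add0r.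
Qed.

Lemma thp_le_Lam {R : realType} n : thp n <= Lam n :> R.
Proof.
rewrite /thp; case: ifP => pn; last exact: Lam_ge0.
rewrite /Lam big_mkcond big_nat_recr/=; last by rewrite prime_gt0.
rewrite pn [X in _ + X]big_ltn ?ltnS ?prime_gt0// expn1 eqxx.
rewrite addrCA lerDl addr_ge0 ?sumr_ge0// => [p _|i _]; last by case: ifP => // _; rewrite ln_nat_ge0.
by case: ifP => // _; rewrite sumr_ge0// => i _; case: ifP => // _; rewrite ln_nat_ge0.
Qed.

Lemma sum_sq_geom {R : realType} M : \sum_(2 <= i < M) (i%:R ^+ 2 / 2 ^+ i : R) <= 6.
Proof.
case: M => [|[|M]]; [by rewrite big_geq|by rewrite big_geq|].
(* Closed form of the partial sums; the full series has sum 11/2. *)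
suff -> : \sum_(2 <= i < M.+2) (i%:R ^+ 2 / 2 ^+ i : R) =
   11 / 2 - (M.+2%:R ^+ 2 + 2 * M.+2%:R + 3) * 2 / 2 ^+ M.+2.
  have : 0 <= (M.+2%:R ^+ 2 + 2 * M.+2%:R + 3) * 2 / 2 ^+ M.+2 :> R by pos.
  lra.
elim: M => [|M IH]; first by rewrite big_geq//; field.
rewrite big_nat_recr//= IH -[M.+3%:R]natr1 [2 ^+ M.+3]exprS; field.
by rewrite expf_neq0.
Qed.

(** Proper prime powers contribute a series dominated, up to Re z = 0, by that of (ln p)^3 p^(-2);
    hence a bound uniform in z. *)
Lemma thp_error {R : realType} : exists2 C : R, 0 < C & forall (z : R[i]) M, 0 <= Rec z ->
  cmod (\sum_(1 <= a < M) rc (Lam a - thp a) * fz 2 z (ln a%:R)) <= C.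
Proof.
(* 48 = 3! 2^3 comes from ln^3 p <= 48 p^(1/2), 6 from the sum of i^2 / 2^i, 4 from p^(-i) <= 4
   p^(-2) 2^(-i), and 8 from the telescoping of p^(-3/2). *)
exists (48 * 6 * 4 * 8); first by pos.
move=> z M x0; apply: le_trans (cmod_sum _ _ _) _.
apply: (@le_trans _ _ (\sum_(1 <= a < M) (Lam a - thp a) * ((ln a%:R) ^+ 2 * expR (- ln a%:R)))).
  apply: ler_sum => a _; rewrite cmodM cmod_rc ger0_norm ?subr_ge0 ?thp_le_Lam//.
  rewrite ler_wpM2l ?subr_ge0 ?thp_le_Lam// Sz_term_le ler_wpM2l ?exprn_ge0 ?ln_nat_ge0//.
  by rewrite ler_expR mulNr lerN2 ler_peMl ?ln_nat_ge0// lerDl.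
rewrite thp_sum.
apply: (@le_trans _ _ (\sum_(1 <= p < M) (48 * 6 * 4 * (8 * (rsq p - rsq p.+1))))); last first.
  rewrite -!mulr_sumr; case: M => [|M]; first by rewrite big_geq// !mulr0.
  rewrite (@telescope_sumr_eq _ 1 M.+1 (fun n => - rsq n))// => [|k _]; last by rewrite opprK addrC.
  rewrite opprK mulrA ler_piMr//.
  have -> : rsq 1 = 1 :> R by rewrite /rsq ln1 mulr0 expR0.
  have := @rsq_ge0 R M.+1; lra.
rewrite big_mkcond /= big_nat_cond [leRHS]big_nat_cond; apply: ler_sum => p /andP[/andP[p1 pM] _].
have r0 := @rsq_incr R p p1; have e0 := @expR_ge0 R (- (3 / 2) * ln p%:R).
case: ifPn => pp; last by rewrite mulr_ge0// (le_trans e0 r0).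
apply: (@le_trans _ _ (48 * 6 * 4 * expR (- (3 / 2) * ln p%:R))); last by rewrite ler_wpM2l.
have p0 : 0 < p%:R :> R by rewrite ltr0n.
have lp0 := @ln_nat_ge0 R p.
apply: (@le_trans _ _ (\sum_(2 <= i < M) (ln p%:R) ^+ 3 * (4 * expR (- 2 * ln p%:R)) * (i%:R ^+ 2 / 2 ^+ i))).
  apply: ler_sum_nat => i /andP[i2 _].
  case: ifPn => _; last by pos.
  rewrite natrX lnXn// -[_ *+ i]mulr_natl.
  have E : expR (- (i%:R * ln (p%:R : R))) <= 4 * (expR (- 2 * ln p%:R) / 2 ^+ i).
    have -> : i%:R = 2 + (i - 2)%:R :> R by rewrite -natrD subnKC.
    rewrite mulrDl opprD expRD -mulNr mulrCA ler_wpM2l ?expR_ge0//.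
    rewrite expRN expRM_natl lnK ?posrE//.
    have -> : 4 / 2 ^+ i = (2 ^+ (i - 2))^-1 :> R.
      by rewrite -[in LHS](subnKC i2) exprD; field; rewrite expf_neq0.
    rewrite lef_pV2 ?posrE ?exprn_gt0//; apply: lerXl => //.
    by rewrite ler_nat prime_gt1.
  set L := ln p%:R in lp0 E *; set e := expR (- (i%:R * L)) in E *; set f := expR (-2 * L) in E *.
  have -> : L * ((i%:R * L) ^+ 2 * e) = i%:R ^+ 2 * L * L * L * e by ring.
  have -> : L ^+ 3 * (4 * f) * (i%:R ^+ 2 / 2 ^+ i) = i%:R ^+ 2 * L * L * L * (4 * (f / 2 ^+ i)) by ring.
  by rewrite ler_wpM2l//; pos.
rewrite -mulr_sumr.
have h3 := @ln_pow_le R 3 2 p%:R isT; rewrite ler1n p1 in h3; have {}h3 := h3 isT.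
have E3 : (ln (p%:R : R)) ^+ 3 * expR (- 2 * ln p%:R) <= 48 * expR (- (3 / 2) * ln p%:R).
  have -> : expR (- (3 / 2) * ln (p%:R : R)) = expR (ln p%:R / 2) * expR (- 2 * ln p%:R).
    by rewrite -expRD; congr expR; field.
  rewrite mulrA ler_wpM2r ?expR_ge0//; apply: le_trans h3 _.
  rewrite ler_wpM2r ?expR_ge0// (_ : 3`! = 6)%N//; lra.
have S := @sum_sq_geom R M; set S1 := \sum_(_ <= _ < _) _ in S *.
have S0 : 0 <= S1 by rewrite sumr_ge0// => i _; pos.
move: E3 e0; set A := _ ^+ 3; set B := expR (- 2 * _); set E := expR _ => E3 e0.
have -> : A * (4 * B) * S1 = 4 * (A * B) * S1 by ring.
have -> : 48 * 6 * 4 * E = 4 * (48 * E) * 6 by ring.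
by apply: ler_pM => //; [rewrite /A /B; pos|rewrite ler_pM2l].
Qed.

(** * Euler product, non-vanishing and bounds on the line *)

Definition rough N n := all (fun q => ~~ (prime q && (q %| n)%N)) (iota 0 N).

Lemma roughS N n : rough N.+1 n = rough N n && ~~ (prime N && (N %| n)%N).
Proof. by rewrite /rough -addn1 iotaD all_cat /= andbT. Qed.

Lemma rough_gt N n : (1 < n < N)%N -> rough N n = false.
Proof.
move=> /andP[n1 nN]; apply/negbTE/allPn; exists (pdiv n).
  rewrite mem_iota /= add0n; apply: leq_ltn_trans nN; apply: dvdn_leq; first lia.
  exact: pdiv_dvd.
by rewrite negbK pdiv_prime// pdiv_dvd.
Qed.

Lemma rough_mul p m : prime p -> rough p (p * m) = rough p m.
Proof.
move=> pp; apply: eq_in_all => q; rewrite mem_iota /= add0n => qp; congr negb.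
case: (boolP (prime q)) => //= pq; rewrite Euclid_dvdM//.
by rewrite dvdn_prime2// (ltn_eqF qp).
Qed.

Lemma ccv_comp {R : realType} (u : nat -> R[i]) l (g : nat -> nat) :
  ccv u l -> g @ \oo --> \oo -> ccv (fun n => u (g n)) l.
Proof. by move=> [u1 u2] gg; split; [exact: cvg_comp u1|exact: cvg_comp u2]. Qed.

Lemma sum_dvd_reindex {R : realType} (P : pred nat) (F : nat -> R[i]) p M : (0 < p)%N ->
  \sum_(1 <= n < M | P n && (p %| n)%N) F n =
  \sum_(1 <= m < (M.-1 %/ p).+1 | P (p * m)%N) F (p * m)%N.
Proof.
move=> p0; rewrite big_mkcond [RHS]big_mkcond /=.
pose G n := if P n then F n else 0.
rewrite [RHS](eq_bigr (fun m => G (p * m)%N))//.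
transitivity (\sum_(1 <= n < M) \sum_(1 <= m < (M.-1 %/ p).+1) (p * m == n)%N%:R * G n).
  apply: eq_big_nat => n /andP[n0 nM]; rewrite -mulr_suml sum_mul_eq// ltnS leq_div2r//; last lia.
  by rewrite andbT /G; case: (p %| n)%N; rewrite ?andbT ?andbF ?mul1r ?mul0r.
rewrite exchange_big_nat /=; apply: eq_big_nat => m /andP[m0 mM].
have pm : (p * m < M)%N.
  have : (p * m <= M.-1)%N by rewrite mulnC -leq_divRL.
  case: M {mM} => //=; rewrite leqn0; nia.
rewrite (bigD1_seq (p * m)%N)/= ?iota_uniq// ?mem_index_iota ?muln_gt0 ?p0 ?m0// eqxx mul1r.
by rewrite big1 ?addr0// => n; rewrite eq_sym => /negbTE ->; rewrite mul0r.
Qed.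

Definition ez {R : realType} (z : R[i]) (n : nat) : R[i] := fz 0 z (ln n%:R).

Lemma ezM {R : realType} (z : R[i]) a b : (0 < a)%N -> (0 < b)%N -> ez z (a * b) = ez z a * ez z b.
Proof. by move=> a0 b0; rewrite /ez ln_mul_nat// fz0D. Qed.

(** Eratosthenes' sieve: for a prime p, the factor 1 - p^(-s) removes the multiples of p from the
    sum over numbers without prime factor below p, because p m is such a number exactly when m
    is. *)
Lemma euler_rough {R : realType} (z : R[i]) N : 0 < Rec z ->
  ccv (fun M => \sum_(1 <= n < M | rough N n) ez z n)
      (\prod_(p < N | prime p) (1 - ez z p) * Dz 0 z).
Proof.
move=> x0; elim: N => [|N IH]; first by rewrite big_ord0 mul1r; exact: DzP.
rewrite big_mkcond big_ord_recr -big_mkcond /=; case: ifPn => pN; last first.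
  under eq_fun => M do under eq_bigl => n do rewrite roughS (negbTE pN) andbT.
  by rewrite mulr1.
have N0 := prime_gt0 pN.
rewrite (_ : (fun M => _) = fun M => \sum_(1 <= n < M | rough N n) ez z n +
   - (ez z N * \sum_(1 <= n < (M.-1 %/ N).+1 | rough N n) ez z n)); last first.
  apply/funext => M; rewrite [X in _ = X + _](bigID (fun n => (N %| n)%N)) /=.
  rewrite sum_dvd_reindex// mulr_sumr.
  under [X in X + _ - _]eq_bigl => m do rewrite rough_mul//.
  rewrite big_nat_cond [X in _ = X + _ - _]big_nat_cond.
  under [X in X + _ - _]eq_bigr => m /andP[/andP[m0 _] _] do rewrite ezM//.
  rewrite -[X in _ = X + _ - _]big_nat_cond addrAC subrr add0r -big_nat_cond.
  by apply: eq_bigl => n; rewrite roughS pN.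
set Q := \prod_(_ < _ | _) _ in IH *.
have -> : Q * (1 - ez z N) * Dz 0 z = Q * Dz 0 z + - (ez z N * (Q * Dz 0 z)) by ring.
apply: (ccvD IH); apply: ccvN; apply: ccvM; first exact: ccv_cst.
apply: (ccv_comp IH (g := fun M => (M.-1 %/ N).+1)).
apply/cvgnyPge => A; near=> M.
have h : (A * N < M)%N by near: M; exact: nbhs_infty_gt.
by apply: ltnW; rewrite ltnS leq_divRL// -ltnS; apply: leq_trans h (leqSpred _).
Unshelve. all: by end_near. Qed.

(** A number other than 1 without prime factor below N is at least N, so the sieved sum differs from
    1 by at most a tail of the series at Re z. Keeping zeta as a factor makes the statement
    meaningful before zeta is known not to vanish. *)
Lemma euler_product {R : realType} (z : R[i]) : 0 < Rec z ->
  ccv (fun N => \prod_(p < N | prime p) (1 - ez z p) * Dz 0 z) 1.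
Proof.
move=> x0; have c := @sz_cvg _ 0 _ x0; set l := limn (sz 0 (Rec z)) in c.
have nd : nondecreasing_seq (sz 0 (Rec z)).
  apply/nondecreasing_seqP => -[|n]; rewrite /sz; first by rewrite !big_geq.
  by rewrite [leRHS]big_nat_recr//= lerDl; pos.
apply: (@ccv_squeeze _ _ _ (fun N => l - sz 0 (Rec z) N)); last first.
  by rewrite -(subrr l); apply: cvgB c; exact: cvg_cst.
near=> N; have N2 : (1 < N)%N by near: N; exact: nbhs_infty_gt.
apply: (ccv_le (u := fun M => \sum_(1 <= n < M | rough N n) ez z n - 1)).
  by apply: ccvD; [exact: euler_rough|exact: ccv_cst].
near=> M; have NM : (N <= M)%N by near: M; exact: nbhs_infty_ge.
rewrite (big_cat_nat (n := N))//=; last exact: ltnW.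
have -> : \sum_(1 <= n < N | rough N n) ez z n = 1.
  have r1 : rough N 1 by apply/allP => q _; case: (boolP (prime q)) => //= /prime_gt1; rewrite dvdn1; lia.
  rewrite big_mkcond big_ltn// r1 big_nat_cond big1 ?addr0; last first.
    by move=> n /andP[nN _]; rewrite rough_gt.
  by rewrite /ez ln1 /fz expr0 rc0 mulr0 cexp0 mulr1 /= addr0.
rewrite [X in cmod (X - _)]addrC addrK; apply: le_trans (cmod_sum _ _ _) _.
apply: (@le_trans _ _ (sz 0 (Rec z) M - sz 0 (Rec z) N)); last first.
  by rewrite lerB//; exact: nondecreasing_cvgn_le.
rewrite /sz [X in _ <= X - _](big_cat_nat (n := N))//=; last exact: ltnW.
rewrite [leRHS]addrAC subrr add0r big_mkcond /=; apply: ler_sum_nat => n _.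
by case: ifP => _; rewrite -?Sz_term_le; pos.
Unshelve. all: by end_near. Qed.

Lemma ezE {R : realType} (x y : R) n :
  ez (Complex x y) n = Complex (expR (- (1 + x) * ln n%:R) * cos (y * ln n%:R))
                               (- (expR (- (1 + x) * ln n%:R) * sin (y * ln n%:R))).
Proof.
rewrite /ez /fz expr0 rc1 mul1r.
have -> : - (1 + Complex x y) * rc (ln n%:R) = Complex (- (1 + x) * ln n%:R) (- (y * ln n%:R)).
  by apply: eq_cplx; rewrite !reimE /=; ring.
by rewrite /cexp /= cosN sinN mulrN.
Qed.

Lemma sum_inv_sq {R : realType} N : \sum_(1 <= n < N) (n%:R ^- 2 : R) <= 2.
Proof.
case: N => [|[|N]]; [by rewrite big_geq|by rewrite big_geq|].
suff : \sum_(1 <= n < N.+2) (n%:R ^- 2 : R) <= 2 - N.+1%:R^-1.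
  move=> /le_trans; apply; by rewrite lerBlDr lerDl invr_ge0.
elim: N => [|N IH]; first by rewrite big_nat1; lra.
rewrite big_nat_recr//=; move: IH; set s := \sum_(_ <= _ < _) _ => IH.
have n0 : 0 < N.+1%:R :> R by rewrite ltr0n.
have -> : N.+2%:R = N.+1%:R + 1 :> R by rewrite natr1.
move: n0 IH; set a := N.+1%:R => a0 IH.
have : (a + 1) ^- 2 <= a^-1 - (a + 1)^-1.
  have -> : a^-1 - (a + 1)^-1 = (a * (a + 1))^-1 by field; rewrite !gt_eqF//; lra.
  by rewrite lef_pV2 ?posrE ?exprn_gt0 ?mulr_gt0//; nra.
by move: IH; move: (a^-1) ((a + 1)^-1) ((a + 1) ^- 2) => b1 b2 b3; lra.
Qed.

Lemma prod_pow_le {R : realType} (r : seq nat) (P : pred nat) (a b c d : nat -> R) :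
  (forall p, P p -> [/\ 0 <= a p, 0 <= b p, 0 <= c p & a p ^+ 6 * b p ^+ 8 * c p ^+ 2 <= d p]) ->
  (\prod_(p <- r | P p) a p) ^+ 6 * (\prod_(p <- r | P p) b p) ^+ 8 * (\prod_(p <- r | P p) c p) ^+ 2
  <= \prod_(p <- r | P p) d p.
Proof.
move=> H; rewrite -!prodrXl -!big_split /=; apply: ler_prod => p /H[a0 b0 c0 ->].
by rewrite andbT !mulr_ge0 ?exprn_ge0.
Qed.

(* Termwise [3 + 4 cos + cos 2 >= 0], with [1 + u <= exp u] replacing logarithms;
   the quadratic error sums to a constant over the primes. *)
Lemma three_four_one {R : realType} (x t : R) : 0 < x ->
  expR (- 16) <= cmod (Dz 0 (rc x)) ^+ 6 * cmod (Dz 0 (Complex x t)) ^+ 8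
                 * cmod (Dz 0 (Complex x (2 * t))) ^+ 2.
Proof.
move=> x0.
have H (z : R[i]) (z0 : 0 < Rec z) := @ccv_cmod _ _ _ (@euler_product R z z0).
have e0 := H (rc x) x0; have e1 := H (Complex x t) x0; have e2 := H (Complex x (2 * t)) x0.
rewrite cmod1 in e0 e1 e2.
pose u (z : R[i]) N := cmod (\prod_(p < N | prime p) (1 - ez z p) * Dz 0 z).
have L : (fun N => u (rc x) N ^+ 6 * u (Complex x t) N ^+ 8 * u (Complex x (2 * t)) N ^+ 2) @ \oo --> (1 : R).
  rewrite [X in _ --> X](_ : 1 = 1 ^+ 6 * 1 ^+ 8 * 1 ^+ 2 :> R); last by rewrite !expr1n !mulr1.
  have X (v : nat -> R) n : v @ \oo --> (1 : R) -> (fun k => v k ^+ n) @ \oo --> (1 ^+ n : R).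
    move=> v1; elim: n => [|n IH]; first by under eq_fun do rewrite expr0; exact: cvg_cst.
    by under eq_fun do rewrite exprS; rewrite exprS; exact: cvgM.
  by apply: cvgM; [apply: cvgM|]; apply: X.
have HL := cvg_lim (@Rhausdorff R) L.
rewrite expRN -[X in X <= _]mul1r ler_pdivrMr ?expR_gt0// -[leLHS]HL.
apply: limr_le; first by apply/cvg_ex; exists 1.
near=> N; rewrite /u !cmodM !exprMn.
set A0 := cmod (Dz 0 (rc x)); set A1 := cmod (Dz 0 (Complex x t)); set A2 := cmod (Dz 0 (Complex x (2 * t))).
set p0 := cmod _; set p1 := cmod _; set p2 := cmod _.
have -> : p0 ^+ 6 * A0 ^+ 6 * (p1 ^+ 8 * A1 ^+ 8) * (p2 ^+ 2 * A2 ^+ 2) =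
  (A0 ^+ 6 * A1 ^+ 8 * A2 ^+ 2) * (p0 ^+ 6 * p1 ^+ 8 * p2 ^+ 2) by ring.
apply: ler_wpM2l; first by rewrite /A0 /A1 /A2; pos.
(* The local errors are 3 r^2 + 4 r^2 + r^2 with r <= 1 / p, and the sum of n^(-2) is at most 2;
   hence 16. *)
apply: (@le_trans _ _ (\prod_(0 <= p < N | prime p) expR (8 * p%:R ^- 2))); last first.
  rewrite -expR_sum ler_expR -mulr_sumr.
  have -> : (16 : R) = 8 * 2 by ring.
  rewrite ler_pM2l//; apply: le_trans (@sum_inv_sq R N).
  rewrite big_mkcond; case: (N) => [|n]; first by rewrite !big_geq.
  by rewrite big_ltn//= add0r; apply: ler_sum_nat => i _; case: ifP => // _; pos.
rewrite /p0 /p1 /p2 !cmod_prod.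
rewrite -!(big_mkord prime (fun p => cmod (1 - ez _ p))).
apply: prod_pow_le => p pp; split; [exact: cmod_ge0|exact: cmod_ge0|exact: cmod_ge0|].
have q0 : 0 < p%:R :> R by rewrite ltr0n prime_gt0.
set r := expR (- (1 + x) * ln (p%:R : R)).
have r0 : 0 <= r by exact: expR_ge0.
have r1 : r <= p%:R^-1.
  by rewrite /r invE_ln// ler_expR mulNr lerN2 ler_peMl ?ln_nat_ge0// lerDl ltW.
have rr : r ^+ 2 <= p%:R ^- 2 by rewrite -exprVn; apply: lerXl.
set th := t * ln (p%:R : R).
have M2 (y : R) : cmod (1 - ez (Complex x y) p) ^+ 2 = 1 - 2 * r * cos (y * ln p%:R) + r ^+ 2.
  rewrite ezE cmod_sqr /= -/r; have := cos2Dsin2 (y * ln (p%:R : R)); move: (cos _) (sin _) (r) => a b r'; clear; nra.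
clearbody r.
(* The exponents 6, 8, 2 are twice 3, 4, 1, so that only squared moduli occur, which are polynomials
   in r and the cosine. *)
have -> : cmod (1 - ez (rc x) p) ^+ 6 = (cmod (1 - ez (rc x) p) ^+ 2) ^+ 3 by rewrite -exprM.
have -> : cmod (1 - ez (Complex x t) p) ^+ 8 = (cmod (1 - ez (Complex x t) p) ^+ 2) ^+ 4 by rewrite -exprM.
rewrite !M2 mul0r cos0 -/th.
have -> : cos (2 * t * ln p%:R) = cos (2 * th) by rewrite /th mulrA.
have -> : cos (2 * th) = 2 * cos th ^+ 2 - 1 by rewrite mulr_natl cos_mulr2n mulr_natl.
set c := cos th.
have b1 : 0 <= 1 - 2 * r * 1 + r ^+ 2.
  by have -> : 1 - 2 * r * 1 + r ^+ 2 = (1 - r) ^+ 2 by [ring]; exact: sqr_ge0.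
have cc : 0 <= 1 - c ^+ 2 by rewrite /c -sin2cos2 sqr_ge0.
have b2 : 0 <= 1 - 2 * r * c + r ^+ 2.
  have -> : 1 - 2 * r * c + r ^+ 2 = (r - c) ^+ 2 + (1 - c ^+ 2) by ring.
  by rewrite addr_ge0 ?sqr_ge0.
have b3 : 0 <= 1 - 2 * r * (2 * c ^+ 2 - 1) + r ^+ 2.
  have -> : 1 - 2 * r * (2 * c ^+ 2 - 1) + r ^+ 2 = (r - (2 * c ^+ 2 - 1)) ^+ 2 + 4 * (c ^+ 2 * (1 - c ^+ 2)) by ring.
  apply: addr_ge0; first exact: sqr_ge0.
  apply: mulr_ge0 => //; apply: mulr_ge0 => //; exact: sqr_ge0.
have f1 : (1 - 2 * r * 1 + r ^+ 2) ^+ 3 <= expR (- 2 * r + r ^+ 2) ^+ 3.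
  by apply: lerXl => //; apply: le_trans (expR_ge1Dx _); clear; lra.
have f2 : (1 - 2 * r * c + r ^+ 2) ^+ 4 <= expR (- 2 * r * c + r ^+ 2) ^+ 4.
  by apply: lerXl => //; apply: le_trans (expR_ge1Dx _); clear; lra.
have f3 : (1 - 2 * r * (2 * c ^+ 2 - 1) + r ^+ 2) <= expR (- 2 * r * (2 * c ^+ 2 - 1) + r ^+ 2).
  by apply: le_trans (expR_ge1Dx _); clear; lra.
apply: (@le_trans _ _ (expR (- 2 * r + r ^+ 2) ^+ 3 * expR (- 2 * r * c + r ^+ 2) ^+ 4
   * expR (- 2 * r * (2 * c ^+ 2 - 1) + r ^+ 2))).
  by apply: ler_pM => //; [rewrite mulr_ge0 ?exprn_ge0|apply: ler_pM => //; rewrite exprn_ge0].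
rewrite -!expRM_natl -!expRD ler_expR.
have : 0 <= r * (1 + c) ^+ 2 by rewrite mulr_ge0 ?sqr_ge0.
move: rr; move: (p%:R ^- 2) (c) (r); clear=> q c r; nra.
Unshelve. all: by end_near. Qed.

Lemma dvcV {R : realType} (f : R -> R[i]) x a : f x != 0 ->
  dvc f x a -> dvc (fun y => (f y)^-1) x (- a / f x ^+ 2).
Proof.
move=> f0 [f1 f2].
have V (w : R[i]) : Rec w^-1 = Rec w / (Rec w ^+ 2 + Imc w ^+ 2) /\
    Imc w^-1 = - (Imc w / (Rec w ^+ 2 + Imc w ^+ 2)) by case: w => p q /=; rewrite ?mulNr.
have n0 : Rec (f x) ^+ 2 + Imc (f x) ^+ 2 != 0 by rewrite -cmod_sqr expf_eq0 /= cmod_eq0.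
have E : Rec (- a / f x ^+ 2) = (Rec a * (Imc (f x) ^+ 2 - Rec (f x) ^+ 2) - 2 * Imc a * Rec (f x) * Imc (f x)) / (Rec (f x) ^+ 2 + Imc (f x) ^+ 2) ^+ 2 /\
  Imc (- a / f x ^+ 2) = (Imc a * (Imc (f x) ^+ 2 - Rec (f x) ^+ 2) + 2 * Rec a * Rec (f x) * Imc (f x)) / (Rec (f x) ^+ 2 + Imc (f x) ^+ 2) ^+ 2.
  have n1 : (Rec (f x) ^+ 2 - Imc (f x) ^+ 2) ^+ 2 + (2 * Rec (f x) * Imc (f x)) ^+ 2 != 0.
    have -> : (Rec (f x) ^+ 2 - Imc (f x) ^+ 2) ^+ 2 + (2 * Rec (f x) * Imc (f x)) ^+ 2 =
      (Rec (f x) ^+ 2 + Imc (f x) ^+ 2) ^+ 2 by ring.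
    by rewrite expf_neq0.
  have e1 : Rec (f x ^+ 2) = Rec (f x) ^+ 2 - Imc (f x) ^+ 2 by rewrite expr2 reimE; ring.
  have e2 : Imc (f x ^+ 2) = 2 * Rec (f x) * Imc (f x) by rewrite expr2 reimE; ring.
  have e3 : (Rec (f x) ^+ 2 - Imc (f x) ^+ 2) ^+ 2 + (2 * Rec (f x) * Imc (f x)) ^+ 2 =
      (Rec (f x) ^+ 2 + Imc (f x) ^+ 2) ^+ 2 by ring.
  rewrite !reimE; have [-> ->] := V (f x ^+ 2); rewrite e1 e2 e3.
  by split; field.
split.
  under [X in dv X]eq_fun do rewrite (V _).1.
  apply: dv_eq.
    apply: dvM; [exact: f1|apply: dvV; first exact: n0].
    by apply: dvD; apply: dvX; eassumption.
  by rewrite E.1; field.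
under [X in dv X]eq_fun do rewrite (V _).2.
apply: dv_eq.
  apply: dvN; apply: dvM; [exact: f2|apply: dvV; first exact: n0].
  by apply: dvD; apply: dvX; eassumption.
by rewrite E.2; field.
Qed.

(** The derivative of [Rm 0] in the abscissa is [- Rm 1], an identity between finite sums. The
    Lipschitz bound passes to the limit in M, so [Az 0] is never differentiated. *)
Lemma Rm_lipschitz {R : realType} (c : R) : 0 < c -> exists2 C : R, 0 < C &
  forall (x y t : R), 0 < x -> x <= y -> y <= 1 -> c <= `|t| ->
  cmod (Az 0 (Complex x t) - Az 0 (Complex y t)) <= C * (1 + ln (3 + `|t|)) ^+ 2 * (y - x).
Proof.
move=> c0; have [C C0 H] := @Rm_bound_log R 1 c c0; exists (2 * C); first by pos.
move=> x y t x0 xy y1 ct.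
have y0 : 0 < y := lt_le_trans x0 xy.
apply: (ccv_le (u := fun M => Rm 0 (Complex x t) M - Rm 0 (Complex y t) M)).
  by apply: ccvD; [|apply: ccvN]; apply: RmP.
near=> M; have M0 : (0 < M)%N by near: M; exact: nbhs_infty_gt.
rewrite -cmodN opprB -[2 * C * _]mulrA.
apply: (@dvc_lipschitz _ (fun w => Rm 0 (Complex w t) M) (fun w => - Rm 1 (Complex w t) M)) => // w /andP[xw wy].
  have z0 : Complex w t != 0 by apply: Rec_neq0 => /=; exact: lt_le_trans xw.
  have dz : dvc (fun w => Complex w t) w 1 by split => /=; [exact: dv_id|exact: dv_cst].
  rewrite /Rm /Sz /=.
  apply: dvc_eq.
    apply: dvcD; last by apply: dvcN; apply: dvcV z0 dz.
    apply: dvcD; last first.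
      apply: dvcM; last by apply: dvcV z0 dz.
      by apply: dvc_cexp; apply: dvcM (dvc_cst _ _); apply: dvcN; exact: dz.
    apply: dvc_sum => n _; rewrite /fz; apply: dvcM; first exact: dvc_cst.
    by apply: dvc_cexp; apply: dvcM (dvc_cst _ _); apply: dvcN; apply: dvcD dz; exact: dvc_cst.
  cbv beta.
  rewrite !expr0n /= !expr1 rc0.
  have -> : \sum_(1 <= i < M.+1) (0 * cexp (- (1 + Complex w t) * rc (ln i%:R)) +
     rc (ln i%:R ^+ 0) * (cexp (- (1 + Complex w t) * rc (ln i%:R)) * (- (0 + 1) * rc (ln i%:R) + - (1 + Complex w t) * 0)))
    = - \sum_(1 <= n < M.+1) fz 1 (Complex w t) (ln n%:R).
    by rewrite -sumrN; apply: eq_bigr => n _; rewrite /fz expr0 expr1 rc1; ring.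
  rewrite opprB opprD; field; exact: z0.
rewrite cmodN; have := H (Complex w t) M M0.
have w0 : 0 < w := lt_le_trans x0 xw.
have cw : c <= cmod (Complex w t) by apply: le_trans ct _; exact: (@Imc_le _ (Complex w t)).
move=> /(_ cw (ltW w0)) /le_trans; apply.
apply: ler_wpM2l; first exact: ltW.
apply: lerXl; first by apply: le_trans (lz_ge1 _).
rewrite /lz lerD2l ler_ln ?posrE ?ltr_pwDl ?cmod_ge0//.
have := cmod_le_reim (Complex w t); rewrite /= (gtr0_norm w0); lra.
Unshelve. all: by end_near. Qed.

(** Let L be 1 + ln (3 + |t|). The inequality [three_four_one] gives |zeta| at least of order
    x^(3/4) L^(-1/4), which is useless as x tends to 0. Moving from an abscissa y to a smaller one
    costs O(L^2 y). At y = e L^(-9) both quantities are of order L^(-7). *)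
Lemma zeta_lower_far {R : realType} (c : R) : 0 < c -> exists2 k : R, 0 < k &
  forall (x t : R), 0 < x -> x <= 1 -> c <= `|t| ->
  k <= cmod (Dz 0 (Complex x t)) * (1 + ln (3 + `|t|)) ^+ 7.
Proof.
move=> c0.
have [C1 C10 H1] := @Rm_lipschitz R c c0.
have [C0 C00 H0] := @Az_bound R 0.
have [C2 C20 H2] := @Az_bound_log R 0 c c0.
pose L (t : R) : R := 1 + ln (3 + `|t|).
have L1 t : 1 <= L t by rewrite lerDl ln_ge0//; have := normr_ge0 t; lra.
have DA z : Dz 0 z = z^-1 + Az 0 z :> R[i] by rewrite /Az fact0 expr1 div1r addrC subrK.
pose Ca := 1 + 2 * C0; pose Cb := c^-1 + 2 * C2.
have Ca0 : 0 < Ca by rewrite /Ca; pos.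
have Cb0 : 0 < Cb by rewrite /Cb; pos.
pose C := C1 + c^-1 ^+ 2.
have CC : 0 < C by rewrite /C; pos.
have Dx (x : R) : 0 < x -> x <= 1 -> cmod (Dz 0 (rc x)) <= Ca / x.
  move=> x0 x1; rewrite DA; apply: le_trans (cmodD _ _) _.
  rewrite cmodV; have := H0 (rc x) x0; rewrite cmod_rc (gtr0_norm x0) => h.
  rewrite /Ca mulrDl mul1r lerD2l; apply: le_trans h _.
  rewrite ler_pdivlMr//; have : (1 + x) * x <= 2 by nra.
  by move=> h2; have := ler_wpM2l (ltW C00) h2; nra.
have D2 (x t : R) : 0 < x -> x <= 1 -> c <= `|t| -> cmod (Dz 0 (Complex x (2 * t))) <= Cb * L t.
  move=> x0 x1 ct; rewrite DA; apply: le_trans (cmodD _ _) _.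
  have ct2 : c <= cmod (Complex x (2 * t)).
    apply: le_trans (@Imc_le _ (Complex x (2 * t))); rewrite /= normrM ger0_norm//; lra.
  have h := H2 (Complex x (2 * t)) x0 ct2; rewrite cmodV.
  have i1 : (cmod (Complex x (2 * t)))^-1 <= c^-1 by rewrite lef_pV2 ?posrE//; exact: lt_le_trans ct2.
  have i2 : lz (Complex x (2 * t)) <= 2 * L t.
    have -> : 2 * L t = 1 + ln (expR 1 * (3 + `|t|) ^+ 2).
      have t3 : 0 < 3 + `|t| by rewrite ltr_pwDl.
      rewrite lnM ?posrE ?expR_gt0 ?exprn_gt0// expRK lnXn// /L; ring.
    rewrite /lz lerD2l ler_ln ?posrE ?ltr_pwDl ?cmod_ge0 ?mulr_gt0 ?expR_gt0 ?exprn_gt0 ?ltr_pwDl//.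
    have := cmod_le_reim (Complex x (2 * t)); rewrite /= (gtr0_norm x0) normrM [`|2|]ger0_norm//.
    have := expR_ge1Dx (1 : R); have := normr_ge0 t; nra.
  rewrite expr1 in h; have -> : Cb * L t = c^-1 * L t + 2 * C2 * L t by rewrite /Cb; ring.
  apply: lerD.
    apply: le_trans i1 _; rewrite ler_peMr// ltW// invr_gt0//.
  apply: le_trans h _; rewrite [2 * C2]mulrC -mulrA; exact: ler_wpM2l (ltW C20) _ _ i2.
pose k2 := expR (- 16) / (Ca ^+ 6 * Cb ^+ 2).
have k20 : 0 < k2 by rewrite /k2; pos.
have low (x t : R) : 0 < x -> x <= 1 -> c <= `|t| ->
    k2 * x ^+ 6 <= cmod (Dz 0 (Complex x t)) ^+ 8 * L t ^+ 2.
  move=> x0 x1 ct; have := three_four_one t x0.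
  have d0 := Dx x x0 x1; have d2 := D2 x t x0 x1 ct.
  set A := cmod (Dz 0 (rc x)) in d0 *; set B := cmod (Dz 0 (Complex x t)); set E := cmod (Dz 0 (Complex x (2 * t))) in d2 *.
  have A0 : 0 <= A by exact: cmod_ge0. have E0 : 0 <= E by exact: cmod_ge0. have B0 : 0 <= B by exact: cmod_ge0.
  move=> h.
  have : expR (- 16) <= (Ca / x) ^+ 6 * B ^+ 8 * (Cb * L t) ^+ 2.
    apply: le_trans h _; apply: ler_pM; rewrite ?mulr_ge0 ?exprn_ge0//; last exact: lerXl.
    by rewrite ler_wpM2r ?exprn_ge0//; exact: lerXl.
  rewrite !exprMn exprVn => h2.
  rewrite /k2 mulrAC ler_pdivrMr; last by pos.
  have x6 : 0 < x ^+ 6 by pos.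
  rewrite -ler_pdivlMr//; apply: le_trans h2 _.
  by rewrite le_eqVlt; apply/orP; left; apply/eqP; ring.
(* [e] is chosen so that [4 C e L^-9 L^2] is below the lower bound at abscissa [e L^-9]. *)
pose e := Num.min 1 (k2 / (4 * C + 1) ^+ 8).
have e0 : 0 < e by rewrite /e lt_min ltr01 /=; pos.
have e1 : e <= 1 by rewrite /e ge_min lexx.
have ek : e * (4 * C) ^+ 8 <= k2.
  have : e <= k2 / (4 * C + 1) ^+ 8 by rewrite /e ge_min lexx orbT.
  rewrite ler_pdivlMr; last by pos.
  apply: le_trans; rewrite ler_wpM2l ?(ltW e0)//; apply: lerXl; first by pos.
  by rewrite lerDl.
have lip (x y t : R) : 0 < x -> x <= y -> y <= 1 -> c <= `|t| ->
    cmod (Dz 0 (Complex y t)) <= cmod (Dz 0 (Complex x t)) + C * L t ^+ 2 * y.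
  move=> x0 xy y1 ct; have y0 := lt_le_trans x0 xy.
  have cz w : c <= cmod (Complex w t) by apply: le_trans ct (@Imc_le _ (Complex w t)).
  have nz w : Complex w t != 0 by rewrite -cmod_gt0; apply: lt_le_trans (cz w).
  have -> : Dz 0 (Complex y t) = Dz 0 (Complex x t) - (Az 0 (Complex x t) - Az 0 (Complex y t))
     - rc (y - x) * ((Complex x t)^-1 * (Complex y t)^-1).
    have -> : rc (y - x) = Complex y t - Complex x t by apply: eq_cplx; rewrite !reimE //= subrr.
    rewrite !DA; move: (nz x) (nz y) => h1 h2; by field; rewrite h1 h2.
  apply: le_trans (cmodB _ _) _; rewrite cmodM cmod_rc cmodM !cmodV ger0_norm ?subr_ge0//.
  apply: le_trans (lerD (cmodB _ _) (lexx _)) _; rewrite -addrA lerD2l.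
  have h := H1 x y t x0 xy y1 ct; rewrite -/(L t) in h.
  have l0 : 0 <= L t by apply: le_trans (L1 t).
  have -> : C * L t ^+ 2 * y = C1 * L t ^+ 2 * y + c^-1 ^+ 2 * L t ^+ 2 * y by rewrite /C; ring.
  apply: lerD.
    by apply: le_trans h _; rewrite ler_wpM2l ?mulr_ge0 ?exprn_ge0 ?(ltW C10)// lerBlDr lerDl ltW.
  have iz w : (cmod (Complex w t))^-1 <= c^-1 by rewrite lef_pV2 ?posrE ?(lt_le_trans c0 (cz w)).
  have i0 w : 0 <= (cmod (Complex w t))^-1 by rewrite invr_ge0 cmod_ge0.
  have hh : (cmod (Complex x t))^-1 * (cmod (Complex y t))^-1 <= c^-1 ^+ 2.
    by rewrite expr2; apply: ler_pM.
  rewrite [leRHS]mulrC; apply: ler_pM; rewrite ?subr_ge0 ?mulr_ge0//; first by rewrite lerBlDr lerDl ltW.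
  by apply: le_trans hh _; rewrite ler_peMr ?exprn_ge0 ?invr_ge0 ?(ltW c0)// exprn_ege1.
have far (x t : R) : 0 < x -> x <= 1 -> c <= `|t| -> e <= x * L t ^+ 9 ->
    4 * C * e <= cmod (Dz 0 (Complex x t)) * L t ^+ 7.
  move=> x0 x1 ct ex; have l0 : 0 <= L t by apply: le_trans (L1 t).
  rewrite -(@ler_pXn2r _ 8)// ?nnegrE; [|by pos|by rewrite mulr_ge0 ?exprn_ge0 ?cmod_ge0].
  rewrite [leRHS]exprMn -exprM -[(7 * 8)%N]/(2 + 54)%N exprD mulrA.
  apply: (@le_trans _ _ (k2 * x ^+ 6 * L t ^+ 54)); last first.
    by rewrite ler_wpM2r ?exprn_ge0//; exact: low.
  have h6 : e ^+ 6 <= x ^+ 6 * L t ^+ 54.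
    by rewrite -[54%N]/(9 * 6)%N exprM -exprMn; apply: lerXl => //; exact: ltW.
  rewrite -[leRHS]mulrA; apply: (@le_trans _ _ (k2 * e ^+ 6)); last by rewrite ler_wpM2l// ltW.
  have -> : (4 * C * e) ^+ 8 = (e ^+ 2 * (4 * C) ^+ 8) * e ^+ 6 by ring.
  rewrite ler_wpM2r ?exprn_ge0 ?(ltW e0)//.
  apply: le_trans ek; rewrite ler_wpM2r ?exprn_ge0//; first by pos.
  by rewrite expr2 ler_piMl// ltW.
exists (3 * C * e); first by pos.
move=> x t x0 x1 ct; rewrite -/(L t).
have l0 : 0 < L t by apply: lt_le_trans (L1 t).
(* For x smaller than e L^(-9), the bound 4 C e L^(-7) valid at that abscissa is carried back to x
   at a cost of C e L^(-7). *)
have [ex|xe] := leP e (x * L t ^+ 9).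
  apply: le_trans (far x t x0 x1 ct ex); rewrite !ler_wpM2r ?(ltW e0) ?(ltW CC)//; lra.
pose y := e / L t ^+ 9.
have l9 : 0 < L t ^+ 9 by rewrite exprn_gt0.
have xy : x <= y by rewrite /y ler_pdivlMr// ltW.
have y1 : y <= 1 by rewrite /y ler_pdivrMr// mul1r (le_trans e1)// exprn_ege1.
have y0 : 0 < y := lt_le_trans x0 xy.
have ey : e <= y * L t ^+ 9 by rewrite /y divfK// gt_eqF.
have f := far y t y0 y1 ct ey; have g := lip x y t x0 xy y1 ct.
have l7 : 0 <= L t ^+ 7 by rewrite exprn_ge0// ltW.
have := ler_wpM2r l7 g; rewrite mulrDl.
have -> : C * L t ^+ 2 * y * L t ^+ 7 = C * e.
  by rewrite /y; field; rewrite gt_eqF.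
lra.
Qed.

(** h = z zeta(1 + z) has no pole at 0, and h1, h2, h3 are its first three derivatives. The
    right-hand side is - (h' / h)'' - [Az 2 z]: the polar parts 2 / z^3 of [Zz 2] and [Dz 2]
    cancel. *)
Lemma Zz2E {R : realType} (z : R[i]) : 0 < Rec z -> Dz 0 z != 0 ->
  let h := 1 + z * Az 0 z in
  let h1 := Az 0 z - z * Az 1 z in
  let h2 := - 2 * Az 1 z + z * Az 2 z in
  let h3 := 3 * Az 2 z - z * Az 3 z in
  Zz 2 z - Dz 2 z = - (h3 / h - 3 * h1 * h2 / h ^+ 2 + 2 * h1 ^+ 3 / h ^+ 3) - Az 2 z.
Proof.
move=> x0 D0 h h1 h2 h3; have z0 := Rec_neq0 x0.
have e1 := Dz1E x0; have e2 := Dz2E x0; have e3 := Dz3E x0.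
have E0 : Az 0 z = Dz 0 z - 1 / z by rewrite /Az expr1.
have E1 : Az 1 z = Dz 1 z - 1 / z ^+ 2 by [].
have E2 : Az 2 z = Dz 2 z - 2 / z ^+ 3 by [].
have E3 : Az 3 z = Dz 3 z - 6 / z ^+ 4 by [].
have -> : Zz 2 z = (Dz 3 z - 2 * ((Dz 2 z - Dz 1 z / Dz 0 z * Dz 1 z) / Dz 0 z) * Dz 1 z - Dz 1 z / Dz 0 z * Dz 2 z) / Dz 0 z.
  have Z0 : Zz 0 z = Dz 1 z / Dz 0 z by rewrite e1 mulfK.
  have Z1 : Zz 1 z = (Dz 2 z - Dz 1 z / Dz 0 z * Dz 1 z) / Dz 0 z.
    by rewrite -Z0 [in Dz 2 z]e2 addrK mulfK.
  rewrite -Z1 -Z0 (_ : Dz 3 z - 2 * Zz 1 z * Dz 1 z - Zz 0 z * Dz 2 z = Zz 2 z * Dz 0 z) ?mulfK//.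
  by rewrite e3; ring.
have hE : h = z * Dz 0 z by rewrite /h E0; field.
rewrite hE /h1 /h2 /h3 E0 E1 E2 E3; field; by rewrite z0 D0.
Qed.

Lemma Zz2_quot_bound {R : realType} (z : R[i]) (q b : R) : 0 < Rec z -> 0 <= q -> Dz 0 z != 0 ->
    cmod ((Az 0 z - z * Az 1 z) / (1 + z * Az 0 z)) <= q ->
    cmod ((- 2 * Az 1 z + z * Az 2 z) / (1 + z * Az 0 z)) <= q ->
    cmod ((3 * Az 2 z - z * Az 3 z) / (1 + z * Az 0 z)) <= q -> cmod (Az 2 z) <= b ->
  cmod (Zz 2 z - Dz 2 z) <= q + 3 * q ^+ 2 + 2 * q ^+ 3 + b.
Proof.
move=> zx.
move=> q0 D0 a1 a2 a3 a4; rewrite Zz2E//.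
set h := 1 + z * Az 0 z in a1 a2 a3 *.
have -> : 3 * (Az 0 z - z * Az 1 z) * (- 2 * Az 1 z + z * Az 2 z) / h ^+ 2 =
  3 * ((Az 0 z - z * Az 1 z) / h) * ((- 2 * Az 1 z + z * Az 2 z) / h).
  by rewrite expr2 invfM; ring.
have -> : 2 * (Az 0 z - z * Az 1 z) ^+ 3 / h ^+ 3 = 2 * ((Az 0 z - z * Az 1 z) / h) ^+ 3.
  by rewrite [in RHS]exprMn exprVn; ring.
move: a1 a2 a3 a4; set h1 := (_ - _) / h; set h2 := (_ + _) / h; set h3 := (_ - _) / h => a1 a2 a3 a4.
clearbody h1 h2 h3.
apply: le_trans (cmodB _ _) _; apply: lerD a4; rewrite cmodN.
apply: le_trans (cmodD _ _) _; apply: lerD; last first.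
  by rewrite cmodM cmod_nat cmodX ler_wpM2l//; apply: lerXl => //; exact: cmod_ge0.
apply: le_trans (cmodB _ _) _; apply: lerD => //.
rewrite !cmodM cmod_nat -mulrA ler_wpM2l// expr2; apply: ler_pM => //; exact: cmod_ge0.
Qed.

Lemma cubic_pow_le {R : realType} (Q B L : R) : 0 <= Q -> 0 <= B -> 1 <= L ->
  Q * L ^+ 11 + 3 * (Q * L ^+ 11) ^+ 2 + 2 * (Q * L ^+ 11) ^+ 3 + B * L ^+ 4 <=
  (Q + 3 * Q ^+ 2 + 2 * Q ^+ 3 + B) * L ^+ 60.
Proof.
move=> Q0 B0 L1.
have LL m n : (m <= n)%N -> L ^+ m <= L ^+ n by move=> ?; rewrite ler_weXn2l.
have -> : (Q * L ^+ 11) ^+ 2 = Q ^+ 2 * L ^+ 22 by rewrite exprMn -exprM.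
have -> : (Q * L ^+ 11) ^+ 3 = Q ^+ 3 * L ^+ 33 by rewrite exprMn -exprM.
have h1 := ler_wpM2l Q0 (LL 11%N 60%N isT).
have h2 := ler_wpM2l (exprn_ge0 2 Q0) (LL 22%N 60%N isT).
have h3 := ler_wpM2l (exprn_ge0 3 Q0) (LL 33%N 60%N isT).
have h4 := ler_wpM2l B0 (LL 4%N 60%N isT).
have -> : (Q + 3 * Q ^+ 2 + 2 * Q ^+ 3 + B) * L ^+ 60 =
  Q * L ^+ 60 + 3 * (Q ^+ 2 * L ^+ 60) + 2 * (Q ^+ 3 * L ^+ 60) + B * L ^+ 60 by ring.
move: h1 h2 h3 h4; move: (L ^+ 60) => X.
move: (Q * X) (Q * L ^+ 11) (Q ^+ 2 * X) (Q ^+ 2 * L ^+ 22) (Q ^+ 3 * X) (Q ^+ 3 * L ^+ 33) (B * X) (B * L ^+ 4).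
by clear=> *; lra.
Qed.

(** Near the pole h = z zeta is bounded below directly. Elsewhere 1 / |zeta| costs L^7 and the
    numerators L^4, so the quotients are of order L^11 and occur at most cubed; 60 is a round
    exponent above 33. *)
Lemma G_bound {R : realType} : exists x1 : R, 0 < x1 <= 1 /\ exists2 C : R, 0 < C &
  forall x t : R, 0 < x -> x <= x1 ->
  cmod (Zz 2 (Complex x t) - Dz 2 (Complex x t)) <= C * (1 + ln (3 + `|t|)) ^+ 60.
Proof.
have [C0 C00 H0] := @Az_bound R 0; have [C1 C10 H1] := @Az_bound R 1.
have [C2 C20 H2] := @Az_bound R 2; have [C3 C30 H3] := @Az_bound R 3.
(* In the disc |z| <= c' the product z [Az 0 z] has modulus at most 1/2, so |h| >= 1/2. *)
pose c' := (4 * C0 + 1)^-1.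
have c'0 : 0 < c' by rewrite /c'; pos.
have c'1 : c' <= 1 by rewrite /c' invf_le1; [lra|pos].
have c'C : c' * C0 <= 1 / 4.
  by rewrite /c' mulrC ler_pdivrMr; [lra|pos].
pose c := c' / 2; have c0 : 0 < c by rewrite /c; pos.
have [L0 L00 G0] := @Az_bound_log R 0 c c0; have [L1 L10 G1] := @Az_bound_log R 1 c c0.
have [L2 L20 G2] := @Az_bound_log R 2 c c0; have [L3 L30 G3] := @Az_bound_log R 3 c c0.
have [k k0 HD] := @zeta_lower_far R c c0.
exists c; split; first by rewrite c0 /c; lra.
have [B B0 [B_0 B_1 B_2 B_3]] : exists2 B, 0 < B & [/\ L0 <= B, L1 <= B, L2 <= B & L3 <= B].
  by exists (L0 + L1 + L2 + L3); [pos|split; move: L00 L10 L20 L30; clear; lra].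
pose Q := 4 * B * (1 + c^-1) / k; have Q0 : 0 < Q by rewrite /Q; pos.
have [Cn Cn0 [Cn_0 Cn_1 Cn_2 Cn_3]] : exists2 B, 0 < B & [/\ C0 <= B, C1 <= B, C2 <= B & C3 <= B].
  by exists (C0 + C1 + C2 + C3); [pos|split; move: C00 C10 C20 C30; clear; lra].
exists ((Q + 3 * Q ^+ 2 + 2 * Q ^+ 3 + B) + ((2 * (10 * Cn)) + 3 * (2 * (10 * Cn)) ^+ 2 + 2 * (2 * (10 * Cn)) ^+ 3 + 2 * Cn)).
  move: Q0 B0 Cn0; clear => Q0 B0 Cn0; apply: addr_gt0.
    by apply: addr_gt0 => //; apply: addr_gt0; [apply: addr_gt0|]; pos.
  by apply: addr_gt0; last (by pos); apply: addr_gt0; [apply: addr_gt0|]; pos.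
move=> x t x0 xc; set z := Complex x t; pose L := 1 + ln (3 + `|t|).
have L1' : 1 <= L by rewrite lerDl ln_ge0//; have := normr_ge0 t; lra.
have Ln n : 1 <= L ^+ n by rewrite exprn_ege1.
have zx : 0 < Rec z by [].
have z0 := Rec_neq0 zx.
have m2 (w : R[i]) : cmod (- 2 * w) = 2 * cmod w.
  by rewrite cmodM; congr (_ * _); rewrite cmodN cmod_nat.
have m3 (w : R[i]) : cmod (3 * w) = 3 * cmod w by rewrite cmodM cmod_nat.
have DA : z * Dz 0 z = 1 + z * Az 0 z by rewrite /Az fact0 expr1 mulrBr div1r mulfV// addrC subrK.
have [tc|ct] := ltP `|t| c.
  have zc : cmod z <= c'.
    have := cmod_le_reim z; rewrite /= (gtr0_norm x0); move: tc xc; rewrite /c; lra.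
  have z1 : cmod z <= 1 by apply: le_trans c'1.
  have zz0 := cmod_ge0 z.
  have a j Cj : 0 < Cj -> Cj <= Cn -> cmod (Az j z) <= Cj * (1 + cmod z) -> cmod (Az j z) <= 2 * Cn.
    by move=> Cj0 CjC /le_trans; apply; rewrite [2 * _]mulrC; apply: ler_pM => //; [exact: ltW|rewrite addr_ge0|move: z1; clear; lra].
  have a0 := a 0%N C0 C00 _ (H0 z zx); have {}a0 : cmod (Az 0 z) <= 2 * Cn by apply: a0.
  have a1 := a 1%N C1 C10 _ (H1 z zx); have {}a1 : cmod (Az 1 z) <= 2 * Cn by apply: a1.
  have a2 := a 2%N C2 C20 _ (H2 z zx); have {}a2 : cmod (Az 2 z) <= 2 * Cn by apply: a2.
  have a3 := a 3%N C3 C30 _ (H3 z zx); have {}a3 : cmod (Az 3 z) <= 2 * Cn by apply: a3.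
  have h0 : 2^-1 <= cmod (1 + z * Az 0 z).
    have := cmod_leB 1 (- (z * Az 0 z)); rewrite opprK cmod1 cmodN cmodM.
    have : cmod z * cmod (Az 0 z) <= 2^-1.
      have := H0 z zx => h; apply: (@le_trans _ _ (cmod z * (C0 * 2))).
        by rewrite ler_wpM2l//; apply: le_trans h _; rewrite ler_pM2l//; lra.
      by apply: (@le_trans _ _ (c' * (C0 * 2))); [rewrite ler_wpM2r//; pos|lra].
    lra.
  have D0 : Dz 0 z != 0.
    apply: contraTneq h0 => D0; rewrite -DA D0 mulr0 cmod0; lra.
  have dv (w : R[i]) : cmod w <= 10 * Cn -> cmod (w / (1 + z * Az 0 z)) <= 2 * (10 * Cn).
    move=> h; rewrite cmodM cmodV mulrC; apply: ler_pM => //; rewrite ?invr_ge0 ?cmod_ge0//.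
    by rewrite -[leRHS]invrK lef_pV2 ?posrE// (lt_le_trans _ h0).
  have zA j : cmod (Az j z) <= 2 * Cn -> cmod (z * Az j z) <= 2 * Cn.
    by move=> h; rewrite cmodM; apply: le_trans h; rewrite ler_piMl ?cmod_ge0.
  apply: le_trans (@Zz2_quot_bound _ z (2 * (10 * Cn)) (2 * Cn) zx _ D0 _ _ _ a2) _; first by pos.
  - apply: dv; apply: le_trans (cmodB _ _) _; move: (zA _ a1) a0 Cn0; clear; lra.
  - apply: dv; apply: le_trans (cmodD _ _) _; rewrite m2; move: (zA _ a2) a1 Cn0; clear; lra.
  - apply: dv; apply: le_trans (cmodB _ _) _; rewrite m3; move: (zA _ a3) a2 Cn0; clear; lra.
  set S := _ + 2 * Cn; have S0 : 0 <= S by rewrite /S; pos.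
  rewrite -/L; apply: (@le_trans _ _ (S * L ^+ 60)); first by rewrite ler_peMr.
  rewrite ler_wpM2r ?(le_trans ler01)// lerDr; pos.
have cz : c <= cmod z by apply: le_trans ct (@Imc_le _ z).
have kz := HD x t x0 _ ct; have {}kz : k <= cmod (Dz 0 z) * L ^+ 7.
  by apply: kz; apply: le_trans xc _; rewrite /c; lra.
have lzL : lz z <= L.
  rewrite /lz lerD2l ler_ln ?posrE ?ltr_pwDl ?cmod_ge0//.
  have := cmod_le_reim z; rewrite /= (gtr0_norm x0); move: xc; rewrite /c; lra.
have a j Cj : 0 < Cj -> Cj <= B -> (j < 4)%N -> cmod (Az j z) <= Cj * lz z ^+ j.+1 -> cmod (Az j z) <= B * L ^+ 4.
  move=> Cj0 CjB j4 /le_trans; apply; apply: ler_pM => //; rewrite ?exprn_ge0 ?(ltW Cj0)//.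
    by apply: le_trans (lz_ge1 z).
  apply: le_trans (lerXl _ _ lzL) _; first by apply: le_trans (lz_ge1 z).
  by rewrite ler_weXn2l.
have a0 := a 0%N L0 L00 _ isT (G0 z zx cz); have {}a0 : cmod (Az 0 z) <= B * L ^+ 4 by apply: a0.
have a1 := a 1%N L1 L10 _ isT (G1 z zx cz); have {}a1 : cmod (Az 1 z) <= B * L ^+ 4 by apply: a1.
have a2 := a 2%N L2 L20 _ isT (G2 z zx cz); have {}a2 : cmod (Az 2 z) <= B * L ^+ 4 by apply: a2.
have a3 := a 3%N L3 L30 _ isT (G3 z zx cz); have {}a3 : cmod (Az 3 z) <= B * L ^+ 4 by apply: a3.
have D0 : Dz 0 z != 0.
  by apply: contraTneq kz => D0; rewrite D0 cmod0 mul0r -ltNge.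
have Dp : 0 < cmod (Dz 0 z) by rewrite cmod_gt0.
have zp : 0 < cmod z by rewrite cmod_gt0.
have iz : (cmod z)^-1 <= c^-1 by rewrite lef_pV2 ?posrE.
have L4 : 0 <= B * L ^+ 4 by rewrite mulr_ge0 ?(le_trans ler01 (Ln _))// ltW.
(* Quotients by [h = z zeta] are compared through [1 / z] and [1 / zeta]. *)
have dv (w v : R[i]) : cmod w <= 3 * (B * L ^+ 4) -> cmod v <= B * L ^+ 4 ->
    cmod ((w + z * v) / (1 + z * Az 0 z)) <= Q * L ^+ 11.
  move=> hw hv; rewrite -DA.
  have -> : (w + z * v) / (z * Dz 0 z) = (w / z + v) / Dz 0 z by field; rewrite z0 D0.
  rewrite cmodM cmodV ler_pdivrMr//.
  apply: (@le_trans _ _ (4 * (1 + c^-1) * (B * L ^+ 4))).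
    apply: le_trans (cmodD _ _) _; rewrite cmodM cmodV.
    have : cmod w * (cmod z)^-1 <= 3 * (B * L ^+ 4) * c^-1 by apply: ler_pM; rewrite ?cmod_ge0 ?invr_ge0 ?cmod_ge0.
    have : 0 <= (B * L ^+ 4) * c^-1 by rewrite mulr_ge0// invr_ge0 ltW.
    move: hv; move: (c^-1) (cmod w * _) (B * L ^+ 4) L4; clear => ci w1 b b0; nra.
  have -> : Q * L ^+ 11 * cmod (Dz 0 z) = 4 * (1 + c^-1) * (B * L ^+ 4) * (cmod (Dz 0 z) * L ^+ 7 / k).
    by rewrite /Q; field; rewrite !gt_eqF.
  rewrite ler_peMr ?ler_pdivlMr ?mul1r//; last by pos.
have B4 : B * L ^+ 4 <= 3 * (B * L ^+ 4) by move: L4; clear; lra.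
apply: le_trans (@Zz2_quot_bound _ z (Q * L ^+ 11) (B * L ^+ 4) zx _ D0 _ _ _ a2) _.
- by rewrite mulr_ge0 ?(le_trans ler01 (Ln _))// ltW.
- by rewrite -mulrN; apply: dv; rewrite ?cmodN//; apply: le_trans B4.
- apply: dv => //; rewrite m2; move: a1 L4; clear; lra.
- rewrite -mulrN; apply: dv; rewrite ?cmodN// m3; move: a2 L4; clear; lra.
rewrite -/L; apply: le_trans (cubic_pow_le (ltW Q0) (ltW B0) L1') _.
rewrite ler_wpM2r ?(le_trans ler01)// lerDl; move: Cn0; clear => Cn0.
apply: addr_ge0; last by pos.
by apply: addr_ge0; first apply: addr_ge0; pos.
Qed.

(** * A Fourier kernel for truncated ramps *)

Local Notation mu := lebesgue_measure.

(** Replaces differentiation under the integral sign: a Taylor estimate of the integrand with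
    quadratic error is integrated and yields the derivative at once. *)
Lemma dv_quadratic {R : realType} (F : R -> R) v d K :
  (forall k, `|F (v + k) - F v - k * d| <= K * k ^+ 2) -> dv F v d.
Proof.
move=> H; have K0 : 0 <= K.
  by have := H 1; rewrite expr1n mulr1; apply: le_trans.
have L : (fun h : R => h^-1 * (F (h + v) - F v)) @ 0^' --> d.
  apply/cvgrPdist_le => e e0; near=> h.
  have h0 : h != 0 by near: h; exact: nbhs_dnbhs_neq.
  have -> : d - h^-1 * (F (h + v) - F v) = - (h^-1 * (F (v + h) - F v - h * d)).
    rewrite [h + v]addrC; move: (F (v + h)) (F v) => a b; by field.
  rewrite normrN normrM normfV ler_pdivrMl ?normr_gt0//; apply: le_trans (H h) _.
  rewrite -[h ^+ 2]real_normK ?num_real// expr2 mulrA mulrC ler_wpM2l//.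
  have : `|h| <= e / (K + 1).
    near: h; have k0 : 0 < e / (K + 1) by rewrite divr_gt0// ltr_wpDl.
    exact: dnbhs0_le.
  rewrite ler_pdivlMr ?ltr_wpDl//; move: (normr_ge0 h); nra.
have [dF E] : derivable F v 1 /\ 'D_1 F v = d.
  have L2 : (fun h : R => h^-1 *: (F (h *: (1 : R) + v) - F v)) @ 0^' --> d.
    by under eq_fun do rewrite scaler1.
  by split; [apply/cvg_ex; exists d|exact: cvg_lim].
by split.
Unshelve. all: by end_near. Qed.

Lemma dv_unique {R : realType} (f g df : R -> R) :
  (forall x, dv f x (df x)) -> (forall x, dv g x (df x)) -> f 0 = g 0 -> f =1 g.
Proof.
move=> Hf Hg fg x.
have H y : dv (fun y => f y - g y) y 0 by apply: dv_eq; [apply: dvD; [exact: Hf|apply: dvN; exact: Hg]|rewrite subrr].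
have [x0|x0] := leP 0 x.
  have [c _] := @dv_MVT R (fun y => f y - g y) (fun=> 0) 0 x x0 (fun y _ => H y).
  by rewrite mul0r fg subrr subr0 => /eqP; rewrite subr_eq0 => /eqP.
have [c _] := @dv_MVT R (fun y => f y - g y) (fun=> 0) x 0 (ltW x0) (fun y _ => H y).
by rewrite mul0r fg subrr sub0r => /eqP; rewrite oppr_eq0 subr_eq0 => /eqP.
Qed.

Definition J {R : realType} (g : R -> R) : R := Rintegral (@lebesgue_measure R) `]0, +oo[ g.
Definition IJ {R : realType} (g : R -> R) := (@lebesgue_measure R).-integrable `]0, +oo[ (EFin \o g).

Lemma J_ftc {R : realType} (f F : R -> R) l : (forall x, 0 <= x -> 0 <= f x) ->
  (forall x, 0 <= x -> {for x, continuous f}) ->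
  (forall x, 0 <= x -> dv F x (f x)) -> F x @[x --> +oo%R] --> l -> IJ f /\ J f = l - F 0.
Proof.
move=> f0 cf dF Fl.
have mf : measurable_fun (`]0, +oo[ : set R) f.
  apply: open_continuous_measurable_fun => // x; rewrite inE/= in_itv/= andbT => x0.
  exact: cf (ltW x0).
have cw : {within `[0, +oo[, continuous f}.
  by apply: continuous_in_subspaceT => x; rewrite inE /= in_itv/= andbT => ?; exact: cf.
have E : (\int[mu]_(x in `]0%R, +oo[) (f x)%:E = l%:E - (F 0)%:E)%E.
  rewrite integral_itv_obnd_cbnd; last exact/measurable_EFinP.
  apply: ge0_continuous_FTC2y => //.
  - by move=> x x0; have [] := dF x (ltW x0).
  - apply: cvg_at_right_filter; exact: dv_continuous (dF 0 (lexx _)).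
  - by move=> x; rewrite in_itv/= andbT => x0; rewrite derive1E; have [_ ->] := dF x (ltW x0).
split; last by rewrite /J /Rintegral E.
apply/integrableP; split; first exact/measurable_EFinP.
under eq_integral => x do rewrite /=.
rewrite (_ : integral _ _ _ = (\int[mu]_(x in `]0%R, +oo[) (f x)%:E)%E); first by rewrite E -EFinB ltry.
by apply: eq_integral => x; rewrite inE/= in_itv/= andbT => x0; rewrite ger0_norm// f0// ltW.
Qed.

Lemma IJ_le {R : realType} (f g : R -> R) : measurable_fun (`]0, +oo[ : set R) f ->
  (forall x, 0 < x -> `|f x| <= g x) -> IJ g -> IJ f.
Proof.
move=> mf fg ig; apply: le_integrable ig => //; first exact/measurable_EFinP.
by move=> x /=; rewrite in_itv/= andbT => x0; rewrite lee_fin (le_trans (fg x x0))// ler_norm.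
Qed.

Lemma J_le {R : realType} (f g : R -> R) : IJ f -> IJ g -> (forall x, 0 < x -> f x <= g x) -> J f <= J g.
Proof.
by move=> ? ? H; apply: le_Rintegral => // x /=; rewrite in_itv/= andbT; exact: H.
Qed.

Lemma IJ_eq {R : realType} (f g : R -> R) : (forall x, 0 < x -> f x = g x) -> IJ f -> IJ g.
Proof.
by move=> H; apply: eq_integrable => // x; rewrite inE/= in_itv/= andbT => ?; rewrite /= H.
Qed.

Lemma J_eq {R : realType} (f g : R -> R) : (forall x, 0 < x -> f x = g x) -> J f = J g.
Proof. by move=> H; apply: eq_Rintegral => x; rewrite inE/= in_itv/= andbT; exact: H. Qed.

Lemma IJD {R : realType} (f g : R -> R) : IJ f -> IJ g -> IJ (fun x => f x + g x).
Proof.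
move=> i1 i2; have := @integrableD _ _ _ mu `]0, +oo[ (measurable_itv _) (EFin \o f) (EFin \o g) i1 i2.
by apply: eq_integrable => // x.
Qed.

Lemma IJZ {R : realType} (f : R -> R) k : IJ f -> IJ (fun x => k * f x).
Proof.
move=> i1; have := @integrableZl _ _ R mu `]0, +oo[ (measurable_itv _) k (EFin \o f) i1.
by apply: eq_integrable => // x.
Qed.

Lemma JD {R : realType} (f g : R -> R) : IJ f -> IJ g -> J (fun x => f x + g x) = J f + J g.
Proof. by move=> ? ?; apply: RintegralD. Qed.

Lemma JZ {R : realType} (f : R -> R) k : IJ f -> J (fun x => k * f x) = k * J f.
Proof. by move=> ?; apply: RintegralZl. Qed.

Lemma IJ0 {R : realType} : IJ (fun=> 0 : R).
Proof. exact: integrable0. Qed.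

Lemma J0 {R : realType} : J (fun=> 0 : R) = 0.
Proof. by rewrite /J /Rintegral integral0. Qed.

Lemma IJ_sum {R : realType} I (r : seq I) (f : I -> R -> R) : (forall i, IJ (f i)) ->
  IJ (fun x => \sum_(i <- r) f i x).
Proof.
move=> H; elim: r => [|i r IH]; first by under eq_fun do rewrite big_nil; exact: IJ0.
by under eq_fun do rewrite big_cons; exact: IJD.
Qed.

Lemma J_sum {R : realType} I (r : seq I) (f : I -> R -> R) : (forall i, IJ (f i)) ->
  J (fun x => \sum_(i <- r) f i x) = \sum_(i <- r) J (f i).
Proof.
move=> H; elim: r => [|i r IH]; first by under [in LHS]eq_fun do rewrite big_nil; rewrite big_nil J0.
by under [in LHS]eq_fun do rewrite big_cons; rewrite big_cons JD ?IH//; exact: IJ_sum.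
Qed.

Lemma J_abs {R : realType} (f g : R -> R) : IJ f -> IJ g -> (forall x, 0 < x -> `|f x| <= g x) -> `|J f| <= J g.
Proof.
move=> i1 i2 H; rewrite ler_norml -[- J g]mulN1r -JZ//; apply/andP; split; apply: J_le => //; first exact: IJZ.
  by move=> x /H; rewrite mulN1r ler_norml => /andP[].
by move=> x /H; rewrite ler_norml => /andP[].
Qed.

Lemma expRN_cvg0 {R : realType} (e : R) : 0 < e -> expR (- e * x) @[x --> +oo%R] --> (0 : R).
Proof.
move=> e0; apply/cvgrPdist_le => d d0; near=> x.
have x0 : 0 < x by near: x; exact: nbhs_pinfty_gt.
rewrite sub0r normrN ger0_norm ?expR_ge0// mulNr expRN -[leRHS]invrK lef_pV2 ?posrE ?expR_gt0 ?invr_gt0//.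
have xd : (e * d)^-1 <= x by near: x; apply: nbhs_pinfty_ge; rewrite num_real.
have := expR_ge1Dx (e * x); apply: le_trans.
have := ler_wpM2l (ltW e0) xd; rewrite invfM mulrA mulfV ?gt_eqF// mul1r; move: (d^-1) => d'; lra.
Unshelve. all: by end_near. Qed.

Lemma J_exp {R : realType} (e : R) : 0 < e -> IJ (fun t => expR (- e * t)) /\ J (fun t => expR (- e * t)) = e^-1.
Proof.
move=> e0; have := @J_ftc R (fun t => expR (- e * t)) (fun t => - e^-1 * expR (- e * t)) 0.
rewrite mulr0 expR0 mulr1 sub0r opprK; apply.
- by move=> x _; exact: expR_ge0.
- by move=> x _; apply: dv_continuous; der; reflexivity.
- by move=> x _; der; field; rewrite gt_eqF.
- by rewrite -[X in _ --> X](mulr0 (- e^-1)); apply: cvgM; [exact: cvg_cst|exact: expRN_cvg0].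
Qed.

Lemma J_cos {R : realType} (e v : R) : 0 < e -> IJ (fun t => expR (- e * t) * cos (t * v)) /\
  J (fun t => expR (- e * t) * cos (t * v)) = e / (e ^+ 2 + v ^+ 2).
Proof.
move=> e0; have [i1 j1] := J_exp e0.
have ev : 0 < e ^+ 2 + v ^+ 2 by rewrite ltr_pwDl ?exprn_gt0// sqr_ge0.
(* [J_ftc] asks for a nonnegative integrand, so e^(- e t) is added here and subtracted
   afterwards. *)
have [] := @J_ftc R (fun t => expR (- e * t) + expR (- e * t) * cos (t * v))
  (fun t => - e^-1 * expR (- e * t) + expR (- e * t) * ((v * sin (t * v) - e * cos (t * v)) / (e ^+ 2 + v ^+ 2))) 0.
- move=> x _; have := cos_geN1 (x * v); have := expR_gt0 (- e * x).
  move: (cos _) (expR _) => c E; clear; nra.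
- by move=> x _; apply: dv_continuous; der; reflexivity.
- by move=> x _; der; field; rewrite !gt_eqF.
- have -> : (0 : R) = - e^-1 * 0 + 0 by rewrite mulr0 addr0.
  apply: cvgD; first by apply: cvgM; [exact: cvg_cst|exact: expRN_cvg0].
  have K0 : (fun t => (`|v| + e) / (e ^+ 2 + v ^+ 2) * expR (- e * t)) @ +oo%R --> (0 : R).
    by rewrite -[X in _ --> X](mulr0 ((`|v| + e) / (e ^+ 2 + v ^+ 2))); apply: cvgM; [exact: cvg_cst|exact: expRN_cvg0].
  have KN := cvgN K0; rewrite oppr0 in KN.
  apply: (@squeeze_cvgr _ _ _ _ (fun t => - ((`|v| + e) / (e ^+ 2 + v ^+ 2) * expR (- e * t)))) K0.
    apply: nearW => t; rewrite -ler_norml normrM ger0_norm ?expR_ge0// [leLHS]mulrC ler_wpM2r ?expR_ge0//.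
    rewrite normrM normfV (gtr0_norm ev) ler_wpM2r ?invr_ge0 ?(ltW ev)//.
    apply: le_trans (ler_normB _ _) _; rewrite !normrM (gtr0_norm e0).
    apply: lerD; [apply: ler_piMr => //|apply: ler_piMr; [exact: ltW|]].
      by rewrite ler_norml sin_geN1 sin_le1.
    by rewrite ler_norml cos_geN1 cos_le1.
  exact: KN.
move=> i2 j2.
have E (t : R) : expR (- e * t) * cos (t * v) =
   (expR (- e * t) + expR (- e * t) * cos (t * v)) + - 1 * expR (- e * t) by ring.
under eq_fun do rewrite E.
split; first by apply: IJD => //; exact: IJZ.
rewrite JD//; last exact: IJZ.
rewrite JZ// j1 j2 !mulr0 !mul0r sin0 cos0 expR0; field.
by rewrite !gt_eqF.
Qed.

Lemma IJ_exp {R : realType} (e C : R) (f : R -> R) : 0 < e ->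
  (forall t, 0 < t -> {for t, continuous f}) -> (forall t, 0 < t -> `|f t| <= C) ->
  IJ (fun t => expR (- e * t) * f t).
Proof.
move=> e0 cf fC; have [i1 _] := J_exp e0; apply: IJ_le (IJZ C i1).
  apply: open_continuous_measurable_fun => // x; rewrite inE/= in_itv/= andbT => x0.
  have ce : {for x, continuous (fun t => expR (- e * t))} by apply: dv_continuous; der; reflexivity.
  exact: (cvgM ce (cf x x0)).
by move=> t t0; rewrite normrM ger0_norm ?expR_ge0// [leLHS]mulrC ler_wpM2r ?expR_ge0// fC.
Qed.

Lemma dv_MVT0 {R : realType} (f df : R -> R) b : (forall x, dv f x (df x)) ->
  exists2 c, `|c| <= `|b| & f b - f 0 = df c * b.
Proof.
move=> H; have [b0|b0] := leP 0 b.
  have [c /andP[c0 cb] e] := @dv_MVT R f df 0 b b0 (fun x _ => H x).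
  by exists c; [rewrite !ger0_norm|rewrite e subr0].
have [c /andP[bc c0] e] := @dv_MVT R f df b 0 (ltW b0) (fun x _ => H x).
exists c; first by rewrite !ler0_norm ?lerN2// ltW.
by rewrite -opprB e; ring.
Qed.

Lemma sin_le_abs {R : realType} (x : R) : `|sin x| <= `|x|.
Proof.
have [c _] := @dv_MVT0 R sin cos x (fun y => ltac:(by der; ring)).
by rewrite sin0 subr0 => ->; rewrite normrM ler_piMl// ler_norml cos_geN1 cos_le1.
Qed.

Lemma cos_le_abs {R : realType} (x : R) : `|1 - cos x| <= `|x|.
Proof.
have [c _] := @dv_MVT0 R cos (fun x => - sin x) x (fun y => ltac:(by der; ring)).
by rewrite cos0 -normrN opprB => ->; rewrite normrM normrN ler_piMl// ler_norml sin_geN1 sin_le1.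
Qed.

Lemma cos_le_sqr {R : realType} (x : R) : `|1 - cos x| <= x ^+ 2.
Proof.
have [c cx] := @dv_MVT0 R cos (fun x => - sin x) x (fun y => ltac:(by der; ring)).
rewrite cos0 -normrN opprB => ->; rewrite normrM normrN -[leRHS]real_normK ?num_real// expr2.
by rewrite ler_wpM2r// (le_trans (sin_le_abs _)).
Qed.

Lemma sin_le_sqr {R : realType} (x : R) : `|sin x - x| <= x ^+ 2.
Proof.
have [c cx] := @dv_MVT0 R (fun x => sin x - x) (fun x => cos x - 1) x (fun y => ltac:(by der; ring)).
rewrite sin0 !subr0 => ->; rewrite normrM -[leRHS]real_normK ?num_real// expr2.
by rewrite ler_wpM2r// -normrN opprB (le_trans (cos_le_abs _)).
Qed.

Lemma cos_taylor1 {R : realType} (a b : R) : `|cos (a + b) - cos a + b * sin a| <= 2 * b ^+ 2.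
Proof.
rewrite cosD (_ : _ - _ + _ = - (cos a * (1 - cos b) + sin a * (sin b - b))); last by ring.
rewrite normrN; apply: le_trans (ler_normD _ _) _; rewrite !normrM mulrDl !mul1r; apply: lerD.
  by apply: le_trans (cos_le_sqr b); rewrite ler_piMl// ler_norml cos_geN1 cos_le1.
by apply: le_trans (sin_le_sqr b); rewrite ler_piMl// ler_norml sin_geN1 sin_le1.
Qed.

Lemma sin_taylor1 {R : realType} (a b : R) : `|sin (a + b) - sin a - b * cos a| <= 2 * b ^+ 2.
Proof.
rewrite sinD (_ : _ - _ - _ = cos a * (sin b - b) - sin a * (1 - cos b)); last by ring.
apply: le_trans (ler_normB _ _) _; rewrite !normrM mulrDl !mul1r; apply: lerD.
  by apply: le_trans (sin_le_sqr b); rewrite ler_piMl// ler_norml cos_geN1 cos_le1.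
by apply: le_trans (cos_le_sqr b); rewrite ler_piMl// ler_norml sin_geN1 sin_le1.
Qed.

Lemma IJ_sinc {R : realType} (e v : R) : 0 < e -> IJ (fun t => expR (- e * t) * (sin (t * v) / t)).
Proof.
move=> e0; apply: (@IJ_exp _ _ `|v|) => // t t0; first by apply: dv_continuous; der; [rewrite gt_eqF|reflexivity].
rewrite normrM normfV ler_pdivrMr ?normr_gt0 ?gt_eqF// mulrC -normrM mulrC; exact: sin_le_abs.
Qed.

Lemma IJ_cosc {R : realType} (e v : R) : 0 < e -> IJ (fun t => expR (- e * t) * ((1 - cos (t * v)) / t ^+ 2)).
Proof.
move=> e0; apply: (@IJ_exp _ _ (v ^+ 2)) => // t t0.
  by apply: dv_continuous; der; [rewrite gt_eqF// exprn_gt0|reflexivity].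
have t2 : 0 < t ^+ 2 by rewrite exprn_gt0.
rewrite normrM normfV (gtr0_norm t2) ler_pdivrMr// mulrC -exprMn mulrC; exact: cos_le_sqr.
Qed.

Lemma J_lin3 {R : realType} (f g h : R -> R) (a b : R) : IJ f -> IJ g -> IJ h ->
  IJ (fun t => f t + (a * g t + b * h t)) /\ J (fun t => f t + (a * g t + b * h t)) = J f + (a * J g + b * J h).
Proof.
move=> i1 i2 i3; have ig := IJZ a i2; have ih := IJZ b i3.
split; first by apply: IJD => //; exact: IJD.
by rewrite JD//; [rewrite JD//; rewrite !JZ|exact: IJD].
Qed.

(** Both sides vanish at v = 0 and have derivative e / (e^2 + v^2) in v, by [J_cos]. The quadratic
    error is integrable because t e^(- e t) <= (2 / e) e^(- e t / 2). *)
Lemma J_sinc {R : realType} (e v : R) : 0 < e -> J (fun t => expR (- e * t) * (sin (t * v) / t)) = atan (v / e).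
Proof.
move=> e0; move: v; apply: (@dv_unique R _ _ (fun v => e / (e ^+ 2 + v ^+ 2))).
- move=> v; apply: (@dv_quadratic R _ v (e / (e ^+ 2 + v ^+ 2)) (2 * (2 / e) * (e / 2)^-1)) => k.
  have [i1 <-] := J_cos v e0; have e20 : 0 < e / 2 by rewrite divr_gt0.
  have [i2 j2] := J_exp e20.
  have ia := IJ_sinc (v + k) e0; have ib := IJ_sinc v e0.
  have [ii jj] := J_lin3 (- 1) (- k) ia ib i1.
  set f := fun t => _ in ii jj.
  rewrite (_ : _ - _ - _ = J f); last by rewrite jj; ring.
  rewrite -j2 [leRHS]mulrAC -JZ//; apply: J_abs => //; first exact: IJZ.
  move=> t tp; rewrite /f; have t0 := ltW tp; have tn0 : t != 0 by rewrite gt_eqF.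
  have := sin_taylor1 (t * v) (t * k); rewrite -mulrDr => h.
  have -> : expR (- e * t) * (sin (t * (v + k)) / t) + (-1 * (expR (- e * t) * (sin (t * v) / t)) +
     - k * (expR (- e * t) * cos (t * v))) = (sin (t * (v + k)) - sin (t * v) - t * k * cos (t * v)) * (expR (- e * t) / t) by field.
  rewrite normrM [`|_ / t|]ger0_norm ?divr_ge0 ?expR_ge0//.
  apply: le_trans (ler_wpM2r (divr_ge0 (expR_ge0 _) t0) h) _.
  have -> : 2 * (t * k) ^+ 2 * (expR (- e * t) / t) = 2 * k ^+ 2 * (t * expR (- e * t)) by field.
  rewrite -[X in _ <= X * _]mulrAC -[leRHS]mulrA; apply: ler_wpM2l (mulr_ge0 (ler0n _ 2) (sqr_ge0 k)) _ _ _.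
  have -> : expR (- e * t) = expR (- (e / 2 * t)) * expR (- (e / 2) * t) by rewrite -expRD; congr expR; field.
  rewrite mulrA ler_wpM2r ?expR_ge0// expRN ler_pdivrMr ?expR_gt0//.
  have e2 : 0 <= 2 / e by rewrite divr_ge0// ltW.
  have := ler_wpM2l e2 (expR_ge1Dx (e / 2 * t)); apply: le_trans.
  have -> : 2 / e * (1 + e / 2 * t) = 2 / e + t by field; rewrite gt_eqF.
  by rewrite lerDr.
- move=> v; der; have d0 : 0 < e ^+ 2 + v ^+ 2 by rewrite ltr_pwDl ?exprn_gt0// sqr_ge0.
  rewrite (_ : 1 + (v / e) ^+ 2 = (e ^+ 2 + v ^+ 2) / e ^+ 2); last by field; rewrite gt_eqF.
  by field; rewrite !gt_eqF.
- rewrite mul0r atan0; rewrite (J_eq (g := fun=> 0)) ?J0// => t _; by rewrite mulr0 sin0 mul0r mulr0.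
Qed.

Lemma J_cosc {R : realType} (e v : R) : 0 < e -> J (fun t => expR (- e * t) * ((1 - cos (t * v)) / t ^+ 2)) =
  v * atan (v / e) - e / 2 * ln (1 + (v / e) ^+ 2).
Proof.
move=> e0; move: v; apply: (@dv_unique R _ _ (fun v => atan (v / e))).
- move=> v; apply: (@dv_quadratic R _ v (atan (v / e)) (2 * e^-1)) => k.
  have [i2 j2] := J_exp e0; rewrite -(J_sinc v e0).
  have i1 := IJ_sinc v e0; have ia := IJ_cosc (v + k) e0; have ib := IJ_cosc v e0.
  have [ii jj] := J_lin3 (- 1) (- k) ia ib i1.
  set f := fun t => _ in ii jj.
  rewrite (_ : _ - _ - _ = J f); last by rewrite jj; ring.
  rewrite -[X in 2 * X]j2 [leRHS]mulrAC -JZ//; apply: J_abs => //; first exact: IJZ.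
  move=> t tp; rewrite /f; have t0 := ltW tp; have tn0 : t != 0 by rewrite gt_eqF.
  have := cos_taylor1 (t * v) (t * k); rewrite -mulrDr => h.
  have -> : expR (- e * t) * ((1 - cos (t * (v + k))) / t ^+ 2) + (-1 * (expR (- e * t) * ((1 - cos (t * v)) / t ^+ 2)) +
     - k * (expR (- e * t) * (sin (t * v) / t))) = (cos (t * (v + k)) - cos (t * v) + t * k * sin (t * v)) * (- (expR (- e * t) / t ^+ 2)) by field.
  have p0 : 0 <= expR (- e * t) / t ^+ 2 by rewrite divr_ge0 ?expR_ge0 ?sqr_ge0.
  rewrite normrM normrN [`|_ / t ^+ 2|]ger0_norm//.
  apply: le_trans (ler_wpM2r p0 h) _.
  by rewrite le_eqVlt; apply/orP; left; apply/eqP; field.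
- move=> v; have ne : 1 + (v / e) ^+ 2 != 0 by rewrite gt_eqF// ltr_pwDl// sqr_ge0.
  der; first by rewrite ltr_pwDl// sqr_ge0.
  move: ne; rewrite [1 + _](_ : _ = (e ^+ 2 + v ^+ 2) / e ^+ 2); last by field; rewrite gt_eqF.
  move=> ne; field; rewrite gt_eqF//=; apply: contra ne => /eqP ->; by rewrite mul0r.
- rewrite !mul0r expr0n/= addr0 ln1 mulr0 subr0; rewrite (J_eq (g := fun=> 0)) ?J0// => t _; by rewrite mulr0 cos0 subrr mul0r mulr0.
Qed.

(** The second difference in v of 1 - cos (t v) is cos (t v) (2 - 2 cos (t h)); divided by t^2 this
    is a Fejer kernel. *)
Lemma J_cosc2 {R : realType} (e v h : R) : 0 < e ->
  let L v := v * atan (v / e) - e / 2 * ln (1 + (v / e) ^+ 2) in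
  IJ (fun t => expR (- e * t) * (cos (t * v) * ((2 - 2 * cos (t * h)) / t ^+ 2))) /\
  J (fun t => expR (- e * t) * (cos (t * v) * ((2 - 2 * cos (t * h)) / t ^+ 2))) = L (v + h) + L (v - h) - 2 * L v.
Proof.
move=> e0 L; have E w := J_cosc w e0.
have i1 := IJ_cosc (v + h) e0; have i2 := IJ_cosc (v - h) e0; have i3 := IJ_cosc v e0.
have [ii jj] := J_lin3 1 (- 2) i1 i2 i3.
have H t : 0 < t -> expR (- e * t) * ((1 - cos (t * (v + h))) / t ^+ 2) + (1 * (expR (- e * t) * ((1 - cos (t * (v - h))) / t ^+ 2))
  + - 2 * (expR (- e * t) * ((1 - cos (t * v)) / t ^+ 2))) = expR (- e * t) * (cos (t * v) * ((2 - 2 * cos (t * h)) / t ^+ 2)).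
  move=> _; rewrite mulrDr mulrBr cosD cosB; move: (_^-1) => ti; ring.
split; first exact: IJ_eq H ii.
by rewrite -(J_eq H) jj !E /L mul1r mulNr addrA.
Qed.

Definition Lk {R : realType} (e v : R) := v * atan (v / e) - e / 2 * ln (1 + (v / e) ^+ 2).

(** As e tends to 0, v atan (v / e) tends to |v| pi / 2 and the logarithmic term disappears. *)
Lemma Lk_cvg {R : realType} (v : R) : Lk (n.+1%:R^-1) v @[n --> \oo] --> pi / 2 * `|v|.
Proof.
pose w := `|v|; have w0 : 0 <= w by exact: normr_ge0.
have E e : Lk e v = w * atan (w / e) - e / 2 * ln (1 + (w / e) ^+ 2).
  rewrite /Lk /w !exprMn real_normK ?num_real//; congr (_ - _).
  by have [v0|v0] := leP 0 v; [rewrite ger0_norm|rewrite ltr0_norm// [- v / e]mulNr atanN mulrNN].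
under eq_fun do rewrite E.
have -> : pi / 2 * `|v| = w * (pi / 2) - 0 by rewrite subr0 mulrC.
have h0 : (fun n => n.+1%:R^-1 : R) @ \oo --> (0 : R) by exact: cvg_harmonic.
apply: cvgB.
  have [->|wn0] := eqVneq w 0; first by rewrite mul0r; under eq_fun do rewrite mul0r; exact: cvg_cst.
  apply: cvgM; first exact: cvg_cst.
  apply: (@cvg_comp _ _ _ (fun n => w / n.+1%:R^-1) (@atan R)); last exact: cvgy_atan.
  apply/cvgryPge => A; near=> n.
  have wp : 0 < w by rewrite lt_neqAle eq_sym wn0.
  rewrite invrK -ler_pdivrMl//; have : A / w <= n%:R by near: n; exact: nbhs_infty_ger.
  by rewrite -natr1 mulrC; lra.
apply: (@cvg_dominated _ _ _ (fun n => 2 * Num.sqrt (1 + w) * Num.sqrt (n.+1%:R^-1))); last first.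
  rewrite -[X in _ --> X](mulr0 (2 * Num.sqrt (1 + w))); apply: cvgM; first exact: cvg_cst.
  by rewrite -[X in _ --> X]sqrtr0; apply: cvg_comp h0 _; exact: sqrt_continuous.
near=> n; set e := n.+1%:R^-1; have e0 : 0 < e by rewrite invr_gt0.
have e1 : e <= 1 by rewrite invf_le1// ler1n.
have y0 : 0 <= w / e by rewrite divr_ge0// ltW.
rewrite subr0 ger0_norm; last first.
  by rewrite mulr_ge0 ?divr_ge0 ?(ltW e0)// ln_ge0// lerDl sqr_ge0.
(* With y = w / e, ln (1 + y^2) <= 4 ln ((1 + y)^(1/2)) <= 4 (1 + y)^(1/2), which makes the term
   O(e^(1/2)). *)
apply: (@le_trans _ _ (e / 2 * (4 * Num.sqrt (1 + w / e)))).
  rewrite ler_wpM2l ?divr_ge0 ?(ltW e0)//.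
  apply: (@le_trans _ _ (ln ((Num.sqrt (1 + w / e)) ^+ 4))).
    rewrite ler_ln ?posrE ?exprn_gt0 ?sqrtr_gt0 ?ltr_pwDl ?sqr_ge0//.
    rewrite -[4%N]/(2 * 2)%N exprM sqr_sqrtr ?addr_ge0//; move: y0; set y := w / e; nra.
  rewrite lnXn ?sqrtr_gt0 ?ltr_pwDl// -[ln _ *+ 4]mulr_natl; apply: ler_wpM2l => //; apply/ltW/ln_sublinear; rewrite sqrtr_gt0 ltr_pwDl//.
have -> : e / 2 * (4 * Num.sqrt (1 + w / e)) = 2 * (e * Num.sqrt (1 + w / e)) by field.
rewrite -mulrA ler_wpM2l// -sqrtrM ?addr_ge0//.
rewrite -[e in e * _](@sqr_sqrtr _ e) ?(ltW e0)// expr2 -mulrA [leRHS]sqrtrM ?addr_ge0// mulrC.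
rewrite ler_wpM2r ?sqrtr_ge0// -sqrtrM ?(ltW e0)// ler_wsqrtr// mulrDr mulr1 mulrCA divff ?gt_eqF// mulr1; lra.
Unshelve. all: by end_near. Qed.

(* Integrable majorant of [sqrt (1 + t) min (b^2, 4 / t^2)]. *)
Lemma J_majorant {R : realType} (b : R) : 1 <= b ->
  let D t := 16 * b ^+ 2 / (4 + (t * b) ^+ 2) + 16 * expR (- (3 / 2) * ln (1 + t)) in
  [/\ IJ D, J D <= 64 * b & forall t G : R, 0 < t -> `|G| <= b ^+ 2 -> `|G| <= 4 / t ^+ 2 ->
    expR (1 / 2 * ln (1 + t)) * `|G| <= D t].
Proof.
move=> b1 D; have b0 : 0 < b by apply: lt_le_trans b1.
have d0 t : 0 < 4 + (t * b) ^+ 2 by rewrite ltr_pwDl// sqr_ge0.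
have [] := @J_ftc R D (fun t => 8 * b * atan (t * b / 2) - 32 * expR (- (1 / 2) * ln (1 + t))) (8 * b * (pi / 2)).
- move=> x x0; rewrite /D addr_ge0// ?mulr_ge0 ?expR_ge0// ?invr_ge0 ?(ltW (d0 _))//; exact: ltW.
- move=> x x0; apply: dv_continuous; rewrite /D; der; [by rewrite gt_eqF|by rewrite ltr_pwDl|reflexivity].
- move=> x x0; have x1 : 0 < 1 + x by rewrite ltr_pwDl.
  der; first by [].
  rewrite /D; have -> : expR (- (3 / 2) * ln (1 + x)) = (1 + x)^-1 * expR (- (1 / 2) * ln (1 + x)).
    by rewrite -[(1 + x)^-1]lnK ?posrE ?invr_gt0// -expRD lnV ?posrE//; congr expR; field.
  have -> : 1 + (x * b / 2) ^+ 2 = (4 + (x * b) ^+ 2) / 4 by field.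
  have := d0 x => d; field; rewrite !gt_eqF//.
- rewrite -[X in _ --> X]subr0; apply: cvgB.
    apply: cvgM; first exact: cvg_cst.
    apply: (@cvg_comp _ _ _ (fun x => x * b / 2) (@atan R)); last exact: cvgy_atan.
    apply/cvgryPge => A; near=> n.
    have : A * 2 / b <= n by near: n; apply: nbhs_pinfty_ge; rewrite num_real.
    by rewrite ler_pdivrMr// ler_pdivlMr.
  rewrite -[X in _ --> X](mulr0 32); apply: cvgM; first exact: cvg_cst.
  have h : ln (1 + t : R) @[t --> +oo%R] --> +oo%R.
    apply/cvgryPge => A; near=> t.
    have : expR A <= t by near: t; apply: nbhs_pinfty_ge; rewrite num_real.
    move=> h; rewrite -[A]expRK ler_ln ?posrE ?expR_gt0 ?(lt_le_trans (expR_gt0 A))//; lra.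
  have h12 : (0 : R) < 1 / 2 by lra.
  exact: (cvg_comp _ _ h (expRN_cvg0 h12)).
move=> iD jD; split => //.
  rewrite jD !mul0r atan0 addr0 ln1 !mulr0 expR0 mulr1 sub0r opprK.
  have := @pihalf_lt2 R; nra.
move=> t G t0 G1 G2.
have x1 : 0 < 1 + t by rewrite ltr_pwDl// ltW.
have [t1|t1] := leP t 1.
  apply: (@le_trans _ _ (2 * (8 * b ^+ 2 / (4 + (t * b) ^+ 2)))); last first.
    rewrite /D -[leLHS]addr0; apply: lerD; last by rewrite mulr_ge0 ?expR_ge0.
    by rewrite !mulrA -natrM.
  apply: ler_pM => //; rewrite ?expR_ge0//.
    apply: (@le_trans _ _ (expR (ln 2))); last by rewrite lnK ?posrE.
    rewrite ler_expR; have l : ln (1 + t) <= ln 2 by rewrite ler_ln ?posrE//; lra.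
    have := @ln_ge0 R 2 ltac:(lra); lra.
  rewrite ler_pdivlMr//; move: G2; rewrite ler_pdivlMr ?exprn_gt0// exprMn => G2.
  have := sqr_ge0 b; nra.
apply: (@le_trans _ _ (16 * expR (- (3 / 2) * ln (1 + t)))); last first.
  by rewrite /D -[leLHS]add0r lerD2r mulr_ge0// ?invr_ge0 ?(ltW (d0 _))// mulr_ge0// sqr_ge0.
have -> : expR (- (3 / 2) * ln (1 + t)) = expR (1 / 2 * ln (1 + t)) * (1 + t) ^- 2.
  rewrite -[(1 + t) ^- 2]lnK ?posrE ?invr_gt0 ?exprn_gt0// -expRD lnV ?posrE ?exprn_gt0// lnXn//.
  by congr expR; field.
rewrite [leRHS]mulrCA ler_wpM2l ?expR_ge0//; apply: le_trans G2 _.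
rewrite ler_pdivlMr ?exprn_gt0// mulrAC ler_pdivrMr ?exprn_gt0//; nra.
Unshelve. all: by end_near. Qed.

Definition ramp {R : realType} (h v : R) : R := Num.max 0 (h - v).

(** For nonnegative v and h, |v + h| + |v - h| - 2 |v| is twice the truncated ramp. *)
Lemma Lk_ramp {R : realType} (h v : R) : 0 <= h -> 0 <= v ->
  Lk (n.+1%:R^-1) (v + h) + Lk (n.+1%:R^-1) (v - h) - 2 * Lk (n.+1%:R^-1) v @[n --> \oo] --> pi * ramp h v.
Proof.
move=> h0 v0.
have -> : pi * ramp h v = pi / 2 * `|v + h| + pi / 2 * `|v - h| - 2 * (pi / 2 * `|v|).
  rewrite /ramp (ger0_norm v0) (ger0_norm (addr_ge0 v0 h0)).
  have [hv|hv] := leP h v.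
    by rewrite max_l ?subr_le0// ger0_norm ?subr_ge0//; field.
  by rewrite max_r ?subr_ge0 ?(ltW hv)// ltr0_norm ?subr_lt0//; field.
by apply: cvgB; [apply: cvgD|apply: cvgM; [exact: cvg_cst|]]; exact: Lk_cvg.
Qed.

Lemma cvg_sumr {R : realType} I (r : seq I) (u : I -> nat -> R) (l : I -> R) :
  (forall i, u i @ \oo --> l i) -> (fun n => \sum_(i <- r) u i n) @ \oo --> \sum_(i <- r) l i.
Proof.
move=> H; elim: r => [|i r IH].
  by under eq_fun do rewrite big_nil; rewrite big_nil; exact: cvg_cst.
by under eq_fun do rewrite big_cons; rewrite big_cons; apply: cvgD.
Qed.

(** Up to a factor pi >= 1, the sum on the left is the limit for e -> 0 of the integral of e^(- e t)
    times the cosine polynomial times the kernel. The growth (1 + t)^(1/2) allowed to the polynomial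
    is integrable against the smaller of B^2 and 4 / t^2. *)
Lemma kernel_bound {R : realType} M (b : nat -> R) (C B h1 h2 : R) : 1 <= B -> 0 <= h1 -> 0 <= h2 ->
  (forall t, 0 <= t -> `|\sum_(1 <= n < M) b n * cos (t * ln n%:R)| <= C * expR (1 / 2 * ln (1 + t))) ->
  (forall t, 0 < t -> `|(2 * cos (t * h1) - 2 * cos (t * h2)) / t ^+ 2| <= B ^+ 2) ->
  `|\sum_(1 <= n < M) b n * (ramp h2 (ln n%:R) - ramp h1 (ln n%:R))| <= C * (64 * B).
Proof.
move=> B1 h10 h20 HS HB.
have C0 : 0 <= C.
  by have := HS 0 (lexx _); rewrite addr0 ln1 mulr0 expR0 mulr1; apply: le_trans.
have [iD jD HD] := J_majorant B1; set D := fun t => _ in iD jD HD.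
pose W e (n : nat) h := Lk e (ln (n%:R : R) + h) + Lk e (ln n%:R - h) - 2 * Lk e (ln n%:R).
have A e : 0 < e -> `|\sum_(1 <= n < M) b n * (W e n h2 - W e n h1)| <= C * (64 * B).
  move=> e0; pose f (h : R) n t := expR (- e * t) * (cos (t * ln (n%:R : R)) * ((2 - 2 * cos (t * h)) / t ^+ 2)).
  have I (h : R) n : IJ (f h n) /\ J (f h n) = W e n h by exact: J_cosc2.
  have -> : \sum_(1 <= n < M) b n * (W e n h2 - W e n h1) =
     J (fun t => \sum_(1 <= n < M) (b n * f h2 n t + - b n * f h1 n t)).
    rewrite J_sum => [|n]; last by apply: IJD; apply: IJZ; exact: (I _ _).1.
    apply: eq_bigr => n _; rewrite JD; try by apply: IJZ; exact: (I _ _).1.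
    rewrite !JZ; try exact: (I _ _).1.
    by rewrite !(I _ _).2; ring.
  apply: (@le_trans _ _ (J (fun t => C * D t))); last by rewrite JZ//; exact: ler_wpM2l.
  apply: J_abs; [|exact: IJZ|].
    by apply: IJ_sum => n; apply: IJD; apply: IJZ; exact: (I _ _).1.
  move=> t t0; have t2 : 0 < t ^+ 2 by rewrite exprn_gt0.
  have -> : \sum_(1 <= n < M) (b n * f h2 n t + - b n * f h1 n t) =
    expR (- e * t) * ((\sum_(1 <= n < M) b n * cos (t * ln n%:R)) * ((2 * cos (t * h1) - 2 * cos (t * h2)) / t ^+ 2)).
    rewrite big_distrl/= big_distrr/=; apply: eq_bigr => n _; rewrite /f; move: (_^-1) => ti; ring.
  have e1 : expR (- e * t) <= 1 by rewrite expR_le1 mulNr oppr_le0 mulr_ge0 ?(ltW e0) ?(ltW t0).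
  rewrite normrM (ger0_norm (expR_ge0 _)) normrM.
  apply: le_trans (ler_piMl _ e1) _; first by rewrite mulr_ge0.
  apply: (@le_trans _ _ (C * expR (1 / 2 * ln (1 + t)) * `|(2 * cos (t * h1) - 2 * cos (t * h2)) / t ^+ 2|)).
    by rewrite ler_wpM2r// HS// ltW.
  rewrite -mulrA ler_wpM2l//; apply: HD => //; first exact: HB.
  rewrite normrM [X in _ * X]ger0_norm ?invr_ge0 ?(ltW t2)// ler_wpM2r ?invr_ge0 ?(ltW t2)//.
  rewrite -mulrBr normrM ger0_norm// (_ : 4 = 2 * 2 :> R); last by ring.
  rewrite ler_wpM2l// (le_trans (ler_normB _ _))// (_ : 2 = 1 + 1 :> R)// lerD// ler_norml cos_geN1 cos_le1//.
have lim : (fun k => \sum_(1 <= n < M) b n * (W (k.+1%:R^-1) n h2 - W (k.+1%:R^-1) n h1)) @ \oo -->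
   \sum_(1 <= n < M) b n * (pi * ramp h2 (ln n%:R) - pi * ramp h1 (ln n%:R)).
  apply: cvg_sumr => n; apply: cvgM; first exact: cvg_cst.
  by apply: cvgB; apply: Lk_ramp => //; exact: ln_nat_ge0.
have L := cvg_lim (@Rhausdorff R) (cvg_norm lim).
have : `|\sum_(1 <= n < M) b n * (pi * ramp h2 (ln n%:R) - pi * ramp h1 (ln n%:R))| <= C * (64 * B).
  rewrite -L; apply: limr_le; first by apply/cvg_ex; eexists; exact: (cvg_norm lim).
  by apply: nearW => k; apply: A; rewrite invr_gt0.
have -> : \sum_(1 <= n < M) b n * (pi * ramp h2 (ln n%:R) - pi * ramp h1 (ln n%:R)) =
   pi * \sum_(1 <= n < M) b n * (ramp h2 (ln n%:R) - ramp h1 (ln n%:R)).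
  by rewrite big_distrr/=; apply: eq_bigr => n _; ring.
rewrite normrM (ger0_norm (pi_ge0 R)); apply: le_trans; rewrite ler_peMl//.
by apply: (@le_trans _ _ 2) => //; [lra|exact: pi_ge2].
Qed.

(** For h >= 1 and k h <= 1 the kernel of a difference of two ramps is at most 4, while that of a
    single ramp of length h is of order h^2. This gain gives access to the unsmoothed sums. *)
Lemma cos_diff_le {R : realType} (h k t : R) : 0 <= h -> 0 <= k -> 0 < t ->
  `|(2 * cos (t * h) - 2 * cos (t * (h + k))) / t ^+ 2| <= 2 * k * (h + k).
Proof.
move=> h0 k0 t0; have t2 : 0 < t ^+ 2 by rewrite exprn_gt0.
rewrite normrM [X in _ * X]ger0_norm ?invr_ge0 ?(ltW t2)// ler_pdivrMr//.
have hk : t * h <= t * (h + k) by rewrite ler_wpM2l ?(ltW t0)// lerDl.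
have H := @dv_lipschitz R cos (fun x => - sin x) (t * h) (t * (h + k)) (t * (h + k)) hk (fun y _ => ltac:(by der; ring)).
rewrite -mulrBr normrM -[cos _ - _]opprB normrN [`|2|]ger0_norm//.
have -> : 2 * k * (h + k) * t ^+ 2 = 2 * (t * (h + k) * (t * (h + k) - t * h)) by ring.
rewrite ler_wpM2l//; apply: H => x /andP[x1 x2].
rewrite normrN (le_trans (sin_le_abs _))// ger0_norm//; exact: (le_trans (mulr_ge0 (ltW t0) h0) x1).
Qed.

(** * Smoothed prime sums *)

(** Coefficients of [Zz 2 - Dz 2] once proper prime powers are removed; subtracting 1 compensates
    the pole. *)
Definition aa {R : realType} (n : nat) : R := (thp n - 1) * ln n%:R ^+ 2.

Lemma aa_abs {R : realType} n : `|aa n| <= ln n%:R ^+ 3 + ln n%:R ^+ 2 :> R.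
Proof.
have l0 := @ln_nat_ge0 R n.
rewrite /aa normrM (ger0_norm (sqr_ge0 _)) exprS -[X in _ <= _ + X]mul1r -mulrDl ler_wpM2r ?sqr_ge0//.
rewrite (le_trans (ler_normB _ _))// normr1 lerD2r ger0_norm /thp; by case: ifP.
Qed.

Lemma ln_pow_le_ex {R : realType} n m : (0 < m)%N ->
  exists2 K : R, 0 < K & forall y, 1 <= y -> ln y ^+ n <= K * expR (ln y / m%:R).
Proof.
move=> m0; exists (n `!%:R * m%:R ^+ n); first by rewrite mulr_gt0 ?exprn_gt0 ?ltr0n// fact_gt0.
by move=> y; exact: ln_pow_le.
Qed.

Lemma log_pow_le_sqrt {R : realType} : exists2 C : R, 0 < C & forall t : R,
  (1 + ln (3 + `|t|)) ^+ 60 <= C * expR (1 / 2 * ln (1 + `|t|)).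
Proof.
have [K K0 HK] := @ln_pow_le_ex R 60 2 isT.
exists (K * expR (ln (3 * expR 1) / 2)); first by rewrite mulr_gt0 ?expR_gt0.
move=> t; have t0 := normr_ge0 t; have e0 := expR_gt0 (1 : R); have := expR_ge1Dx (1 : R) => e1.
have t3 : 0 < 3 + `|t| by rewrite ltr_pwDl.
have -> : 1 + ln (3 + `|t|) = ln (expR 1 * (3 + `|t|)) by rewrite lnM ?posrE// expRK.
apply: le_trans (HK _ _) _; first by nra.
rewrite -mulrA ler_wpM2l ?(ltW K0)// -expRD ler_expR.
rewrite (_ : ln _ / 2 + _ = ln (3 * expR 1 * (1 + `|t|)) / 2); last first.
  by rewrite [in RHS]lnM ?posrE ?mulr_gt0 ?ltr_pwDl//; field.
by rewrite ler_pM2r ?invr_gt0// ler_ln ?posrE ?mulr_gt0 ?ltr_pwDl//; nra.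
Qed.

Lemma tail_le {R : realType} (x : R) : 0 < x -> exists M0 : nat, forall M M', (M0 <= M)%N -> (M <= M')%N ->
  \sum_(M <= n < M') `|aa n| * expR (- (1 + x) * ln n%:R) <= 1.
Proof.
move=> x0; pose u M := sz 3 x M + sz 2 x M.
have cu : cvgn u by apply: is_cvgD; exact: sz_cvg.
have ul : u @ \oo --> limn u := cu.
have [N _ HN] : \forall n \near \oo, `|limn u - u n| <= 1 / 2 by move: ul => /cvgrPdist_le; apply; lra.
exists N.+1 => M M' NM MM'.
have a1 := HN M (ltnW NM); have a2 := HN M' (leq_trans (ltnW NM) MM').
have : \sum_(M <= n < M') `|aa n| * expR (- (1 + x) * ln n%:R) <= u M' - u M; last first.
  by move: a1 a2; rewrite !ler_norml; lra.
have -> : u M' - u M = \sum_(M <= n < M') (ln n%:R ^+ 3 + ln n%:R ^+ 2) * expR (- (1 + x) * ln n%:R).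
  rewrite /u /sz -!big_split /= (big_cat_nat (n := M) (p := M'))//=; last by case: (M) NM.
  by rewrite addrAC subrr add0r; apply: eq_bigr => n _; rewrite mulrDl.
by apply: ler_sum => n _; rewrite ler_wpM2r ?expR_ge0// aa_abs.
Qed.

(** M0 depends on x but not on t, as the kernel is integrated over all t. This is possible because
    [tail_le] bounds the tail absolutely; only the auxiliary N inside the proof depends on t. *)
Lemma S_bound {R : realType} : exists x1 : R, 0 < x1 /\ exists2 C : R, 0 < C &
  forall x, 0 < x -> x <= x1 -> exists M0, forall M, (M0 <= M)%N -> forall t, 0 <= t ->
  `|\sum_(1 <= n < M) (aa n * expR (- (1 + x) * ln n%:R)) * cos (t * ln n%:R)| <= C * expR (1 / 2 * ln (1 + t)).
Proof.
have [x1 [/andP[x10 _] [C1 C10 H1]]] := @G_bound R.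
have [C2 C20 H2] := @thp_error R; have [C3 C30 H3] := @log_pow_le_sqrt R.
exists x1; split => //; exists (C1 * C3 + (2 + C2)); first by rewrite addr_gt0 ?mulr_gt0 ?addr_gt0.
move=> x x0 xx; have [M0 HM] := tail_le x0; exists M0.+1 => M MM t t0.
pose z := Complex x t; have zx : 0 < Rec z by [].
pose U N := \sum_(1 <= n < N) rc (aa n) * fz 0 z (ln (n%:R : R)).
have UE N : U N = Zs 2 z N - Sz 2 z N - \sum_(1 <= a < N) rc (Lam a - thp a) * fz 2 z (ln a%:R).
  rewrite /U /Zs /Sz -!sumrB; apply: eq_bigr => n _.
  by rewrite [fz 2 _ _]fz_exp /aa !(rcM, rcD, rcN) rc1; ring.
have G := ccv_cmod (ccvD (ZzP 2 zx) (ccvN (DzP 2 zx))).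
have [N [NM HN]] : exists N, (M <= N)%N /\ cmod (Zs 2 z N - Sz 2 z N) <= cmod (Zz 2 z - Dz 2 z) + 1.
  have : \forall n \near \oo, cmod (Zs 2 z n - Sz 2 z n) <= cmod (Zz 2 z - Dz 2 z) + 1.
    move: G => /cvgrPdist_le /(_ 1 ltr01); apply: filterS => n; rewrite ler_norml => /andP[h1 h2]; lra.
  by move=> [K _ HK]; exists (maxn M K); rewrite leq_maxl; split => //; apply: HK; rewrite /= leq_maxr.
have h1 : cmod (U N) <= C1 * C3 * expR (1 / 2 * ln (1 + t)) + 1 + C2.
  rewrite UE; apply: le_trans (cmodB _ _) _; apply: lerD; last exact/H2/ltW.
  apply: le_trans HN _; rewrite lerD2r; apply: le_trans (H1 x t x0 xx) _.
  by rewrite -mulrA ler_wpM2l ?(ltW C10)//; have := H3 t; rewrite (ger0_norm t0).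
have h2 : cmod (U M - U N) <= 1.
  rewrite -cmodN opprB /U [X in X - _](big_cat_nat (n := M))//=; last by case: (M) MM.
  rewrite addrAC subrr add0r; apply: le_trans (cmod_sum _ _ _) _.
  apply: le_trans (HM M N (ltnW MM) NM); apply: ler_sum => n _.
  by rewrite cmodM cmod_rc cmod_fz ?ln_nat_ge0// expr0 mul1r.
have -> : \sum_(1 <= n < M) aa n * expR (- (1 + x) * ln n%:R) * cos (t * ln n%:R) = Rec (U M).
  rewrite /U (big_morph _ (@RecD R) (erefl : Rec (0 : R[i]) = 0)); apply: eq_bigr => n _.
  by rewrite RecM -[fz _ _ _]/(ez z n) ezE /= mul0r subr0 mulrA.
apply: le_trans (Rec_le _) _; rewrite -[U M](subrK (U N)); apply: le_trans (cmodD _ _) _.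
apply: le_trans (lerD h2 h1) _.
have e1 : 1 <= expR (1 / 2 * ln (1 + t)).
  by rewrite -[1 in leLHS]expR0 ler_expR; apply: mulr_ge0; [lra|apply: ln_ge0; lra].
move: e1 C20; move: (expR _) (C1 * C3); clear => e c; nra.
Qed.

Lemma ramp_eq0 {R : realType} (h v : R) : h <= v -> ramp h v = 0.
Proof. by move=> hv; rewrite /ramp max_l// subr_le0. Qed.

Lemma ramp_gen {R : realType} : exists2 C : R, 0 < C & forall (M : nat) (h1 h2 B : R),
  1 <= B -> 0 <= h1 -> 0 <= h2 -> h1 <= ln M%:R -> h2 <= ln M%:R ->
  (forall t, 0 < t -> `|(2 * cos (t * h1) - 2 * cos (t * h2)) / t ^+ 2| <= B ^+ 2) ->
  `|\sum_(1 <= n < M) aa n * expR (- ln n%:R) * (ramp h2 (ln n%:R) - ramp h1 (ln n%:R))| <= C * (64 * B).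
Proof.
have [x1 [x10 [C C0 H]]] := @S_bound R; exists C => // M h1 h2 B B1 h10 h20 h1M h2M HB.
pose x k : R := x1 / k.+1%:R.
have x0 k : 0 < x k by rewrite divr_gt0.
have xx k : x k <= x1 by rewrite ler_pdivrMr// ler_peMr ?(ltW x10)// ler1n.
have A k : `|\sum_(1 <= n < M) aa n * expR (- (1 + x k) * ln n%:R) * (ramp h2 (ln n%:R) - ramp h1 (ln n%:R))| <= C * (64 * B).
  have [M0 HM] := H _ (x0 k) (xx k).
  have := @kernel_bound R (maxn M M0) (fun n => aa n * expR (- (1 + x k) * ln n%:R)) C B h1 h2 B1 h10 h20
    (HM _ (leq_maxr _ _)) HB.
  case: M h1M h2M {HM} => [|M] h1M h2M; first by move=> _; rewrite big_geq// normr0; apply: mulr_ge0 (ltW C0) _; lra.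
  rewrite (big_cat_nat (n := M.+1) (p := maxn M.+1 M0)) ?leq_maxl//= [X in _ + X]big_nat_cond [X in _ + X]big1 ?addr0//.
  move=> n /andP[/andP[Mn _] _].
  have lM : ln M.+1%:R <= ln n%:R :> R by rewrite ler_ln ?posrE ?ltr0n ?ler_nat//; lia.
  by rewrite !ramp_eq0 ?subrr ?mulr0// (le_trans _ lM).
have lim : (fun k => \sum_(1 <= n < M) aa n * expR (- (1 + x k) * ln n%:R) * (ramp h2 (ln n%:R) - ramp h1 (ln n%:R))) @ \oo -->
   \sum_(1 <= n < M) aa n * expR (- ln n%:R) * (ramp h2 (ln n%:R) - ramp h1 (ln n%:R)).
  apply: cvg_sumr => n; apply: cvgM; last exact: cvg_cst; apply: cvgM; first exact: cvg_cst.
  apply: (@cvg_comp _ _ _ (fun k => - (1 + x k) * ln n%:R) (@expR R)); last exact: continuous_expR.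
  rewrite -[- ln _]mulN1r; apply: cvgM; last exact: cvg_cst; apply: cvgN.
  rewrite -[X in _ --> X]addr0; apply: cvgD; first exact: cvg_cst.
  rewrite -(mulr0 x1); apply: cvgM; [exact: cvg_cst|exact: cvg_harmonic].
have L := cvg_lim (@Rhausdorff R) (cvg_norm lim).
rewrite -L; apply: limr_le; first by apply/cvg_ex; eexists; exact: (cvg_norm lim).
by apply: nearW => k; exact: A.
Qed.

Definition E2 {R : realType} M (h : R) : R := \sum_(1 <= n < M) aa n / n%:R * ramp h (ln n%:R).

(** [ramp_gen] is used with B = 2 h for one ramp, compared with the ramp of length 0, and with B = 2
    for an increment with k h <= 1. *)
Lemma E2_bound {R : realType} : exists2 C : R, 0 < C & forall M (h : R), 1 <= h -> h <= ln M%:R ->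
  `|E2 M h| <= C * h /\ forall k, 0 <= k -> k * h <= 1 -> h + k <= ln M%:R -> `|E2 M (h + k) - E2 M h| <= C.
Proof.
have [C C0 H] := @ramp_gen R; exists (C * 128); first by rewrite mulr_gt0.
move=> M h h1 hM; have h0 : 0 <= h by apply: le_trans h1.
have E n : (0 < n)%N -> expR (- ln (n%:R : R)) = n%:R^-1 by move=> n0; rewrite invE_ln// ltr0n.
split.
  have := H M 0 h (2 * h).
  rewrite (eq_big_nat _ _ (F2 := fun n => aa n / n%:R * ramp h (ln n%:R))); last first.
    by move=> n /andP[n0 _]; rewrite E// (@ramp_eq0 _ 0) ?ln_nat_ge0// subr0.
  move=> /(_ _ (lexx _) h0 (le_trans h0 hM) hM) h'.
  rewrite -[C * 128 * h](_ : C * (64 * (2 * h)) = _); last by ring.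
  apply: h'; first by lra.
  move=> t t0; have := @cos_diff_le R 0 h t (lexx _) h0 t0; rewrite add0r => /le_trans; apply; nra.
move=> k k0 kh hk.
have := H M h (h + k) 2.
rewrite (eq_big_nat _ _ (F2 := fun n => aa n / n%:R * ramp (h + k) (ln n%:R) - aa n / n%:R * ramp h (ln n%:R))); last first.
  by move=> n /andP[n0 _]; rewrite E// mulrBr.
rewrite sumrB => h'; rewrite (_ : C * 128 = C * (64 * 2)); last by ring.
apply: h' => //; [lra|exact: addr_ge0|].
move=> t t0; apply: le_trans (cos_diff_le h0 k0 t0) _; nra.
Qed.

(** * Mertens sums with error O(1/log^2) *)

Lemma ln_step_le {R : realType} n : (0 < n)%N -> ln n.+1%:R - ln n%:R <= n%:R^-1 :> R.
Proof.
move=> n0; have n0' : (0 : R) < n%:R by rewrite ltr0n.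
have i0 : 0 < n%:R^-1 :> R by rewrite invr_gt0.
have -> : ln n.+1%:R = ln (1 + n%:R^-1) + ln n%:R :> R.
  rewrite -lnM ?posrE ?addr_gt0//; congr ln; rewrite -natr1; field; exact: lt0r_neq0.
by rewrite addrK; apply: le_ln1Dx; lra.
Qed.

Lemma ln_step_ge {R : realType} n : (0 < n)%N -> n.+1%:R^-1 <= ln n.+1%:R - ln n%:R :> R.
Proof.
move=> n0; have n0' : (0 : R) < n%:R by rewrite ltr0n.
have n1' : (0 : R) < n.+1%:R by rewrite ltr0n.
have n1 : n.+1%:R^-1 < 1 :> R by rewrite invf_lt1// ltr1n.
have -> : ln n%:R = ln (1 + - n.+1%:R^-1) + ln n.+1%:R :> R.
  rewrite -lnM ?posrE ?subr_gt0//; congr ln.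
  by rewrite mulrDl mul1r mulNr mulVf ?gt_eqF// -natr1 addrK.
have : ln (1 + - n.+1%:R^-1) <= - n.+1%:R^-1 :> R by apply: le_ln1Dx; move: n1; move: (_^-1) => y; lra.
move: (ln _) (_^-1) (ln _) => x y z; clear; lra.
Qed.

Lemma ln_ge_expR {R : realType} (k y : R) : expR k <= y -> k <= ln y.
Proof. by move=> h; rewrite -[k]expRK ler_ln ?posrE ?expR_gt0// (lt_le_trans (expR_gt0 k)). Qed.

Definition ll {R : realType} (n : nat) : R := ln n%:R.

Lemma ll_mono {R : realType} m n : (0 < m)%N -> (m <= n)%N -> ll m <= ll n :> R.
Proof. by move=> m0 mn; rewrite /ll ler_ln ?posrE ?ltr0n ?ler_nat// (leq_trans m0). Qed.

Lemma expR1_le4 {R : realType} : expR 1 <= 4 :> R.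
Proof.
have := expR_ge1Dx (- (1 / 2) : R); rewrite expRN => h.
have e0 := expR_gt0 (1 / 2 : R).
have h2 : expR (1 / 2) <= 2 :> R.
  have := ler_wpM2r (ltW e0) h; rewrite mulVf ?gt_eqF//; lra.
have -> : 1 = 1 / 2 + 1 / 2 :> R by field.
by rewrite expRD; nra.
Qed.

Lemma ll_ge1 {R : realType} n : (4 <= n)%N -> 1 <= ll n :> R.
Proof.
move=> n3; apply: ln_ge_expR; apply: (@le_trans _ _ 4%:R); last by rewrite ler_nat.
exact: expR1_le4.
Qed.

Lemma ll_ge2 {R : realType} n : (16 <= n)%N -> 2 <= ll n :> R.
Proof.
move=> n3; apply: ln_ge_expR; apply: (@le_trans _ _ 16%:R); last by rewrite ler_nat.
have -> : 2 = 1 + 1 :> R by []. rewrite expRD.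
have := @expR1_le4 R; have := expR_gt0 (1 : R); nra.
Qed.

Definition AA {R : realType} n : R := \sum_(1 <= i < n.+1) aa i / i%:R.
(** A primitive of [AA] in the variable ln n; it is the value of [E2] at h = ln n, which the Fourier
    bound controls. *)
Definition ee {R : realType} n : R := \sum_(1 <= i < n.+1) aa i / i%:R * (ll n - ll i).

Lemma eeS {R : realType} n : ee n.+1 - ee n = AA n * (ll n.+1 - ll n) :> R.
Proof.
rewrite /ee /AA big_nat_recr//= subrr mulr0 addr0 -sumrB big_distrl/=.
by apply: eq_bigr => i _; ring.
Qed.

Lemma E2_ee {R : realType} i M : (0 < i)%N -> (i <= M)%N -> E2 M (ll i) = ee i :> R.
Proof.
move=> i0 iM; rewrite /E2 /ee.
have -> : \sum_(1 <= n < i.+1) aa n / n%:R * (ll i - ll n) = \sum_(1 <= n < i) aa n / n%:R * ramp (ll i) (ln (n%:R : R)).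
  rewrite big_nat_recr//= subrr mulr0 addr0; apply: eq_big_nat => n /andP[n0 ni].
  by rewrite /ramp max_r// subr_ge0 ll_mono// ltnW.
rewrite (big_cat_nat (n := i))//= [X in _ + X]big_nat_cond [X in _ + X]big1 ?addr0// => n /andP[/andP[ni _] _].
by rewrite ramp_eq0 ?mulr0// ll_mono.
Qed.

Lemma window_up {R : realType} i M (b : R) : (0 < i)%N -> ll i <= b ->
  \sum_(i.+1 <= n < M) (ll n <= b)%R%:R / n%:R <= b - ll i.
Proof.
move=> i0 ib; have [Mi|iM] := leqP M i; first by rewrite big_geq ?subr_ge0// ltnW.
apply: (@le_trans _ _ (\sum_(i.+1 <= n < M) (Num.min (ll n) b - Num.min (ll n.-1) b))).
  apply: ler_sum_nat => -[//|n] /andP[ni _].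
  have := @ln_step_ge R n (leq_trans i0 ni).
  case: (leP (ll n.+1) b) => h1.
    have h0 : ll n <= b by apply: le_trans h1; apply: ll_mono => //; lia.
    by rewrite mul1r min_l//.
  move=> _; rewrite mul0r subr_ge0 ge_min lexx orbT//.
have -> : \sum_(i.+1 <= n < M) (Num.min (ll n) b - Num.min (ll n.-1) b) = \sum_(i <= n < M.-1) (Num.min (ll n.+1) b - Num.min (ll n) b).
  by case: M iM => // M iM; rewrite big_add1.
rewrite telescope_sumr; last by lia.
by rewrite [Num.min (ll i) b]min_l// lerD2r ge_min lexx orbT.
Qed.

(** The factor 2 comes from 1 / n <= 2 / (n + 1), and the term 1 / i from the step of the logarithm
    past i. *)
Lemma window_down {R : realType} i (a : R) : (0 < i)%N -> a <= ll i ->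
  \sum_(1 <= n < i.+1) (a < ll n)%R%:R / n%:R <= 2 * (ll i + i%:R^-1 - a).
Proof.
move=> i0 ai.
apply: (@le_trans _ _ (\sum_(1 <= n < i.+1) 2 * (Num.max (ll n.+1) a - Num.max (ll n) a))).
  apply: ler_sum_nat => n /andP[n0 _].
  have := @ln_step_ge R n n0; rewrite -/(ll _) -/(ll n).
  have lm : ll n <= ll n.+1 :> R by exact: ll_mono.
  case: (ltP a (ll n)) => h1.
    rewrite max_l ?(le_trans (ltW h1))// => h.
    apply: (@le_trans _ _ (2 * n.+1%:R^-1)); last by rewrite ler_wpM2l.
    have n0' : (0 : R) < n%:R by rewrite ltr0n.
    rewrite mul1r ler_pdivlMr ?ltr0n// mulrC ler_pdivrMr// -natr1; have : (1 : R) <= n%:R by rewrite ler1n.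
    lra.
  by move=> _; rewrite mul0r mulr_ge0// subr_ge0 le_max lexx orbT.
rewrite -mulr_sumr telescope_sumr// ler_wpM2l// [Num.max (ll 1) a]maxC.
have := @ln_step_le R i i0; rewrite -/(ll _) -/(ll i) => h.
have lm : ll i <= ll i.+1 :> R by exact: ll_mono.
rewrite max_l ?(le_trans ai)//.
have : a <= Num.max a (ll 1) by rewrite le_max lexx.
lra.
Qed.

(** The one-sided Tauberian condition: the contribution of primes to [aa] is nonnegative, so only
    the subtracted ln^2 n can make it negative. *)
Lemma aa_le0 {R : realType} n : - (ll n) ^+ 2 <= aa n :> R.
Proof.
have -> : aa n = thp n * ll n ^+ 2 - ll n ^+ 2 :> R by rewrite /aa /ll; ring.
rewrite lerBrDr addNr mulr_ge0 ?sqr_ge0// /thp; case: ifP => // _; exact: ln_nat_ge0.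
Qed.

(** Tauberian step. An increment of [E2] is k [AA i] plus a sum over the window between h and h + k,
    which the one-sided condition bounds below; this bounds [AA i] above. [AA_down] uses the window
    that precedes h for the opposite bound. *)
Lemma AA_up {R : realType} (C h k : R) i M : (0 < i)%N -> (i < M)%N -> ll i = h -> 2 <= h -> 0 < k -> k <= 1 / 2 ->
  `|E2 M (h + k) - E2 M h| <= C -> k * AA i <= C + 8 * k * (k * h ^+ 2).
Proof.
move=> i0 iM1 hE h2 k0 k1 up.
have h0 : 0 < h by apply: lt_le_trans h2.
have split_i (F : nat -> R) : \sum_(1 <= n < M) F n = \sum_(1 <= n < i.+1) F n + \sum_(i.+1 <= n < M) F n.
  by rewrite (big_cat_nat (n := i.+1)).
have E : E2 M (h + k) - E2 M h = k * AA i + \sum_(i.+1 <= n < M) aa n / n%:R * ramp (h + k) (ll n).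
  rewrite /E2 -sumrB split_i /AA mulr_sumr; congr (_ + _).
    apply: eq_big_nat => n /andP[n0 ni]; have lh : ll n <= h by rewrite -hE; apply: ll_mono.
    have r1 : 0 <= h - ll n by rewrite subr_ge0.
    have r2 : 0 <= h + k - ll n by move: r1 k0; clear; lra.
    by rewrite -/(ll n) /ramp !max_r//; ring.
  apply: eq_big_nat => n /andP[ni _]; have lh : h <= ll n by rewrite -hE; apply: ll_mono => //; lia.
  by rewrite (ramp_eq0 lh) mulr0 subr0.
have W := @window_up R i M (h + k) i0 ltac:(rewrite hE lerDl; exact: ltW).
have : - ((h + k) ^+ 2 * k * k) <= \sum_(i.+1 <= n < M) aa n / n%:R * ramp (h + k) (ll n).
  apply: (@le_trans _ _ (- ((h + k) ^+ 2 * k * \sum_(i.+1 <= n < M) (ll n <= h + k)%R%:R / n%:R))).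
    rewrite lerN2; apply: ler_wpM2l; first by rewrite mulr_ge0 ?sqr_ge0// ltW.
    by apply: le_trans W _; rewrite hE addrAC subrr add0r.
  rewrite mulr_sumr -sumrN; apply: ler_sum_nat => n /andP[ni _].
  have n0 : (0 : R) < n%:R by rewrite ltr0n; lia.
  have lh : h <= ll n by rewrite -hE; apply: ll_mono => //; lia.
  have [le1|gt1] := leP (ll n) (h + k); last by rewrite mul0r mulr0 oppr0 ramp_eq0 ?mulr0// ltW.
  have -> : - ((h + k) ^+ 2 * k * (true%:R / n%:R)) = - ((h + k) ^+ 2 * k) / n%:R by rewrite mul1r mulNr.
  rewrite [leRHS]mulrAC ler_wpM2r ?invr_ge0 ?(ltW n0)//.
  have := @aa_le0 R n; rewrite /ramp max_r ?subr_ge0// => a0.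
  have r0 : 0 <= h + k - ll n by rewrite subr_ge0.
  have r1 : h + k - ll n <= k by move: lh; clear; lra.
  have : (ll n) ^+ 2 <= (h + k) ^+ 2 by apply: lerXl => //; move: lh le1 h2; clear; lra.
  move: (ll n) (aa n) a0 r0 r1 (sqr_ge0 (ll n : R)) k0; clear => l a a0 r0 r1 s k0 q; nra.
have : (h + k) ^+ 2 <= 4 * h ^+ 2 by move: k1 k0 h2; clear; nra.
move: up; rewrite E ler_norml => /andP[_]; move: k0; move: (\sum_(_ <= _ < _) _) (AA i); clear => s a; nra.
Qed.

Lemma AA_down {R : realType} (C h k : R) i M : (0 < i)%N -> (i < M)%N -> ll i = h -> 2 <= h -> 0 < k -> k <= 1 / 2 ->
  i%:R^-1 <= k ->  `|E2 M h - E2 M (h - k)| <= C -> - (C + 8 * k * (k * h ^+ 2)) <= k * AA i.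
Proof.
move=> i0 iM1 hE h2 k0 k1 ik dn.
have h0 : 0 < h by apply: lt_le_trans h2.
have split_i (F : nat -> R) : \sum_(1 <= n < M) F n = \sum_(1 <= n < i.+1) F n + \sum_(i.+1 <= n < M) F n.
  by rewrite (big_cat_nat (n := i.+1)).
have E : E2 M h - E2 M (h - k) = k * AA i - \sum_(1 <= n < i.+1) aa n / n%:R * (k - (ramp h (ll n) - ramp (h - k) (ll n))).
  rewrite /E2 -sumrB split_i /AA mulr_sumr -sumrB [X in _ + X]big_nat_cond [X in _ + X]big1 ?addr0.
    by apply: eq_big_nat => n _; ring.
  move=> n /andP[/andP[ni _] _]; have lh : h <= ll n by rewrite -hE; apply: ll_mono => //; lia.
  by rewrite !ramp_eq0 ?subrr// ltW// (lt_le_trans _ lh)// ltrBlDr ltrDl.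
have W := @window_down R i (h - k) i0 ltac:(rewrite hE lerBlDr lerDl; exact: ltW).
have : - (h ^+ 2 * k * (4 * k)) <= \sum_(1 <= n < i.+1) aa n / n%:R * (k - (ramp h (ll n) - ramp (h - k) (ll n))).
  apply: (@le_trans _ _ (- (h ^+ 2 * k * \sum_(1 <= n < i.+1) (h - k < ll n)%R%:R / n%:R))).
    rewrite lerN2; apply: ler_wpM2l; first by rewrite mulr_ge0 ?sqr_ge0// ltW.
    apply: le_trans W _; rewrite hE; move: ik; move: (_^-1) => y; clear; lra.
  rewrite mulr_sumr -sumrN; apply: ler_sum_nat => n /andP[n1 ni].
  have n0 : (0 : R) < n%:R by rewrite ltr0n.
  have lh : ll n <= h by rewrite -hE; apply: ll_mono.
  have [le1|gt1] := leP (ll n) (h - k).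
    have r1 : 0 <= h - k - ll n by rewrite subr_ge0.
    have r2 : 0 <= h - ll n by rewrite subr_ge0.
    rewrite mul0r mulr0 oppr0 /ramp !max_r//.
    by rewrite (_ : k - _ = 0) ?mulr0//; ring.
  have -> : - (h ^+ 2 * k * (true%:R / n%:R)) = - (h ^+ 2 * k) / n%:R by rewrite mul1r mulNr.
  rewrite [leRHS]mulrAC ler_wpM2r ?invr_ge0 ?(ltW n0)//.
  have := @aa_le0 R n; rewrite (ramp_eq0 (ltW gt1)) subr0 /ramp max_r ?subr_ge0// => a0.
  have l0 : 0 <= ll n :> R by exact: ln_nat_ge0.
  have r0 : 0 <= k - (h - ll n) by move: gt1; clear; lra.
  have r1 : k - (h - ll n) <= k by move: lh; clear; lra.
  have : (ll n) ^+ 2 <= h ^+ 2 by apply: lerXl.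
  move: (ll n) (aa n) a0 r0 r1 (sqr_ge0 (ll n : R)) k0; clear => l a a0 r0 r1 s k0 q; nra.
move: dn; rewrite E ler_norml => /andP[+ _]; move: k0; move: (\sum_(_ <= _ < _) _) (AA i); clear => s a; nra.
Qed.

Lemma AA_bound {R : realType} : exists2 C : R, 0 < C & forall i, (24 <= i)%N ->
  `|AA i| <= C * ll i /\ `|ee i| <= C * ll i.
Proof.
have [C C0 H] := @E2_bound R; exists (C + 16); first by rewrite addr_gt0.
move=> i i24; have i0 : (0 < i)%N by lia.
have i0' : (0 : R) < i%:R by rewrite ltr0n.
set h := @ll R i; have h2 : 2 <= h by apply: ll_ge2; lia.
have h0 : 0 < h by apply: lt_le_trans h2.
(* With k = 1 / h, the condition k h <= 1 keeps increments of [E2] bounded, and k (k h^2) = 1 keeps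
   the window sums bounded; division by k then leaves O(h). *)
pose k := h^-1; have k0 : 0 < k by rewrite invr_gt0.
have kh : k * h = 1 by rewrite mulVf// gt_eqF.
have k1 : k <= 1 / 2 by rewrite -(@ler_pM2r _ h)// kh; move: h2; clear; lra.
have hi : h <= i%:R by apply/ltW/ln_sublinear.
have ik : i%:R^-1 <= k by rewrite lef_pV2 ?posrE.
have kk : k * (k * h ^+ 2) = 1 by rewrite expr2 mulrA mulrACA kh mulr1.
clearbody k.
(* ln 4 >= 1 leaves room for h + k below ln M. *)
pose M := (4 * i)%N; have iM1 : (i < M)%N by rewrite /M; lia.
have iM := ltnW iM1.
have hM : h + 1 <= ll M.
  rewrite /ll /M natrM lnM ?posrE// addrC lerD2r.
  by apply: ln_ge_expR; exact: expR1_le4.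
have hM0 : h <= ln M%:R by move: hM; rewrite /ll; clear; lra.
clearbody M.
have [eb up] := H M h ltac:(move: h2; clear; lra) hM0; rewrite (E2_ee _ iM)// in eb.
have {}up := up k (ltW k0) ltac:(by rewrite kh) ltac:(move: k1 hM; rewrite /ll; clear; lra).
have [_ dn] := H M (h - k) ltac:(move: h2 k1; clear; lra) ltac:(move: hM0 k0; clear; lra).
have {}dn := dn k (ltW k0) ltac:(move: kh k0 h0; clear; nra) ltac:(move: hM0; clear; lra); rewrite subrK in dn.
have D1 := AA_up i0 iM1 (erefl h) h2 k0 k1 up.
have D2 := AA_down i0 iM1 (erefl h) h2 k0 k1 ik dn.
split; last by apply: le_trans eb _; rewrite ler_wpM2r ?(ltW h0)// lerDl.
have Ch : (C + 8) * h <= (C + 16) * h by rewrite ler_wpM2r ?(ltW h0)//; clear; lra.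
rewrite -mulrA kk mulr1 in D1 D2.
have D1' := ler_wpM2r (ltW h0) D1; have D2' := ler_wpM2r (ltW h0) D2.
rewrite mulrAC kh mul1r in D1'; rewrite [X in _ <= X]mulrAC kh mul1r in D2'.
by rewrite ler_norml; apply/andP; split; move: Ch D1' D2'; clear; lra.
Qed.

Definition phn {R : realType} n : R := (ll n)^-1 ^+ 3.
(** Minus the divided difference of l^(-3) between l = ln n and l = ln (n + 1), from a^3 - b^3 = (a
    - b) (a^2 + a b + b^2) and 1 / l - 1 / l' = (l' - l) a b. In this form its monotonicity in n is
    visible. *)
Definition chn {R : realType} n : R := let a := (ll n)^-1 in let b := (ll n.+1)^-1 in
  a * b ^+ 3 + a ^+ 2 * b ^+ 2 + a ^+ 3 * b.

Lemma ll_gt0 {R : realType} n : (2 <= n)%N -> 0 < ll n :> R.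
Proof. by move=> n2; rewrite /ll ln_gt0// ltr1n. Qed.

Lemma llV_ge0 {R : realType} n : 0 <= (ll n)^-1 :> R.
Proof. by rewrite invr_ge0 ln_nat_ge0. Qed.

Lemma llV_le {R : realType} m n : (2 <= m)%N -> (m <= n)%N -> (ll n)^-1 <= (ll m)^-1 :> R.
Proof.
move=> m2 mn; rewrite lef_pV2 ?posrE ?ll_gt0//; last exact: leq_trans mn.
by apply: ll_mono => //; exact: ltnW.
Qed.

Lemma ph_ch {R : realType} n : (2 <= n)%N -> phn n - phn n.+1 = (ll n.+1 - ll n) * chn n :> R.
Proof.
move=> n2; have a0 := @ll_gt0 R n n2; have b0 : 0 < ll n.+1 :> R by apply: ll_gt0; lia.
by rewrite /phn /chn; field; rewrite !gt_eqF.
Qed.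

Lemma chn_ge0 {R : realType} n : 0 <= chn n :> R.
Proof.
have a0 := @llV_ge0 R n; have b0 := @llV_ge0 R n.+1; rewrite /chn.
by apply: addr_ge0; [apply: addr_ge0|]; apply: mulr_ge0 => //; exact: exprn_ge0.
Qed.

Lemma chn_dec {R : realType} n : (2 <= n)%N -> chn n.+1 <= chn n :> R.
Proof.
move=> n2; have a0 := @llV_ge0 R n; have b0 := @llV_ge0 R n.+1; have c0 := @llV_ge0 R n.+2; rewrite /chn.
have ab : (ll n.+1)^-1 <= (ll n)^-1 :> R by apply: llV_le.
have bc : (ll n.+2)^-1 <= (ll n.+1)^-1 :> R by apply: llV_le => //; lia.
by apply: lerD; [apply: lerD|]; apply: ler_pM => //; rewrite ?exprn_ge0//; apply: lerXl.
Qed.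

Lemma chn_le {R : realType} n : (2 <= n)%N -> chn n <= 3 * (ll n)^-1 ^+ 4 :> R.
Proof.
move=> n2; have a0 := @llV_ge0 R n; have b0 := @llV_ge0 R n.+1; rewrite /chn.
have ab : (ll n.+1)^-1 <= (ll n)^-1 :> R by apply: llV_le.
move: a0 b0 ab; move: (_^-1) (_^-1) => b a a0 b0 ab.
have -> : 3 * a ^+ 4 = a * a ^+ 3 + a ^+ 2 * a ^+ 2 + a ^+ 3 * a by ring.
by apply: lerD; [apply: lerD|]; apply: ler_pM => //; rewrite ?exprn_ge0//; apply: lerXl.
Qed.

(* Summation by parts twice; the total variation telescopes because [chn] is decreasing. *)
Lemma abel_twice {R : realType} : exists2 C : R, 0 < C & forall N M, (24 <= N)%N -> (N <= M)%N ->
  `|\sum_(N.+1 <= n < M.+1) aa n / n%:R * phn n| <= C * (ll N)^-1 ^+ 2.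
Proof.
have [C C0 H] := @AA_bound R; exists (C * 12); first by rewrite mulr_gt0.
(* Chosen so that [g m - g m.+1] is [ll m.+1 * (chn m - chn m.+1)], which bounds the increments of V
   below up to the factor C. *)
pose g (n : nat) : R := ll n * chn n + phn n.
have g0 n : 0 <= g n.
  by rewrite /g addr_ge0 ?exprn_ge0 ?llV_ge0// mulr_ge0 ?chn_ge0// ln_nat_ge0.
move=> N M N24 NM.
pose T m : R := \sum_(N.+1 <= n < m.+1) aa n / n%:R * phn n.
(* T without the boundary terms of the two summations by parts. *)
pose V m : R := T m - AA m * phn m - ee m * chn m.
have VV m : (N <= m)%N -> `|V m - V N| <= C * (g N - g m).
  elim: m => [|m IH]; first by rewrite leqn0 => /eqP ->; rewrite !subrr normr0 mulr0.
  rewrite leq_eqVlt => /orP[/eqP <-|]; first by rewrite !subrr normr0 mulr0.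
  rewrite ltnS => Nm; have m2 : (2 <= m)%N by lia.
  have E : V m.+1 - V m = ee m.+1 * (chn m - chn m.+1).
    rewrite /V /T big_nat_recr/=; last by rewrite ltnS.
    have -> : AA m.+1 = AA m + aa m.+1 / m.+1%:R :> R by rewrite /AA big_nat_recr.
    have := @eeS R m; have := @ph_ch R m m2 => e1 e2.
    have e3 : AA m * (phn m - phn m.+1) = (ee m.+1 - ee m) * chn m :> R by rewrite e1 e2; ring.
    move: e3; move: (AA m) (phn m) (phn m.+1) (ee m.+1) (ee m) (chn m) (chn m.+1) (\sum_(_ <= _ < _) _) (aa _ / _).
    clear => a p p' e' e c c' s x h; rewrite -[RHS]addr0.
    have -> : s + x * p' - (a + x) * p' - e' * c' - (s - a * p - e * c) = e' * (c - c') + (a * (p - p') - (e' - e) * c) by ring.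
    by rewrite h subrr.
  have [_ eb] := H m.+1 ltac:(lia).
  have -> : V m.+1 - V N = (V m.+1 - V m) + (V m - V N) by ring.
  apply: le_trans (ler_normD _ _) _.
  have -> : C * (g N - g m.+1) = C * (g m - g m.+1) + C * (g N - g m) by ring.
  apply: lerD; last exact: IH.
  rewrite E normrM [X in _ * X]ger0_norm ?subr_ge0 ?chn_dec//.
  apply: le_trans (ler_wpM2r _ eb) _; first by rewrite subr_ge0 chn_dec.
  rewrite -mulrA ler_wpM2l ?(ltW C0)//.
  have -> : g m - g m.+1 = ll m.+1 * (chn m - chn m.+1) + (phn m - phn m.+1 - (ll m.+1 - ll m) * chn m).
    by rewrite /g; ring.
  by rewrite ph_ch// subrr addr0.
have b m : (N <= m)%N -> `|AA m * phn m| <= C * (ll N)^-1 ^+ 2 /\ `|ee m * chn m| <= 3 * (C * (ll N)^-1 ^+ 2).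
  move=> Nm; have [a1 a2] := H m (leq_trans N24 Nm).
  have l0 : 0 < ll m :> R by apply: ll_gt0; lia.
  have l1 : 1 <= ll m :> R by apply: ll_ge1; lia.
  have lm : (ll m)^-1 ^+ 2 <= (ll N)^-1 ^+ 2 :> R by apply: lerXl; [exact: llV_ge0|apply: llV_le => //; lia].
  have l3 : 0 <= phn m :> R by rewrite exprn_ge0 ?llV_ge0.
  split.
    rewrite normrM (ger0_norm l3); apply: le_trans (ler_wpM2r l3 a1) _.
    apply: le_trans (ler_wpM2l (ltW C0) lm); rewrite /phn le_eqVlt; apply/orP; left; apply/eqP; field.
    by rewrite gt_eqF.
  rewrite normrM (ger0_norm (chn_ge0 m)); apply: le_trans (ler_wpM2r (chn_ge0 _) a2) _.
  apply: (@le_trans _ _ (C * ll m * (3 * (ll m)^-1 ^+ 4))).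
    by rewrite ler_wpM2l ?chn_le ?mulr_ge0 ?(ltW C0) ?(ltW l0)//; lia.
  have -> : C * ll m * (3 * (ll m)^-1 ^+ 4) = 3 * (C * (ll m)^-1 ^+ 3) by field; rewrite gt_eqF.
  rewrite ler_pM2l// ler_pM2l//; apply: le_trans lm; rewrite exprS ler_piMl ?exprn_ge0 ?llV_ge0//.
  by rewrite invf_le1.
have gN : g N <= 4 * (ll N)^-1 ^+ 2.
  have l0 : 0 < ll N :> R by apply: ll_gt0; lia.
  have l1 : 1 <= ll N :> R by apply: ll_ge1; lia.
  have i1 : (ll N)^-1 <= 1 :> R by rewrite invf_le1.
  have : ll N * chn N <= ll N * (3 * (ll N)^-1 ^+ 4) :> R by rewrite ler_wpM2l ?chn_le ?(ltW l0)//; lia.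
  have -> : ll N * (3 * (ll N)^-1 ^+ 4) = 3 * (ll N)^-1 ^+ 3 :> R by field; rewrite gt_eqF.
  have : (ll N)^-1 ^+ 3 <= (ll N)^-1 ^+ 2 :> R by rewrite exprS ler_piMl ?exprn_ge0 ?llV_ge0.
  rewrite /g /phn; move: (ll N * chn N) (_ ^+ 3) (_ ^+ 2) => x y z; clear; lra.
have TN : T N = 0 by rewrite /T big_geq.
have [b1 b2] := b M NM; have [b3 b4] := b N (leqnn _).
have := VV M NM; rewrite /V TN -/(T M).
have := ler_wpM2l (ltW C0) gN.
have := mulr_ge0 (ltW C0) (g0 M); move: b1 b2 b3 b4; rewrite mulrA !ler_norml.
move: (T M) (AA M * _) (ee M * _) (AA N * _) (ee N * _) ((ll N)^-1 ^+ 2) (g M) (g N) => a1 a2 a3 a4 a5 a6 a7 a8.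
clear; rewrite mulrBr => /andP[] ? ? /andP[] ? ? /andP[] ? ? /andP[] ? ? ? ? /andP[] ? ?; apply/andP; split; lra.
Qed.

Definition Lp {R : realType} (n : nat) : R := if prime n then - ln (1 - n%:R^-1) else 0.

Lemma neg_ln1B {R : realType} (x : R) : 0 <= x -> x <= 1 / 2 -> x <= - ln (1 - x) <= x + 2 * x ^+ 2.
Proof.
move=> x0 x2; have h : 0 < 1 - x by lra.
have := @le_ln1Dx R (- x) ltac:(lra); rewrite lerNr => ->/=.
have i0 : 0 < (1 - x)^-1 by rewrite invr_gt0.
rewrite -lnV ?posrE//; have := @le_ln1Dx R ((1 - x)^-1 - 1) ltac:(move: i0; move: (_^-1) => y; lra).
rewrite addrC subrK => /le_trans; apply.
have -> : (1 - x)^-1 - 1 = x + x ^+ 2 / (1 - x) by field; rewrite gt_eqF.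
rewrite lerD2l mulrC ler_wpM2r ?sqr_ge0// -[leRHS]invrK lef_pV2 ?posrE ?invr_gt0//; lra.
Qed.

Lemma nat_lnsqr_le {R : realType} n : (2 <= n)%N -> n%:R^-1 <= 2 * (ll n)^-1 ^+ 2 :> R.
Proof.
move=> n2; have l0 := @ll_gt0 R n n2; have n0 : (0 : R) < n%:R by rewrite ltr0n; lia.
rewrite exprVn ler_pdivlMr ?exprn_gt0// mulrC ler_pdivrMr//.
have := @ln_pow_le R 2 1 n%:R isT; rewrite divr1 lnK ?posrE// expr1n mulr1; apply.
by rewrite ler1n; lia.
Qed.

Lemma sum_inv_sq_tail {R : realType} N M : (0 < N)%N -> (N <= M)%N ->
  \sum_(N.+1 <= n < M.+1) (n%:R : R)^-1 ^+ 2 <= N%:R^-1.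
Proof.
move=> N0 NM; have N0' : (0 : R) < N%:R by rewrite ltr0n.
suff : \sum_(N.+1 <= n < M.+1) (n%:R : R)^-1 ^+ 2 <= N%:R^-1 - M%:R^-1.
  by move/le_trans; apply; rewrite lerBlDr lerDl invr_ge0.
rewrite big_add1 /= -[leRHS]opprK opprB -(@telescope_sumr _ N M (fun n => (n%:R : R)^-1))// -sumrN.
apply: ler_sum_nat => n /andP[Nn _]; have n0 : (0 : R) < n%:R by rewrite ltr0n; lia.
rewrite -natr1 opprB.
have -> : (n%:R : R)^-1 - (n%:R + 1)^-1 = (n%:R * (n%:R + 1))^-1 by field; rewrite !gt_eqF ?addr_gt0.
rewrite exprVn lef_pV2 ?posrE ?mulr_gt0 ?exprn_gt0 ?addr_gt0//; nra.
Qed.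

Lemma sum_nln {R : realType} N M : (4 <= N)%N -> (N <= M)%N ->
  `|\sum_(N.+1 <= n < M.+1) (n%:R * ll n)^-1 - (ln (ll M) - ln (ll N))| <= 2 * (ll N)^-1 ^+ 2 :> R.
Proof.
move=> N4 NM; have lN : 1 <= ll N :> R by apply: ll_ge1.
have D n : (N <= n)%N -> 0 <= (ln (@ll R n.+1) - ln (ll n)) - (n.+1%:R * ll n.+1)^-1 <= (n%:R * ll n)^-1 - (n.+1%:R * ll n.+1)^-1.
  move=> Nn; have n0 : (0 < n)%N by lia.
  have a0 : 0 < @ll R n by apply: ll_gt0; lia.
  have b0 : 0 < @ll R n.+1 by apply: ll_gt0; lia.
  have n0' : (0 : R) < n%:R by rewrite ltr0n.
  have n1' : (0 : R) < n.+1%:R by rewrite ltr0n.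
  have dL := @ln_step_le R n n0; have dG := @ln_step_ge R n n0; rewrite -/(ll n) -/(ll n.+1) in dL dG.
  have lnd (x y : R) : 0 < x -> 0 < y -> ln y - ln x <= (y - x) / x.
    move=> x0 y0; rewrite -lnV ?posrE// -lnM ?posrE ?invr_gt0//.
    have := @le_ln1Dx R (y / x - 1) ltac:(have : 0 < y / x by [rewrite divr_gt0]; lra).
    by rewrite addrC subrK mulrBl divff ?gt_eqF.
  have u := lnd _ _ a0 b0; have l := lnd _ _ b0 a0.
  apply/andP; split.
    rewrite subr_ge0 invfM; apply: (@le_trans _ _ ((ll n.+1 - ll n) / ll n.+1)).
      by rewrite ler_wpM2r ?invr_ge0 ?(ltW b0).
    by move: l; rewrite -[ll n - ll n.+1]opprB mulNr; lra.
  rewrite lerD2r; apply: le_trans u _; rewrite invfM.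
  by rewrite ler_wpM2r ?invr_ge0 ?(ltW a0).
have -> : \sum_(N.+1 <= n < M.+1) (n%:R * ll n)^-1 - (ln (ll M) - ln (ll N)) =
   - \sum_(N <= n < M) ((ln (ll n.+1) - ln (ll n)) - (n.+1%:R * ll n.+1)^-1) :> R.
  by rewrite [in RHS]sumrB (telescope_sumr (fun n => ln (@ll R n)))// big_add1/= [RHS]opprB.
rewrite normrN ger0_norm; last by rewrite big_nat; apply: sumr_ge0 => n /andP[Nn _]; case/andP: (D n Nn).
apply: (@le_trans _ _ (N%:R * ll N)^-1).
  apply: (@le_trans _ _ (\sum_(N <= n < M) ((n%:R * ll n)^-1 - (n.+1%:R * ll n.+1)^-1))).
    by apply: ler_sum_nat => n /andP[Nn _]; case/andP: (D n Nn).
  rewrite -[X in X <= _]opprK -sumrN (eq_bigr (fun n => (n.+1%:R * @ll R n.+1)^-1 - (n%:R * ll n)^-1)); last by move=> n _; rewrite opprB.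
  rewrite (telescope_sumr (fun n => (n%:R * @ll R n)^-1))// opprB lerBlDr lerDl invr_ge0 mulr_ge0//.
  exact: ln_nat_ge0.
rewrite invfM; apply: le_trans (nat_lnsqr_le _); last by lia.
by rewrite ler_piMr ?invr_ge0// invf_le1//; apply: lt_le_trans lN.
Qed.

(** [aa n / n * phn n] is (thp n - 1) / (n ln n). So the sum of 1 / p splits into the sum of
    [abel_twice] and the sum of 1 / (n ln n), which is ln ln; the rest is the O(1 / p^2) by which
    [Lp p] exceeds 1 / p. *)
Lemma mertens_cauchy {R : realType} : exists2 C : R, 0 < C & forall N M, (24 <= N)%N -> (N <= M)%N ->
  `|\sum_(N.+1 <= n < M.+1) Lp n - (ln (ll M) - ln (ll N))| <= C * (ll N)^-1 ^+ 2.
Proof.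
have [C C0 H] := @abel_twice R; exists (C + 6); first by rewrite addr_gt0.
move=> N M N24 NM.
have h1 := H N M N24 NM; have h2 := @sum_nln R N M ltac:(lia) NM.
have E : \sum_(N.+1 <= n < M.+1) Lp n = \sum_(N.+1 <= n < M.+1) aa n / n%:R * phn n +
   \sum_(N.+1 <= n < M.+1) (n%:R * ll n)^-1 + \sum_(N.+1 <= n < M.+1) (if prime n then - ln (1 - n%:R^-1) - n%:R^-1 else 0) :> R.
  rewrite -!big_split/=; apply: eq_big_nat => n /andP[Nn _].
  have n0 : (0 : R) < n%:R by rewrite ltr0n; lia.
  have l0 : 0 < ll n :> R by apply: ll_gt0; lia.
  rewrite /Lp /aa /thp -/(ll n) /phn; case: ifP => _; last by field; rewrite !gt_eqF.
  by move: (ln _) => x; field; rewrite !gt_eqF.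
set S3 := \sum_(_ <= n < _) (if prime n then _ - _ else 0) in E.
have h3 : 0 <= S3 <= 4 * (ll N)^-1 ^+ 2.
  have b n : prime n -> 0 <= - ln (1 - (n%:R : R)^-1) - n%:R^-1 <= 2 * (n%:R)^-1 ^+ 2.
    move=> pn; have n2 : n%:R^-1 <= 1 / 2 :> R.
      by rewrite div1r lef_pV2 ?posrE ?ltr0n ?prime_gt0// ler_nat prime_gt1.
    have /andP[b1 b2] := @neg_ln1B R n%:R^-1 ltac:(by rewrite invr_ge0) n2.
    by apply/andP; split; [rewrite subr_ge0|rewrite lerBlDl].
  apply/andP; split.
    by rewrite /S3; apply: sumr_ge0 => n _; case: ifP => // /b /andP[].
  apply: (@le_trans _ _ (2 * N%:R^-1)); last by have := @nat_lnsqr_le R N ltac:(lia); move: (_^-1) (_ ^+ 2) => x y; lra.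
  apply: (@le_trans _ _ (2 * \sum_(N.+1 <= n < M.+1) (n%:R)^-1 ^+ 2)); last by rewrite ler_wpM2l// sum_inv_sq_tail//; lia.
  rewrite mulr_sumr; apply: ler_sum_nat => n _; case: ifP => [/b /andP[]//|_].
  by rewrite mulr_ge0// exprn_ge0// invr_ge0.
rewrite E; move: h1 h2 h3; rewrite !ler_norml.
move: (\sum_(_ <= _ < _) _ * _) (\sum_(_ <= _ < _) _^-1) (ln _ - ln _) ((ll N)^-1 ^+ 2) => a b c d; clear => /andP[? ?] /andP[? ?] /andP[? ?].
apply/andP; split; lra.
Qed.

Lemma ll_near {R : realType} (A : R) : \forall n \near \oo, A <= ll n.
Proof. near=> n; apply: ln_ge_expR; near: n; exact: nbhs_infty_ger. Unshelve. all: by end_near. Qed.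

Lemma llV_near {R : realType} (e : R) : 0 < e -> \forall n \near \oo, (ll n)^-1 <= e.
Proof.
move=> e0; near=> n; have : e^-1 <= ll n by near: n; exact: ll_near.
have i0 : 0 < e^-1 by rewrite invr_gt0.
by move=> h; rewrite -[e]invrK lef_pV2 ?posrE// (lt_le_trans i0).
Unshelve. all: by end_near. Qed.

Lemma mertens_ex {R : realType} : exists c : R, exists2 C : R, 0 < C & forall N, (24 <= N)%N ->
  `|\sum_(0 <= n < N.+1) Lp n - ln (ll N) - c| <= C * (ll N)^-1 ^+ 2.
Proof.
have [C C0 H] := @mertens_cauchy R.
pose u N : R := \sum_(0 <= n < N.+1) Lp n - ln (ll N).
have D N M : (24 <= N)%N -> (N <= M)%N -> `|u M - u N| <= C * (ll N)^-1 ^+ 2.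
  move=> N24 NM; have := H N M N24 NM; rewrite /u [X in X - ln (ll M)](big_cat_nat (n := N.+1))//=.
  by move/le_trans: (lexx (C * (ll N)^-1 ^+ 2)) => _; rewrite (_ : _ + _ - _ - _ = \sum_(N.+1 <= n < M.+1) Lp n - (ln (ll M) - ln (ll N)))//; ring.
have cu : cvgn u.
  apply/cauchy_cvgP; apply: cauchy_exP => e e0.
  have [N [N24 HN]] : exists N, (24 <= N)%N /\ (ll N)^-1 < Num.min 1 (e / C).
    have m0 : 0 < Num.min 1 (e / C) / 2 by rewrite divr_gt0// lt_min ltr01 divr_gt0.
    have [K _ HK] : \forall n \near \oo, (ll n)^-1 <= Num.min 1 (e / C) / 2 by exact: llV_near.
    exists (maxn 24 K); rewrite leq_maxl; split => //; apply: le_lt_trans (HK _ _) _; first by rewrite /= leq_maxr.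
    by move: m0; lra.
  exists (u N).
  have : \forall M \near \oo, ball (u N) e (u M); last by [].
  near=> M; rewrite /ball/= distrC.
  have NM : (N <= M)%N by near: M; exact: nbhs_infty_ge.
  apply: le_lt_trans (D N M N24 NM) _.
  move: HN; rewrite lt_min => /andP[h1 h2]; have l0 := @llV_ge0 R N.
  have : (ll N)^-1 * C < e by rewrite -ltr_pdivlMr.
  move/(le_lt_trans _); apply; rewrite mulrC ler_wpM2r ?(ltW C0)// expr2 ler_piMl//; exact: ltW.
exists (limn u); exists C => // N N24.
rewrite -normrN opprB.
have L : (fun M => `|u M - u N|) @ \oo --> `|limn u - u N|.
  by apply: cvg_norm; apply: cvgB => //; exact: cvg_cst.
rewrite -(cvg_lim (@Rhausdorff R) L); apply: limr_le; first by apply/cvg_ex; eexists; exact: L.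
by near=> M; apply: D => //; near: M; exact: nbhs_infty_ge.
Unshelve. all: by end_near. Qed.

(** * The constant in the theorem of Mertens *)

Lemma gamma_cvg {R : realType} :
  (fun n : nat => \sum_(0 <= k < n) (k.+1%:R : R)^-1 - ln (n%:R : R)) @ \oo --> (euler_gamma : R).
Proof.
pose u (n : nat) : R := \sum_(0 <= k < n) (k.+1%:R : R)^-1 - ln (n%:R : R).
suff : cvgn (fun n => u n.+1) by move=> h; apply/cvg_ex; move: h => /cvg_ex[l]; rewrite (cvg_shiftS u) => h; exists l.
apply: nonincreasing_is_cvgn.
  apply/nonincreasing_seqP => n; rewrite /u big_nat_recr//=.
  have := @ln_step_ge R n.+1 isT; move: (ln _) (ln _) (_^-1) (\sum_(_ <= _ < _) _) => a b c d; clear; lra.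
exists 0 => _ [n _ <-]; rewrite /u subr_ge0.
apply: (@le_trans _ _ (ln (n.+2%:R))); first by rewrite ler_ln ?posrE ?ltr0n// ler_nat.
elim: n => [|n IH].
  have := @ln_step_le R 1 isT; rewrite big_nat1 ln1 invr1; lra.
rewrite big_nat_recr//=; have := @ln_step_le R n.+2 isT.
move: IH; move: (ln _) (ln _) (_^-1) (\sum_(_ <= _ < _) _) => a b c d; clear; lra.
Qed.

Lemma ln_series {R : realType} (x : R) : 0 <= x -> x < 1 ->
  (fun J => \sum_(1 <= j < J.+1) x ^+ j / j%:R) @ \oo --> - ln (1 - x).
Proof.
move=> x0 x1.
apply: (@cvg_dominated _ _ _ (fun J => (1 - x)^-1 * x ^+ J)); last first.
  rewrite -[X in _ --> X](mulr0 ((1 - x)^-1)); apply: cvgM; first exact: cvg_cst.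
  by apply: cvg_expr; rewrite ger0_norm.
apply: nearW => J; rewrite opprK.
have d0 y : 0 <= y <= x -> 0 < 1 - y by move=> /andP[_ yx]; rewrite subr_gt0 (le_lt_trans yx).
have H y : 0 <= y <= x -> dv (fun y => \sum_(1 <= j < J.+1) y ^+ j / j%:R + ln (1 - y)) y (- (y ^+ J / (1 - y))).
  move=> yx; have e := d0 y yx; apply: dv_eq.
    apply: dvD; first by apply: dv_sum => j _; apply: dvM; [apply: dvX; exact: dv_id|exact: dv_cst].
    by apply: (@dv_ln R (fun y => 1 - y) y _ e); apply: dvD; [exact: dv_cst|apply: dvN; exact: dv_id].
  cbv beta.
  have -> : \sum_(1 <= i < J.+1) (i%:R * y ^+ i.-1 * 1 / i%:R + y ^+ i * 0) = \sum_(0 <= i < J) y ^+ i.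
    rewrite big_add1/=; apply: eq_bigr => i _.
    have n0 : (i.+1%:R : R) != 0 by rewrite pnatr_eq0.
    by rewrite mulr1 mulr0 addr0 mulrAC mulfV// mul1r.
  have -> : \sum_(0 <= i < J) y ^+ i = (1 - y ^+ J) / (1 - y).
    apply: (canRL (mulfK (lt0r_neq0 e))); rewrite big_mkord mulrC -opprB mulNr -subrX1; ring.
  field; exact: lt0r_neq0.
have := @dv_lipschitz R _ _ 0 x ((1 - x)^-1 * x ^+ J) x0 H _.
have -> : \sum_(1 <= j < J.+1) (0 : R) ^+ j / j%:R = 0.
  by rewrite big_nat_cond big1// => j /andP[/andP[j0 _] _]; rewrite expr0n gtn_eqF// mul0r.
rewrite !subr0 ln1 addr0 subr0 => h; apply: le_trans (h _) _.
  move=> y /andP[y0 yx]; rewrite normrN normrM normfV (ger0_norm (exprn_ge0 _ y0)) (gtr0_norm (d0 _ _)) ?y0//.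
  rewrite mulrC; apply: ler_pM; [by rewrite invr_ge0 ltW// d0// y0|exact: exprn_ge0| |exact: lerXl].
  by rewrite lef_pV2 ?posrE ?subr_gt0 ?(le_lt_trans yx)//; lra.
by rewrite ler_piMr ?mulr_ge0 ?exprn_ge0 ?invr_ge0 ?subr_ge0// ltW.
Qed.

(** The difference vanishes at y = 1 and its derivative in y is O(x^2). It is used with x = 1 / p
    and y = p^(-d). *)
Lemma Lp_pow_diff {R : realType} (x y : R) : 0 <= x -> x <= 1 / 2 -> 0 <= y -> y <= 1 ->
  `|- ln (1 - x * y) - y * - ln (1 - x)| <= 6 * x ^+ 2 * (1 - y).
Proof.
move=> x0 x2 y0 y1.
have H z : y <= z <= 1 -> dv (fun z => - ln (1 - x * z) - z * - ln (1 - x)) z (x / (1 - x * z) - - ln (1 - x)).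
  move=> /andP[yz z1]; have p : 0 < 1 - x * z by have z0 := le_trans y0 yz; nra.
  by der => //; field; exact: lt0r_neq0.
have := @dv_lipschitz R _ _ y 1 (6 * x ^+ 2) y1 H _.
rewrite mulr1 mul1r subrr sub0r normrN; apply.
move=> z /andP[yz z1]; have z0 := le_trans y0 yz.
have xz : x * z <= x by rewrite ler_piMr.
have p : 1 / 2 <= 1 - x * z by lra.
have p0 : 0 < 1 - x * z by lra.
have e : x / (1 - x * z) = x + x ^+ 2 * z / (1 - x * z) by field; exact: lt0r_neq0.
have b : 0 <= x ^+ 2 * z / (1 - x * z) <= 2 * x ^+ 2.
  rewrite divr_ge0 ?mulr_ge0 ?sqr_ge0 ?(ltW p0)//= ler_pdivrMr//.
  have := sqr_ge0 x; move: (x ^+ 2) (x * z) p z1 z0; clear => q w p z1 z0 q0; nra.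
have /andP[l1 l2] := neg_ln1B x0 x2.
rewrite e ler_norml; move: b l1 l2 (sqr_ge0 x); set a := _ / _; move: a (ln _) (x ^+ 2) => a l q; clear => /andP[? ?] *.
by apply/andP; split; lra.
Qed.

(** Primes are grouped by e^(j-1) < p <= e^j: in such a block p^(-d) is comparable to x^j with x =
    e^(-d), and the harmonic sums meet the power series of - ln (1 - x). *)
Definition Nj {R : realType} (j : nat) : nat := Num.truncn (expR (j%:R : R)).

Lemma NjP {R : realType} j : ((@Nj R j)%:R : R) <= expR j%:R < ((@Nj R j).+1%:R : R).
Proof. by rewrite /Nj truncn_itv// expR_ge0. Qed.

Lemma Nj_mono {R : realType} i j : (i <= j)%N -> (@Nj R i <= @Nj R j)%N.
Proof.
move=> ij; rewrite -ltnS -(ltr_nat R); have /andP[a _] := @NjP R i; have /andP[_ b] := @NjP R j.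
by apply: le_lt_trans a _; apply: le_lt_trans b; rewrite ler_expR ler_nat.
Qed.

Lemma Nj0 {R : realType} : @Nj R 0 = 1%N.
Proof. by rewrite /Nj expR0 truncn1. Qed.

Lemma Nj_gt0 {R : realType} j : (0 < @Nj R j)%N.
Proof. by rewrite -(@Nj0 R); exact: Nj_mono. Qed.

Lemma ll_Nj {R : realType} j : j%:R - 1 <= @ll R (@Nj R j) <= j%:R.
Proof.
have /andP[h1 h2] := @NjP R j; have N0 := @Nj_gt0 R j.
have N0' : (0 : R) < (@Nj R j)%:R by rewrite ltr0n.
apply/andP; split; last by rewrite /ll -[leRHS]expRK ler_ln ?posrE ?expR_gt0.
have : expR j%:R <= 2 * ((@Nj R j)%:R : R).
  by apply: le_trans (ltW h2) _; rewrite -natrM ler_nat; lia.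
move=> h; have := @ln_step_le R 1 isT; rewrite ln1 subr0 invr1 => l2.
have : j%:R <= ln (2 * ((@Nj R j)%:R : R)) by rewrite -[leLHS]expRK ler_ln ?posrE ?expR_gt0 ?mulr_gt0.
rewrite lnM ?posrE// /ll; lra.
Qed.

Definition Pj {R : realType} (j : nat) : R := \sum_(0 <= n < (@Nj R j).+1) Lp n.
Definition Hj {R : realType} (j : nat) : R := \sum_(1 <= i < j.+1) (i%:R)^-1.

Lemma ln_cvg0_diff {R : realType} : (fun j => ln (@ll R (@Nj R j)) - ln (j%:R : R)) @ \oo --> (0 : R).
Proof.
apply: (@cvg_dominated _ _ _ (fun j => 2 * harmonic j)); last first.
  by rewrite -[X in _ --> X](mulr0 2); apply: cvgM; [exact: cvg_cst|exact: cvg_harmonic].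
near=> j; have j4 : (4 <= j)%N by near: j; exact: nbhs_infty_ge.
have /andP[l1 l2] := @ll_Nj R j; have j4' : (4 : R) <= j%:R by rewrite ler_nat.
have l0 : 0 < @ll R (@Nj R j) by lra.
have j0 : (0 : R) < j%:R by lra.
rewrite subr0 ler0_norm ?subr_le0 ?ler_ln ?posrE// opprB -lnV ?posrE// -lnM ?posrE ?invr_gt0//.
have := @le_ln1Dx R (j%:R / ll (@Nj R j) - 1) ltac:(have : 0 < j%:R / @ll R (@Nj R j) by [rewrite divr_gt0]; lra).
rewrite addrC subrK => /le_trans; apply.
rewrite /harmonic/= lerBlDr ler_pdivrMr//.
have j1 : (0 : R) < j.+1%:R by rewrite ltr0n.
rewrite -(@ler_pM2r _ j.+1%:R)// [leRHS]mulrAC mulrDl mulfVK ?gt_eqF// -natr1.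
by move: l1 l2 j4'; move: (ll _) (j%:R) => l y; clear; nra.
Unshelve. all: by end_near. Qed.

Lemma Dj_cvg {R : realType} (c C : R) : (forall N, (24 <= N)%N ->
  `|\sum_(0 <= n < N.+1) Lp n - ln (ll N) - c| <= C * (ll N)^-1 ^+ 2) ->
  (fun j => Pj j - Hj j) @ \oo --> c - euler_gamma.
Proof.
move=> H.
have N8 : (fun j => Pj j - ln (ll (@Nj R j))) @ \oo --> c.
  have C0 : 0 <= C.
    have := H 24%N isT => h; have := le_trans (normr_ge0 _) h.
    by rewrite pmulr_lge0// exprn_gt0// invr_gt0 ll_gt0.
  apply: (@cvg_dominated _ _ _ (fun j => C * (4 * harmonic j))); last first.
    rewrite -[X in _ --> X](mulr0 C) -(mulr0 4); apply: cvgM; [exact: cvg_cst|].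
    by apply: cvgM; [exact: cvg_cst|exact: cvg_harmonic].
  near=> j; have j4 : (30 <= j)%N by near: j; exact: nbhs_infty_ge.
  have /andP[l1 l2] := @ll_Nj R j; have j4' : (30 : R) <= j%:R by rewrite ler_nat.
  have l0 : 0 < @ll R (@Nj R j) by lra.
  have NN : (24 <= @Nj R j)%N.
    rewrite -(ler_nat R); have := @ln_sublinear R (@Nj R j)%:R.
    have n0 : (0 : R) < (@Nj R j)%:R by rewrite ltr0n Nj_gt0.
    by move=> /(_ n0); rewrite -/(ll _); lra.
  have := H _ NN; rewrite -/(Pj j) => /le_trans; apply; rewrite ler_wpM2l//.
  rewrite exprVn /harmonic/= -[leLHS]mul1r ler_pdivrMr ?exprn_gt0// mulrAC ler_pdivlMr// mul1r -natr1.
  by move: l1 l2 j4'; move: (ll _) (j%:R) => l y; clear; nra.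
have -> : (fun j => Pj j - Hj j) = (fun j => (Pj j - ln (ll (@Nj R j))) + (ln (@ll R (@Nj R j)) - ln (j%:R : R))
    + - (\sum_(0 <= k < j) (k.+1%:R : R)^-1 - ln (j%:R : R))).
  by apply/funext => j; rewrite /Hj big_add1/=; ring.
rewrite -[c in c - _]addr0; apply: cvgD; first exact: (cvgD N8 (@ln_cvg0_diff R)).
exact: (cvgN (@gamma_cvg R)).
Unshelve. all: by end_near. Qed.

Lemma Lp_ge0 {R : realType} n : 0 <= Lp n :> R.
Proof.
rewrite /Lp; case: ifP => // pn; have n0 : 0 <= (n%:R : R)^-1 by rewrite invr_ge0.
have n2 : n%:R^-1 <= 1 / 2 :> R by rewrite div1r lef_pV2 ?posrE ?ltr0n ?prime_gt0// ler_nat prime_gt1.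
by have /andP[h _] := neg_ln1B n0 n2; exact: le_trans h.
Qed.

Definition Ld {R : realType} (d : R) N : R := \sum_(0 <= n < N) Lp n * expR (- d * ln n%:R).
(** Partial sums of ln zeta(1 + d) from the Euler product. [Ld] replaces - ln (1 - p^(-1-d)) by
    p^(-d) times - ln (1 - 1 / p), which is linear in [Lp] and costs O(d) in total. *)
Definition ad {R : realType} (d : R) N : R :=
  \sum_(0 <= n < N) if prime n then - ln (1 - n%:R^-1 * expR (- d * ln n%:R)) else 0.

Lemma ad_Ld {R : realType} : exists2 C : R, 0 < C & forall d N, 0 < d -> `|ad d N - Ld d N| <= C * d.
Proof.
have [C C0 H] := @sz_bound R 1; exists (6 * (C * 2 + 1)); first by rewrite mulr_gt0// addr_gt0// mulr_gt0.
move=> d N d0; rewrite /ad /Ld -sumrB.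
apply: le_trans (ler_norm_sum _ _ _) _.
apply: (@le_trans _ _ (\sum_(0 <= n < N) 6 * (d * (ln n%:R * expR (- (1 + 1) * ln n%:R))))).
  apply: ler_sum_nat => n _; rewrite /Lp; case: ifP => pn; last first.
    by rewrite mul0r subrr normr0 mulr_ge0// mulr_ge0 ?(ltW d0)// mulr_ge0 ?expR_ge0// ln_nat_ge0.
  have n0 : (0 : R) < n%:R by rewrite ltr0n prime_gt0.
  have n2 : n%:R^-1 <= 1 / 2 :> R by rewrite div1r lef_pV2 ?posrE// ler_nat prime_gt1.
  have i0 : 0 <= (n%:R : R)^-1 by rewrite invr_ge0 ltW.
  have l0 := @ln_nat_ge0 R n.
  set y := expR _.
  have y1 : y <= 1 by rewrite /y expR_le1 mulNr oppr_le0 mulr_ge0 ?(ltW d0).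
  have y2 : 1 - y <= d * ln n%:R by have := expR_ge1Dx (- d * ln (n%:R : R)); rewrite -/y; lra.
  rewrite [- ln _ * y]mulrC; apply: le_trans (Lp_pow_diff i0 n2 (expR_ge0 _) y1) _.
  have -> : expR (- (1 + 1) * ln n%:R) = n%:R^-1 ^+ 2 :> R.
    by rewrite invE_ln// -expRM_natl; congr expR; ring.
  rewrite -mulrA ler_wpM2l// [leRHS]mulrA [leRHS]mulrC ler_wpM2l ?sqr_ge0//.
have s1 : \sum_(0 <= n < N) ln n%:R * expR (- (1 + 1) * ln n%:R) <= C * 2 + 1 :> R.
  have := H 1 N ltr01; rewrite /sz expr1n divr1 (_ : (1 `!)%:R = 1 :> R)//; apply: le_trans.
  case: N => [|N]; first by rewrite !big_geq.
  rewrite big_ltn// ln0// mul0r add0r.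
  by apply: ler_sum_nat => n _; rewrite expr1.
rewrite -!mulr_sumr; have := ler_wpM2l (ltW d0) s1; move: (\sum_(_ <= _ < _) _) => s; clear; lra.
Qed.

Lemma ad_cvg {R : realType} (d : R) : 0 < d -> ad d @ \oo --> ln (cmod (Dz 0 (rc d))).
Proof.
move=> d0; have zx : 0 < Rec (rc d) by [].
have e := @ccv_cmod _ _ _ (@euler_product R (rc d) zx); rewrite cmod1 in e.
have E N : cmod (\prod_(p < N | prime p) (1 - ez (rc d) p) * Dz 0 (rc d)) = expR (- ad d N) * cmod (Dz 0 (rc d)).
  rewrite cmodM cmod_prod; congr (_ * _).
  rewrite /ad -sumrN expR_sum -(big_mkord prime (fun p => cmod (1 - ez (rc d) p))) big_mkcond; apply: eq_bigr => p _.
  case: ifP => pp; last by rewrite oppr0 expR0.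
  have p0 : (0 : R) < p%:R by rewrite ltr0n prime_gt0.
  have x1 : p%:R^-1 * expR (- d * ln p%:R) < 1 :> R.
    rewrite -[ltRHS]mulr1; apply: ltr_pM; rewrite ?invr_ge0 ?expR_ge0 ?(ltW p0)//.
      by rewrite invf_lt1// ltr1n prime_gt1.
    by rewrite expR_lt1 mulNr oppr_lt0 mulr_gt0// ln_gt0// ltr1n prime_gt1.
  rewrite opprK lnK ?posrE ?subr_gt0//.
  have -> : 1 - ez (rc d) p = rc (1 - p%:R^-1 * expR (- d * ln p%:R)).
    rewrite rcD rc1 rcN; congr (1 - _); rewrite /rc ezE mul0r cos0 sin0 mulr1 mulr0 oppr0; congr Complex.
    by rewrite [in RHS]invE_ln// -expRD; congr expR; ring.
  by rewrite cmod_rc ger0_norm// subr_ge0 ltW.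
rewrite (_ : (fun N => _) = (fun N => expR (- ad d N) * cmod (Dz 0 (rc d)))) in e; last by apply/funext => N; exact: E.
have D0 : 0 < cmod (Dz 0 (rc d)).
  rewrite lt_neqAle cmod_ge0 andbT eq_sym; apply/eqP => D0; move: e; rewrite D0.
  rewrite (_ : (fun N => _) = fun=> 0); last by apply/funext => N; rewrite mulr0.
  by move/(cvg_unique (@Rhausdorff R) (cvg_cst 0))/eqP; rewrite eq_sym oner_eq0.
have l1 : {for (1 : R), continuous (@ln R)} by apply: continuous_ln.
have := cvg_comp _ _ e l1; rewrite ln1 => h.
have -> : ad d = fun N => ln (cmod (Dz 0 (rc d))) - ln (expR (- ad d N) * cmod (Dz 0 (rc d))).
  by apply/funext => N; rewrite lnM ?posrE ?expR_gt0// expRK; ring.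
rewrite -[X in _ --> X]subr0; apply: cvgB; [exact: cvg_cst|exact: h].
Qed.

(** In the j-th block p^(-d) lies between x^j and e^d x^j, where x = e^(-d). *)
Lemma Ld_Pj {R : realType} (d : R) J : 0 < d ->
  let S := \sum_(1 <= j < J.+1) (Pj j - Pj j.-1) * expR (- d) ^+ j in
  S <= Ld d (@Nj R J).+1 <= expR d * S.
Proof.
move=> d0 /=; elim: J => [|J IH].
  rewrite big_geq// mulr0 Nj0 /Ld; apply/andP; split.
    by apply: sumr_ge0 => n _; rewrite mulr_ge0 ?Lp_ge0 ?expR_ge0.
  by rewrite !big_nat_recr//= big_nil /Lp /= !mul0r !addr0.
rewrite big_nat_recr//=.
have NN : ((@Nj R J).+1 <= (@Nj R J.+1).+1)%N by rewrite ltnS; exact: Nj_mono.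
have -> : Ld d (@Nj R J.+1).+1 = Ld d (@Nj R J).+1 + \sum_((@Nj R J).+1 <= n < (@Nj R J.+1).+1) Lp n * expR (- d * ln (n%:R : R)).
  by rewrite /Ld (big_cat_nat (n := (@Nj R J).+1)).
have -> : Pj J.+1 - Pj J = \sum_((@Nj R J).+1 <= n < (@Nj R J.+1).+1) Lp n :> R.
  by rewrite /Pj [X in X - _](big_cat_nat (n := (@Nj R J).+1))//= addrAC subrr add0r.
have b n : ((@Nj R J).+1 <= n < (@Nj R J.+1).+1)%N -> expR (- d) ^+ J.+1 <= expR (- d * ln (n%:R : R)) <= expR d * expR (- d) ^+ J.+1.
  move=> /andP[n1 n2]; rewrite -expRM_natl -expRD !ler_expR.
  have n0 : (0 : R) < n%:R by rewrite ltr0n; lia.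
  have l1 : J%:R <= ln (n%:R : R).
    apply: ln_ge_expR; have /andP[_ h] := @NjP R J; apply: le_trans (ltW h) _; by rewrite ler_nat.
  have l2 : ln (n%:R : R) <= J.+1%:R.
    rewrite -[leRHS]expRK ler_ln ?posrE ?expR_gt0//; have /andP[h _] := @NjP R J.+1; apply: le_trans h; by rewrite ler_nat.
  rewrite -natr1 in l2 *; move: l1 l2; move: (ln _) (J%:R : R) => l j; clear -d0 => l1 l2; apply/andP; split; nra.
move: IH => /andP[h1 h2]; rewrite mulrDr; apply/andP; split; apply: lerD => //.
  rewrite mulr_suml; apply: ler_sum_nat => n nn; rewrite ler_wpM2l ?Lp_ge0//; by case/andP: (b n nn).
rewrite mulrCA mulr_suml; apply: ler_sum_nat => n nn; rewrite ler_wpM2l ?Lp_ge0//; by case/andP: (b n nn).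
Qed.

(** Abel's theorem with explicit constants: after a summation by parts the first j0 terms cost at
    most (1 - x) B each, and the others e in total. *)
Lemma abelian {R : realType} (D : nat -> R) (k x e B : R) j0 : 0 <= x -> x <= 1 -> D 0%N = 0 -> 0 <= e ->
  (forall j, `|D j - k| <= B) -> (forall j, (j0 <= j)%N -> `|D j - k| <= e) -> forall J,
  `|\sum_(1 <= j < J.+1) (D j - D j.-1) * x ^+ j - k| <= (1 - x) * B * (1 + j0%:R) + e + B * x ^+ J.
Proof.
move=> x0 x1 D0 e0 HB He J.
have B0 : 0 <= B by apply: le_trans (HB 0%N).
have x1' : 0 <= 1 - x by rewrite subr_ge0.
have xJ n : 0 <= x ^+ n <= 1 by rewrite exprn_ge0// exprn_ile1.
suff H : `|\sum_(1 <= j < J.+1) (D j - D j.-1) * x ^+ j - k - (D J - k) * x ^+ J| <= (1 - x) * B * (1 + (minn J j0)%:R) + e * (1 - x ^+ J).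
  rewrite -[X in `|X|](subrK ((D J - k) * x ^+ J)); apply: le_trans (ler_normD _ _) _; apply: lerD.
    apply: le_trans H _; apply: lerD.
      by rewrite ler_wpM2l ?mulr_ge0// lerD2l ler_nat geq_minr.
    by have /andP[a b] := xJ J; nra.
  have /andP[a b] := xJ J; by rewrite normrM (ger0_norm a) ler_wpM2r.
elim: J => [|J IH].
  rewrite big_geq// D0 expr0 mulr1 sub0r subrr normr0 subrr mulr0 addr0 min0n addr0 mulr1; exact: mulr_ge0.
rewrite big_nat_recr//= -[X in `|X|](addrK (\sum_(1 <= j < J.+1) (D j - D j.-1) * x ^+ j - k - (D J - k) * x ^+ J)).
set S := \sum_(_ <= _ < _) _ in IH *.
have -> : S + (D J.+1 - D J) * x ^+ J.+1 - k - (D J.+1 - k) * x ^+ J.+1 + (S - k - (D J - k) * x ^+ J) - (S - k - (D J - k) * x ^+ J)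
  = (S - k - (D J - k) * x ^+ J) + (D J - k) * (x ^+ J * (1 - x)) by rewrite exprS; ring.
apply: le_trans (ler_normD _ _) _.
have /andP[a b] := xJ J; have xx : 0 <= x ^+ J * (1 - x) by exact: mulr_ge0.
rewrite [X in _ + X <= _]normrM (ger0_norm xx).
have [jJ|Jj] := leqP j0 J.
  have -> : minn J.+1 j0 = j0 by apply/minn_idPr; exact: leqW.
  rewrite (minn_idPr jJ) in IH.
  have := ler_wpM2r xx (He J jJ).
  have -> : e * (1 - x ^+ J.+1) = e * (1 - x ^+ J) + e * (x ^+ J * (1 - x)) by rewrite exprS; ring.
  by move=> h; rewrite addrA; apply: lerD.
have -> : minn J.+1 j0 = J.+1 by apply/minn_idPl.
have m : minn J j0 = J by apply/minn_idPl; exact: ltnW.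
rewrite m in IH; rewrite -natr1.
have h1 : `|D J - k| * (x ^+ J * (1 - x)) <= B * (1 - x).
  apply: ler_pM => //; by rewrite ler_piMl.
have h2 : e * (1 - x ^+ J) <= e * (1 - x ^+ J.+1) by rewrite ler_wpM2l// lerB// exprS ler_piMl.
have -> : (1 - x) * B * (1 + (J%:R + 1)) = (1 - x) * B * (1 + J%:R) + B * (1 - x) by ring.
rewrite [leRHS]addrAC; apply: lerD; last exact: h1.
by apply: le_trans IH _; rewrite lerD2l.
Qed.

Lemma ln_near1 {R : realType} (y q : R) : 0 <= q -> q <= 1 / 2 -> 1 - q <= y -> y <= 1 + q -> `|ln y| <= 2 * q.
Proof.
move=> q0 q2 y1 y2; have y0 : 0 < y by lra.
have i0 : 0 < y^-1 by rewrite invr_gt0.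
have h1 : ln y <= q by have := @le_ln1Dx R (y - 1) ltac:(lra); rewrite addrC subrK; lra.
have h2 : - ln y <= 2 * q.
  rewrite -lnV ?posrE//; have := @le_ln1Dx R (y^-1 - 1) ltac:(move: i0; move: (_^-1) => z; lra).
  rewrite addrC subrK => /le_trans; apply; rewrite lerBlDr -div1r ler_pdivrMr//; nra.
by rewrite ler_norml; apply/andP; split; lra.
Qed.

(** [Pj - Hj] tends to k = c - gamma, hence so do its Abel means. As d tends to 0 these means are ln
    zeta(1 + d) + ln (1 - x) up to o(1), and this tends to 0 because zeta(1 + d) is about 1 / d and
    1 - x about d. So k = 0. *)
Lemma mertens_const {R : realType} (c C : R) : (forall N, (24 <= N)%N ->
  `|\sum_(0 <= n < N.+1) Lp n - ln (ll N) - c| <= C * (ll N)^-1 ^+ 2) -> c = euler_gamma.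
Proof.
move=> H; have HD := Dj_cvg H; set k := c - euler_gamma in HD.
apply/eqP; rewrite -subr_eq0 -/k; apply/eqP.
pose D j : R := Pj j - Hj j.
have D0 : D 0%N = 0.
  have -> : D 0%N = Pj 0 by rewrite /D [Hj 0]/Hj big_geq// subr0.
  by rewrite /Pj Nj0 !big_nat_recr//= big_nil /Lp /= !addr0.
have [B B0 HB] : exists2 B, 0 < B & forall j, `|D j - k| <= B.
  have /cvg_seq_bounded[B [_ HB]] : cvgn (fun j => D j - k) by apply/cvg_ex; exists (k - k); apply: cvgB => //; exact: cvg_cst.
  exists (Num.max 1 (B + 1)); first by rewrite lt_max ltr01.
  by move=> j; rewrite le_max; apply/orP; right; apply: HB => //; rewrite ltrDl.
have [C1 C10 HL] := @ad_Ld R.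
have [C2 C20 HA] := @Az_bound R 0.
suff S e : 0 < e -> e <= 1 -> `|k| <= 12 * e.
  apply/eqP; rewrite -normr_eq0 eq_le normr_ge0 andbT; apply/ler_addgt0Pr => e e0; rewrite add0r.
  have m0 : 0 < Num.min 1 (e / 12) by rewrite lt_min ltr01 divr_gt0.
  apply: le_trans (S _ m0 _) _; first by rewrite ge_min lexx.
  rewrite mulrC -ler_pdivlMr//; by rewrite ge_min lexx orbT.
move=> e0 e1.
have [j0 _ Hj0] : \forall j \near \oo, `|k - D j| <= e by move: HD => /cvgrPdist_le; exact.
have j1 : 0 <= 1 + j0%:R :> R by rewrite addr_ge0.
pose K := 8 * (1 + 2 * C2) + C1 + B * (1 + j0%:R) + 1.
have K0 : 0 < K by rewrite /K; have := ler0n R j0; nra.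
(* The square is there to get d ln zeta(1 + d) <= e: the logarithm is bounded by 2 zeta^(1/2), and d
   zeta(1 + d) stays bounded. *)
pose d := e ^+ 2 / K; have d0 : 0 < d by rewrite divr_gt0 ?exprn_gt0.
have dK : d * K = e ^+ 2 by rewrite divfK// gt_eqF.
have e2 : e ^+ 2 <= e by rewrite expr2 ler_piMl// ltW.
have [q1 q2 q3 q4] : [/\ 8 * (1 + 2 * C2) * d <= e ^+ 2, C1 * d <= e, B * (1 + j0%:R) * d <= e & d <= e].
  have a1 : 0 <= C1 * d by rewrite mulr_ge0// ltW.
  have a2 : 0 <= B * (1 + j0%:R) * d by exact: (mulr_ge0 (mulr_ge0 (ltW B0) j1) (ltW d0)).
  have a3 : 0 <= (1 + 2 * C2) * d by rewrite mulr_ge0 ?(ltW d0)//; lra.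
  have : 8 * ((1 + 2 * C2) * d) + C1 * d + B * (1 + j0%:R) * d + d = e ^+ 2 by rewrite -dK /K; ring.
  move: a1 a2 a3 (ltW d0) e2; move: (C1 * d) (B * _ * d) (e ^+ 2); rewrite -mulrA; move: (_ * d) => u v w z.
  by clear => *; split; lra.
clearbody d; clear K K0 dK; set x := expR (- d); have x0 : 0 < x by exact: expR_gt0.
have xd : 1 - d <= x by have := expR_ge1Dx (- d).
have x1 : x < 1 by rewrite /x expR_lt1 oppr_lt0.
have d1 : d <= 1 by lra.
have xd2 : x <= 1 - d + d ^+ 2.
  have : x * (1 + d) <= 1 by rewrite /x expRN mulrC ler_pdivrMr ?expR_gt0// mul1r expR_ge1Dx.
  by move: d0 d1; clear; nra.
set E := cmod (Dz 0 (rc d)).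
have [E1 E2] : 1 - 2 * C2 * d <= E * d /\ E * d <= 1 + 2 * C2 * d.
  have zx : 0 < Rec (rc d) by [].
  have := HA (rc d) zx; rewrite /Az cmod_rc (gtr0_norm d0) expr1 => h.
  have i : cmod (0 `!%:R / rc d) = d^-1 by rewrite cmodM cmodV cmod_rc (gtr0_norm d0) cmod_nat mul1r.
  have h1 := cmod_leB (Dz 0 (rc d)) (0 `!%:R / rc d).
  have h2 := cmod_leB (0 `!%:R / rc d) (Dz 0 (rc d)).
  rewrite -[cmod (_ - _)]cmodN opprB i in h2; rewrite i in h1; rewrite -/E in h1 h2.
  have g : C2 * (1 + d) <= 2 * C2 by have := C20; nra.
  have h3 : E <= d^-1 + 2 * C2 by move: h1 h g; move: (d^-1) (cmod _) => a b; clear; lra.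
  have h4 : d^-1 - 2 * C2 <= E by move: h2 h g; move: (d^-1) (cmod _) => a b; clear; lra.
  have := ler_wpM2r (ltW d0) h3; have := ler_wpM2r (ltW d0) h4.
  have -> : (d^-1 - 2 * C2) * d = 1 - 2 * C2 * d by field; rewrite gt_eqF.
  have -> : (d^-1 + 2 * C2) * d = 1 + 2 * C2 * d by field; rewrite gt_eqF.
  by move=> ? ?; split.
pose q := (1 + 2 * C2) * d.
have qe : 8 * q <= e ^+ 2 by rewrite /q mulrA.
have q0 : 0 <= q by rewrite /q mulr_ge0 ?(ltW d0)//; lra.
have Ed : 0 < E by move: E1 qe d0 e2 e1 C20; rewrite /q; clear; nra.
have logs : `|ln E + ln (1 - x)| <= 2 * (2 * q).
  rewrite -lnM ?posrE ?subr_gt0//; apply: ln_near1; [lra|lra| |].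
    apply: (@le_trans _ _ (E * d * (1 - d))); last by have := ltW Ed; move: xd2; clear; nra.
    by move: E1 q0 d0 d1 C20; rewrite /q; clear; nra.
  apply: (@le_trans _ _ (E * d)); first by rewrite ler_wpM2l ?(ltW Ed)//; lra.
  by move: E2 d0 C20; rewrite /q; clear; nra.
have lnE : d * ln E <= e.
  have [l1|l1] := leP (ln E) 0; first by rewrite (le_trans _ (ltW e0))// mulr_ge0_le0// ltW.
  have hE : 1 <= E by rewrite leNgt; apply/negP => h; move: l1; rewrite ltNge ln_le0// ltW.
  have := @ln_pow_le R 1 2 E isT hE; rewrite !expr1 (_ : (1 `!)%:R = 1 :> R)// mul1r; set s := expR _ => h.
  have s2 : s ^+ 2 = E by rewrite /s -expRM_natl mulrC divfK// lnK.
  have s0 : 0 < s by exact: expR_gt0.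
  apply: (@le_trans _ _ (d * (2 * s))); first by rewrite ler_wpM2l// ltW.
  rewrite -(@ler_pXn2r _ 2)// ?nnegrE ?(ltW e0)//; last by rewrite !mulr_ge0// ltW.
  have -> : (d * (2 * s)) ^+ 2 = 4 * d * (s ^+ 2 * d) by ring.
  rewrite s2; apply: le_trans qe; move: E2 d0 C20 d1; rewrite /q; clear; move: (E * d) => u hu dd CC d1'.
  have h1 : u <= 1 + 2 * C2 by nra.
  have h2 : 0 <= 4 * d by lra.
  by have := ler_wpM2l h2 h1; nra.
have [J [J1 J2 J3]] : exists J, [/\ `|ad d (@Nj R J).+1 - ln E| <= e, `|\sum_(1 <= j < J.+1) x ^+ j / j%:R - (- ln (1 - x))| <= e & B * x ^+ J <= e].
  have c1 : (fun J => ad d (@Nj R J).+1) @ \oo --> ln E.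
    apply: cvg_comp (ad_cvg d0); apply/cvgnyPge => A; near=> J.
    rewrite leqW// -(ler_nat R); have /andP[_ h] := @NjP R J.
    have /andP[l _] := @ll_Nj R J.
    have n0 : (0 : R) < (@Nj R J)%:R by rewrite ltr0n Nj_gt0.
    have := ln_sublinear n0; rewrite -/(ll _).
    have : A.+1%:R <= J%:R :> R by rewrite ler_nat; near: J; exact: nbhs_infty_ge.
    rewrite -natr1; lra.
  have c2 := ln_series (ltW x0) x1.
  have c3 : (fun J => B * x ^+ J) @ \oo --> (0 : R).
    rewrite -[X in _ --> X](mulr0 B); apply: cvgM; first exact: cvg_cst.
    by apply: cvg_expr; rewrite gtr0_norm.
  have : \forall J \near \oo, [/\ `|ad d (@Nj R J).+1 - ln E| <= e, `|\sum_(1 <= j < J.+1) x ^+ j / j%:R - (- ln (1 - x))| <= e & B * x ^+ J <= e].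
    near=> J; split.
    - by rewrite distrC; near: J; move: c1 => /cvgrPdist_le; exact.
    - by rewrite distrC; near: J; move: c2 => /cvgrPdist_le; exact.
    - have : `|0 - B * x ^+ J| <= e by near: J; move: c3 => /cvgrPdist_le; exact.
      by rewrite sub0r normrN; apply: le_trans; exact: ler_norm.
  by move=> [J _ HJ]; exists J; exact: (HJ J (leqnn J)).
have := @abelian R D k x e B j0 (ltW x0) (ltW x1) D0 (ltW e0) HB _ J.
move=> /(_ (fun j jj => ltac:(rewrite distrC; exact: Hj0))) ab.
have /andP[p1 p2] := Ld_Pj J d0; rewrite -/x in p1 p2.
set S := \sum_(_ <= _ < _) _ in p1 p2.
have E' : \sum_(1 <= j < J.+1) (D j - D j.-1) * x ^+ j = S - \sum_(1 <= j < J.+1) x ^+ j / j%:R.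
  rewrite /S -sumrB; apply: eq_big_nat => -[//|j] _.
  have hj : Hj j.+1 = Hj j + (j.+1%:R)^-1 :> R by rewrite /Hj big_nat_recr.
  by rewrite [j.+1.-1]/= /D hj; ring.
rewrite E' in ab.
have := HL d (@Nj R J).+1 d0 => hl.
have S1 : Ld d (@Nj R J).+1 - S <= d * Ld d (@Nj R J).+1.
  have : x * Ld d (@Nj R J).+1 <= S.
    by rewrite /x expRN mulrC ler_pdivrMr ?expR_gt0// mulrC.
  have : 0 <= Ld d (@Nj R J).+1 by apply: sumr_ge0 => n _; rewrite mulr_ge0 ?Lp_ge0 ?expR_ge0.
  by move: xd; clear; move: (Ld _ _) => l; nra.
have ab2 : (1 - x) * B * (1 + j0%:R) <= e.
  apply: le_trans q3; rewrite -mulrA [leRHS]mulrC; apply: ler_wpM2r; [exact: (mulr_ge0 (ltW B0) j1)|move: xd; clear; lra].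
move: ab J1 J2 J3 hl logs; rewrite !ler_norml.
move: S1 ab2 p1 q2 lnE qe e2 q4 e1 d0 q0.
move: (Ld _ _) (S) (\sum_(_ <= _ < _) _) (ad _ _) (ln E) (ln (1 - x)) (k).
move: ((1 - x) * B * _) (B * x ^+ J) (C1 * d) q (e ^+ 2) => u v w q' ee L S' T A lE l1x k'; clear.
move=> S1 ab2 p1 q2 lnE qe e2 q4 e1 d0 q0 /andP[a1 a2] /andP[b1 b2] /andP[c1 c2] v1 /andP[g1 g2] /andP[h1 h2].
have dL : d * L <= 3 * e.
  have h1' : L <= lE + (2 * e) by lra.
  have := ler_wpM2l (ltW d0) h1'; have h2' : d * (2 * e) <= 2 * e by rewrite ler_piMl; lra.
  by rewrite mulrDr; lra.
by apply/andP; split; lra.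
Unshelve. all: by end_near. Qed.

(** * The profile function and the constants *)

(* Limit profile: at [t = k / p] the mean of the tilted factor is [H_p * wf rho t]. *)
Definition wf {R : realType} (r t : R) : R := (1 - expR (- 3 * t)) / (1 + r * expR (- 3 * t)).

Lemma wf_den {R : realType} (r t : R) : 0 < r -> 0 < 1 + r * expR (- 3 * t).
Proof. by move=> r0; rewrite addr_gt0// mulr_gt0// expR_gt0. Qed.

Lemma wf_1B {R : realType} (r t : R) : 0 < r -> 1 - wf r t = (1 + r) * expR (- 3 * t) / (1 + r * expR (- 3 * t)).
Proof. by move=> r0; have := wf_den t r0 => d; rewrite /wf; field; rewrite gt_eqF. Qed.

Lemma wf_dv {R : realType} (r t : R) : 0 < r ->
  dv (wf r) t (3 * (1 + r) * expR (- 3 * t) / (1 + r * expR (- 3 * t)) ^+ 2).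
Proof.
move=> r0; have d := wf_den t r0; rewrite /wf; der; first by rewrite gt_eqF.
by field; rewrite gt_eqF.
Qed.

Lemma wf_d_bound {R : realType} (r t : R) : 0 < r -> r <= 2 ->
  0 <= 3 * (1 + r) * expR (- 3 * t) / (1 + r * expR (- 3 * t)) ^+ 2 <= 9 * expR (- 3 * t).
Proof.
move=> r0 r2; have d := wf_den t r0; have e0 := expR_gt0 (- 3 * t).
apply/andP; split.
  apply: mulr_ge0; last by rewrite invr_ge0 sqr_ge0.
  by apply: mulr_ge0 (ltW e0); lra.
rewrite ler_pdivrMr ?exprn_gt0//; have h : 1 <= (1 + r * expR (- 3 * t)) ^+ 2.
  by rewrite exprn_ege1// lerDl mulr_ge0 ?(ltW r0) ?(ltW e0).
move: h; move: (_ ^+ 2) => q h; have : 3 * (1 + r) <= 9 * q by lra.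
by move=> h2; have := ler_wpM2r (ltW e0) h2; lra.
Qed.

Lemma wf_mono {R : realType} (r s t : R) : 0 < r -> r <= 2 -> s <= t -> wf r s <= wf r t.
Proof.
move=> r0 r2 st; apply: (dv_le st) => [x _|x _]; first exact: wf_dv.
by case/andP: (wf_d_bound x r0 r2).
Qed.

Lemma wf0 {R : realType} (r : R) : wf r 0 = 0.
Proof. by rewrite /wf mulr0 expR0 subrr mul0r. Qed.

Lemma wf_ge0 {R : realType} (r t : R) : 0 < r -> r <= 2 -> 0 <= t -> 0 <= wf r t.
Proof. by move=> r0 r2 t0; rewrite -(wf0 r); exact: wf_mono. Qed.

Lemma wf_le1 {R : realType} (r t : R) : 0 < r -> 0 <= 1 - wf r t.
Proof.
move=> r0; rewrite wf_1B//; have e0 := expR_gt0 (- 3 * t); have := wf_den t r0 => d.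
by rewrite divr_ge0 ?(ltW d)// mulr_ge0 ?(ltW e0)//; lra.
Qed.

Lemma wf_1B_le {R : realType} (r t : R) : 0 < r -> r <= 2 -> 1 - wf r t <= 3 * expR (- 3 * t).
Proof.
move=> r0 r2; rewrite wf_1B//; have e0 := expR_gt0 (- 3 * t); have := wf_den t r0 => d.
rewrite ler_pdivrMr//; have h : 1 <= 1 + r * expR (- 3 * t) by rewrite lerDl mulr_ge0 ?(ltW r0) ?(ltW e0).
move: h; move: (1 + r * _) => q h; have : 1 + r <= 3 * q by lra.
by move=> h2; have := ler_wpM2r (ltW e0) h2; lra.
Qed.

Lemma wf_diff {R : realType} (r s t : R) : 0 < r -> r <= 2 -> s <= t ->
  wf r t - wf r s <= 9 * expR (- 3 * s) * (t - s).
Proof.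
move=> r0 r2 st.
have := dv_lipschitz st (M := 9 * expR (- 3 * s)) (fun x _ => wf_dv x r0).
move=> h; apply: le_trans (ler_norm _) _; apply: h => x /andP[sx xt].
have /andP[a b] := wf_d_bound x r0 r2; rewrite ger0_norm//; apply: le_trans b _.
by rewrite ler_pM2l// ler_expR; lra.
Qed.

Lemma wf_le {R : realType} (r t : R) : 0 < r -> r <= 2 -> 0 <= t -> wf r t <= 9 * t.
Proof. by move=> r0 r2 t0; have := wf_diff r0 r2 t0; rewrite wf0 mulr0 expR0 !subr0 mulr1. Qed.

Definition Om {R : realType} (r t : R) : R := \int[mu]_(s in `]0, t]) (wf r s / s).

Lemma wfs_cont {R : realType} (r t : R) : 0 < r -> 0 < t -> {for t, continuous (fun s => wf r s / s)}.
Proof.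
move=> r0 t0; apply: dv_continuous; apply: dv_eq; first apply: dvM; first exact: (wf_dv t r0).
  by apply: (@dvV _ (fun y => y)); [rewrite gt_eqF|exact: dv_id].
reflexivity.
Qed.

Lemma cst_itv_int {R : realType} (u c : R) : mu.-integrable `]0, u] (EFin \o (fun _ : R => c)).
Proof.
have fin : (mu (`]0%R, u%R]%classic : set R) < +oo)%E.
  by rewrite lebesgue_measure_itv/=; case: ifP => // _; rewrite -EFinB ltry.
apply/integrableP; split; first exact: measurable_cst.
by under eq_integral do rewrite /=; rewrite integral_cst//= lte_mul_pinfty// lee_fin.
Qed.

Lemma wfs_int {R : realType} (r u : R) : 0 < r -> r <= 2 ->
  mu.-integrable `]0, u] (EFin \o (fun s => wf r s / s)).
Proof.
move=> r0 r2.
have ic := @cst_itv_int R u 9.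
apply: le_integrable ic => //.
  apply/measurable_EFinP; apply: (measurable_funS (measurable_itv `]0, +oo[)).
    by move=> x /=; rewrite !in_itv/= => /andP[-> _].
  apply: open_continuous_measurable_fun => // x; rewrite inE/= in_itv/= andbT => x0.
  exact: wfs_cont.
move=> x /=; rewrite in_itv/= => /andP[x0 _]; rewrite lee_fin [X in _ <= X]ger0_norm//.
have h : 0 <= wf r x / x by apply: divr_ge0; [apply: wf_ge0 => //; exact: ltW|exact: ltW].
by rewrite /= (ger0_norm h) ler_pdivrMr// wf_le// ltW.
Qed.

Lemma Om_dv {R : realType} (r t : R) : 0 < r -> r <= 2 -> 0 < t -> dv (Om r) t (wf r t / t).
Proof.
move=> r0 r2 t0; have [] := @continuous_FTC1 R (fun s => wf r s / s) (BRight 0) t (t + 1).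
- by rewrite ltrDl.
- exact: wfs_int.
- exact: t0.
- exact: wfs_cont.
by move=> d1; rewrite derive1E => d2; split; [exact: d1|exact: d2].
Qed.

Lemma Om_bound {R : realType} (r t : R) : 0 < r -> r <= 2 -> 0 < t -> 0 <= Om r t <= 9 * t.
Proof.
move=> r0 r2 t0; apply/andP; split.
  apply: Rintegral_ge0 => x /=; rewrite in_itv/= => /andP[x0 _].
  by apply: divr_ge0; [apply: wf_ge0 => //; exact: ltW|exact: ltW].
apply: (@le_trans _ _ (\int[mu]_(s in `]0, t]) (9 : R))).
  apply: le_Rintegral => //; [exact: wfs_int|exact: cst_itv_int|].
  move=> x /=; rewrite in_itv/= => /andP[x0 _].
  by rewrite ler_pdivrMr// wf_le// ltW.
by rewrite Rintegral_cst//= lebesgue_measure_itv/= lte_fin t0 -EFinB subr0.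
Qed.

(* Common form of the two constants: [rho = 2] gives [Cmax], [rho = 1 / 2] gives [Cmin]. *)
Definition Crho {R : realType} (r : R) : R :=
  Om r 1 - \int[mu]_(s in `[1, +oo[) ((1 - wf r s) / s).

(** On t >= 1 the function ln t - Om increases, while ln t - Om + e^(-3 t) decreases, as 1 - wf <= 3
    e^(-3 t). The limit is caught between the two, and the fundamental theorem of calculus
    identifies it with [- Crho r]. *)
Lemma Om_log {R : realType} (r : R) : 0 < r -> r <= 2 ->
  forall t, 1 <= t -> `|Om r t - ln t - Crho r| <= expR (- 3 * t).
Proof.
move=> r0 r2; pose Gf t : R := ln t - Om r t.
have dG t : 0 < t -> dv Gf t ((1 - wf r t) / t).
  move=> t0; apply: dv_eq; first apply: dvD; first by apply: (@dv_ln _ (fun y => y)); [|exact: dv_id].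
    by apply: dvN; exact: Om_dv.
  by rewrite /= mulr1 mulrBl mul1r.
have G1 s t : 1 <= s -> s <= t -> Gf s <= Gf t.
  move=> s1 st; apply: (dv_le st) => x /andP[sx xt]; first by apply: dG; lra.
  by rewrite divr_ge0 ?wf_le1//; lra.
have G2 s t : 1 <= s -> s <= t -> Gf t + expR (- 3 * t) <= Gf s + expR (- 3 * s).
  move=> s1 st; rewrite -lerN2.
  have := @dv_le R (fun t => - (Gf t + expR (- 3 * t))) (fun t => - ((1 - wf r t) / t - 3 * expR (- 3 * t))) s t st; apply.
    move=> x /andP[sx xt]; apply: dv_eq; first apply: dvN; first apply: dvD; first by apply: dG; lra.
      by der; reflexivity.
    by ring.
  move=> x /andP[sx xt]; have x0 : 1 <= x by lra.
  rewrite oppr_ge0 subr_le0; apply: le_trans (wf_1B_le x r0 r2).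
  by rewrite ler_pdivrMr ?ler_peMr ?wf_le1//; lra.
have cv : cvgn (fun n => Gf n.+1%:R).
  apply: nondecreasing_is_cvgn.
    by apply/nondecreasing_seqP => n; apply: G1; rewrite ?ler1n// ler_nat.
  exists (Gf 1 + expR (- 3 * 1)) => _ [n _ <-].
  by have := @G2 1 n.+1%:R (lexx _) ltac:(by rewrite ler1n); have := expR_ge0 (- 3 * n.+1%:R : R); lra.
set l := limn (fun n => Gf n.+1%:R) in cv.
have ub t : 1 <= t -> Gf t <= l <= Gf t + expR (- 3 * t).
  move=> t1; apply/andP; split.
    apply: limr_ge => //; near=> n; apply: G1 => //.
    by near: n; apply: filterS (nbhs_infty_ger t) => n h; apply: le_trans h _; rewrite ler_nat.
  apply: limr_le => //; near=> n.
  have tn : t <= n.+1%:R by near: n; apply: filterS (nbhs_infty_ger t) => n h; apply: le_trans h _; rewrite ler_nat.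
  by have := G2 t _ t1 tn; have := expR_ge0 (- 3 * n.+1%:R : R); lra.
have lim : Gf x @[x --> +oo%R] --> l.
  apply/cvgrPdist_le => e e0.
  have h3 : (0 : R) < 3 by [].
  have := @expRN_cvg0 R 3 h3; move=> /cvgrPdist_le /(_ e e0) h.
  near=> x; have x1 : 1 <= x by near: x; apply: nbhs_pinfty_ge; rewrite num_real.
  have /andP[a b] := ub x x1.
  have : `|0 - expR (- 3 * x)| <= e by near: x; exact: h.
  rewrite sub0r normrN ger0_norm ?expR_ge0// => c.
  by rewrite ger0_norm ?subr_ge0//; lra.
have -> : Crho r = - l.
  rewrite /Crho; have -> : \int[mu]_(s in `[1, +oo[) ((1 - wf r s) / s) = l - Gf 1; last by rewrite /Gf ln1; ring.
  apply: Rintegral_ge0_continuous_FTC2y.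
  - by move=> x x1; rewrite divr_ge0 ?wf_le1//; lra.
  - apply: (dv_within (df := fun x => (- (3 * (1 + r) * expR (- 3 * x) / (1 + r * expR (- 3 * x)) ^+ 2)) * x^-1 + (1 - wf r x) * (- (x ^- 2) * 1))) => x /=.
    rewrite in_itv/= andbT => x1; apply: dvM; last by apply: (@dvV _ (fun y => y)); [rewrite gt_eqF//; lra|exact: dv_id].
    by rewrite -[X in dv _ _ X]add0r; apply: dvD; [exact: dv_cst|apply: dvN; exact: wf_dv].
  - exact: lim.
  - by move=> x x1; have [] := dG x ltac:(lra).
  - by apply: cvg_at_right_filter; apply: dv_continuous (dG 1 _).
  - by move=> x; rewrite in_itv/= andbT => x1; rewrite derive1E; have [_ ->] := dG x ltac:(lra).
move=> t t1; have /andP[a b] := ub t t1.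
have -> : Om r t - ln t - - l = l - Gf t by rewrite /Gf; ring.
by rewrite ger0_norm ?subr_ge0//; lra.
Unshelve. all: by end_near. Qed.

Lemma wft_int {R : realType} (r : R) : 0 < r -> r <= 2 ->
  mu.-integrable `[1, +oo[ (EFin \o (fun s => (1 - wf r s) / s)).
Proof.
move=> r0 r2; have h3 : (0 : R) < 3 by [].
have [ie _] := @J_exp R 3 h3; have ie2 := IJZ 3 ie.
have sub : (`[1, +oo[%classic : set R) `<=` `]0, +oo[%classic.
  by move=> x /=; rewrite !in_itv/= !andbT; apply: lt_le_trans.
have ie3 : mu.-integrable `[1, +oo[ (EFin \o (fun t : R => 3 * expR (- 3 * t))).
  apply: integrableS; [exact: (measurable_itv `]0, +oo[)|exact: measurable_itv|exact: sub|exact: ie2].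
apply: le_integrable ie3 => //.
  apply/measurable_EFinP; apply: (measurable_funS (measurable_itv `]0, +oo[)) => //.
  apply: open_continuous_measurable_fun => // x; rewrite inE/= in_itv/= andbT => x0.
  apply: dv_continuous; apply: dv_eq; first apply: dvM; first by apply: dvD; [exact: dv_cst|apply: dvN; exact: (wf_dv x r0)].
    by apply: (@dvV _ (fun y => y)); [rewrite gt_eqF|exact: dv_id].
  reflexivity.
move=> x /=; rewrite in_itv/= andbT => x1; rewrite lee_fin.
have x0 : 0 < x by apply: lt_le_trans x1.
have h : 0 <= (1 - wf r x) / x by apply: divr_ge0; [exact: wf_le1|exact: ltW].
rewrite (ger0_norm h) ger0_norm; last by rewrite mulr_ge0 ?expR_ge0.
by apply: le_trans (wf_1B_le x r0 r2); rewrite ler_pdivrMr// ler_peMr// wf_le1.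
Qed.

(** Factoring the dominant exponential out of the denominators turns the integrands into 2 (wf 2 t)
    / t and - 2 (1 - wf 2 t) / t; the prefactor 1/2 removes the 2. For [Cmin] the factor taken out
    is 2 e^t. *)
Lemma CmaxE {R : realType} : Cmax = Crho 2 :> R.
Proof.
have e0 (s : R) := expR_gt0 (- 3 * s).
have r0 : (0 : R) < 2 by []. have r2 : (2 : R) <= 2 by [].
rewrite /Cmax /Crho /Om.
have -> : \int[mu]_(t in `]0, 1]) ((2 * expR (2 * t) - 2 * expR (- t)) / (t * (expR (2 * t) + 2 * expR (- t)))) =
   2 * \int[mu]_(s in `]0, 1]) (wf 2 s / s) :> R.
  rewrite -RintegralZl//; last exact: wfs_int.
  apply: eq_Rintegral => s; rewrite inE/= in_itv/= => /andP[s0 _].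
  have := e0 s; have := expR_gt0 (- s); have := wf_den s r0; rewrite /wf.
  have -> : expR (2 * s) = expR (- s) / expR (- 3 * s) by rewrite -expRN -expRD; congr expR; ring.
  move: (expR _) (expR _) => a b d a0 b0.
  have -> : a / b + 2 * a = a / b * (1 + 2 * b) by field; rewrite gt_eqF.
  by field; rewrite !gt_eqF.
have -> : \int[mu]_(t in `[1, +oo[) (- 6 / (t * (expR (3 * t) + 2))) =
   - 2 * \int[mu]_(s in `[1, +oo[) ((1 - wf 2 s) / s) :> R.
  rewrite -RintegralZl//; last exact: wft_int.
  apply: eq_Rintegral => s; rewrite inE/= in_itv/= andbT => s1.
  have s0 : 0 < s by apply: lt_le_trans s1.
  rewrite wf_1B//; have := e0 s; have := wf_den s r0.
  have -> : expR (3 * s) = (expR (- 3 * s))^-1 by rewrite -expRN; congr expR; ring.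
  move: (expR _) => b d b0.
  have -> : b^-1 + 2 = b^-1 * (1 + 2 * b) by field; rewrite gt_eqF.
  by field; rewrite !gt_eqF.
by field.
Qed.

Lemma CminE {R : realType} : Cmin = Crho (2^-1) :> R.
Proof.
have e0 (s : R) := expR_gt0 (- 3 * s).
have r0 : (0 : R) < 2^-1 by rewrite invr_gt0. have r2 : (2^-1 : R) <= 2 by lra.
rewrite /Cmin /Crho /Om; congr (_ + _).
  apply: eq_Rintegral => s; rewrite inE/= in_itv/= => /andP[s0 _].
  have := e0 s; have := expR_gt0 s; have := wf_den s r0; rewrite /wf.
  have -> : expR (- 2 * s) = expR s * expR (- 3 * s) by rewrite -expRD; congr expR; ring.
  move: (expR _) (expR _) => a b d a0 b0.
  have -> : a * b + 2 * a = 2 * a * (1 + 2^-1 * b) by field.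
  by field; rewrite !gt_eqF//=; move: d; lra.
rewrite -[RHS]mulN1r -RintegralZl//; last exact: wft_int.
apply: eq_Rintegral => s; rewrite inE/= in_itv/= andbT => s1.
have s0 : 0 < s by apply: lt_le_trans s1.
rewrite wf_1B//; have := e0 s; have := expR_gt0 s; have := wf_den s r0.
have -> : expR (- 2 * s) = expR s * expR (- 3 * s) by rewrite -expRD; congr expR; ring.
move: (expR _) (expR _) => a b d a0 b0.
have -> : a * b + 2 * a = 2 * a * (1 + 2^-1 * b) by field.
by field; rewrite !gt_eqF//=; move: d; lra.
Qed.

(** * Summation by parts against the profile *)

Definition ph {R : realType} (r k : R) (n : nat) : R := wf r (k / n%:R).
Definition Dl {R : realType} (r k : R) (n : nat) : R := ph r k n - ph r k n.+1.

Lemma parts {R : realType} (a ph : nat -> R) n0 m : (n0 <= m)%N ->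
  \sum_(n0.+1 <= n < m.+1) a n * ph n = (\sum_(0 <= i < m.+1) a i) * ph m.+1 - (\sum_(0 <= i < n0.+1) a i) * ph n0
   + \sum_(n0 <= n < m.+1) (\sum_(0 <= i < n.+1) a i) * (ph n - ph n.+1).
Proof.
elim: m => [|m IH]; first by rewrite leqn0 => /eqP ->; rewrite big_geq// !big_nat1; ring.
rewrite leq_eqVlt => /orP[/eqP <-|]; first by rewrite big_geq// big_nat1; ring.
rewrite ltnS => h; rewrite big_nat_recr ?ltnS//= IH// [X in _ = _ + X]big_nat_recr/=; last exact: leqW.
have -> : \sum_(0 <= i < m.+2) a i = \sum_(0 <= i < m.+1) a i + a m.+1 by rewrite big_nat_recr.
ring.
Qed.

Lemma parts_back {R : realType} (g ph : nat -> R) n0 m : (n0 <= m)%N ->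
  \sum_(n0 <= n < m.+1) g n * (ph n - ph n.+1) = g n0 * ph n0 - g m.+1 * ph m.+1
   + \sum_(n0 <= n < m.+1) ph n.+1 * (g n.+1 - g n).
Proof.
elim: m => [|m IH]; first by rewrite leqn0 => /eqP ->; rewrite !big_nat1; ring.
rewrite leq_eqVlt => /orP[/eqP <-|]; first by rewrite !big_nat1; ring.
rewrite ltnS => h; rewrite big_nat_recr ?leqW//= IH// [X in _ = _ + X]big_nat_recr ?leqW//=; ring.
Qed.

Lemma ph_mono {R : realType} (r k : R) m n : 0 < r -> r <= 2 -> 0 <= k -> (0 < m)%N -> (m <= n)%N ->
  ph r k n <= ph r k m.
Proof.
move=> r0 r2 k0 m0 mn; apply: wf_mono => //; rewrite ler_wpM2l// lef_pV2 ?posrE ?ltr0n ?ler_nat//.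
exact: leq_trans mn.
Qed.

Lemma Dl_ge0 {R : realType} (r k : R) n : 0 < r -> r <= 2 -> 0 <= k -> (0 < n)%N -> 0 <= Dl r k n.
Proof. by move=> r0 r2 k0 n0; rewrite subr_ge0; exact: ph_mono. Qed.

Lemma sum_Dl {R : realType} (r k : R) n0 m : (n0 <= m)%N ->
  \sum_(n0 <= n < m) Dl r k n = ph r k n0 - ph r k m.
Proof.
move=> h; rewrite -[RHS]opprB -(telescope_sumr (ph r k))// -sumrN.
by apply: eq_bigr => n _; rewrite /Dl opprB.
Qed.

Lemma expRN_leX {R : realType} (u : R) n : 0 < u -> expR (- u) <= n`!%:R / u ^+ n.
Proof.
move=> u0; have := @expR_ge_pow R n u (ltW u0) => h.
have f0 : (0 : R) < n`!%:R by rewrite ltr0n fact_gt0.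
rewrite expRN ler_pdivlMr ?exprn_gt0// mulrC ler_pdivrMr ?expR_gt0//.
Qed.

Lemma sqrt_exp {R : realType} (y : R) : 0 < y ->
  y = expR (1 / 2 * ln y) ^+ 2 /\ expR (- (3 / 2) * ln y) = (expR (1 / 2 * ln y) ^+ 3)^-1.
Proof.
move=> y0; rewrite -!expRM_natl -expRN; split; last by congr expR; field.
by rewrite -[LHS](lnK (x := y)) ?posrE//; congr expR; field.
Qed.

Lemma sum_n32 {R : realType} M N : (0 < M)%N ->
  \sum_(M <= n < N) expR (- (3 / 2) * ln (n%:R : R)) <= 8 * expR (- (1 / 2) * ln (M%:R : R)).
Proof.
move=> M0; have [NM|MN] := leqP N M; first by rewrite big_geq// mulr_ge0// expR_ge0.
pose h (n : nat) : R := expR (- (1 / 2) * ln n%:R).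
apply: (@le_trans _ _ (\sum_(M <= n < N) (8 * (h n - h n.+1)))).
  apply: ler_sum_nat => n /andP[Mn _]; have n0 : (0 < n)%N by apply: leq_trans Mn.
  have n0' : (0 : R) < n%:R by rewrite ltr0n.
  have n1' : (n%:R : R) <= n.+1%:R by rewrite ler_nat.
  have dH (y : R) : n%:R <= y <= n.+1%:R -> dv (fun y => - expR (- (1 / 2) * ln y)) y (1 / 2 * expR (- (3 / 2) * ln y)).
    move=> /andP[y1 _]; have y0 : 0 < y by apply: lt_le_trans y1.
    der; first exact: y0.
    have -> : expR (- (3 / 2) * ln y) = y^-1 * expR (- (1 / 2) * ln y).
      by rewrite -[in RHS](lnK (x := y^-1)) ?posrE ?invr_gt0// -expRD lnV ?posrE//; congr expR; field.
    by field; rewrite gt_eqF.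
  have [c /andP[c1 c2]] := dv_MVT n1' dH.
  have -> : h n - h n.+1 = - expR (- (1 / 2) * ln n.+1%:R) - - expR (- (1 / 2) * ln n%:R) by rewrite /h; ring.
  move=> ->; have -> : n.+1%:R - n%:R = 1 :> R by rewrite -natr1; ring.
  rewrite mulr1 mulrA.
  have -> : 8 * (1 / 2) = 4 :> R by field.
  apply: (@le_trans _ _ (4 * expR (- (3 / 2) * ln (2 * (n%:R : R))))).
    rewrite lnM ?posrE// mulrDr expRD mulrA ler_peMl ?expR_ge0//.
    have : expR (- 2 * ln 2) <= expR (- (3 / 2) * ln 2) :> R.
      by rewrite ler_expR; have := @ln_ge0 R 2 ltac:(lra); lra.
    have -> : expR (- 2 * ln 2) = 1 / 4 :> R.
      by rewrite mulNr expRN expRM_natl lnK ?posrE//; field.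
    lra.
  have c0 : 0 < c by apply: lt_le_trans c1.
  have lc : ln c <= ln (2 * (n%:R : R)).
    rewrite ler_ln ?posrE ?mulr_gt0//; apply: le_trans c2 _; rewrite -natr1.
    by have : (1 : R) <= n%:R by [rewrite ler1n]; lra.
  by rewrite ler_wpM2l// ler_expR; lra.
rewrite -mulr_sumr ler_wpM2l//.
rewrite (_ : \sum_(_ <= _ < _) _ = h M - h N); first by rewrite gerBl expR_ge0.
rewrite -[RHS]opprB -(telescope_sumr h) ?(ltnW MN)// -sumrN.
by apply: eq_bigr => n _; rewrite opprB.
Qed.

(** The first bound serves n > k. The second serves n <= k, where the profile saturates and e^(- u)
    <= 6 / u^3 is used. *)
Lemma Dl_le {R : realType} (r k : R) n : 0 < r -> r <= 2 -> 0 < k -> (0 < n)%N ->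
  Dl r k n <= 9 * k / n%:R ^+ 2 /\ Dl r k n <= 16 * n%:R / k ^+ 2.
Proof.
move=> r0 r2 k0 n0; have n0' : (0 : R) < n%:R by rewrite ltr0n.
have n1' : (1 : R) <= n%:R by rewrite ler1n.
have n1 : (0 : R) < n.+1%:R by rewrite ltr0n.
have st : k / n.+1%:R <= k / n%:R by rewrite ler_wpM2l ?(ltW k0)// lef_pV2 ?posrE// ler_nat.
have h := wf_diff r0 r2 st.
have e : k / n%:R - k / n.+1%:R <= k / n%:R ^+ 2.
  have -> : k / n%:R - k / n.+1%:R = k / (n%:R * n.+1%:R) by rewrite -natr1; field; rewrite natr1 !gt_eqF.
  rewrite ler_wpM2l ?(ltW k0)// lef_pV2 ?posrE ?mulr_gt0 ?exprn_gt0// expr2 ler_wpM2l ?(ltW n0')// ler_nat//.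
set u := 3 * (k / n.+1%:R).
have u0 : 0 < u by rewrite /u mulr_gt0// divr_gt0.
have hu : Dl r k n <= 9 * expR (- u) * (k / n%:R ^+ 2).
  apply: le_trans h _; rewrite /u mulNr ler_wpM2l// mulr_ge0// expR_ge0.
have kn : 0 <= k / n%:R ^+ 2 by rewrite divr_ge0 ?(ltW k0)// exprn_ge0// ltW.
split.
  apply: le_trans hu _; rewrite -[9 * k / _]mulrA ler_wpM2r//.
  by rewrite -[leRHS]mulr1 ler_wpM2l// expR_le1 oppr_le0 ltW.
apply: le_trans hu _; apply: (@le_trans _ _ (9 * (6 / u ^+ 3) * (k / n%:R ^+ 2))).
  by rewrite ler_wpM2r// ler_wpM2l//; have := @expRN_leX R u 3 u0.
have -> : 9 * (6 / u ^+ 3) * (k / n%:R ^+ 2) = 2 * n.+1%:R ^+ 3 / (k ^+ 2 * n%:R ^+ 2).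
  by rewrite /u; field; rewrite !gt_eqF.
have c : n.+1%:R ^+ 3 <= 8 * n%:R ^+ 3 :> R.
  have -> : 8 * n%:R ^+ 3 = (2 * n%:R) ^+ 3 :> R by ring.
  by apply: lerXl; [exact: ltW|rewrite -natr1; lra].
have -> : 16 * n%:R / k ^+ 2 = 2 * (8 * n%:R ^+ 3) / (k ^+ 2 * n%:R ^+ 2) by field; rewrite !gt_eqF.
by rewrite ler_wpM2r ?ler_wpM2l// invr_ge0 mulr_ge0// exprn_ge0// ltW.
Qed.

Lemma lnsq_le {R : realType} (y : R) : 0 < y -> 1 <= y -> ln y ^+ 2 <= 2 * y /\ ln y ^+ 2 <= 8 * expR (1 / 2 * ln y).
Proof.
move=> y0 y1; split.
  have := @ln_pow_le R 2 1 y isT y1; rewrite divr1 lnK ?posrE// expr1n mulr1.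
  by rewrite (_ : (2 `!)%:R = 2 :> R).
have := @ln_pow_le R 2 2 y isT y1; rewrite (_ : (2 `!)%:R = 2 :> R)//.
have -> : ln y / 2 = 1 / 2 * ln y by field.
by have -> : 2 * 2 ^+ 2 = 8 :> R by ring.
Qed.

Lemma sum_if_le {R : realType} (c : R) n0 m K : (0 < n0)%N -> 0 <= c ->
  \sum_(n0 <= n < m) (if (n <= K)%N then c else 0) <= c * K%:R.
Proof.
move=> n00 c0; suff : \sum_(n0 <= n < m) (if (n <= K)%N then c else 0) <= c * (minn m.-1 K)%:R.
  by move/le_trans; apply; rewrite ler_wpM2l// ler_nat geq_minr.
elim: m => [|m IH]; first by rewrite big_geq// mulr_ge0.
have [mn|nm] := ltnP m n0; first by rewrite big_geq ?mulr_ge0.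
rewrite big_nat_recr//=; case: leqP => mK.
  apply: le_trans (lerD IH (lexx c)) _; have m0 := leq_trans n00 nm.
  have -> : minn m.-1 K = m.-1 by lia.
  by rewrite -[in leRHS](prednK m0) -natr1 mulrDr mulr1.
rewrite addr0; apply: le_trans IH _; rewrite ler_wpM2l// ler_nat; lia.
Qed.

Lemma sum_if_gt {R : realType} (g : nat -> R) n0 m K : (forall n, 0 <= g n) ->
  \sum_(n0 <= n < m) (if (n <= K)%N then 0 else g n) <= \sum_(K.+1 <= n < m) g n.
Proof.
move=> g0; elim: m => [|m IH]; first by rewrite !big_geq.
have [mn|nm] := ltnP m n0; first by rewrite big_geq//; apply: sumr_ge0.
rewrite big_nat_recr//=; case: leqP => mK; last by rewrite [leRHS]big_nat_recr//= lerD2r.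
by rewrite addr0; apply: le_trans IH _; rewrite !big_geq//; lia.
Qed.

(* [sum ln(n/k)^2 Dl n] approximates the convergent integral of [ln^2 t w'(t)]. *)
Lemma sum_lnsq_Dl {R : realType} (r k : R) n0 m : 0 < r -> r <= 2 -> 1 <= k -> (0 < n0)%N ->
  \sum_(n0 <= n < m) (ln n%:R - ln k) ^+ 2 * Dl r k n <= 640.
Proof.
move=> r0 r2 k1 n00; have k0 : 0 < k by apply: lt_le_trans k1.
pose K := Num.truncn k.
have /andP[K1 K2] : (K%:R : R) <= k < K.+1%:R by rewrite truncn_itv// ltW.
have K0 : (0 < K)%N by rewrite -ltnS -(ltr_nat R); apply: le_lt_trans K2.
(* Up to k: ln^2 (k / n) <= 2 k / n against 16 n / k^2. Beyond k: ln^2 (n / k) <= 8 (n / k)^(1/2)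
   against 9 k / n^2. *)
have b n : (0 < n)%N -> (ln n%:R - ln k) ^+ 2 * Dl r k n <= if (n <= K)%N then 32 / k else 72 * expR (1 / 2 * ln k) * expR (- (3 / 2) * ln n%:R).
  move=> np; have n0' : (0 : R) < n%:R by rewrite ltr0n.
  have [D1 D2] := @Dl_le R r k n r0 r2 k0 np; have D0 := @Dl_ge0 R r k n r0 r2 (ltW k0) np.
  have s0 := sqr_ge0 (ln (n%:R : R) - ln k).
  case: leqP => nK.
    have nk : n%:R <= k by apply: le_trans K1; rewrite ler_nat.
    have [l _] := @lnsq_le R (k / n%:R) ltac:(by rewrite divr_gt0) ltac:(by rewrite ler_pdivlMr ?mul1r).
    have e : (ln n%:R - ln k) ^+ 2 = ln (k / n%:R) ^+ 2 by rewrite lnM ?posrE ?invr_gt0// lnV ?posrE//; ring.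
    rewrite e; apply: (@le_trans _ _ ((2 * (k / n%:R)) * (16 * n%:R / k ^+ 2))).
      by apply: ler_pM => //; exact: sqr_ge0.
    by rewrite le_eqVlt; apply/orP; left; apply/eqP; field; rewrite !gt_eqF.
  have kn : k <= n%:R by apply: le_trans (ltW K2) _; rewrite ler_nat.
  have [_ l] := @lnsq_le R (n%:R / k) ltac:(by rewrite divr_gt0) ltac:(by rewrite ler_pdivlMr ?mul1r).
  have e : ln n%:R - ln k = ln (n%:R / k) by rewrite lnM ?posrE ?invr_gt0// lnV ?posrE.
  rewrite e; apply: (@le_trans _ _ (8 * expR (1 / 2 * ln (n%:R / k)) * (9 * k / n%:R ^+ 2))).
    by apply: ler_pM => //; exact: sqr_ge0.
  rewrite -e mulrBr expRD expRN.
  have [k2 _] := sqrt_exp k0; have [n2 ->] := sqrt_exp n0'.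
  rewrite [in 9 * k]k2 [in _ / n%:R ^+ 2]n2.
  have := expR_gt0 (1 / 2 * ln k); have := expR_gt0 (1 / 2 * ln (n%:R : R)).
  move: (expR _) (expR _) => x y x0 y0.
  by rewrite le_eqVlt; apply/orP; left; apply/eqP; field; rewrite !gt_eqF.
apply: (@le_trans _ _ (\sum_(n0 <= n < m) ((if (n <= K)%N then 32 / k else 0) + (if (n <= K)%N then 0 else 72 * expR (1 / 2 * ln k) * expR (- (3 / 2) * ln n%:R))))).
  apply: ler_sum_nat => n /andP[h _]; apply: le_trans (b n (leq_trans n00 h)) _.
  by case: leqP; rewrite ?addr0 ?add0r.
rewrite big_split/=.
have k32 : 0 <= 32 / k by rewrite divr_ge0// ltW.
have h1 := @sum_if_le R (32 / k) n0 m K n00 k32.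
have h2 := @sum_if_gt R (fun n => 72 * expR (1 / 2 * ln k) * expR (- (3 / 2) * ln n%:R)) n0 m K _.
apply: le_trans (lerD h1 (h2 _)) _; first by move=> n; rewrite !mulr_ge0 ?expR_ge0.
(* At most K <= k terms of size 32 / k give 32; the others give at most 72 * 8 = 576. *)
have -> : 640 = 32 + 608 :> R by ring.
apply: lerD.
  by rewrite mulrAC ler_pdivrMr// ler_wpM2l.
rewrite -mulr_sumr; have := @sum_n32 R K.+1 m isT => h3.
apply: le_trans (ler_wpM2l _ h3) _; first by rewrite mulr_ge0 ?expR_ge0.
have : expR (1 / 2 * ln k) * expR (- (1 / 2) * ln K.+1%:R) <= 1.
  rewrite -expRD expR_le1; have : ln k <= ln K.+1%:R by rewrite ler_ln ?posrE ?ltr0n// ltW.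
  lra.
by move: (expR _) (expR _) => x y; clear; nra.
Qed.

(** The middle term is the integral of wf (k / y) / y over [n, n + 1], and y -> wf (k / y)
    decreases. *)
Lemma Om_step {R : realType} (r k : R) n : 0 < r -> r <= 2 -> 0 < k -> (0 < n)%N ->
  ph r k n.+1 * (ln n.+1%:R - ln n%:R) <= Om r (k / n%:R) - Om r (k / n.+1%:R) <= ph r k n * (ln n.+1%:R - ln n%:R).
Proof.
move=> r0 r2 k0 n0; have n0' : (0 : R) < n%:R by rewrite ltr0n.
have nn : (n%:R : R) <= n.+1%:R by rewrite ler_nat.
have kd (y : R) : 0 < y -> 0 < k / y by move=> ?; rewrite divr_gt0.
have D c y : n%:R <= y <= n.+1%:R -> dv (fun y => - Om r (k / y) - c * ln y) y ((wf r (k / y) - c) / y).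
  move=> /andP[y1 _]; have y0 : 0 < y by apply: lt_le_trans y1.
  apply: dv_eq; first apply: dvD; first apply: dvN; first apply: (@dv_comp _ (Om r) (fun y => k / y)).
        exact: Om_dv (kd y y0).
      by apply: dvM; [exact: dv_cst|apply: (@dvV _ (fun y => y)); [rewrite gt_eqF|exact: dv_id]].
    by apply: dvN; apply: dvM; [exact: dv_cst|apply: (@dv_ln _ (fun y => y)); [|exact: dv_id]].
  by rewrite /=; field; rewrite !gt_eqF.
have mono (y z : R) : 0 < y -> y <= z -> wf r (k / z) <= wf r (k / y).
  move=> y0 yz; apply: wf_mono => //; rewrite ler_wpM2l ?(ltW k0)// lef_pV2 ?posrE//; exact: lt_le_trans yz.
have h1 : - Om r (k / n%:R) - ph r k n.+1 * ln n%:R <= - Om r (k / n.+1%:R) - ph r k n.+1 * ln n.+1%:R.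
  apply: (dv_le nn (D (ph r k n.+1))) => y /andP[y1 y2]; have y0 : 0 < y by apply: lt_le_trans y1.
  by rewrite divr_ge0 ?(ltW y0)// subr_ge0 mono.
have h2 : - (- Om r (k / n%:R) - ph r k n * ln n%:R) <= - (- Om r (k / n.+1%:R) - ph r k n * ln n.+1%:R).
  apply: (@dv_le R (fun y => - (- Om r (k / y) - ph r k n * ln y)) (fun y => - ((wf r (k / y) - ph r k n) / y)) _ _ nn) => y /andP[y1 y2].
    by apply: dvN; apply: D; rewrite y1.
  have y0 : 0 < y by apply: lt_le_trans y1.
  by rewrite -mulNr opprB divr_ge0 ?(ltW y0)// subr_ge0 mono.
rewrite !mulrBr; apply/andP; split; lra.
Qed.

Lemma ln1D_ge {R : realType} (x : R) : - (1 / 2) <= x -> x - 2 * x ^+ 2 <= ln (1 + x).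
Proof.
move=> x2; have [x0|x0] := leP x 0.
  have := @neg_ln1B R (- x) ltac:(lra) ltac:(lra); rewrite opprK sqrrN => /andP[_]; lra.
have i0 : 0 < (1 + x)^-1 by rewrite invr_gt0; lra.
have : - ln (1 + x) <= (1 + x)^-1 - 1.
  rewrite -lnV ?posrE; last by lra.
  have := @le_ln1Dx R ((1 + x)^-1 - 1) ltac:(move: i0; move: (_^-1) => z; lra).
  by rewrite addrC subrK.
have : (1 + x)^-1 - 1 <= - x + 2 * x ^+ 2.
  have -> : (1 + x)^-1 - 1 = - x + x ^+ 2 / (1 + x) by field; rewrite gt_eqF//; lra.
  rewrite lerD2l ler_pdivrMr; last by lra.
  by have := sqr_ge0 x; nra.
lra.
Qed.

(** Summing back by parts leaves the sum of ph(n + 1) (ln (n + 1) - ln n), a Riemann sum for [Om].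
    Its defect is at most the sum of [Dl] divided by n0, and the former telescopes to at most 1. *)
Lemma sum_ln_Dl {R : realType} (r k : R) n0 m : 0 < r -> r <= 2 -> 0 < k -> (0 < n0)%N -> (n0 <= m)%N ->
  `|\sum_(n0 <= n < m.+1) (ln n%:R - ln k) * Dl r k n -
    ((ln n0%:R - ln k) * ph r k n0 - (ln m.+1%:R - ln k) * ph r k m.+1 + Om r (k / n0%:R) - Om r (k / m.+1%:R))| <= n0%:R^-1.
Proof.
move=> r0 r2 k0 n00 nm.
rewrite (parts_back (fun n => ln (n%:R : R) - ln k))//.
rewrite (eq_bigr (fun n => ph r k n.+1 * (ln n.+1%:R - ln n%:R))); last by move=> n _; congr (_ * _); ring.
set S := \sum_(_ <= _ < _) _.
have E : Om r (k / n0%:R) - Om r (k / m.+1%:R) = \sum_(n0 <= n < m.+1) (Om r (k / n%:R) - Om r (k / n.+1%:R)).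
  rewrite -[LHS]opprB -(telescope_sumr (fun n => Om r (k / n%:R))) ?leqW// -sumrN.
  by apply: eq_bigr => n _; rewrite opprB.
rewrite -[_ + Om r _ - _]addrA E.
rewrite (_ : _ - _ = - (\sum_(n0 <= n < m.+1) (Om r (k / n%:R) - Om r (k / n.+1%:R)) - S)); last by ring.
rewrite normrN -sumrB ger0_norm; last first.
  rewrite big_nat; apply: sumr_ge0 => n /andP[n1 _]; rewrite subr_ge0.
  by case/andP: (Om_step r0 r2 k0 (leq_trans n00 n1)).
apply: (@le_trans _ _ (\sum_(n0 <= n < m.+1) n0%:R^-1 * Dl r k n)).
  apply: ler_sum_nat => n /andP[n1 _]; have np := leq_trans n00 n1.
  have /andP[_ h] := Om_step r0 r2 k0 np.
  apply: (@le_trans _ _ (Dl r k n * (ln n.+1%:R - ln n%:R))); first by rewrite /Dl mulrBl lerD2r.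
  rewrite mulrC ler_wpM2r ?Dl_ge0 ?(ltW k0)//; apply: le_trans (ln_step_le np) _.
  by rewrite lef_pV2 ?posrE ?ltr0n// ler_nat.
rewrite -mulr_sumr sum_Dl ?leqW// ler_piMr ?invr_ge0//.
have := @wf_le1 R r (k / n0%:R) r0; have := @wf_ge0 R r (k / m.+1%:R) r0 r2 ltac:(by rewrite divr_ge0// ltW).
by rewrite /ph; lra.
Qed.

(** For n <= n0 the profile lies between its value at n0 and 1, so replacing it by that value costs
    at most the factor 1 - ph(n0), which is tiny at the cut-off. *)
Lemma S_head {R : realType} (r k : R) (a : nat -> R) n0 : 0 < r -> r <= 2 -> 0 <= k -> a 0%N = 0 -> (forall n, 0 <= a n) ->
  (0 < n0)%N ->
  0 <= \sum_(0 <= n < n0.+1) a n * ph r k n - (\sum_(0 <= i < n0.+1) a i) * ph r k n0 <= (\sum_(0 <= i < n0.+1) a i) * (1 - ph r k n0).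
Proof.
move=> r0 r2 k0 a0 ap n00; rewrite !mulr_suml -sumrB.
have b n : (0 < n)%N -> (n <= n0)%N -> 0 <= a n * ph r k n - a n * ph r k n0 <= a n * (1 - ph r k n0).
  move=> np nn; rewrite -mulrBr mulr_ge0 ?subr_ge0 ?ph_mono//= ler_wpM2l// lerD2r.
  by have := @wf_le1 R r (k / n%:R) r0; rewrite /ph; lra.
apply/andP; split.
  rewrite big_nat; apply: sumr_ge0 => -[_|n /andP[_ nn]]; first by rewrite a0 !mul0r subrr.
  by case/andP: (b n.+1 isT nn).
apply: ler_sum_nat => -[_|n /andP[_ nn]]; first by rewrite a0 !mul0r subrr.
by case/andP: (b n.+1 isT nn).
Qed.

(* Parameters of the cut-off: [s = sqrt k], [s < n0 <= 2 s], [q = 1 / s]. *)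
Lemma cutoff {R : realType} (k : R) (N : nat) : expR 48 <= k -> k ^+ 2 <= N%:R ->
  exists (s : R) (n0 : nat), [/\ 48 <= ln k, 25 <= s, k = s ^+ 2, ln k <= s & ln k ^+ 2 <= 8 * s] /\
  [/\ (n0%:R : R) <= 2 * s, (24 <= n0)%N, ln k / 2 <= ll n0, ll n0 <= ln k & (n0 < N)%N] /\
  [/\ s <= n0%:R, 1 <= k / n0%:R, s / 2 <= k / n0%:R, ln (N%:R : R) * k / N%:R <= 4 / s & k / N%:R <= s ^- 2].
Proof.
pose U := ln k; pose s := expR (1 / 2 * ln k); pose n0 := (Num.truncn s).+1.
move=> k48 kN; exists s, n0; rewrite -/U.
have k0 : 0 < k by apply: lt_le_trans k48; exact: expR_gt0.
have U48 : 48 <= U by apply: ln_ge_expR.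
(* The threshold 48 gives s >= 1 + 24 through 1 + x <= e^x, hence n0 >= 24, the range in which the
   Mertens bound is available. *)
have s25 : 25 <= s by have := expR_ge1Dx (1 / 2 * ln k); rewrite -/s -/U; lra.
have ks : k = s ^+ 2 by have [] := sqrt_exp k0.
have k1 : 1 <= k by rewrite ks; nra.
have Us : U <= s.
  have := @expR_ge_pow R 2 (U / 4) ltac:(lra).
  have -> : s = expR (U / 4) ^+ 2 by rewrite /s -/U -expRM_natl; congr expR; field.
  rewrite (_ : (2 `!)%:R = 2 :> R)//; have := expR_ge1Dx (U / 4); move: (expR _) => e; nra.
have U2 : U ^+ 2 <= 8 * s by have [_] := lnsq_le k0 k1.
have s0 : 0 <= s by lra.
have /andP[t1 t2] : (Num.truncn s)%:R <= s < (Num.truncn s).+1%:R by rewrite truncn_itv.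
have n02 : (n0%:R : R) <= 2 * s by rewrite /n0 -natr1; lra.
have n0p : (0 : R) < n0%:R by rewrite ltr0n.
have n24 : (24 <= n0)%N by rewrite -(ler_nat R); rewrite /n0; lra.
have sp : 0 < s by lra.
have N0 : (0 : R) < N%:R by apply: lt_le_trans kN; rewrite exprn_gt0.
have ll1 : U / 2 <= ll n0.
  have -> : U / 2 = ln s by rewrite /s expRK -/U; field.
  by rewrite /ll ler_ln ?posrE// ltW.
have ll2 : ll n0 <= U.
  rewrite /ll /U ler_ln ?posrE//; apply: le_trans n02 _; rewrite ks; nra.
have nN : (n0 < N)%N.
  rewrite -(ltr_nat R); apply: lt_le_trans kN; apply: le_lt_trans n02 _; rewrite ks; nra.
have t0 : s / 2 <= k / n0%:R by rewrite ler_pdivlMr// ks; nra.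
have h4 : ln (N%:R : R) * k / N%:R <= 4 / s.
  have [v2 v3] := sqrt_exp N0; set w := expR _ in v2 v3.
  have w0 : 0 < w by exact: expR_gt0.
  pose v := expR (ln (N%:R : R) / 4); have v0 : 0 < v by exact: expR_gt0.
  have wv : w = v ^+ 2 by rewrite /w /v -expRM_natl; congr expR; field.
  have sv : s <= v.
    rewrite /s /v ler_expR; have : ln (k ^+ 2) <= ln (N%:R : R) by rewrite ler_ln ?posrE ?exprn_gt0.
    by rewrite lnXn// -[ln k *+ 2]mulr_natl; lra.
  have N1 : (1 : R) <= N%:R by apply: le_trans kN; rewrite exprn_ege1.
  have lN : ln (N%:R : R) <= 4 * v.
    by have := @ln_pow_le R 1 4 (N%:R) isT N1; rewrite !expr1 (_ : (1 `!)%:R = 1 :> R)// mul1r.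
  apply: (@le_trans _ _ (4 * v * k / N%:R)).
    by rewrite ler_wpM2r ?invr_ge0 ?(ltW N0)// ler_wpM2r// ltW.
  rewrite v2 wv ks ler_pdivrMr ?exprn_gt0//.
  have -> : 4 / s * (v ^+ 2) ^+ 2 = 4 * v * (v ^+ 3 / s) by field; rewrite gt_eqF.
  rewrite ler_wpM2l ?mulr_ge0 ?(ltW v0)// ler_pdivlMr// -exprSr.
  by apply: lerXl => //; exact: ltW.
have h5 : k / N%:R <= s ^- 2 by rewrite ler_pdivrMr// mulrC ler_pdivlMr ?exprn_gt0// -ks -expr2.
have t1' : s <= n0%:R by exact: ltW.
have t0' : 1 <= k / n0%:R by lra.
by split; [split|split; split].
Qed.

(** Linear arithmetic for [S_asym]: s is the sum of (ln n - ln k) times the increments of the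
    profile, and a, b stand for the logarithms of the end points. The boundary term at n0 cancels
    the logarithm in [Om], leaving the constant C. *)
Lemma S_combine1 {R : realType} (s U a p0 b pN O0 ON e i C q : R) :
  `|s - ((a - U) * p0 - (b - U) * pN + O0 - ON)| <= i -> `|O0 - (U - a) - C| <= e ->
  0 <= (U - a) * (1 - p0) <= 2 * q -> 0 <= (b - U) * pN <= 36 * q -> 0 <= ON <= 9 * q ^+ 2 ->
  e <= q ^+ 2 -> i <= q -> q ^+ 2 <= q / 25 -> `|s - C| <= 60 * q.
Proof.
rewrite !ler_norml => /andP[? ?] /andP[? ?] /andP[? ?] /andP[? ?] /andP[? ?] *.
apply/andP; split; lra.
Qed.

Lemma S_combine2 {R : realType} (h An p0 Am X z z2 z3 z1 B c g Ca q V : R) :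
  0 <= c / V -> 0 <= h - An * p0 <= An * (1 - p0) -> `|z2| <= c * (12 * q + 12 * g * q) -> `|z3| <= c * (60 * q) ->
  z1 <= c * (1280 / V) -> (39 * B + c * (72 + 12 * g)) * q <= (39 * B + c * (80 + 12 * g)) * (8 / V) ->
  An * (1 - p0) <= 3 * B * q -> 0 <= Am <= 36 * B * q ->
  z + z2 + z3 - z1 - 4 * Ca / V <= X <= z + z2 + z3 + 4 * Ca / V ->
  `|h + (Am - An * p0 + X) - z| <= (8 * (39 * B + c * (80 + 12 * g)) + 4 * Ca + 1280 * c) / V.
Proof.
rewrite !ler_norml => cV /andP[? ?] /andP[? ?] /andP[? ?] ? ? ? /andP[? ?] /andP[? ?].
apply/andP; split; lra.
Qed.

(** After summation by parts, the partial sums cH (ln ln n + Gam) are averaged against the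
    increments of the profile, which live around n = k. Expanding ln ln n around ln k, the zeroth
    order gives ln ln k, the first order gives [Crho r / ln k] through [Om_log], and the second
    order is O(1 / ln^2 k) by [sum_lnsq_Dl]. *)
Lemma S_asym {R : realType} (r cH Gam Ca : R) (a : nat -> R) :
  0 < r -> r <= 2 -> 0 < cH -> 0 <= Ca -> a 0%N = 0 -> (forall n, 0 <= a n) ->
  (forall n, (24 <= n)%N -> `|\sum_(0 <= i < n.+1) a i - cH * (ln (ll n) + Gam)| <= Ca * (ll n)^-1 ^+ 2) ->
  exists2 C : R, 0 < C & forall k, expR 48 <= k -> forall N, k ^+ 2 <= N%:R ->
   `|\sum_(0 <= n < N) a n * ph r k n - cH * (ln (ln k) + Gam + Crho r / ln k)| <= C * (ln k)^-1 ^+ 2.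
Proof.
move=> r0 r2 cH0 Ca0 a0 ap HA.
pose B := cH * (1 + `|Gam|) + Ca.
have B0 : 0 < B by rewrite ltr_pwDl// mulr_gt0// ltr_pwDl.
exists (8 * (39 * B + cH * (80 + 12 * `|Gam|)) + 4 * Ca + 1280 * cH).
  have g0 := normr_ge0 Gam; move: B0 cH0 Ca0; move: `|Gam| g0 B => g g0 B'; clear -g0 => *; nra.
move=> k k48 N kN.
have [s [n0 [[U48 s25 ks Us U2] [[n02 n24 ll1 ll2 nN] [n0s t1 t0 hN1 hN2]]]]] := cutoff k48 kN.
have k0 : 0 < k by apply: lt_le_trans k48; exact: expR_gt0.
set U := ln k in U48 Us U2 ll1 ll2 *.
have n00 : (0 < n0)%N by exact: leq_trans n24.
have n0p : (0 : R) < n0%:R by rewrite ltr0n.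
case: N kN nN hN1 hN2 => [//|m] kN nm hN1 hN2; rewrite ltnS in nm.
pose A n : R := \sum_(0 <= i < n.+1) a i.
have A0 n : 0 <= A n by apply: sumr_ge0.
have sp : 0 < s by lra.
pose q := s^-1; have q0 : 0 < q by rewrite invr_gt0.
have qs : q * s = 1 by rewrite mulVf// gt_eqF.
have Up : 0 < U by lra.
have Ub n : (24 <= n)%N -> A n <= B * ll n.
  move=> n24'; have := HA n n24'; rewrite -/(A n) => h.
  have l1 : 1 <= ll n :> R by apply: ll_ge1; exact: leq_trans n24'.
  have i1 : (ll n)^-1 ^+ 2 <= 1 :> R.
    by rewrite exprVn invf_le1 ?exprn_ege1// exprn_gt0//; lra.
  have l2 : ln (@ll R n) <= ll n by apply/ltW/ln_sublinear; lra.
  have g1 := ler_norm Gam; have g0 := normr_ge0 Gam.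
  have h3 := ler_wpM2l Ca0 i1; move: h; rewrite ler_norml => /andP[_ h].
  have e1 : cH * (ln (ll n) + Gam) <= cH * (ll n + `|Gam|) by rewrite ler_pM2l//; lra.
  have e2 : cH * (ll n + `|Gam|) <= cH * (1 + `|Gam|) * ll n.
    rewrite -mulrA ler_pM2l// mulrDl mul1r lerD2l; exact: ler_peMr.
  have e3 : Ca <= Ca * ll n by exact: ler_peMr.
  by rewrite /B [(_ + Ca) * _]mulrDl; lra.
have sq : 1 / 2 <= q * (k / n0%:R).
  by have := ler_wpM2l (ltW q0) t0; move: (k / n0%:R) => t h; lra.
have e0 : expR (- 3 * (k / n0%:R)) <= q ^+ 2.
  have u0 : 0 < 3 * (k / n0%:R) by rewrite mulr_gt0// divr_gt0.
  have := @expRN_leX R (3 * (k / n0%:R)) 2 u0; rewrite -mulNr => /le_trans; apply.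
  rewrite (_ : (2 `!)%:R = 2 :> R)// ler_pdivrMr ?exprn_gt0// -exprMn.
  apply: (@le_trans _ _ ((3 / 2) ^+ 2)); first by lra.
  by apply: lerXn2r; rewrite ?nnegrE; move: sq; move: (k / _) (q) => t q'; clear; lra.
have phi0 : 0 <= 1 - ph r k n0 <= 3 * q ^+ 2.
  rewrite wf_le1//=; apply: le_trans (wf_1B_le _ r0 r2) _; by rewrite ler_wpM2l.
have phiN : 0 <= ph r k m.+1 <= 9 * q ^+ 2.
  have kn : 0 <= k / m.+1%:R by rewrite divr_ge0// ltW.
  rewrite wf_ge0//=; apply: le_trans (wf_le r0 r2 kn) _; by rewrite ler_wpM2l// /q exprVn.
have P1 := @S_head R r k a n0 r0 r2 (ltW k0) a0 ap n00; rewrite -/(A n0) in P1.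
have P3a : \sum_(n0 <= n < m.+1) Dl r k n = ph r k n0 - ph r k m.+1 by apply: sum_Dl; exact: leqW.
have D0 n : (n0 <= n)%N -> 0 <= Dl r k n by move=> h; apply: Dl_ge0 => //; [exact: ltW|exact: leq_trans h].
have L1 := @sum_ln_Dl R r k n0 m r0 r2 k0 n00 nm; rewrite -/U in L1.
set sL1 := \sum_(_ <= _ < _) _ in L1.
have L2 := @sum_lnsq_Dl R r k n0 m.+1 r0 r2 ltac:(rewrite ks; nra) n00; rewrite -/U in L2.
set sL2 := \sum_(_ <= _ < _) _ in L2.
have OmN : 0 <= Om r (k / m.+1%:R) <= 9 * q ^+ 2.
  have kn : 0 < k / m.+1%:R by rewrite divr_gt0.
  have /andP[h1 h2] := Om_bound r0 r2 kn; rewrite h1/=; apply: le_trans h2 _; by rewrite ler_wpM2l// /q exprVn.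
have Om0 := Om_log r0 r2 t1.
pose D : R := ph r k n0 - ph r k m.+1.
pose X : R := \sum_(n0 <= n < m.+1) A n * Dl r k n.
have X12 : cH * ((ln U + Gam) * D + sL1 / U - 2 * sL2 / U ^+ 2) - 4 * Ca / U ^+ 2 <= X <= cH * ((ln U + Gam) * D + sL1 / U) + 4 * Ca / U ^+ 2.
  have D1 : D <= 1 by move: phi0 phiN; rewrite /D; clear => /andP[? ?] /andP[? ?]; lra.
  have iU : 0 <= U ^- 2 by rewrite invr_ge0 exprn_ge0// ltW.
  have c4 : 4 * Ca / U ^+ 2 * D <= 4 * Ca / U ^+ 2 by rewrite ler_piMr// mulr_ge0// mulr_ge0.
  (* Expansion of ln (ll n) in x = (ln n - U) / U. The lower bound needs x >= - 1/2, which is what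
     ln n0 >= U / 2 provides. *)
  have pt n : (n0 <= n)%N -> cH * (ln U + Gam + (ln n%:R - U) / U - 2 * (ln n%:R - U) ^+ 2 / U ^+ 2) - 4 * Ca / U ^+ 2 <= A n <=
      cH * (ln U + Gam + (ln n%:R - U) / U) + 4 * Ca / U ^+ 2.
    move=> nn; have := HA n (leq_trans n24 nn); rewrite -/(A n) ler_norml => /andP[a1 a2].
    have ln1 : U / 2 <= ll n by apply: le_trans ll1 _; exact: ll_mono.
    have lp : 0 < @ll R n by move: ln1 Up; clear; lra.
    have i2 : Ca * (ll n)^-1 ^+ 2 <= 4 * Ca / U ^+ 2.
      rewrite [4 * Ca]mulrC -mulrA ler_wpM2l//; apply: (@le_trans _ _ ((U / 2)^-1 ^+ 2)).
        by apply: lerXl; rewrite ?invr_ge0 ?(ltW lp)// lef_pV2 ?posrE//; move: Up; clear; lra.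
      by rewrite le_eqVlt; apply/orP; left; apply/eqP; field; rewrite gt_eqF.
    pose x := (ln n%:R - U) / U.
    have xE : 1 + x = ll n / U by rewrite /x /ll; field; rewrite gt_eqF.
    have x2 : - (1 / 2) <= x by rewrite /x ler_pdivlMr//; move: ln1; rewrite /ll; clear; lra.
    have lE : ln (ll n) = ln U + ln (1 + x) by rewrite xE lnM ?posrE ?invr_gt0// lnV ?posrE//; ring.
    have u1 : ln (1 + x) <= x by apply: le_ln1Dx; move: x2; clear; lra.
    have u2 := ln1D_ge x2.
    have xx : x ^+ 2 = (ln n%:R - U) ^+ 2 / U ^+ 2 by rewrite /x expr_div_n.
    rewrite lE in a1 a2; rewrite -/x -[2 * _ / _]mulrA -xx.
    have c1 : cH * (ln U + ln (1 + x) + Gam) <= cH * (ln U + Gam + x).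
      by rewrite ler_pM2l//; move: u1; clear; lra.
    have c2 : cH * (ln U + Gam + x - 2 * x ^+ 2) <= cH * (ln U + ln (1 + x) + Gam).
      by rewrite ler_pM2l//; move: u2; clear; lra.
    move: a1 a2 i2 c1 c2; move: (cH * _) (cH * _) (cH * _) (Ca * _) (4 * Ca / _) (A n); clear => *; apply/andP; split; lra.
  have E1 : \sum_(n0 <= n < m.+1) (cH * (ln U + Gam + (ln n%:R - U) / U) + 4 * Ca / U ^+ 2) * Dl r k n =
     cH * ((ln U + Gam) * D + sL1 / U) + 4 * Ca / U ^+ 2 * D.
    rewrite /D -P3a /sL1 [_ / U]mulr_suml !mulr_sumr -big_split mulr_sumr -big_split; apply: eq_bigr => n _ /=; ring.
  have E2 : \sum_(n0 <= n < m.+1) (cH * (ln U + Gam + (ln n%:R - U) / U - 2 * (ln n%:R - U) ^+ 2 / U ^+ 2) - 4 * Ca / U ^+ 2) * Dl r k n =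
     cH * ((ln U + Gam) * D + sL1 / U - 2 * sL2 / U ^+ 2) - 4 * Ca / U ^+ 2 * D.
    rewrite (eq_bigr (fun n => (cH * (ln U + Gam) - 4 * Ca / U ^+ 2) * Dl r k n + cH / U * ((ln n%:R - U) * Dl r k n) -
       cH * 2 / U ^+ 2 * ((ln n%:R - U) ^+ 2 * Dl r k n))); last by move=> n _; ring.
    rewrite sumrB big_split/= -!mulr_sumr P3a -/D -/sL1 -/sL2; ring.
  apply/andP; split.
    apply: (@le_trans _ _ (cH * ((ln U + Gam) * D + sL1 / U - 2 * sL2 / U ^+ 2) - 4 * Ca / U ^+ 2 * D)); first by rewrite lerD2l lerN2.
    by rewrite -E2; apply: ler_sum_nat => n /andP[h _]; rewrite ler_wpM2r ?D0//; case/andP: (pt n h).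
  apply: (@le_trans _ _ (cH * ((ln U + Gam) * D + sL1 / U) + 4 * Ca / U ^+ 2 * D)); last by rewrite lerD2l.
  by rewrite -E1; apply: ler_sum_nat => n /andP[h _]; rewrite ler_wpM2r ?D0//; case/andP: (pt n h).
have g0 := normr_ge0 Gam.
have Uq : U * q <= 1 by rewrite mulrC -qs ler_pM2l.
have qU : q <= 8 / U ^+ 2.
  by rewrite ler_pdivlMr ?exprn_gt0//; have := ler_wpM2l (ltW q0) U2; move: qs; clear => qs; rewrite [q * (8 * s)]mulrCA qs; lra.
have q25 : q <= 1 / 25 by rewrite -(ler_pM2r sp) qs; move: s25; clear; lra.
have hk9 : ph r k m.+1 <= 9 * (k / m.+1%:R).
  by apply: wf_le => //; rewrite divr_ge0// ltW.
have iN : n0%:R^-1 <= q by rewrite /q lef_pV2 ?posrE.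
have lN0 : U <= ln m.+1%:R.
  rewrite ler_ln ?posrE ?ltr0n//; apply: le_trans kN.
  rewrite expr2 ler_peMr ?(ltW k0)// ks -(expr1n R 2) lerXn2r ?nnegrE//; move: s25; clear; lra.
have lNphi : ln m.+1%:R * ph r k m.+1 <= 36 * q.
  apply: (@le_trans _ _ (ln m.+1%:R * (9 * (k / m.+1%:R)))); first by rewrite ler_wpM2l//; move: lN0 Up; clear; lra.
  by rewrite mulrCA [ln _ * _]mulrA; apply: (le_trans (ler_wpM2l _ hN1)) => //; rewrite /q; clear; lra.
have lk0 : ln (k / n0%:R) = U - ln n0%:R by rewrite lnM ?posrE ?invr_gt0// lnV ?posrE//.
have sLC : `|sL1 - Crho r| <= 60 * q.
  have h0 : 0 <= (U - ln n0%:R) * (1 - ph r k n0) <= 2 * q.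
    case/andP: phi0 => p1 p2; move: ll1 ll2; rewrite /ll => ll1 ll2; rewrite mulr_ge0//=; last by rewrite subr_ge0.
    apply: (@le_trans _ _ (U / 2 * (3 * q ^+ 2))); first by apply: ler_pM => //; move: ll1 ll2 Up; move: (ln n0%:R) (U); clear => *; lra.
    by have := ler_wpM2r (ltW q0) Uq; move: q0; clear; lra.
  have h1 : 0 <= (ln m.+1%:R - U) * ph r k m.+1 <= 36 * q.
    case/andP: phiN => p1 _; rewrite mulr_ge0 ?subr_ge0//=.
    by apply: le_trans lNphi; rewrite ler_wpM2r// gerBl ltW.
  have q2 : q ^+ 2 <= q / 25 by rewrite expr2; have := ler_wpM2l (ltW q0) q25; clear; lra.
  rewrite lk0 in Om0; exact: (S_combine1 L1 Om0 h0 h1 OmN e0 iN q2).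
have sAn : A n0 * (1 - ph r k n0) <= 3 * B * q.
  case/andP: phi0 => p1 p2.
  apply: (@le_trans _ _ (B * U * (3 * q ^+ 2))).
    apply: ler_pM => //; apply: le_trans (Ub _ n24) _; by rewrite ler_pM2l.
  by have := ler_wpM2l (ltW (mulr_gt0 B0 q0)) Uq; clear; lra.
have sAm : 0 <= A m * ph r k m.+1 <= 36 * B * q.
  case/andP: phiN => p1 _; rewrite mulr_ge0//=.
  apply: (@le_trans _ _ (B * ln m.+1%:R * ph r k m.+1)).
    rewrite ler_wpM2r//; apply: le_trans (Ub _ (leq_trans n24 nm)) _.
    by rewrite ler_pM2l// /ll ler_ln ?posrE ?ltr0n ?ler_nat//; apply: leq_trans nm.
  by have := ler_wpM2l (ltW B0) lNphi; clear; lra.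
have D1 : - (12 * q ^+ 2) <= D - 1 <= 0.
  by move: phi0 phiN; rewrite /D; clear => /andP[? ?] /andP[? ?]; lra.
have lU : 0 <= ln U <= U by rewrite ln_ge0/=; [apply/ltW/ln_sublinear|lra].
have sD : `|(ln U + Gam) * (D - 1)| <= 12 * q + 12 * `|Gam| * q.
  rewrite normrM; apply: (@le_trans _ _ ((U + `|Gam|) * (12 * q ^+ 2))).
    apply: ler_pM => //.
      apply: le_trans (ler_normD _ _) _; rewrite lerD2r; case/andP: lU => l1 l2; by rewrite ger0_norm.
    by case/andP: D1 => d1 d2; rewrite ler0_norm//; move: d1; clear; lra.
  have h1 := ler_wpM2r (ltW q0) Uq; have q1 : q <= 1 by move: q25; clear; lra.
  by have := ler_wpM2l (mulr_ge0 g0 (ltW q0)) q1; move: h1; clear; lra.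
have sLU : `|(sL1 - Crho r) / U| <= 60 * q.
  rewrite normrM; apply: le_trans sLC; rewrite ler_piMr// normrV ?unitfE ?gt_eqF// invf_le1 ?normr_gt0 ?gt_eqF//.
  by rewrite gtr0_norm//; move: U48; clear; lra.
have sL20 : 2 * sL2 / U ^+ 2 <= 1280 / U ^+ 2.
  by rewrite ler_pM2r ?invr_gt0 ?exprn_gt0//; move: L2; clear; lra.
rewrite (@big_cat_nat _ _ _ n0.+1)//=.
rewrite (@parts _ a (ph r k))//.
have -> : \sum_(n0 <= n < m.+1) (\sum_(0 <= i < n.+1) a i) * (ph r k n - ph r k n.+1) = X by [].
rewrite -/(A m) -/(A n0).
set head := \sum_(_ <= _ < _) _ in P1 *.
have -> : (ln k)^-1 ^+ 2 = (U ^+ 2)^-1 by rewrite exprVn.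
have cE : cH * ((ln U + Gam) * D + sL1 / U) = cH * (ln U + Gam + Crho r / U) + cH * ((ln U + Gam) * (D - 1)) + cH * ((sL1 - Crho r) / U) by ring.
have w1 : `|cH * ((ln U + Gam) * (D - 1))| <= cH * (12 * q + 12 * `|Gam| * q) by rewrite normrM gtr0_norm// ler_pM2l.
have w2 : `|cH * ((sL1 - Crho r) / U)| <= cH * (60 * q) by rewrite normrM gtr0_norm// ler_pM2l.
have w3 := ler_wpM2l (ltW cH0) sL20.
have w4 : (39 * B + cH * (72 + 12 * `|Gam|)) * q <= (39 * B + cH * (80 + 12 * `|Gam|)) * (8 / U ^+ 2).
  have y1 : 0 <= 39 * B by rewrite mulr_ge0// ltW.
  have y2 : 0 <= 72 + 12 * `|Gam| by rewrite addr_ge0// mulr_ge0.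
  apply: ler_pM => //; [by rewrite addr_ge0// mulr_ge0// ltW|exact: ltW|].
  by rewrite lerD2l ler_pM2l// lerD2r; clear; lra.
rewrite [cH * (_ + _ - _)]mulrBr cE in X12.
have cV : 0 <= cH / U ^+ 2 by rewrite divr_ge0 ?exprn_ge0// ltW.
exact: (S_combine2 cV P1 w1 w2 w3 w4 sAn sAm X12).
Qed.

(** * Tilted laws at a prime *)

(* The variable attached to [p = 1 / x] is twice the logarithm of the Euler factor (or its
   opposite). Up to scaling it has mass 1 at [H], [rho] at [- L] and [r] at 0. [Dd], [Tt], [Vv]
   are the unnormalised Laplace transform, mean and variance of its exponential tilt. *)
Definition adm {R : realType} (rho x H L r : R) := [/\ x / 2 <= H <= 4 * x, x / 2 <= L <= 4 * x,
  `|H + L - 3 * x| <= 5 * x ^+ 2, `|rho * L - H| <= 6 * x ^+ 2 & 0 <= r <= 6 * x].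

Definition Dd {R : realType} (rho H L r k : R) : R := expR (k * H) + rho * expR (- (k * L)) + r.
Definition Tt {R : realType} (rho H L r k : R) : R := (H * expR (k * H) - rho * L * expR (- (k * L))) / Dd rho H L r k.
Definition Vv {R : realType} (rho H L r k : R) : R :=
  (H ^+ 2 * expR (k * H) + rho * L ^+ 2 * expR (- (k * L))) / Dd rho H L r k - Tt rho H L r k ^+ 2.

Lemma Dd_gt {R : realType} (rho H L r k : R) : 0 < rho -> 0 <= r -> expR (k * H) < Dd rho H L r k.
Proof.
move=> r0 rr; have := mulr_gt0 r0 (expR_gt0 (- (k * L))); rewrite /Dd; lra.
Qed.

Lemma Dd_gt0 {R : realType} (rho H L r k : R) : 0 < rho -> 0 <= r -> 0 < Dd rho H L r k.
Proof. by move=> r0 rr; apply: lt_trans (Dd_gt _ _ _ r0 rr); exact: expR_gt0. Qed.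

Lemma Tt_dv {R : realType} (rho H L r k : R) : 0 < rho -> 0 <= r -> dv (Tt rho H L r) k (Vv rho H L r k).
Proof.
move=> r0 rr; have d := Dd_gt0 H L k r0 rr; rewrite /Tt /Vv /Tt /Dd in d *.
by der; [rewrite gt_eqF|field; rewrite gt_eqF].
Qed.

Lemma lnDd_dv {R : realType} (rho H L r k : R) : 0 < rho -> 0 <= r -> dv (fun k => ln (Dd rho H L r k)) k (Tt rho H L r k).
Proof.
move=> r0 rr; have d := Dd_gt0 H L k r0 rr; rewrite /Tt /Dd in d *.
by der; [|field; rewrite gt_eqF].
Qed.

(** Variance as a sum over pairs of atoms of the product of their masses and the squared distance:
    nonnegativity is visible, and no product contains the square of the dominant mass. *)
Lemma VvE {R : realType} (rho H L r k : R) : 0 < rho -> 0 <= r ->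
  Vv rho H L r k = (rho * (H + L) ^+ 2 * (expR (k * H) * expR (- (k * L))) +
    r * (H ^+ 2 * expR (k * H) + rho * L ^+ 2 * expR (- (k * L)))) / Dd rho H L r k ^+ 2.
Proof.
move=> r0 rr; have d := Dd_gt0 H L k r0 rr; rewrite /Vv /Tt /Dd in d *.
by field; rewrite gt_eqF.
Qed.

Lemma Vv_ge0 {R : realType} (rho H L r k : R) : 0 < rho -> 0 <= r -> 0 <= Vv rho H L r k.
Proof.
move=> r0 rr; have d := Dd_gt0 H L k r0 rr; rewrite VvE//.
have e1 := expR_ge0 (k * H); have e2 := expR_ge0 (- (k * L)).
rewrite divr_ge0 ?exprn_ge0 ?(ltW d)// addr_ge0//.
  by rewrite mulr_ge0// mulr_ge0// ?sqr_ge0// ltW.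
apply: mulr_ge0 => //; apply: addr_ge0; first by rewrite mulr_ge0 ?sqr_ge0.
by rewrite mulr_ge0// mulr_ge0 ?sqr_ge0// ltW.
Qed.

(** A strong tilt concentrates the law at H: relative to it, the masses at - L and 0 are O(e^(- k x
    / 2)), since H and L are at least x / 2. *)
Lemma Vv_le {R : realType} (rho x H L r k : R) : 0 < rho -> rho <= 2 -> 0 < x -> x <= 1 / 2 -> 0 <= k ->
  adm rho x H L r -> Vv rho H L r k <= 300 * x ^+ 2 * expR (- (k * x / 2)).
Proof.
move=> r0 r2 x0 x2 k0 [/andP[h1 h2] /andP[l1 l2] _ _ /andP[rr r6]].
have d := Dd_gt H L k r0 rr; have dp := Dd_gt0 H L k r0 rr.
rewrite VvE// ler_pdivrMr ?exprn_gt0//.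
set E := expR (k * H) in d *; set F := expR _; set e := expR (- (k * x / 2)).
have E0 : 0 < E by exact: expR_gt0.
have F0 : 0 < F by exact: expR_gt0.
have e0 : 0 < e by exact: expR_gt0.
have kH : k * x / 2 <= k * H by rewrite -mulrA ler_wpM2l.
have kL : k * x / 2 <= k * L by rewrite -mulrA ler_wpM2l.
have kx : 0 <= k * x / 2 by rewrite divr_ge0// mulr_ge0// ltW.
have eE : 1 <= e * E by rewrite -expRD -[leLHS]expR0 ler_expR; move: kH; clear; lra.
have Fe : F <= e by rewrite ler_expR lerN2.
have e1 : e <= 1 by rewrite -[leRHS]expR0 ler_expR oppr_le0.
have E11 : 1 <= E by rewrite -[leLHS]expR0 ler_expR; move: kH kx; clear; lra.
have EE : E <= E ^+ 2 by rewrite expr2 ler_peMr// ltW.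
have FE : E * F <= e * E ^+ 2 by rewrite mulrC; apply: ler_pM => //; exact: ltW.
have E1 : E <= e * E ^+ 2 by rewrite expr2 mulrA ler_peMl// ltW.
have D2 : e * E ^+ 2 <= e * Dd rho H L r k ^+ 2 by rewrite ler_pM2l// lerXn2r ?nnegrE ?ltW.
have w : 0 < e * E ^+ 2 by rewrite mulr_gt0// exprn_gt0.
have F1 : F <= e * E ^+ 2 by apply: le_trans E1; apply: le_trans E11; exact: le_trans e1.
have c0 : 0 <= 300 * x ^+ 2 by exact: mulr_ge0 (ler0n _ _) (sqr_ge0 _).
apply: le_trans (_ : _ <= 300 * x ^+ 2 * (e * E ^+ 2)) _; last first.
  by apply: le_trans (ler_wpM2l c0 D2) _; rewrite mulrA lexx.
move: (e * E ^+ 2) w FE E1 F1 => Q w; clear D2 e1 Fe eE d dp e0 kH kL kx EE E11 => FE E1 F1.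
have a1 : rho * (H + L) ^+ 2 <= 128 * x ^+ 2.
  have : (H + L) ^+ 2 <= (8 * x) ^+ 2 by apply: lerXn2r; rewrite ?nnegrE; lra.
  have := sqr_ge0 (H + L); rewrite exprMn; nra.
have a2 : rho * (H + L) ^+ 2 * (E * F) <= 128 * x ^+ 2 * Q.
  apply: ler_pM => //; first by rewrite mulr_ge0 ?sqr_ge0// ltW.
  by rewrite ltW// mulr_gt0.
have a3 : H ^+ 2 * E <= 16 * x ^+ 2 * Q.
  apply: ler_pM => //; [exact: sqr_ge0|exact: ltW|].
  have : H ^+ 2 <= (4 * x) ^+ 2 by apply: lerXn2r; rewrite ?nnegrE; lra.
  by rewrite exprMn; lra.
have a4 : rho * L ^+ 2 * F <= 32 * x ^+ 2 * Q.
  apply: ler_pM => //; [by rewrite mulr_ge0 ?sqr_ge0// ltW|exact: ltW|].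
  have : L ^+ 2 <= (4 * x) ^+ 2 by apply: lerXn2r; rewrite ?nnegrE; lra.
  have := sqr_ge0 L; rewrite exprMn; nra.
have a5 : r * (H ^+ 2 * E + rho * L ^+ 2 * F) <= 3 * (48 * x ^+ 2 * Q).
  apply: ler_pM => //; [|lra|lra].
  apply: addr_ge0; first by rewrite mulr_ge0 ?sqr_ge0// ltW.
  by rewrite mulr_ge0 ?(ltW F0)// mulr_ge0 ?sqr_ge0// ltW.
have : 0 <= x ^+ 2 * Q by rewrite mulr_ge0 ?sqr_ge0// ltW.
lra.
Qed.

Lemma expR_sub_le {R : realType} (a b c : R) : c <= a -> c <= b -> `|expR (- a) - expR (- b)| <= `|a - b| * expR (- c).
Proof.
suff H (a' b' : R) : c <= a' -> a' <= b' -> `|expR (- a') - expR (- b')| <= `|a' - b'| * expR (- c).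
  move=> ca cb; have [ab|/ltW ab] := leP a b; first exact: H.
  by rewrite -normrN opprB -[`|a - b|]normrN opprB; exact: H.
move=> ca ab; have e := expR_ge1Dx (- (b' - a')); have eb : expR (- b') <= expR (- a') by rewrite ler_expR lerN2.
rewrite ger0_norm ?subr_ge0// ler0_norm ?subr_le0// opprB.
have -> : expR (- b') = expR (- a') * expR (- (b' - a')) by rewrite -expRD; congr expR; ring.
have : expR (- a') <= expR (- c) by rewrite ler_expR lerN2.
have := expR_gt0 (- a'); move: (expR (- (b' - a'))) (expR (- a')) (expR (- c)) e => u v w e v0 vw; clear eb.
have h : v * (1 - u) <= v * (b' - a') by rewrite ler_pM2l//; lra.
have := ler_wpM2l (_ : 0 <= b' - a') vw; rewrite subr_ge0 => /(_ ab); lra.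
Qed.

(** If H + L = 3 x, rho L = H and r = 0, the tilted mean is exactly H wf(k x). The deviations from
    these three relations contribute O(x^2) or, in the case of r, H O(x), each with a decaying
    exponential. *)
Lemma Tt_near {R : realType} (rho x H L r k : R) : 0 < rho -> rho <= 2 -> 0 < x -> x <= 1 / 2 -> 0 <= k ->
  adm rho x H L r -> `|Tt rho H L r k - H * wf rho (k * x)| <= 60 * x ^+ 2 * (1 + k * x) * expR (- (k * x / 2)).
Proof.
move=> r0 r2 x0 x2 k0 [/andP[h1 h2] /andP[l1 l2] hl dl /andP[rr r6]].
have d := Dd_gt H L k r0 rr; have dp := Dd_gt0 H L k r0 rr.
pose E := expR (k * H); pose e := expR (- (k * (H + L))); pose z := expR (- (3 * (k * x))).
pose q := expR (- (k * x / 2)); pose s := expR (- (k * H)).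
have E0 : 0 < E by exact: expR_gt0.
have e0 : 0 < e by exact: expR_gt0.
have z0 : 0 < z by exact: expR_gt0.
have q0 : 0 < q by exact: expR_gt0.
have s0 : 0 < s by exact: expR_gt0.
have zq : `|z - e| <= 5 * (k * x ^+ 2) * q.
  apply: le_trans (@expR_sub_le R _ _ (k * x / 2) _ _) _; [nra|nra|].
  rewrite ler_wpM2r ?(ltW q0)// -normrN (_ : - (_ - _) = k * (H + L - 3 * x)); last by ring.
  by rewrite normrM ger0_norm// mulrCA ler_wpM2l.
have eq' : e <= q by rewrite ler_expR; nra.
have sq' : s <= q by rewrite ler_expR; nra.
have z1 : z <= 1 by rewrite -[leRHS]expR0 ler_expR; nra.
have den1 : 0 < 1 + rho * e + r * s by rewrite -addrA ltr_pwDl// addr_ge0// mulr_ge0// ltW.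
have den2 : 0 < 1 + rho * z by rewrite ltr_pwDl// mulr_ge0// ltW.
have TE : Tt rho H L r k = (H - rho * L * e) / (1 + rho * e + r * s).
  have FE : expR (- (k * L)) = E * e by rewrite -expRD; congr expR; ring.
  have sE : s = E^-1 by rewrite -expRN.
  have dE : Dd rho H L r k = E * (1 + rho * e + r * s) by rewrite /Dd FE -/E sE; field; rewrite gt_eqF.
  by rewrite /Tt dE FE -/E; field; rewrite !gt_eqF.
have wE : wf rho (k * x) = (1 - z) / (1 + rho * z) by rewrite /wf /z mulNr.
have -> : Tt rho H L r k - H * wf rho (k * x) =
   (H * (1 + rho) * (z - e) - (rho * L - H) * e * (1 + rho * z) - H * r * s * (1 - z)) / ((1 + rho * e + r * s) * (1 + rho * z)).
  by rewrite TE wE; field; rewrite !gt_eqF.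
rewrite normrM normfV ler_pdivrMr ?normr_gt0 ?mulf_neq0 ?gt_eqF//.
rewrite [`|_ * (1 + rho * z)|]gtr0_norm ?mulr_gt0//.
have p1 : 0 <= rho * e by rewrite mulr_ge0// ltW.
have p2 : 0 <= rho * z by rewrite mulr_ge0// ltW.
have p3 : 0 <= r * s by rewrite mulr_ge0// ltW.
have dd : 1 <= (1 + rho * e + r * s) * (1 + rho * z).
  by apply: mulr_ege1; [move: p1 p3; clear; lra|move: p2; clear; lra].
have b0 : 0 <= 60 * x ^+ 2 * (1 + k * x) * q.
  have kx : 0 <= 1 + k * x by rewrite addr_ge0// mulr_ge0// ltW.
  have x2' : 0 <= 60 * x ^+ 2 by exact: mulr_ge0 (ler0n _ _) (sqr_ge0 _).
  exact: (mulr_ge0 (mulr_ge0 x2' kx) (ltW q0)).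
apply: le_trans (ler_peMr b0 dd).
apply: le_trans (ler_normB _ _) _; apply: (le_trans (lerD (ler_normB _ _) (lexx _))).
have t1 : `|H * (1 + rho) * (z - e)| <= 12 * x * (5 * (k * x ^+ 2) * q).
  rewrite normrM ger0_norm; last by rewrite mulr_ge0//; lra.
  by apply: ler_pM => //; [rewrite mulr_ge0//; lra|nra].
have t2 : `|(rho * L - H) * e * (1 + rho * z)| <= 6 * x ^+ 2 * q * 3.
  rewrite !normrM (gtr0_norm e0) (gtr0_norm den2); apply: ler_pM => //; first by rewrite mulr_ge0// ltW.
    by rewrite ltW.
  - by apply: ler_pM => //; exact: ltW.
  - by nra.
have t3 : `|H * r * s * (1 - z)| <= 4 * x * (6 * x) * q * 1.
  have H0 : 0 <= H by lra.
  have z10 : 0 <= 1 - z by lra.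
  rewrite ger0_norm; last by rewrite !mulr_ge0// ltW.
  apply: ler_pM => //; [by rewrite !mulr_ge0// ltW| |lra].
  by apply: ler_pM => //; [rewrite mulr_ge0|exact: ltW|apply: ler_pM].
have := mulr_ge0 (sqr_ge0 x) (ltW q0); move: t1 t2 t3.
move: (`|_|) (`|_|) (`|_|) => n1 n2 n3; clear; rewrite !expr2; lra.
Qed.

(** With t = k / n, the factor (1 + t) t^(1/2) e^(- t / 2) is at most 16; the decay is traded for
    k^(-1/2) n^(-3/2), which is summable in n. *)
Lemma decay_n32 {R : realType} (k : R) n : 0 < k -> (0 < n)%N ->
  (n%:R^-1) ^+ 2 * (1 + k * n%:R^-1) * expR (- (k * n%:R^-1 / 2)) <= 16 * expR (- (1 / 2) * ln k) * expR (- (3 / 2) * ln (n%:R : R)).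
Proof.
move=> k0 n0; have np : (0 : R) < n%:R by rewrite ltr0n.
pose t := k * n%:R^-1; have t0 : 0 < t by rewrite divr_gt0.
rewrite -/t; pose y := expR (1 / 2 * ln t).
have y0 : 0 < y by exact: expR_gt0.
have yt : y <= 1 + t.
  rewrite -[leRHS]lnK ?posrE ?ler_expR; last by lra.
  have a1 : ln t <= ln (1 + t) by rewrite ler_ln ?posrE; lra.
  have a2 : 0 <= ln (1 + t) by apply: ln_ge0; lra.
  lra.
have e4 : (1 + t / 4) ^+ 2 <= expR (t / 2).
  rewrite (_ : t / 2 = 2%:R * (t / 4)) ?expRM_natl; last by field.
  apply: lerXn2r; rewrite ?nnegrE; [lra|exact: expR_ge0|exact: expR_ge1Dx].
have h : (1 + t) * y * expR (- (t / 2)) <= 16.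
  rewrite expRN ler_pdivrMr ?expR_gt0//; apply: (@le_trans _ _ (16 * (1 + t / 4) ^+ 2)); last by rewrite ler_pM2l.
  have : (1 + t) * y <= (1 + t) * (1 + t) by rewrite ler_pM2l//; lra.
  rewrite expr2; nra.
have E : expR (- (1 / 2) * ln k) * expR (- (3 / 2) * ln n%:R) * y = n%:R^-1 ^+ 2.
  rewrite -[n%:R^-1 ^+ 2]lnK ?posrE ?exprn_gt0 ?invr_gt0// -!expRD; congr expR.
  by rewrite lnXn ?invr_gt0// /t lnM ?posrE ?invr_gt0// lnV ?posrE// -mulr_natl; field.
rewrite -E; set c := _ * expR (- (3 / 2) * _); have c0 : 0 < c by rewrite mulr_gt0 ?expR_gt0.
have -> : c * y * (1 + t) * expR (- (t / 2)) = c * ((1 + t) * y * expR (- (t / 2))) by ring.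
by rewrite -[leRHS]mulrA -/c mulrC ler_pM2r.
Qed.

Lemma sum_decay {R : realType} (k c : R) (P : pred nat) (f : nat -> R) N : 0 < k -> 0 <= c ->
  (forall n, P n -> (0 < n)%N) ->
  (forall n, P n -> `|f n| <= c * (n%:R^-1 ^+ 2 * (1 + k * n%:R^-1) * expR (- (k * n%:R^-1 / 2)))) ->
  `|\sum_(0 <= n < N | P n) f n| <= 128 * c * expR (- (1 / 2) * ln k).
Proof.
move=> k0 c0 P0 H; set e := expR _; have e0 : 0 < e by exact: expR_gt0.
apply: le_trans (ler_norm_sum _ _ _) _.
apply: (@le_trans _ _ (\sum_(0 <= n < N | P n) 16 * c * e * expR (- (3 / 2) * ln (n%:R : R)))).
  apply: ler_sum => n Pn; apply: le_trans (H n Pn) _.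
  by apply: le_trans (ler_wpM2l c0 (decay_n32 k0 (P0 n Pn))) _; rewrite -/e le_eqVlt; apply/orP; left; apply/eqP; ring.
rewrite -mulr_sumr.
have h : \sum_(0 <= n < N | P n) expR (- (3 / 2) * ln (n%:R : R)) <= 8.
  case: N => [|N]; first by rewrite big_geq.
  have := @sum_n32 R 1 N.+1 isT; rewrite ln1 mulr0 expR0 mulr1; apply: le_trans.
  rewrite big_mkcond/= big_nat_recl//= [leRHS]big_add1/=.
  have -> : P 0%N = false by apply/negP => /P0.
  rewrite add0r; apply: ler_sum => n _; case: ifP => // _; exact: expR_ge0.
have := ler_wpM2l (mulr_ge0 c0 (ltW e0)) h; lra.
Qed.

Definition Hp {R : realType} (Hs : nat -> R) (n : nat) : R := if prime n then Hs n else 0.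

Lemma prime_inv {R : realType} p : prime p -> 0 < (p%:R^-1 : R) /\ (p%:R^-1 : R) <= 1 / 2.
Proof.
move=> pp; have p2 : (2 : R) <= p%:R by rewrite ler_nat prime_gt1.
by split; [rewrite invr_gt0; lra|rewrite mul1r lef_pV2 ?posrE; lra].
Qed.

(** [S_asym] gives the main term. Replacing the tilted means by the profile costs O(k^(-1/2)) over
    all primes, which is dominated by 1 / ln^2 k, and the variances obey the same estimate. Nothing
    depends on N beyond k^2 <= N. *)
Lemma mean_asym {R : realType} (rho cH Gam Ca : R) (Hs Ls rs : nat -> R) :
  0 < rho -> rho <= 2 -> 0 < cH -> 0 <= Ca -> (forall p, prime p -> adm rho p%:R^-1 (Hs p) (Ls p) (rs p)) ->
  (forall n, (24 <= n)%N -> `|\sum_(0 <= i < n.+1) Hp Hs i - cH * (ln (ll n) + Gam)| <= Ca * (ll n)^-1 ^+ 2) ->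
  exists2 C : R, 0 < C & forall k, expR 48 <= k -> forall N, k ^+ 2 <= N%:R ->
   `|\sum_(0 <= p < N | prime p) Tt rho (Hs p) (Ls p) (rs p) k - cH * (ln (ln k) + Gam + Crho rho / ln k)| <= C / ln k ^+ 2 /\
   \sum_(0 <= p < N | prime p) Vv rho (Hs p) (Ls p) (rs p) k <= C * expR (- (1 / 2) * ln k).
Proof.
move=> r0 r2 cH0 Ca0 Had HA.
have ap n : 0 <= Hp Hs n.
  rewrite /Hp; case: ifP => // pn; have [/andP[h _] _ _ _ _] := Had n pn; apply: le_trans h.
  by rewrite divr_ge0// invr_ge0.
have h0 : Hp Hs 0%N = 0 by [].
have [C C0 HC] := S_asym r0 r2 cH0 Ca0 h0 ap HA.
have [c1 c10 c1E] : exists2 c1 : R, 0 <= c1 & c1 = 128 * 60 by eexists; last reflexivity; exact: mulr_ge0 (ler0n _ _) (ler0n _ _).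
have [c2 c20 c2E] : exists2 c2 : R, 0 <= c2 & c2 = 128 * 300 by eexists; last reflexivity; exact: mulr_ge0 (ler0n _ _) (ler0n _ _).
exists (C + c1 * 8 + c2) => [|k k48 N kN].
  by rewrite -addrA ltr_pwDl// addr_ge0// mulr_ge0.
have k0 : 0 < k by apply: lt_le_trans k48; exact: expR_gt0.
have k1 : 1 <= k by apply: le_trans k48; rewrite -[leLHS]expR0 ler_expR ler0n.
have U0 : 0 < ln k by have := ln_ge_expR k48; lra.
set e := expR (- (1 / 2) * ln k); have e0 : 0 < e by exact: expR_gt0.
have eU : e <= 8 / ln k ^+ 2.
  have [_ h] := lnsq_le k0 k1; rewrite ler_pdivlMr ?exprn_gt0//.
  have ee : e * expR (1 / 2 * ln k) = 1 by rewrite -expRD -[RHS]expR0; congr expR; ring.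
  by have := ler_wpM2l (ltW e0) h; rewrite [e * (8 * _)]mulrCA ee mulr1.
have pz p : prime p -> 0 <= k * p%:R^-1 by move=> pp; rewrite divr_ge0// ltW.
split.
  have S1 : `|\sum_(0 <= p < N | prime p) (Tt rho (Hs p) (Ls p) (rs p) k - Hs p * ph rho k p)| <= c1 * e.
    rewrite c1E; apply: sum_decay; [by []|exact: ler0n|by move=> n /prime_gt0|].
    move=> p pp; have [x0 x2] := @prime_inv R p pp.
    by have := Tt_near r0 r2 x0 x2 (ltW k0) (Had p pp); rewrite !mulrA.
  have S2 := HC k k48 N kN.
  have E : \sum_(0 <= n < N) Hp Hs n * ph rho k n = \sum_(0 <= n < N | prime n) Hs n * ph rho k n.
    by rewrite [RHS]big_mkcond; apply: eq_bigr => n _; rewrite /Hp; case: ifP; rewrite ?mul0r.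
  rewrite sumrB -E in S1; rewrite exprVn in S2.
  apply: le_trans (ler_distD (\sum_(0 <= n < N) Hp Hs n * ph rho k n) _ _) _.
  apply: (le_trans (lerD S1 S2)); have h := ler_wpM2l c10 eU.
  have h2 : 0 <= c2 / ln k ^+ 2 by rewrite divr_ge0// exprn_ge0// ltW.
  by rewrite [leRHS]mulrDl [in leRHS]mulrDl -[c1 * 8 / _]mulrA; move: h h2; move: (c1 * e) (c1 * _) (C / _) (_ / _) => *; lra.
have : `|\sum_(0 <= p < N | prime p) Vv rho (Hs p) (Ls p) (rs p) k| <= c2 * e.
  rewrite c2E; apply: sum_decay; [by []|exact: ler0n|by move=> n /prime_gt0|].
  move=> p pp; have [x0 x2] := @prime_inv R p pp; have [_ _ _ _ /andP[rr _]] := Had p pp.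
  rewrite ger0_norm ?Vv_ge0//; apply: le_trans (Vv_le r0 r2 x0 x2 (ltW k0) (Had p pp)) _.
  rewrite -mulrA; apply: ler_wpM2l; first exact: ler0n.
  rewrite -[_ * (1 + _) * _]mulrA; apply: ler_wpM2l; first exact: sqr_ge0.
  by apply: ler_peMl; [exact: expR_ge0|rewrite lerDl pz].
move/(le_trans (ler_norm _)); move=> h; apply: le_trans h _; rewrite ler_wpM2r ?(ltW e0)// lerDr.
by rewrite addr_ge0 ?(ltW C0)// mulr_ge0.
Qed.

Definition Fcum {R : realType} (rho : R) (Hs Ls rs : nat -> R) N k : R :=
  \sum_(0 <= p < N | prime p) (ln (Dd rho (Hs p) (Ls p) (rs p) k) - ln (Dd rho (Hs p) (Ls p) (rs p) 0)).

Lemma Fcum_dv {R : realType} (rho : R) (Hs Ls rs : nat -> R) N k : 0 < rho ->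
  (forall p, prime p -> 0 <= rs p) ->
  dv (Fcum rho Hs Ls rs N) k (\sum_(0 <= p < N | prime p) Tt rho (Hs p) (Ls p) (rs p) k).
Proof.
move=> r0 rr; apply: dv_sum => p pp; apply: dv_eq; last exact: subr0.
by apply: dvD; [exact: lnDd_dv (rr _ pp)|exact: dvN (dv_cst _ _)].
Qed.

(** The derivative of k ln ln k produces an extra 1 / ln k; this is why the transform has c - 1
    where the mean has c. *)
Lemma main_dv {R : realType} (a g c K k : R) : 1 < k ->
  dv (fun k => a * k * (ln (ln k) + g) + a * (c - 1) * k / ln k + K * k / ln k ^+ 2) k
   (a * (ln (ln k) + g + c / ln k) + (K - a * (c - 1)) / ln k ^+ 2 - 2 * K / ln k ^+ 3).
Proof.
move=> k1; have k0 : 0 < k by lra.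
have l0 : 0 < ln k by rewrite ln_gt0.
der; try by rewrite ?expf_neq0 ?gt_eqF.
by field; rewrite !gt_eqF.
Qed.

(** Starting value for the integration in k, uniform in N: the mean increases with k because
    variances are nonnegative, and at k = 0 its terms are O(1 / p^2). *)
Lemma Fcum_base {R : realType} (rho k M : R) (Hs Ls rs : nat -> R) N : 0 < rho -> 0 < k ->
  (forall p, prime p -> adm rho p%:R^-1 (Hs p) (Ls p) (rs p)) ->
  \sum_(0 <= p < N | prime p) Tt rho (Hs p) (Ls p) (rs p) k <= M -> `|Fcum rho Hs Ls rs N k| <= k * (`|M| + 128 * 12).
Proof.
move=> r0 k0 Had HM.
have rr p : prime p -> 0 <= rs p by move=> pp; have [_ _ _ _ /andP[]] := Had p pp.
pose S c := \sum_(0 <= p < N | prime p) Tt rho (Hs p) (Ls p) (rs p) c.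
have Smono c d : c <= d -> S c <= S d.
  move=> cd; apply: (@dv_le R S (fun c => \sum_(0 <= p < N | prime p) Vv rho (Hs p) (Ls p) (rs p) c) _ _ cd).
    by move=> x _; apply: dv_sum => p pp; exact: Tt_dv (rr _ pp).
  by move=> x _; apply: sumr_ge0 => p pp; exact: Vv_ge0 (rr _ pp).
have S0 : `|S 0| <= 128 * 12 * expR (- (1 / 2) * ln 1).
  apply: sum_decay; [by []|exact: ler0n|by move=> n /prime_gt0|].
  move=> p pp; have [x0 x2] := @prime_inv R p pp; have [_ _ _ dl _] := Had p pp.
  rewrite /Tt !mul0r oppr0 expR0 !mulr1 mul1r; have d := Dd_gt0 (Hs p) (Ls p) 0 r0 (rr _ pp).
  have d1 : 1 <= Dd rho (Hs p) (Ls p) (rs p) 0 by have := Dd_gt (Hs p) (Ls p) 0 r0 (rr _ pp); rewrite mul0r expR0; exact: ltW.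
  rewrite normrM normfV (gtr0_norm d) ler_pdivrMr//; apply: le_trans (_ : _ <= 6 * p%:R^-1 ^+ 2) _.
    by rewrite -normrN opprB.
  have e2 := expR_ge1Dx (- (p%:R^-1 / 2 : R)); have x2p : 0 < (p%:R^-1 : R) ^+ 2 by rewrite exprn_gt0.
  move: (p%:R^-1) (expR _) x0 x2 e2 x2p (Dd _ _ _ _ _) d1 => x e x0 x2 e2 x2p D d1; clear -x0 x2 e2 x2p d1.
  have h1 : x ^+ 2 <= x ^+ 2 * (2 * ((1 + x) * e)) by rewrite ler_peMr ?(ltW x2p)//; nra.
  have h2 : 0 <= x ^+ 2 * ((1 + x) * e) by rewrite mulr_ge0 ?(ltW x2p)//; nra.
  have h3 : 6 * x ^+ 2 <= 12 * (x ^+ 2 * (1 + x) * e) by rewrite -mulrA; lra.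
  apply: le_trans h3 _; rewrite ler_peMr// -mulrA; lra.
rewrite ln1 mulr0 expR0 mulr1 in S0.
have F0 : Fcum rho Hs Ls rs N 0 = 0 by rewrite /Fcum big1// => p _; rewrite subrr.
have [c /andP[c0 ck]] := @dv_MVT R (Fcum rho Hs Ls rs N) S 0 k (ltW k0) (fun x _ => Fcum_dv _ _ N x r0 rr).
rewrite F0 !subr0 => ->; rewrite mulrC normrM (gtr0_norm k0) ler_pM2l//.
have h1 := Smono _ _ c0; have h2 := Smono _ _ ck; have h3 := ler_norm M.
move: HM S0; rewrite -/(S k) => HM; rewrite !ler_norml => /andP[a1 a2].
move: h1 h2 h3 HM a1; have := normr_ge0 M; move: (S 0) (S c) (S k) (`|M|) => s1 s2 s3 m; clear => *; apply/andP; split; lra.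
Qed.

Lemma F_combine {R : realType} (F F0 G G0 H H0 m y z b c : R) :
  c = b + `|G0| + `|H0| -> c <= y -> `|F0| <= b -> G0 - F0 <= G - F -> F0 - H0 <= F - H ->
  G = m + z -> H = m - z -> `|F - m| <= z + y.
Proof.
have := ler_norm G0; have := ler_norm (- G0); have := ler_norm H0; have := ler_norm (- H0).
rewrite !normrN; move: (`|G0|) (`|H0|) => g h; rewrite !ler_norml => ? ? ? ? ? ? /andP[? ?] *.
apply/andP; split; lra.
Qed.

Lemma F_asym {R : realType} (rho cH Gam Ca : R) (Hs Ls rs : nat -> R) :
  0 < rho -> rho <= 2 -> 0 < cH -> 0 <= Ca -> (forall p, prime p -> adm rho p%:R^-1 (Hs p) (Ls p) (rs p)) ->
  (forall n, (24 <= n)%N -> `|\sum_(0 <= i < n.+1) Hp Hs i - cH * (ln (ll n) + Gam)| <= Ca * (ll n)^-1 ^+ 2) ->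
  exists2 C : R, 0 < C & forall k, expR 48 <= k -> forall N, k ^+ 2 <= N%:R ->
   `|Fcum rho Hs Ls rs N k - (cH * k * (ln (ln k) + Gam) + cH * (Crho rho - 1) * k / ln k)| <= C * k / ln k ^+ 2.
Proof.
move=> r0 r2 cH0 Ca0 Had HA.
have [C C0 HC] := mean_asym r0 r2 cH0 Ca0 Had HA.
have rr p : prime p -> 0 <= rs p by move=> pp; have [_ _ _ _ /andP[]] := Had p pp.
have [k0 k0E] : exists k0 : R, k0 = expR 48 by eexists.
pose c := Crho rho; have k00 : 0 < k0 by rewrite k0E; exact: expR_gt0.
(* Barriers: from k0 on, the derivative of [Gf K1] is above that of [Fcum] and the derivative of
   [Gf (- K1)] below it. There ln k >= 48, so the term 2 K1 / ln^3 k is at most a fraction of K1 /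
   ln^2 k. *)
pose Gf K (k : R) := cH * k * (ln (ln k) + Gam) + cH * (c - 1) * k / ln k + K * k / ln k ^+ 2.
pose K1 := 2 * (C + `|cH * (c - 1)|).
pose M := cH * (ln (ln k0) + Gam + c / ln k0) + C / ln k0 ^+ 2.
pose C3 := k0 * (`|M| + 128 * 12) + `|Gf K1 k0| + `|Gf (- K1) k0|.
have C30 : 0 <= C3.
  apply: addr_ge0 (addr_ge0 (mulr_ge0 (ltW k00) (addr_ge0 (normr_ge0 _) _)) (normr_ge0 _)) (normr_ge0 _).
  exact: mulr_ge0 (ler0n _ _) (ler0n _ _).
have K10 : 0 < K1 by rewrite mulr_gt0// ltr_pwDl.
exists (K1 + 2 * C3) => [|k k48 N kN]; first by apply: ltr_pwDl => //; exact: mulr_ge0.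
rewrite -k0E in k48.
have kp : 0 < k by exact: lt_le_trans k48.
have k1 : 1 <= k by apply: le_trans k48; rewrite k0E -[leLHS]expR0 ler_expR ler0n.
have k48' := k48; rewrite k0E in k48'; have U48 := ln_ge_expR k48'; have U0 : 0 < ln k by lra.
have [Uk _] := lnsq_le kp k1.
have one : C3 <= 2 * C3 * k / ln k ^+ 2.
  by rewrite ler_pdivlMr ?exprn_gt0//; have := ler_wpM2l C30 Uk; lra.
have k0N : k0 ^+ 2 <= N%:R.
  by apply: le_trans kN; apply: lerXn2r; rewrite ?nnegrE ?(ltW k00) ?(ltW kp).
have base : `|Fcum rho Hs Ls rs N k0| <= k0 * (`|M| + 128 * 12).
  apply: Fcum_base => //; have k00' : expR 48 <= k0 by rewrite k0E.
  have [h _] := HC k0 k00' N k0N.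
  by move: h; rewrite ler_norml => /andP[_]; rewrite /M -/c; lra.
have der_bound x : k0 <= x <= k -> `|\sum_(0 <= p < N | prime p) Tt rho (Hs p) (Ls p) (rs p) x - cH * (ln (ln x) + Gam + c / ln x)| <= C / ln x ^+ 2.
  move=> /andP[x1 x2]; have x1' := x1; rewrite k0E in x1'.
  have [|h _] := HC x x1' N _; last exact: h.
  by apply: le_trans kN; apply: lerXn2r; rewrite ?nnegrE ?(ltW kp)// ltW// (lt_le_trans k00).
have aux x : k0 <= x -> C / ln x ^+ 2 <= (K1 - cH * (c - 1)) / ln x ^+ 2 - 2 * K1 / ln x ^+ 3 /\
   C / ln x ^+ 2 <= (K1 + cH * (c - 1)) / ln x ^+ 2 - 2 * K1 / ln x ^+ 3.
  rewrite k0E => x1; have u48 := ln_ge_expR x1; have u0 : 0 < ln x by lra.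
  have -> : 2 * K1 / ln x ^+ 3 = 2 * K1 / ln x / ln x ^+ 2 by field; rewrite gt_eqF.
  have h : 2 * K1 / ln x <= K1 / 24.
    rewrite ler_pdivrMr//; have := ler_wpM2l (ltW K10) u48; lra.
  have n1 := ler_norm (cH * (c - 1)); have n2 := ler_norm (- (cH * (c - 1))); rewrite normrN in n2.
  rewrite -!mulrBl !ler_pM2r ?invr_gt0 ?exprn_gt0//; have n0 := normr_ge0 (cH * (c - 1)).
  have K1E : K1 = 2 * (C + `|cH * (c - 1)|) by [].
  move: h n1 n2 n0 C0 K1E; move: (2 * K1 / ln x) (cH * (c - 1)) (`|_|) (K1) => q z w K'; clear => *; split; lra.
have dF x : dv (Fcum rho Hs Ls rs N) x (\sum_(0 <= p < N | prime p) Tt rho (Hs p) (Ls p) (rs p) x) by exact: Fcum_dv.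
have x1 x : k0 <= x -> 1 < x by move=> h; apply: lt_le_trans h; rewrite k0E -[ltLHS]expR0 ltr_expR ltr0n.
have up : Gf K1 k0 - Fcum rho Hs Ls rs N k0 <= Gf K1 k - Fcum rho Hs Ls rs N k.
  apply: (@dv_le R (fun x => Gf K1 x - Fcum rho Hs Ls rs N x) _ _ _ k48).
    by move=> x /andP[h _]; apply: dvD; [exact: main_dv (x1 _ h)|exact: dvN (dF x)].
  move=> x hx; have := der_bound x hx; have [h _] := aux x (proj1 (andP hx)).
  rewrite ler_norml => /andP[_]; move: h; move: (\sum_(_ <= _ < _ | _) _) (cH * (_ + _ + _)) => s t; clear; lra.
have dn : Fcum rho Hs Ls rs N k0 - Gf (- K1) k0 <= Fcum rho Hs Ls rs N k - Gf (- K1) k.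
  apply: (@dv_le R (fun x => Fcum rho Hs Ls rs N x - Gf (- K1) x) _ _ _ k48).
    by move=> x /andP[h _]; apply: dvD; [exact: dF|apply: dvN; exact: main_dv (x1 _ h)].
  move=> x hx; have := der_bound x hx; have [_ h] := aux x (proj1 (andP hx)).
  rewrite ler_norml => /andP[+ _]; move: h; rewrite mulrN -opprD !mulNr opprK.
  move: (\sum_(_ <= _ < _ | _) _) (cH * (_ + _ + _)) (_ / _) (_ / _) (_ / _) => s t z1 z2 z3; clear; lra.
have -> : (K1 + 2 * C3) * k / ln k ^+ 2 = K1 * k / ln k ^+ 2 + 2 * C3 * k / ln k ^+ 2.
  by rewrite -mulrDl -mulrDl.
have C3E : C3 = k0 * (`|M| + 128 * 12) + `|Gf K1 k0| + `|Gf (- K1) k0| by [].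
have E1 : Gf K1 k = cH * k * (ln (ln k) + Gam) + cH * (c - 1) * k / ln k + K1 * k / ln k ^+ 2 by [].
have E2 : Gf (- K1) k = cH * k * (ln (ln k) + Gam) + cH * (c - 1) * k / ln k - K1 * k / ln k ^+ 2 by rewrite /Gf !mulNr.
exact: (F_combine C3E one base up dn E1 E2).
Qed.

(** * Prime sums for the two tails *)

(* [n^-1 * exp (- 2 ln n)] is [n^-3], in the form of the summand of [ad 2]. *)
Definition Lp3 {R : realType} (n : nat) : R := if prime n then - ln (1 - n%:R^-1 * expR (- 2 * ln n%:R)) else 0.
(** At a prime p this is ln |1 - omega3 / p|^2, as that square is 1 + 1 / p + 1 / p^2. *)
Definition Mp {R : realType} (n : nat) : R := if prime n then ln (1 + n%:R^-1 + n%:R^-1 ^+ 2) else 0.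

Lemma cube_inv {R : realType} n : (0 < n)%N -> n%:R^-1 * expR (- 2 * ln n%:R) = n%:R^-1 ^+ 3 :> R.
Proof.
move=> n0; have np : (0 : R) < n%:R by rewrite ltr0n.
rewrite exprS; congr (_ * _); rewrite mulNr expRN expRM_natl lnK ?posrE// exprVn//.
Qed.

Lemma Lp3_bound {R : realType} n : 0 <= Lp3 n :> R /\ (prime n -> Lp3 n <= 2 * n%:R^-1 ^+ 3 :> R).
Proof.
rewrite /Lp3; case: ifP => // pn; have [x0 x2] := @prime_inv R n pn.
rewrite cube_inv ?prime_gt0//; move: (n%:R^-1) x0 x2 => x x0 x2.
have x3 : 0 <= x ^+ 3 by rewrite exprn_ge0// ltW.
have x8 : x ^+ 3 <= 1 / 8.
  apply: le_trans (_ : _ <= (1 / 2) ^+ 3) _; last by lra.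
  by apply: lerXn2r; rewrite ?nnegrE ?(ltW x0)//; lra.
have := @neg_ln1B R (x ^+ 3) x3 ltac:(lra); move: (x ^+ 3) x3 x8 => y y0 y8 /andP[h1 h2]; split; nra.
Qed.

(** From 1 - x^3 = (1 - x) (1 + x + x^2) with x = 1 / p. Summed over primes, this is how zeta(3)
    enters the lower tail. *)
Lemma MpE {R : realType} n : Mp n = Lp n - Lp3 n :> R.
Proof.
rewrite /Mp /Lp /Lp3; case: ifP => pn; last by rewrite subr0.
have [x0 x2] := @prime_inv R n pn; rewrite cube_inv ?prime_gt0//; move: (n%:R^-1) x0 x2 => x x0 x2.
have d1 : 0 < 1 - x by lra.
have d2 : 0 < 1 + x + x ^+ 2 by have := exprn_gt0 2 x0; lra.
by rewrite (_ : 1 - x ^+ 3 = (1 - x) * (1 + x + x ^+ 2)) ?lnM ?posrE//; [ring|ring].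
Qed.

Lemma cvg_le_near {R : realType} (u : nat -> R) l a : u @ \oo --> l -> (\forall n \near \oo, u n <= a) -> l <= a.
Proof.
by move=> h H; rewrite -(cvg_lim (@Rhausdorff R) h); apply: limr_le => //; apply/cvg_ex; exists l.
Qed.

Lemma cvg_ge_near {R : realType} (u : nat -> R) l a : u @ \oo --> l -> (\forall n \near \oo, a <= u n) -> a <= l.
Proof.
by move=> h H; rewrite -(cvg_lim (@Rhausdorff R) h); apply: limr_ge => //; apply/cvg_ex; exists l.
Qed.

Lemma zeta3_ad {R : realType} : 0 < (zeta3 : R) /\ ad 2 @ \oo --> ln (zeta3 : R).
Proof.
have d2 : 0 < (2 : R) by [].
have zx : 0 < Rec (rc (2 : R)) by [].
have [h1 h2] := DzP 0 zx.
have E n : (1 <= n)%N -> fz 0 (rc (2 : R)) (ln n%:R) = rc ((n%:R ^+ 3)^-1).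
  move=> n0; have np : (0 : R) < n%:R by rewrite ltr0n.
  rewrite /fz expr0 rc1 mul1r -rc1 -rcD -rcN -rcM cexp_rc; congr rc.
  rewrite (_ : - (1 + 2) * ln n%:R = - (3%:R * ln n%:R)); last by ring.
  by rewrite expRN expRM_natl lnK ?posrE.
have SE M : Sz 0 (rc (2 : R)) M = rc (\sum_(1 <= n < M) ((n%:R : R) ^+ 3)^-1).
  rewrite /Sz (eq_big_nat _ _ (F2 := fun n => rc ((n%:R ^+ 3)^-1 : R))); last by move=> n /andP[n1 _]; exact: E.
  by apply: eq_cplx; [exact: (big_morph _ (@RecD R) erefl)|rewrite (big_morph _ (@ImcD R) erefl) big1].
have zE : (zeta3 : R) = Rec (Dz 0 (rc (2 : R))).
  apply: (cvg_lim (@Rhausdorff R)); have : (fun M => Rec (Sz 0 (rc (2 : R)) M)) = (fun N : nat => \sum_(1 <= n < N) ((n%:R : R) ^+ 3)^-1).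
    by apply/funext => M; rewrite SE.
  by move=> <-.
have iE : Imc (Dz 0 (rc (2 : R))) = 0.
  apply: (cvg_unique (@Rhausdorff R) h2); rewrite (_ : (fun n => _) = fun=> 0); first exact: cvg_cst.
  by apply/funext => M; rewrite SE.
have z1 : 1 <= (zeta3 : R).
  rewrite zE; apply: (cvg_ge_near h1); near=> M.
  have M2 : (1 < M)%N by near: M; exact: nbhs_infty_gt.
  rewrite SE /= big_ltn// expr1n invr1 lerDl; apply: sumr_ge0 => n _; by rewrite invr_ge0 exprn_ge0.
split; first by lra.
have -> : (zeta3 : R) = cmod (Dz 0 (rc (2 : R))).
  by rewrite cmodE iE expr0n addr0 -zE sqrtr_sqr ger0_norm//; lra.
exact: ad_cvg.
Unshelve. all: by end_near. Qed.

Lemma Lp3_sum {R : realType} N : (24 <= N)%N -> `|\sum_(0 <= n < N.+1) Lp3 n - ln (zeta3 : R)| <= 4 * (ll N)^-1 ^+ 2.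
Proof.
move=> N24; have [z0 h] := @zeta3_ad R.
have adE M : @ad R 2 M = \sum_(0 <= n < M) @Lp3 R n by [].
have tail M : (N < M)%N -> 0 <= @ad R 2 M - ad 2 N.+1 <= 2 * (N%:R^-1 : R).
  move=> NM; rewrite (adE M) (@big_cat_nat _ _ _ N.+1)//= -adE addrAC subrr add0r; apply/andP; split.
    by apply: sumr_ge0 => n _; case: (@Lp3_bound R n).
  case: M NM => // M NM; rewrite ltnS in NM.
  apply: le_trans (_ : _ <= 2 * \sum_(N.+1 <= n < M.+1) (n%:R : R)^-1 ^+ 2) _; last first.
    by rewrite ler_pM2l//; apply: sum_inv_sq_tail => //; exact: leq_trans N24.
  rewrite mulr_sumr; apply: ler_sum_nat => n /andP[Nn _].
  have n0 : (0 : R) <= n%:R^-1 by rewrite invr_ge0.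
  have [pn|pn] := boolP (prime n); last first.
    by rewrite /Lp3 (negbTE pn) mulr_ge0// exprn_ge0.
  have [_ /(_ pn) b] := @Lp3_bound R n; apply: le_trans b _; rewrite ler_pM2l// exprS ler_piMl ?exprn_ge0//.
  by have [_ x2] := @prime_inv R n pn; apply: le_trans x2 _; lra.
have b : `|ad 2 N.+1 - ln (zeta3 : R)| <= 2 * N%:R^-1.
  have u : ln (zeta3 : R) - ad 2 N.+1 <= 2 * N%:R^-1.
    rewrite lerBlDr; apply: (cvg_le_near h); near=> M.
    have M2 : (N < M)%N by near: M; exact: nbhs_infty_gt.
    by have /andP[_] := tail M M2; rewrite lerBlDr.
  have l : ad 2 N.+1 <= ln (zeta3 : R).
    apply: (cvg_ge_near h); near=> M.
    have M2 : (N < M)%N by near: M; exact: nbhs_infty_gt.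
    by have /andP[+ _] := tail M M2; rewrite subr_ge0.
  by rewrite ler0_norm ?subr_le0// opprB.
rewrite -adE; apply: le_trans b _; have := @nat_lnsqr_le R N ltac:(exact: leq_trans N24).
by move=> h2; rewrite (_ : 4 = 2 * 2 :> R); [rewrite -mulrA ler_pM2l|ring].
Unshelve. all: by end_near. Qed.

(** The largest value of the variable at p is [2 * Lp p]; hence cH = 2 and Gam = gamma in the upper
    tail. *)
Lemma mertens_max {R : realType} : exists2 C : R, 0 <= C & forall n, (24 <= n)%N ->
  `|\sum_(0 <= i < n.+1) Hp (fun p => 2 * Lp p) i - 2 * (ln (ll n) + euler_gamma)| <= C * (ll n)^-1 ^+ 2.
Proof.
have [c [C C0 H]] := @mertens_ex R; have cE := mertens_const H.
exists (2 * C) => [|n n24]; first by rewrite mulr_ge0// ltW.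
have -> : \sum_(0 <= i < n.+1) Hp (fun p => 2 * Lp p) i = 2 * \sum_(0 <= i < n.+1) Lp i :> R.
  by rewrite mulr_sumr; apply: eq_bigr => i _; rewrite /Hp /Lp; case: (prime i); rewrite ?mulr0.
rewrite -mulrBr normrM ger0_norm// -mulrA ler_pM2l//; apply: le_trans (H n n24).
by rewrite cE opprD addrA.
Qed.

(** The largest value of the opposite variable is [Mp p]; hence cH = 1, and the constant is shifted
    by - ln zeta(3). *)
Lemma mertens_min {R : realType} : exists2 C : R, 0 <= C & forall n, (24 <= n)%N ->
  `|\sum_(0 <= i < n.+1) Hp Mp i - 1 * (ln (ll n) + (euler_gamma - ln zeta3))| <= C * (ll n)^-1 ^+ 2.
Proof.
have [c [C C0 H]] := @mertens_ex R; have cE := mertens_const H.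
exists (C + 4) => [|n n24]; first by rewrite addr_ge0// ltW.
have -> : \sum_(0 <= i < n.+1) Hp Mp i = \sum_(0 <= i < n.+1) Lp i - \sum_(0 <= i < n.+1) Lp3 i :> R.
  by rewrite -sumrB; apply: eq_bigr => i _; rewrite -MpE /Hp /Mp; case: (prime i).
have := H n n24; have := @Lp3_sum R n n24; rewrite cE mul1r [(C + 4) * _]mulrDl.
move: (\sum_(_ <= _ < _) _) (\sum_(_ <= _ < _) _) (4 * _) (C * _) (ln _) (ln _) => a b u v l z.
rewrite !ler_norml => /andP[? ?] /andP[? ?]; apply/andP; split; lra.
Qed.

Lemma Lp_Mp_bounds {R : realType} p : prime p -> let x : R := p%:R^-1 in
  [/\ x <= @Lp R p <= x + 2 * x ^+ 2, x - x ^+ 2 <= @Mp R p <= x + x ^+ 2 & 0 <= @Lp R p - Mp p <= x ^+ 2].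
Proof.
move=> pp x; have [x0 x2] := @prime_inv R p pp; rewrite -/x in x0 x2.
have h1 : x <= Lp p <= x + 2 * x ^+ 2 by rewrite /Lp pp; apply: neg_ln1B => //; exact: ltW.
have h2 : Mp p <= x + x ^+ 2.
  rewrite /Mp pp -/x -addrA; apply: le_ln1Dx; have := exprn_gt0 2 x0; lra.
have [l3 /(_ pp)] := @Lp3_bound R p; rewrite -/x => l4.
have h3 : 2 * x ^+ 3 <= x ^+ 2 by rewrite exprS mulrA ler_piMl ?exprn_ge0 ?(ltW x0)//; lra.
have E := @MpE R p; split => //; [|apply/andP; split; lra].
move: h1 => /andP[a b]; apply/andP; split; lra.
Qed.

Lemma adm_max {R : realType} (r : nat -> R) p : prime p -> 0 <= r p <= 6 * p%:R^-1 ->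
  adm 2 p%:R^-1 (2 * Lp p) (Mp p) (r p).
Proof.
move=> pp hr; have [x0 x2] := @prime_inv R p pp; have [/andP[l1 l2] /andP[m1 m2] /andP[d1 d2]] := @Lp_Mp_bounds R p pp.
move: (p%:R^-1) (Lp p) (Mp p) x0 x2 l1 l2 m1 m2 d1 d2 hr => x l m x0 x2 l1 l2 m1 m2 d1 d2 hr.
have q1 : x ^+ 2 <= x / 2 by rewrite expr2; nra.
have q0 : 0 <= x ^+ 2 by rewrite sqr_ge0.
by split => //; rewrite ?ler_norml; apply/andP; split; lra.
Qed.

Lemma adm_min {R : realType} (r : nat -> R) p : prime p -> 0 <= r p <= 6 * p%:R^-1 ->
  adm (2^-1) p%:R^-1 (Mp p) (2 * Lp p) (r p).
Proof.
move=> pp hr; have [x0 x2] := @prime_inv R p pp; have [/andP[l1 l2] /andP[m1 m2] /andP[d1 d2]] := @Lp_Mp_bounds R p pp.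
move: (p%:R^-1) (Lp p) (Mp p) x0 x2 l1 l2 m1 m2 d1 d2 hr => x l m x0 x2 l1 l2 m1 m2 d1 d2 hr.
have q1 : x ^+ 2 <= x / 2 by rewrite expr2; nra.
have q0 : 0 <= x ^+ 2 by rewrite sqr_ge0.
by split => //; rewrite ?ler_norml; apply/andP; split; lra.
Qed.

(** * Finite products of laws *)

Definition vals {R : realType} : seq R[i] := [:: 0; 1; omega3; omega3 ^+ 2].

(* Expectation of [g] over independent values listed along [s]. *)
Fixpoint Ex {R : realType} (q : nat -> R[i] -> R) (s : seq nat) (g : seq R[i] -> R) : R :=
  if s is p :: s' then \sum_(v <- vals) q p v * Ex q s' (fun l => g (v :: l)) else g [::].

Fixpoint Ss {R : realType} (xi : nat -> R[i] -> R) (s : seq nat) (l : seq R[i]) : R :=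
  match s, l with p :: s', v :: l' => xi p v + Ss xi s' l' | _, _ => 0 end.

(** A is the normalising constant of the masses 1, rho, r. Testing against every g states the law of
    the image under [xi] without listing the values v, two of which have the same image. *)
Definition law {R : realType} (rho H L r : R) (q xi : R[i] -> R) := (forall v, v \in vals -> 0 <= q v) /\
  exists2 A, A * (1 + rho + r) = 1 & forall g : R -> R, \sum_(v <- vals) q v * g (xi v) = A * (g H + rho * g (- L) + r * g 0).

Section Tilt.
Context {R : realType}.
Variables (rho : R) (Hs Ls rs : nat -> R) (q xi : nat -> R[i] -> R).
Hypothesis rho0 : 0 < rho.
Hypothesis rr : forall p, prime p -> 0 <= rs p.
Hypothesis Hlaw : forall p, prime p -> law rho (Hs p) (Ls p) (rs p) (q p) (xi p).

Lemma Ex_le s g h : all prime s -> (forall l, g l <= h l) -> Ex q s g <= Ex q s h.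
Proof.
elim: s g h => [|p s IH] g h //= /andP[pp ps] gh.
have [q0 _] := Hlaw pp; rewrite big_seq [leRHS]big_seq; apply: ler_sum => v vv.
by apply: ler_wpM2l; [exact: q0|exact: IH].
Qed.

Lemma ExZ s g c : Ex q s (fun l => c * g l) = c * Ex q s g.
Proof.
elim: s g => [|p s IH] g //=; rewrite mulr_sumr; apply: eq_bigr => v _.
by rewrite IH mulrCA.
Qed.

Lemma ExB s g h : Ex q s (fun l => g l - h l) = Ex q s g - Ex q s h.
Proof.
by elim: s g h => [|p s IH] g h //=; rewrite -sumrB; apply: eq_bigr => v _; rewrite IH mulrBr.
Qed.

Lemma Ex_eq s g h : (forall l, g l = h l) -> Ex q s g = Ex q s h.
Proof. by move=> gh; congr (Ex q s _); apply/funext. Qed.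

Definition lmgf k p := ln (Dd rho (Hs p) (Ls p) (rs p) k) - ln (Dd rho (Hs p) (Ls p) (rs p) 0).
Definition tm k p := Tt rho (Hs p) (Ls p) (rs p) k.
Definition tv k p := Vv rho (Hs p) (Ls p) (rs p) k.

(** A general quadratic polynomial is allowed, so that one computation covers mass, mean and
    variance of the tilted law. *)
Lemma law_moments k p : prime p -> forall a b c : R,
  \sum_(v <- vals) q p v * (expR (k * xi p v) * (a * xi p v ^+ 2 + b * xi p v + c)) =
  expR (lmgf k p) * (a * (tv k p + tm k p ^+ 2) + b * tm k p + c).
Proof.
move=> pp a b c; have [_ [A A1 HA]] := Hlaw pp.
rewrite (HA (fun x => expR (k * x) * (a * x ^+ 2 + b * x + c))).
have D := Dd_gt0 (Hs p) (Ls p) k rho0 (rr pp); have D0 := Dd_gt0 (Hs p) (Ls p) 0 rho0 (rr pp).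
have d1 : 0 < 1 + rho + rs p by rewrite ltr_wpDr ?rr// addr_gt0.
have AE : A = (1 + rho + rs p)^-1 by apply: (mulIf (lt0r_neq0 d1)); rewrite A1 mulVf// gt_eqF.
have D0E : Dd rho (Hs p) (Ls p) (rs p) 0 = 1 + rho + rs p by rewrite /Dd !mul0r oppr0 expR0 mulr1.
rewrite /lmgf expRB !lnK ?posrE// D0E /tv /tm /Vv subrK /Tt AE.
rewrite !mulr0 expR0 mulrN mul1r; rewrite /Dd in D *.
by field; rewrite !gt_eqF.
Qed.

(** The free constant c carries the deviation of the values already read, which lets the induction
    on the list go through: each step adds a centred variable to c and hence its variance to c^2. *)
Lemma Ex_var k s : all prime s -> forall c,
  Ex q s (fun l => expR (k * Ss xi s l) * (c + (Ss xi s l - \sum_(p <- s) tm k p)) ^+ 2) =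
  expR (\sum_(p <- s) lmgf k p) * (c ^+ 2 + \sum_(p <- s) tv k p).
Proof.
elim: s => [|p s IH] /= ps c; first by rewrite !big_nil mulr0 expR0 subr0 !addr0.
case/andP: ps => pp ps.
have Bc (f : nat -> R) : \sum_(j <- p :: s) f j = f p + \sum_(j <- s) f j by rewrite big_cons.
rewrite !Bc.
have E v : Ex q s (fun l => expR (k * (xi p v + Ss xi s l)) * (c + (xi p v + Ss xi s l - (tm k p + \sum_(j <- s) tm k j))) ^+ 2) =
   expR (k * xi p v) * (expR (\sum_(j <- s) lmgf k j) * ((c + xi p v - tm k p) ^+ 2 + \sum_(j <- s) tv k j)).
  rewrite -(IH ps) -ExZ; apply: Ex_eq => l; rewrite mulrDr expRD -mulrA; congr (_ * (_ * _ ^+ 2)); ring.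
rewrite (eq_bigr (fun v => expR (\sum_(j <- s) lmgf k j) * (q p v * (expR (k * xi p v) * (1 * xi p v ^+ 2 + (2 * (c - tm k p)) * xi p v + ((c - tm k p) ^+ 2 + \sum_(j <- s) tv k j)))))).
  rewrite -mulr_sumr law_moments// expRD; ring.
by move=> v _; rewrite E; ring.
Qed.

Lemma Ex_mgf k s : all prime s -> Ex q s (fun l => expR (k * Ss xi s l)) = expR (\sum_(p <- s) lmgf k p).
Proof.
elim: s => [|p s IH] /=; first by rewrite big_nil mulr0.
case/andP=> pp ps; rewrite big_cons expRD.
rewrite (eq_bigr (fun v => expR (\sum_(j <- s) lmgf k j) * (q p v * (expR (k * xi p v) * (0 * xi p v ^+ 2 + 0 * xi p v + 1))))).
  by rewrite -mulr_sumr law_moments//; ring.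
move=> v _; rewrite !mul0r !add0r mulr1 mulrCA; congr (_ * _); rewrite mulrC -(IH ps) -ExZ.
by apply: Ex_eq => l; rewrite mulrDr expRD.
Qed.

Lemma Ex_chernoff (k : R) s y : 0 <= k -> all prime s ->
  Ex q s (fun l => (y < Ss xi s l)%R%:R) <= expR (\sum_(p <- s) lmgf k p - k * y).
Proof.
move=> k0 ps; rewrite addrC expRD -Ex_mgf// -ExZ; apply: Ex_le => // l.
rewrite -expRD; case: ltP => h; last exact: expR_ge0.
by rewrite -[leLHS]expR0 ler_expR addrC subr_ge0 ler_wpM2l// ltW.
Qed.

(* Chebyshev's inequality under the law tilted by [exp (k S)]. *)
Lemma Ex_tilt (k : R) s (d : R) : 0 <= k -> 0 < d -> all prime s -> \sum_(p <- s) tv k p <= d ^+ 2 / 2 ->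
  expR (\sum_(p <- s) lmgf k p - k * (\sum_(p <- s) tm k p + d)) / 2 <=
  Ex q s (fun l => (\sum_(p <- s) tm k p - d < Ss xi s l)%R%:R).
Proof.
move=> k0 d0 ps V2; set m := \sum_(p <- s) tm k p; have d2 : 0 < d ^+ 2 by rewrite exprn_gt0.
have E1 := Ex_mgf k ps; have E2 := Ex_var k ps 0; rewrite expr0n add0r -/m in E2.
(* g - h is a lower bound of the indicator: it equals e^(k (S - m - d)) (1 - (S - m)^2 / d^2), which
   is at most 0 if |S - m| >= d and at most 1 otherwise. *)
pose g l := expR (- (k * (m + d))) * expR (k * Ss xi s l).
pose h l := expR (- (k * (m + d))) / d ^+ 2 * (expR (k * Ss xi s l) * (0 + (Ss xi s l - m)) ^+ 2).
apply: (@le_trans _ _ (Ex q s (fun l => g l - h l))).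
  rewrite ExB !ExZ E1 E2 expRD [X in X / 2]mulrC.
  have V1 : (\sum_(p <- s) tv k p) / d ^+ 2 <= 1 / 2 by rewrite ler_pdivrMr//; lra.
  have e0 := mulr_gt0 (expR_gt0 (- (k * (m + d)))) (expR_gt0 (\sum_(p <- s) lmgf k p)).
  have := ler_wpM2l (ltW e0) V1.
  move: (expR (- _)) (expR (\sum_(p <- s) lmgf k p)) (\sum_(p <- s) tv k p) => a b v.
  have -> : a / d ^+ 2 * (b * v) = a * b * (v / d ^+ 2) by ring.
  by move=> hh; rewrite lerBrDr -lerBrDl; apply: le_trans hh _; rewrite mul1r {2}(splitr (a * b)) addrK.
apply: Ex_le => // l; rewrite /g /h add0r.
set S := Ss xi s l.
have -> : expR (- (k * (m + d))) * expR (k * S) - expR (- (k * (m + d))) / d ^+ 2 * (expR (k * S) * (S - m) ^+ 2) =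
  expR (k * (S - (m + d))) * (1 - (S - m) ^+ 2 / d ^+ 2).
    rewrite [k * (S - _)]mulrBr expRD; move: (expR (- _)) (expR (k * S)) => a b.
  by field; rewrite gt_eqF.
have [h1|h1] := ltP (`|S - m|) d.
  have [s1 s2] : - d < S - m /\ S - m < d by move: h1; rewrite ltr_norml => /andP.
  have -> : m - d < S by lra.
  apply: (@le_trans _ _ (expR (k * (S - (m + d))) * 1)).
    by rewrite ler_wpM2l ?expR_ge0// gerBl divr_ge0 ?sqr_ge0// ltW.
  by rewrite mulr1 -[leRHS]expR0 ler_expR mulr_ge0_le0//; lra.
apply: (@le_trans _ _ 0); last by case: ltP.
rewrite mulr_ge0_le0 ?expR_ge0// subr_le0 ler_pdivlMr// mul1r -[leRHS]real_normK ?num_real//.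
by apply: lerXn2r; rewrite ?nnegrE// ltW.
Qed.

(* Some partial sum of the centred variables, started at [c], exceeds [eta] in absolute value. *)
Fixpoint exc (eta c : R) (s : seq nat) (l : seq R[i]) : bool :=
  (eta < `|c|) || match s, l with p :: s', v :: l' => exc eta (c + (xi p v - tm 0 p)) s' l' | _, _ => false end.

Lemma Ex_cst s c : all prime s -> Ex q s (fun=> c) = c.
Proof.
move=> ps; rewrite -[c in LHS]mulr1; have := @ExZ s (fun=> 1) c => /= ->.
suff -> : Ex q s (fun=> 1) = 1 by rewrite mulr1.
elim: s ps => //= p s IH /andP[pp ps]; under eq_bigr do rewrite IH//.
have [_ [A A1 HA]] := Hlaw pp; rewrite (HA (fun=> 1)) -[RHS]A1; ring.
Qed.

Lemma tv_ge0 k s : all prime s -> 0 <= \sum_(p <- s) tv k p.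
Proof.
by move=> /allP ps; rewrite big_seq; apply: sumr_ge0 => p /ps pp; exact: Vv_ge0 rho0 (rr pp).
Qed.

(* Kolmogorov's maximal inequality, by recursion on the list thanks to the free start [c]. *)
Lemma Ex_exc (eta : R) s : 0 <= eta -> all prime s -> forall c,
  eta ^+ 2 * Ex q s (fun l => (exc eta c s l)%:R) <= c ^+ 2 + \sum_(p <- s) tv 0 p.
Proof.
move=> e0; elim: s => [|p s IH] ps c.
  rewrite big_nil addr0 /= orbF; case: ltP => h; last by rewrite mulr0 sqr_ge0.
  by rewrite mulr1 -[leRHS]real_normK ?num_real//; apply: lerXn2r; rewrite ?nnegrE// ltW.
have tvp := tv_ge0 0 ps; move: (ps) => /= /andP[pp ps'].
have [h|h] := ltP eta `|c|.
  apply: (@le_trans _ _ (c ^+ 2)); last by rewrite lerDl.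
  rewrite [X in _ * X](_ : _ = 1) ?mulr1; last exact: (Ex_cst 1 ps).
  by rewrite -[leRHS]real_normK ?num_real//; apply: lerXn2r; rewrite ?nnegrE// ltW.
rewrite mulr_sumr.
apply: (@le_trans _ _ (\sum_(v <- vals) q p v * ((c + (xi p v - tm 0 p)) ^+ 2 + \sum_(j <- s) tv 0 j))).
  have [q0 _] := Hlaw pp; rewrite big_seq [leRHS]big_seq; apply: ler_sum => v vv.
  by rewrite mulrCA; apply: ler_wpM2l; [exact: q0|exact: (IH ps')].
rewrite [\sum_(j <- p :: s) _]big_cons (eq_bigr (fun v => q p v * (expR (0 * xi p v) * (1 * xi p v ^+ 2 + (2 * (c - tm 0 p)) * xi p v + ((c - tm 0 p) ^+ 2 + \sum_(j <- s) tv 0 j))))).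
  by rewrite law_moments// /lmgf subrr expR0 le_eqVlt; apply/orP; left; apply/eqP; ring.
by move=> v _; rewrite mul0r expR0; ring.
Qed.

End Tilt.

(** * Cylinder events *)

(** From cos (3 t) = 1 at t = 2 pi / 3 one gets (cos t - 1) (2 cos t + 1)^2 = 0, and sin t > 0
    excludes cos t = 1. *)
Lemma omega3E {R : realType} : exists2 s : R, 0 < s & omega3 = Complex (- 2^-1) s /\ s ^+ 2 = 3 / 4.
Proof.
pose t : R := 2 * pi / 3; have p0 := @pi_gt0 R.
have s0 : 0 < sin t by apply: sin_gt0_pi; rewrite /t; apply/andP; split; lra.
have cs := cos2Dsin2 t.
have c3 : cos (t + t + t) = 1.
  have -> : t + t + t = pi + pi by rewrite /t; field.
  by rewrite cosD cospi sinpi; ring.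
move: c3; rewrite !cosD sinD => c3.
have c2 : (cos t - 1) * (2 * cos t + 1) ^+ 2 = 0.
  have -> : (cos t - 1) * (2 * cos t + 1) ^+ 2 = (cos t * cos t - sin t * sin t) * cos t - (sin t * cos t + cos t * sin t) * sin t - 1
     + 3 * cos t * (cos t ^+ 2 + sin t ^+ 2 - 1) by ring.
  by rewrite c3 cs; ring.
have ct : cos t = - 2^-1.
  move/eqP: c2; rewrite mulf_eq0 expf_eq0 /= => /orP[/eqP h|/eqP h]; last by lra.
  exfalso; have : cos t = 1 by lra.
  move=> h1; move: cs; rewrite h1 => h2; have : sin t ^+ 2 = 0 by lra.
  by move/eqP; rewrite expf_eq0 /= gt_eqF.
exists (sin t) => //; split; first by rewrite /omega3 -/t ct.
by move: cs; rewrite ct; lra.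
Qed.

Lemma omega3_sqr {R : realType} (s : R) : omega3 = Complex (- 2^-1) s -> s ^+ 2 = 3 / 4 -> omega3 ^+ 2 = Complex (- 2^-1) (- s).
Proof.
move=> -> h; have h2 : s * s = 3 / 4 by rewrite -expr2.
by rewrite expr2; apply: eq_cplx; rewrite !reimE /=; [rewrite h2; field|field].
Qed.

Lemma vals_uniq {R : realType} : uniq (@vals R).
Proof.
have [s s0 [oE s2]] := @omega3E R; have oE2 := omega3_sqr oE s2.
rewrite /vals oE2 oE /= !inE !negb_or andbT -!andbA.
by apply/and5P; split; rewrite ?andbT; repeat (apply/andP; split); apply/eqP => -[]; lra.
Qed.

Section Bridge.
Context {R : realType} {d : measure_display} {T : measurableType d}.
Variables (P : probability T R) (X : nat -> T -> R[i]).
Hypothesis Xrange : forall p w, prime p -> X p w \in vals.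
Hypothesis Xmeas : forall p v, prime p -> measurable (X p @^-1` [set v]).
Hypothesis Xindep : indep_primes P X.

Definition qX p v : R := fine (P (X p @^-1` [set v])).

Lemma qXE p v : prime p -> P (X p @^-1` [set v]) = (qX p v)%:E.
Proof. by move=> pp; rewrite fineK// fin_num_measure//; exact: Xmeas. Qed.

(** Independence is given only for prescribed values at finitely many primes. The event is split
    according to the value at the next prime, which moves into the prefix [pre]; once the list is
    exhausted the hypothesis applies. *)
Lemma bridge_prefix s : forall pre v (B : seq R[i] -> bool), uniq (pre ++ s) -> all prime (pre ++ s) ->
  let E := (\bigcap_(p in [set` pre]) (X p @^-1` [set v p])) `&` [set w | B [seq X p w | p <- s]] in
  measurable E /\ P E = (\prod_(p <- pre) qX p (v p) * Ex qX s (fun l => (B l)%:R))%:E.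
Proof.
elim: s => [|p s IH] pre v B us ps E.
  rewrite cats0 in us ps.
  have mA : measurable (\bigcap_(p in [set` pre]) (X p @^-1` [set v p])).
    by apply: fin_bigcap_measurable => // p /= pin; apply: Xmeas; exact: (allP ps).
  have PA : P (\bigcap_(p in [set` pre]) (X p @^-1` [set v p])) = (\prod_(p <- pre) qX p (v p))%:E.
    rewrite Xindep// (big_morph EFin (@EFinM R) erefl); apply: eq_big_seq => p pin.
    by apply: qXE; exact: (allP ps).
  have [hB|hB] := boolP (B [::]).
    have -> : E = \bigcap_(p in [set` pre]) (X p @^-1` [set v p]) by apply/seteqP; split => w; [case|].
    by rewrite /= hB mulr1.
  have -> : E = set0 by apply/seteqP; split => w // [_]; rewrite /= (negbTE hB).
  by rewrite /= (negbTE hB) mulr0 measure0.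
pose v' u p' := if p' == p then u else v p'.
have pm : perm_eq (pre ++ p :: s) ((p :: pre) ++ s) by rewrite (perm_catCA pre [:: p] s).
have us' : uniq ((p :: pre) ++ s) by rewrite -(perm_uniq pm).
have ps' : all prime ((p :: pre) ++ s) by rewrite -(perm_all _ pm).
have pp : prime p by case/andP: ps'.
have pn p' : p' \in pre -> p' == p = false.
  by move=> pin; apply/negbTE/eqP => e; move: us' => /= /andP[/negP]; rewrite mem_cat -e pin.
pose F u := (\bigcap_(p' in [set` p :: pre]) (X p' @^-1` [set v' u p'])) `&` [set w | B (u :: [seq X p w | p <- s])].
have IHu u := IH (p :: pre) (v' u) (fun l => B (u :: l)) us' ps'.
have FX u w : F u w -> X p w = u.
  by case=> h _; have := h p (mem_head _ _); rewrite /= /v' eqxx.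
have EF : E = \bigcup_(u in [set` vals]) F u.
  apply/seteqP; split => w.
    case=> h1 h2; exists (X p w) => /=; first exact: Xrange.
    split=> // p' /=; rewrite inE => /orP[/eqP ->|pin]; first by rewrite /v' eqxx.
    by rewrite /v' pn//; exact: h1.
  case=> u uin Fw; have Xu := FX u w Fw; case: Fw => h1 h2; split; last by rewrite /= Xu.
  move=> p' pin /=; have pin2 : p' \in p :: pre by rewrite inE pin orbT.
  by have := h1 p' pin2; rewrite /= /v' pn.
have tF : trivIset [set` vals] F.
  by move=> u u' _ _ [w [/FX <- /FX <-]].
have mF u : [set` vals] u -> measurable (F u) by move=> _; case: (IHu u).
split; first by rewrite EF; apply: fin_bigcup_measurable => //; exact: finite_seq.
transitivity (\sum_(u <- vals) P (F u))%E.
  have fs : finite_set [set` @vals R] by exact: finite_seq.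
  have H := @measure_fin_bigcup _ _ _ P _ _ F fs tF mF; rewrite EF H.
  by symmetry; apply: fsbig_seq; exact: vals_uniq.
rewrite (eq_bigr (fun u => (qX p u * (\prod_(p <- pre) qX p (v p) * Ex qX s (fun l => (B (u :: l))%:R)))%:E)).
  by rewrite sumEFin /= mulr_sumr; congr EFin; apply: eq_bigr => u _; rewrite mulrCA.
move=> u _; have [_ ->] := IHu u; congr EFin; rewrite mulrA; congr (_ * _).
rewrite big_cons /v' eqxx; congr (_ * _); apply: eq_big_seq => p' pin.
by rewrite pn.
Qed.

Lemma bridge s (B : seq R[i] -> bool) : uniq s -> all prime s ->
  measurable [set w | B [seq X p w | p <- s]] /\ P [set w | B [seq X p w | p <- s]] = (Ex qX s (fun l => (B l)%:R))%:E.
Proof.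
move=> us ps; have [h1 h2] := @bridge_prefix s [::] (fun=> 0) B us ps.
by rewrite big_nil mul1r set_nil bigcap_set0 setTI in h1 h2.
Qed.

Definition prs m n := [seq p <- index_iota m n | prime p].

Lemma prs_uniq m n : uniq (prs m n).
Proof. by rewrite filter_uniq// iota_uniq. Qed.

Lemma prs_prime m n : all prime (prs m n).
Proof. exact: filter_all. Qed.

Lemma prs_cat m n k : (m <= n)%N -> (n <= k)%N -> prs m k = prs m n ++ prs n k.
Proof.
move=> mn nk; rewrite /prs -filter_cat /index_iota; congr [seq p <- _ | prime p].
have -> : (k - m = (n - m) + (k - n))%N by lia.
by rewrite iotaD; congr (_ ++ iota _ _); lia.
Qed.

Lemma big_prs (f : nat -> R) m n : \sum_(p <- prs m n) f p = \sum_(m <= p < n | prime p) f p.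
Proof. by rewrite big_filter. Qed.

Lemma Ss_sum (xi : nat -> R[i] -> R) s w : Ss xi s [seq X p w | p <- s] = \sum_(p <- s) xi p (X p w).
Proof. by elim: s => [|p s IH] /=; rewrite ?big_nil// big_cons IH. Qed.

Lemma exc_prefix rho Hs Ls rs (xi : nat -> R[i] -> R) eta s1 s2 w : forall c,
  eta < `|c + \sum_(p <- s1) (xi p (X p w) - tm rho Hs Ls rs 0 p)| ->
  exc rho Hs Ls rs xi eta c (s1 ++ s2) [seq X p w | p <- s1 ++ s2].
Proof.
elim: s1 => [|p s1 IH] c /=; first by rewrite big_nil addr0 => h; case: s2 => [|? ?] /=; rewrite h.
by rewrite big_cons addrA => /IH ->; rewrite orbT.
Qed.

Lemma exc_cat rho Hs Ls rs (xi : nat -> R[i] -> R) eta s1 s2 w : forall c,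
  exc rho Hs Ls rs xi eta c s1 [seq X p w | p <- s1] ->
  exc rho Hs Ls rs xi eta c (s1 ++ s2) [seq X p w | p <- s1 ++ s2].
Proof.
elim: s1 => [|p s1 IH] c /=; first by rewrite orbF => h; case: s2 => [|? ?] /=; rewrite h.
by case/orP => [->//|/IH ->]; rewrite orbT.
Qed.

End Bridge.

(** * The random Euler product *)

(** The factor 2 avoids the square root in |1 - v / p|; sg is 1 for the upper tail and - 1 for the
    lower one. *)
Definition xi {R : realType} (sg : R) (p : nat) (v : R[i]) : R := sg * 2 * ln (cmod ((1 - v / Complex p%:R 0)^-1)).

(** Mass at 0 relative to that of a single cube root of unity: 2 / (p + 2) divided by p / (3 (p +
    2)) is 6 / p. *)
Definition rq {R : realType} (p : nat) : R := if (p %% 3 == 1)%N then 6 * p%:R^-1 else 0.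

Lemma rq_bound {R : realType} p : 0 <= @rq R p <= 6 * p%:R^-1.
Proof. by rewrite /rq; case: ifP => _; rewrite ?lexx ?andbT ?andTb mulr_ge0// invr_ge0. Qed.

Lemma vals_Re_le1 {R : realType} (v : R[i]) : v \in vals -> complex.Re v <= 1.
Proof.
have [s s0 [oE s2]] := @omega3E R; have oE2 := omega3_sqr oE s2.
rewrite /vals !inE => /or4P[] /eqP ->; rewrite ?oE2 ?oE /=; [exact: ler01|exact: lexx|lra|lra].
Qed.

Lemma factor_sq {R : realType} (x a b : R) : cmod (1 - Complex a b / Complex (x^-1) 0) ^+ 2 = (1 - a * x) ^+ 2 + b ^+ 2 * x ^+ 2.
Proof.
have -> : (Complex (x^-1) 0)^-1 = rc x by rewrite -[Complex _ _]/(rc x^-1) rcV invrK.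
by rewrite cmod_sqr !reimE /=; ring.
Qed.

Lemma factor_gt0 {R : realType} p (v : R[i]) : prime p -> v \in vals -> 0 < cmod ((1 - v / Complex (p%:R : R) 0)^-1).
Proof.
move=> pp /vals_Re_le1 v1; have [x0 x2] := @prime_inv R p pp; rewrite cmodV invr_gt0 cmod_gt0; apply/eqP => h.
case: v v1 h => a b /= a1; rewrite -[p%:R]invrK => h.
have := factor_sq (p%:R^-1) a b; rewrite h cmod0 expr0n /= => /esym/eqP.
have b2 : 0 <= b ^+ 2 * (p%:R^-1) ^+ 2 by rewrite mulr_ge0 ?sqr_ge0.
rewrite paddr_eq0 ?sqr_ge0// => /andP[]; rewrite sqrf_eq0 => /eqP h2 _.
move: (p%:R^-1) x0 x2 h2 => x x0 x2 h2; have : a * x <= 1 * x by rewrite ler_pM2r.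
lra.
Qed.

Lemma xi_sq {R : realType} sg p (a b : R) c : prime p -> Complex a b \in vals -> (1 - a * p%:R^-1) ^+ 2 + b ^+ 2 * p%:R^-1 ^+ 2 = c ->
  xi sg p (Complex a b) = - (sg * ln c).
Proof.
move=> pp vv <-; have c0 := factor_gt0 pp vv; rewrite -factor_sq invrK /xi.
move: c0; rewrite cmodV invr_gt0 => c0; rewrite lnV ?posrE// lnXn// -mulr_natl; ring.
Qed.

Lemma xi_vals {R : realType} (sg : R) p : prime p ->
  [/\ xi sg p 0 = 0, xi sg p 1 = sg * (2 * Lp p), xi sg p omega3 = - (sg * Mp p) & xi sg p (omega3 ^+ 2) = - (sg * Mp p)].
Proof.
move=> pp; have [s s0 [oE s2]] := @omega3E R; have oE2 := omega3_sqr oE s2.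
have [x0 x2] := @prime_inv R p pp.
have i0 : (0 : R[i]) \in vals by rewrite inE eqxx.
have i1 : (1 : R[i]) \in vals by rewrite !inE eqxx orbT.
have i2 : (omega3 : R[i]) \in vals by rewrite !inE eqxx !orbT.
have i3 : (omega3 ^+ 2 : R[i]) \in vals by rewrite !inE eqxx !orbT.
split.
- by rewrite (@xi_sq _ sg p 0 0 1 pp i0) ?ln1 ?mulr0 ?oppr0//; ring.
- rewrite (@xi_sq _ sg p 1 0 ((1 - p%:R^-1) ^+ 2) pp i1); last by ring.
  by rewrite lnXn ?subr_gt0; [rewrite /Lp pp -mulr_natl; ring|lra].
- by rewrite oE in i2 *; rewrite (@xi_sq _ sg p _ _ (1 + p%:R^-1 + p%:R^-1 ^+ 2) pp i2) ?/Mp ?pp// s2; field; rewrite pnatr_eq0 -lt0n prime_gt0.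
- by rewrite oE2 in i3 *; rewrite (@xi_sq _ sg p _ _ (1 + p%:R^-1 + p%:R^-1 ^+ 2) pp i3) ?/Mp ?pp// sqrrN s2; field; rewrite pnatr_eq0 -lt0n prime_gt0.
Qed.

Lemma Tt0_le {R : realType} (rho x H L r : R) : 0 < rho -> adm rho x H L r -> `|Tt rho H L r 0| <= 6 * x ^+ 2.
Proof.
move=> r0 [_ _ _ dl /andP[rr _]]; rewrite /Tt !mul0r oppr0 expR0 !mulr1; have d := Dd_gt0 H L 0 r0 rr.
have d1 : 1 <= Dd rho H L r 0 by have := Dd_gt H L 0 r0 rr; rewrite mul0r expR0; exact: ltW.
rewrite normrM normfV (gtr0_norm d) ler_pdivrMr//; apply: le_trans (_ : _ <= 6 * x ^+ 2) _.
  by rewrite -normrN opprB.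
by rewrite ler_peMr// mulr_ge0// sqr_ge0.
Qed.

Section Prob.
Context {R : realType} {d : measure_display} {T : measurableType d}.
Variables (P : probability T R) (X : nat -> T -> R[i]).
Hypothesis Xrange : forall p w, prime p -> X p w \in vals.
Hypothesis Xmeas : forall p v, prime p -> measurable (X p @^-1` [set v]).
Hypothesis Xlaw23 : forall p, prime p -> (p %% 3 = 2)%N \/ p = 3%N ->
     P (X p @^-1` [set 0]) = 0%E /\
     forall v, v \in [:: 1; omega3; omega3 ^+ 2] ->
       P (X p @^-1` [set v]) = (3^-1 : R)%:E.
Hypothesis Xlaw1 : forall p, prime p -> (p %% 3 = 1)%N ->
     P (X p @^-1` [set 0]) = (2 / (p%:R + 2) : R)%:E /\
     forall v, v \in [:: 1; omega3; omega3 ^+ 2] ->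
       P (X p @^-1` [set v]) = (p%:R / (3 * (p%:R + 2)) : R)%:E.
Hypothesis Xindep : indep_primes P X.

Lemma q_law p : prime p -> exists a : R, [/\ 0 <= a, a * (3 + rq p) = 1, qX P X p 0 = a * rq p &
  [/\ qX P X p 1 = a, qX P X p omega3 = a & qX P X p (omega3 ^+ 2) = a]].
Proof.
move=> pp; have p0 : (0 : R) < p%:R by rewrite ltr0n prime_gt0.
have m1 : (1 : R[i]) \in [:: 1; omega3; omega3 ^+ 2] by rewrite inE eqxx.
have m2 : (omega3 : R[i]) \in [:: 1; omega3; omega3 ^+ 2] by rewrite !inE eqxx orbT.
have m3 : (omega3 ^+ 2 : R[i]) \in [:: 1; omega3; omega3 ^+ 2] by rewrite !inE eqxx !orbT.
have [/eqP p1|p1] := boolP (p %% 3 == 1)%N.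
  have [h0 h] := Xlaw1 pp p1; exists (p%:R / (3 * (p%:R + 2))).
  have p2 : (0 : R) < p%:R + 2 by rewrite addr_gt0.
  rewrite /rq p1 /= /qX h0 !h//=; split; [by apply: divr_ge0 => //; apply: mulr_ge0 => //; exact: ltW|by field; rewrite !gt_eqF|by field; rewrite !gt_eqF|by []].
have [|h0 h] := Xlaw23 pp.
  have : (p %% 3 < 3)%N by rewrite ltn_mod.
  case E : (p %% 3)%N p1 => [|[|[|]]]//= _ _; [right|by left].
  by apply/esym/eqP; rewrite -(dvdn_prime2 _ pp)// /dvdn E.
exists 3^-1; rewrite /rq (negbTE p1) /qX h0 !h//= mulr0 addr0; split => //; rewrite ?invr_ge0//.
by rewrite mulVf.
Qed.

Lemma big_vals (f : R[i] -> R) : \sum_(v <- vals) f v = f 0 + (f 1 + (f omega3 + f (omega3 ^+ 2))).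
Proof. by rewrite /vals !big_cons big_nil addr0. Qed.

Lemma q_ge0 p v : prime p -> v \in vals -> 0 <= qX P X p v.
Proof. by move=> pp _; apply: fine_ge0. Qed.

(** The two values [omega3] and [omega3 ^+ 2] are both sent to - [Mp p], hence rho = 2. *)
Lemma law_max p : prime p -> law 2 (2 * Lp p) (Mp p) (rq p) (qX P X p) (xi 1 p).
Proof.
move=> pp; have [a [a0 a1 q0 [q1 q2 q3]]] := q_law pp; have [x0 x1 x2 x3] := @xi_vals R 1 p pp.
split=> [v vv|]; first exact: q_ge0.
exists a => [|g]; first by rewrite -[RHS]a1; ring.
by rewrite big_vals x0 x1 x2 x3 q0 q1 q2 q3 !mul1r; ring.
Qed.

(** After the change of sign the doubled mass sits at the top value [Mp p]; normalising it to 1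
    halves the two other masses. *)
Lemma law_min p : prime p -> law 2^-1 (Mp p) (2 * Lp p) (rq p / 2) (qX P X p) (xi (-1) p).
Proof.
move=> pp; have [a [a0 a1 q0 [q1 q2 q3]]] := q_law pp; have [x0 x1 x2 x3] := @xi_vals R (-1) p pp.
split=> [v vv|]; first exact: q_ge0.
exists (2 * a) => [|g]; first by rewrite -[RHS]a1; field.
by rewrite big_vals x0 x1 x2 x3 q0 q1 q2 q3 !mulN1r opprK; field.
Qed.

Definition SX sg N w : R := \sum_(p <- prs 0 N) xi sg p (X p w).

Lemma partialL_SX N w : partialL X N w = expR (SX 1 N w / 2).
Proof.
rewrite /partialL cmod_prod /SX mulr_suml expR_sum big_filter /index_iota subn0 -(big_mkord prime (fun p => cmod ((1 - X p w / Complex (p%:R) 0)^-1))).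
rewrite /index_iota subn0; apply: eq_bigr => p pp; rewrite /xi mul1r mulrAC mulfV// mul1r lnK ?posrE//.
exact: factor_gt0 pp (Xrange w pp).
Qed.

Lemma SX_opp N w : SX (-1) N w = - SX 1 N w.
Proof. by rewrite /SX -sumrN; apply: eq_bigr => p _; rewrite /xi; ring. Qed.

Lemma SX_event sg N (y : R) : measurable [set w | y < SX sg N w] /\
  P [set w | y < SX sg N w] = (Ex (qX P X) (prs 0 N) (fun l => (y < Ss (xi sg) (prs 0 N) l)%R%:R))%:E.
Proof.
have [h1 h2] := bridge Xrange Xmeas Xindep (fun l => y < Ss (xi sg) (prs 0 N) l) (prs_uniq 0 N) (prs_prime 0 N).
have E : [set w | y < SX sg N w] = [set w | y < Ss (xi sg) (prs 0 N) [seq X p w | p <- prs 0 N]].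
  by apply/seteqP; split => w /=; rewrite Ss_sum.
by rewrite E.
Qed.

(** A partial product depends on finitely many coordinates with finitely many values, so the
    preimage of any set is a cylinder event. *)
Lemma partialL_meas N : measurable_fun setT (fun w => (partialL X N w)%:E).
Proof.
apply/measurable_EFinP => _ Y mY; rewrite setTI.
have [h1 _] := bridge Xrange Xmeas Xindep (fun l => `[< Y (expR (Ss (xi 1) (prs 0 N) l / 2)) >]) (prs_uniq 0 N) (prs_prime 0 N).
rewrite (_ : _ @^-1` Y = [set w | `[< Y (expR (Ss (xi 1) (prs 0 N) [seq X p w | p <- prs 0 N] / 2)) >]])//.
by apply/seteqP; split => w /=; rewrite Ss_sum partialL_SX; [move=> h; apply/asboolP|move/asboolP].
Qed.

Lemma absL_meas : measurable_fun setT (absL X).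
Proof. apply: measurable_fun_limn_esup => n; exact: partialL_meas. Qed.

(** D says that some partial sum of the centred variables beyond n exceeds eta. Its probability is
    bounded by Kolmogorov's inequality on each finite block, then by monotone limit. The constant
    300 is that of [Vv_le] at k = 0, and 6 / n bounds the sum of the means. *)
Lemma tail_event sg rho Hs Ls rs (eta : R) n : 0 < rho -> rho <= 2 -> 0 < eta -> (0 < n)%N ->
  (forall p, prime p -> adm rho p%:R^-1 (Hs p) (Ls p) (rs p)) ->
  (forall p, prime p -> law rho (Hs p) (Ls p) (rs p) (qX P X p) (xi sg p)) ->
  exists D : set T, [/\ measurable D, (P D <= (300 * n%:R^-1 / eta ^+ 2)%:E)%E &
    forall w, ~ D w -> forall M, (n < M)%N -> `|SX sg M w - SX sg n.+1 w| <= eta + 6 * n%:R^-1].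
Proof.
move=> r0 r2 e0 n0 Had Hlaw.
have rr p : prime p -> 0 <= rs p by move=> pp; have [_ _ _ _ /andP[]] := Had p pp.
pose F K := [set w | exc rho Hs Ls rs (xi sg) eta 0 (prs n.+1 (n.+1 + K)) [seq X p w | p <- prs n.+1 (n.+1 + K)]].
have BF K := bridge Xrange Xmeas Xindep (exc rho Hs Ls rs (xi sg) eta 0 (prs n.+1 (n.+1 + K))) (prs_uniq n.+1 (n.+1 + K)) (prs_prime n.+1 (n.+1 + K)).
have mF K : measurable (F K) by case: (BF K).
have sumx (f : nat -> R) c M : 0 <= c -> (forall p, prime p -> f p <= c * p%:R^-1 ^+ 2) -> (n <= M)%N -> \sum_(p <- prs n.+1 M.+1) f p <= c * n%:R^-1.
  move=> c0 hf nM; rewrite big_prs; apply: (@le_trans _ _ (c * \sum_(n.+1 <= p < M.+1) (p%:R : R)^-1 ^+ 2)).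
    rewrite mulr_sumr big_mkcond; apply: ler_sum => p _; case: ifP => [/hf//|_].
    by rewrite mulr_ge0// sqr_ge0.
  by rewrite ler_wpM2l//; exact: sum_inv_sq_tail.
have PF K : (P (F K) <= (300 * n%:R^-1 / eta ^+ 2)%:E)%E.
  have [_ ->] := BF K; rewrite lee_fin ler_pdivlMr ?exprn_gt0// mulrC.
  apply: le_trans (@Ex_exc R rho Hs Ls rs (qX P X) (xi sg) r0 rr Hlaw eta _ (ltW e0) (prs_prime _ _) 0) _.
  rewrite expr0n add0r addSn; apply: sumx; [exact: ler0n| |exact: leq_addr].
  move=> p pp; have [x0 x2] := @prime_inv R p pp.
  by have := Vv_le r0 r2 x0 x2 (lexx 0) (Had p pp); rewrite !mul0r oppr0 expR0 mulr1.
exists (\bigcup_K F K); have mD : measurable (\bigcup_K F K) by exact: bigcup_measurable.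
split => //.
  have nd : nondecreasing_seq F.
    move=> i j ij; apply/subsetPset => w; rewrite /F /= (@prs_cat n.+1 (n.+1 + i) (n.+1 + j)) ?leq_addr ?leq_add2l//.
    exact: exc_cat.
  have h := @nondecreasing_cvg_mu _ _ R P F mF mD nd; rewrite -(cvg_lim (@ereal_hausdorff R) h).
  by apply: lime_le; [apply/cvg_ex; eexists; exact: h|apply: nearW => K; exact: PF].
move=> w wD M nM; have NF K : ~ F K w by move=> h; apply: wD; exists K.
have ME : prs 0 M = prs 0 n.+1 ++ prs n.+1 M by apply: prs_cat.
rewrite /SX ME big_cat /= addrAC subrr add0r.
have -> : \sum_(p <- prs n.+1 M) xi sg p (X p w) = \sum_(p <- prs n.+1 M) (xi sg p (X p w) - tm rho Hs Ls rs 0 p) + \sum_(p <- prs n.+1 M) tm rho Hs Ls rs 0 p.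
  by rewrite -big_split; apply: eq_bigr => p _; rewrite /= subrK.
apply: le_trans (ler_normD _ _) _; apply: lerD.
  rewrite leNgt; apply/negP => h; apply: (NF (M - n.+1)%N); rewrite /F /= subnKC//.
  have := @exc_prefix R d T X rho Hs Ls rs (xi sg) eta (prs n.+1 M) [::] w 0; rewrite add0r cats0; exact.
case: M nM {ME} => // M nM; apply: le_trans (ler_norm_sum _ _ _) _; apply: sumx => // p pp.
exact: Tt0_le (Had p pp).
Qed.

Lemma absL_between w n (a b : R) : (forall M, (n < M)%N -> a <= partialL X M w <= b) -> (a%:E <= absL X w)%E /\ (absL X w <= b%:E)%E.
Proof.
move=> H; rewrite /absL limn_esup_lim; set u := fun N => (partialL X N w)%:E.
have cu : cvgn (esups u) by exact: is_cvg_esups.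
split.
  apply: lime_ge => //; near=> m; apply: (@le_trans _ _ (u (maxn n.+1 m))).
    by rewrite lee_fin; case/andP: (H (maxn n.+1 m) (leq_maxl _ _)).
  by apply: ereal_sup_ubound; exists (maxn n.+1 m) => //=; exact: leq_maxr.
apply: lime_le => //; near=> m; have nm : (n < m)%N by near: m; exact: nbhs_infty_gt.
apply: ub_ereal_sup => _ [j /= mj <-]; rewrite lee_fin.
by case/andP: (H j (leq_trans nm mj)).
Unshelve. all: by end_near. Qed.

End Prob.

(** * Tail probabilities *)

(** Chernoff exponent at k = e^(t - c), with U = t - c. The term k cH (ln U - ln t) is about - cH c
    k / t, and together with cH (c - 1) k / U it leaves - cH k / t. Lowering the threshold by
    t^(-2), as a margin for the tail of the product, costs only a relative O(1 / t). *)
Lemma upper_exp {R : realType} (cH Gam c C : R) (Fc : nat -> R -> R) : 0 < cH -> 0 < C ->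
  (forall k, expR 48 <= k -> forall N, k ^+ 2 <= N%:R ->
   `|Fc N k - (cH * k * (ln (ln k) + Gam) + cH * (c - 1) * k / ln k)| <= C * k / ln k ^+ 2) ->
  exists2 K : R, 0 < K & exists2 t0 : R, 1 <= t0 & forall t, t0 <= t -> forall N, expR (t - c) ^+ 2 <= N%:R ->
    Fc N (expR (t - c)) - expR (t - c) * (cH * (ln t + Gam) - t^-1 ^+ 2) <= - (cH * expR (t - c) / t) * (1 - K / t).
Proof.
move=> cH0 C0 H; have n0 := normr_ge0 (c * (c - 1)); have n1 := normr_ge0 c.
pose K := (2 * cH * `|c * (c - 1)| + 4 * C + 1) / cH.
have KE : cH * K = 2 * cH * `|c * (c - 1)| + 4 * C + 1 by rewrite /K mulrCA mulfV ?mulr1// gt_eqF.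
have K0 : 0 < K by rewrite divr_gt0// addr_gt0 ?ltr01// ltr_wpDl ?mulr_gt0// mulr_ge0// mulr_ge0// ltW.
exists K => //; exists (48 + 2 * `|c|) => [|t tt N]; first by lra.
have cc := ler_norm c; have U48 : 48 <= t - c by lra.
have t0 : 0 < t by lra.
have U0 : 0 < t - c by lra.
have Ut : t <= 2 * (t - c) by lra.
move=> kN; have := H (expR (t - c)) _ N kN; rewrite ler_expR => /(_ U48).
rewrite expRK; set k := expR _; set U := t - c in U48 U0 Ut *; have k0 : 0 < k by exact: expR_gt0.
rewrite ler_norml => /andP[_ h].
have lU : ln U <= ln t - c / t.
  have -> : U = t * (1 + - (c / t)) by rewrite /U; field; rewrite gt_eqF.
  have h1 : - (c / t) > -1 by rewrite ltrN2 ltr_pdivrMr//; lra.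
  by rewrite lnM ?posrE//; [rewrite lerD2l; exact: le_ln1Dx|lra].
pose i := t^-1; pose j := U^-1.
have i0 : 0 < i by rewrite invr_gt0.
have j0 : 0 < j by rewrite invr_gt0.
have ji : j <= 2 * i.
  by rewrite /i /j -[U^-1]div1r ler_pdivrMr// -mulrA [i * U]mulrC mulrA ler_pdivlMr ?mul1r.
have jE : j = i + c * i * j by rewrite /i /j /U; field; rewrite !gt_eqF.
rewrite -/i.
have h2 : k * (cH * (ln U + Gam) + cH * (c - 1) * j + C * j ^+ 2) = cH * k * (ln U + Gam) + cH * (c - 1) * k / U + C * k / U ^+ 2.
  by rewrite /j; field; rewrite gt_eqF.
have b1 : cH * (ln U + Gam) <= cH * (ln t - c * i + Gam) by rewrite ler_pM2l// lerD2r.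
have b2 : cH * (c - 1) * j <= cH * (c - 1) * i + cH * `|c * (c - 1)| * (2 * i ^+ 2).
  rewrite {1}jE mulrDr lerD2l.
  have -> : cH * (c - 1) * (c * i * j) = cH * ((c * (c - 1)) * (i * j)) by ring.
  rewrite -[leRHS]mulrA ler_pM2l//; apply: (@le_trans _ _ (`|c * (c - 1)| * (i * j))).
    by rewrite ler_wpM2r ?ler_norm// mulr_ge0// ltW.
  by rewrite ler_wpM2l// expr2 mulrCA ler_pM2l.
have b3 : C * j ^+ 2 <= C * (4 * i ^+ 2).
  by rewrite ler_pM2l// (_ : 4 * i ^+ 2 = (2 * i) ^+ 2); [apply: lerXn2r; rewrite ?nnegrE; lra|ring].
have b4 : cH * (ln U + Gam) + cH * (c - 1) * j + C * j ^+ 2 <= cH * (ln t + Gam) - cH * i + (cH * K - 1) * i ^+ 2.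
  rewrite KE; move: b1 b2 b3; move: (cH * (ln U + Gam)) (cH * (c - 1) * j) (C * j ^+ 2) => x y z; lra.
have b5 := ler_wpM2l (ltW k0) b4; rewrite h2 in b5.
move: h b5; rewrite -exprVn -/j; clear; move: (Fc N k) (ln U) (ln t) (j) (i) (K) (k) => *; lra.
Qed.

(** The shift B / t of ln k makes the tilted mean exceed the threshold by 2 t^(-2): one t^(-2) is
    spent on Chebyshev's inequality, the other on the tail of the product. The final - 1 pays for
    the factor 1/2 in [Ex_tilt]. *)
Lemma lower_exp {R : realType} (cH Gam c C : R) (Fc m v : nat -> R -> R) : 0 < cH -> 0 < C ->
  (forall k, expR 48 <= k -> forall N, k ^+ 2 <= N%:R ->
   `|Fc N k - (cH * k * (ln (ln k) + Gam) + cH * (c - 1) * k / ln k)| <= C * k / ln k ^+ 2) ->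
  (forall k, expR 48 <= k -> forall N, k ^+ 2 <= N%:R ->
   `|m N k - cH * (ln (ln k) + Gam + c / ln k)| <= C / ln k ^+ 2 /\ v N k <= C * expR (- (1 / 2) * ln k)) ->
  exists2 K : R, 0 < K & exists2 t0 : R, 1 <= t0 & forall t, t0 <= t -> exists2 k : R, 0 < k & forall N, k ^+ 2 <= N%:R ->
    [/\ v N k <= (t^-1 ^+ 2) ^+ 2 / 2, cH * (ln t + Gam) + t^-1 ^+ 2 <= m N k - t^-1 ^+ 2 &
     - (cH * expR (t - c) / t) * (1 + K / t) <= Fc N k - k * (m N k + t^-1 ^+ 2) - 1].
Proof.
move=> cH0 C0 HF Hm; have n1 := normr_ge0 c.
pose a := `|c| + 1; have a0 : 0 < a by rewrite ltr_wpDl.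
(* Raising ln k by B / t raises the mean by about cH B / t^2. This has to cover the desired 2 / t^2,
   the error 4 C / t^2, and the quadratic terms of the expansions of ln U and 1 / U. *)
pose B := (2 + 4 * C) / cH + 2 * a ^+ 2 + 2 * `|c| * a.
have BE : cH * (B - 2 * a ^+ 2 - 2 * `|c| * a) = 2 + 4 * C by rewrite /B; field; rewrite gt_eqF.
have B0 : 0 < B.
  have y1 : 0 < (2 + 4 * C) / cH by rewrite divr_gt0// addr_gt0// mulr_gt0.
  have y2 : 0 <= 2 * a ^+ 2 by rewrite mulr_ge0// sqr_ge0.
  have y3 : 0 <= 2 * `|c| * a by rewrite mulr_ge0 ?(ltW a0)// mulr_ge0.
  by move: y1 y2 y3; rewrite /B; clear; lra.
pose G := 2 * a + (8 * C + 1) / cH.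
have GE : cH * G = 2 * a * cH + (8 * C + 1) by rewrite /G; field; rewrite gt_eqF.
have G0 : 0 < G.
  by apply: addr_gt0; [exact: mulr_gt0|apply: divr_gt0 => //; apply: addr_gt0 => //; exact: mulr_gt0].
pose K := 2 * B + G + 2 * B * G + 1.
have BG : 0 < B * G by rewrite mulr_gt0.
exists K; first by rewrite /K; move: BG B0 G0; clear; lra.
have [f5 f50 f5E] : exists2 f5 : R, 0 <= f5 & f5 = 5`!%:R by eexists; [|reflexivity]; exact: ler0n.
(* For t >= tt the variance, at most C e^(- t / 4), is at most t^(-4) / 2; this is x^5 <= 5! e^x at
   x = t / 4. *)
pose tt := 2 * C * (f5 * 4 ^+ 5).
have tt0 : 0 <= tt by apply: mulr_ge0; [rewrite mulr_ge0// ltW|rewrite mulr_ge0// exprn_ge0].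
have cH48 : 0 < 48 / cH by rewrite divr_gt0.
exists (96 + 2 * B + 8 * a + tt + 48 / cH) => [|t ht]; first by move: B0 a0 tt0 cH48; clear; lra.
have t96 : 96 <= t by move: ht B0 a0 tt0 cH48; clear; lra.
have tB : 2 * B <= t by move: ht B0 a0 tt0 cH48; clear; lra.
have ta : 8 * a <= t by move: ht B0 a0 tt0 cH48; clear; lra.
have ttt : tt <= t by move: ht B0 a0 tt0 cH48; clear; lra.
have t48 : 48 / cH <= t by move: ht B0 a0 tt0 cH48; clear; lra.
clear ht; have t0 : 0 < t by move: t96; clear; lra.
pose i := t^-1; have i0 : 0 < i by rewrite invr_gt0.
have it : i * t = 1 by rewrite mulVf// gt_eqF.
have i1 : i <= 1 by rewrite invf_le1//; move: t96; clear; lra.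
have Bi : B * i <= 1 / 2 by rewrite ler_pdivrMr//; move: tB; clear; lra.
have ai : a * i <= 1 / 8 by rewrite ler_pdivrMr//; move: ta; clear; lra.
pose h := (c - B * i) * i.
have ha : `|h| <= a * i.
  rewrite normrM (gtr0_norm i0) ler_pM2r//; apply: le_trans (ler_normB _ _) _.
  by rewrite /a lerD2l ger0_norm ?mulr_ge0 ?(ltW B0) ?(ltW i0)//; move: Bi; clear; lra.
have [h1 h2] : - (a * i) <= h /\ h <= a * i by move: ha; rewrite ler_norml => /andP.
pose U := t - c + B * i.
have UE : U = t * (1 - h) by rewrite /U /h; move: it; clear => it; rewrite mulrBr mulr1 mulrCA [t * i]mulrC it; ring.
have U2 : t <= 2 * U by rewrite UE; move: h1 h2 ai t0; clear => *; nra.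
have U48 : 48 <= U by move: U2 t96; clear; lra.
have U0 : 0 < U by move: U48; clear; lra.
pose j := U^-1; have j0 : 0 < j by rewrite invr_gt0.
have ji : j <= 2 * i.
  by rewrite /i /j -[U^-1]div1r ler_pdivrMr// -mulrA [t^-1 * U]mulrC mulrA ler_pdivlMr ?mul1r.
have jE : j = i + h * j.
  have jU : j * U = 1 by rewrite mulVf// gt_eqF.
  have E : (t - t * (1 - h)) * i = h * (i * t) by ring.
  have -> : h * j = (t - U) * i * j by rewrite UE E it mulr1.
  by rewrite mulrBl mulrBl [t * i]mulrC it mul1r [U * i]mulrC -mulrA [U * j]mulrC jU; ring.
pose k' := expR U; have k'0 : 0 < k' by exact: expR_gt0.
exists k' => // N kN.
have k'48 : expR 48 <= k' by rewrite ler_expR.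
have := HF k' k'48 N kN; have [+ HV] := Hm k' k'48 N kN; rewrite /k' expRK -/k' in HV *.
rewrite -[U ^- 2]exprVn -/j => Hmm HFF; rewrite -/i.
have j2 : j ^+ 2 <= 4 * i ^+ 2 by rewrite (_ : 4 * i ^+ 2 = (2 * i) ^+ 2); [apply: lerXn2r; rewrite ?nnegrE; move: ji i0 j0; clear; lra|ring].
have Cj : C * j ^+ 2 <= 4 * C * i ^+ 2 by have := ler_wpM2l (ltW C0) j2; clear; lra.
have hj : `|h * j| <= 2 * a * i ^+ 2.
  rewrite normrM (gtr0_norm j0); apply: le_trans (_ : _ <= (a * i) * (2 * i)) _; first by apply: ler_pM => //; exact: ltW.
  by rewrite expr2; clear; lra.
have [hj1 hj2] : - (2 * a * i ^+ 2) <= h * j /\ h * j <= 2 * a * i ^+ 2 by move: hj; rewrite ler_norml => /andP.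
have lnU : ln t - h - 2 * (a ^+ 2 * i ^+ 2) <= ln U.
  have l1 := @ln1D_ge R (- h) ltac:(move: h2 ai; clear; lra).
  rewrite UE lnM ?posrE//; last by move: h2 ai; clear; lra.
  have hh : h ^+ 2 <= a ^+ 2 * i ^+ 2.
    rewrite -exprMn -[h ^+ 2]real_normK ?num_real//.
    by apply: lerXn2r; rewrite ?nnegrE //; apply: mulr_ge0; exact: ltW.
  by move: l1 hh; rewrite sqrrN; clear; lra.
split.
- apply: le_trans HV _; apply: (@le_trans _ _ (C * expR (- (t / 4)))).
    by rewrite ler_pM2l// ler_expR; move: U2; clear; lra.
  have t4 : 0 < t / 4 by rewrite divr_gt0.
  have := @expRN_leX R (t / 4) 5 t4; rewrite -f5E => e5.
  apply: le_trans (ler_wpM2l (ltW C0) e5) _.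
  have -> : f5 / (t / 4) ^+ 5 = f5 * 4 ^+ 5 * i ^+ 5 by rewrite expr_div_n invf_div mulrA exprVn.
  have -> : C * (f5 * 4 ^+ 5 * i ^+ 5) = tt * i * (i ^+ 2) ^+ 2 / 2 by rewrite /tt -exprM; field.
  have ti : tt * i <= 1 by rewrite ler_pdivrMr// mul1r.
  by rewrite ler_pM2r ?invr_gt0// ler_piMl ?sqr_ge0.
- have cj : c * j >= c * i - 2 * `|c| * a * i ^+ 2.
    rewrite jE [c * (_ + _)]mulrDr lerD2l; apply: le_trans (_ : - (`|c| * `|h * j|) <= _); last by rewrite -normrM lerNl -normrN ler_norm.
    rewrite lerN2; have := ler_wpM2l n1 hj; clear; lra.
  have l2 := ler_wpM2l (ltW cH0) lnU; have l3 := ler_wpM2l (ltW cH0) cj.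
  have hE : h = c * i - B * i ^+ 2 by rewrite /h; ring.
  have BE2 : cH * B * i ^+ 2 = (2 + 4 * C) * i ^+ 2 + cH * (2 * a ^+ 2) * i ^+ 2 + cH * (2 * `|c| * a) * i ^+ 2.
    by rewrite -BE; ring.
  move: Hmm; rewrite ler_norml => /andP[q1 _]; rewrite hE in l2.
  move: q1 l2 l3 Cj BE2; move: (m N k') (ln U) (ln t) (C * j ^+ 2); clear => x y z w; lra.
have kB : k' <= expR (t - c) * (1 + 2 * B * i).
  rewrite /k' /U expRD ler_pM2l ?expR_gt0//.
  have eN := expR_ge1Dx (- (B * i)); have e0 := expR_gt0 (B * i).
  have ee : expR (- (B * i)) * expR (B * i) = 1 by rewrite -expRD addrC subrr expR0.
  have Bi0 : 0 <= B * i by rewrite mulr_ge0// ltW.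
  have e1 := ler_wpM2r (ltW e0) eN; rewrite ee in e1.
  have e2 : (1 + 2 * (B * i)) * (1 - B * i) >= 1 by move: Bi Bi0; move: (B * i) => x; clear; nra.
  move: e0 e1 e2 Bi Bi0; rewrite -mulrA; move: (B * i) (expR _) => x e; clear => *; nra.
(* The loss of 1 in the exponent is absorbed in the relative error O(1 / t); the condition t >= 48 /
   cH is used here. *)
have k1 : 1 <= cH * expR (t - c) * i * i.
  have ct := ler_norm c; have e3 := @expR_ge_pow R 3 (t / 2) ltac:(move: t0; clear; lra).
  have e4 : expR (t / 2) <= expR (t - c) by rewrite ler_expR; move: ta ct t0; rewrite /a; clear; move: (`|c|) => n; lra.
  have e5 : (t / 2) ^+ 3 <= 6 * expR (t - c) by apply: le_trans e3 _; rewrite (_ : (3 `!)%:R = 6 :> R)// ler_pM2l.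
  have c48 : 48 <= t * cH by rewrite -ler_pdivrMr.
  have e6 : t ^+ 2 <= cH * expR (t - c).
    have e7 := ler_wpM2l (ltW cH0) e5; have e8 := ler_wpM2l (sqr_ge0 t) c48.
    have -> : t ^+ 2 = t ^+ 2 * 48 / 48 by field.
    rewrite ler_pdivrMr//; apply: le_trans e8 _.
    by rewrite (_ : t ^+ 2 * (t * cH) = 8 * (cH * (t / 2) ^+ 3)); [move: e7; clear; lra|field].
  have := ler_wpM2r (ltW (mulr_gt0 i0 i0)) e6; rewrite [X in _ <= X]mulrA; apply: le_trans.
  by rewrite (_ : t ^+ 2 * (i * i) = (i * t) ^+ 2); [rewrite it expr1n|ring].
have jb : cH * j + 2 * (C * j ^+ 2) + i ^+ 2 <= cH * i * (1 + G * i).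
  have -> : cH * i * (1 + G * i) = cH * i + (cH * G) * i ^+ 2 by ring.
  have jE' : cH * j = cH * i + cH * (h * j) by rewrite -mulrDr -jE.
  have := ler_wpM2l (ltW cH0) hj2; rewrite GE jE'; move: Cj; move: (C * j ^+ 2) (h * j) => x y; clear; lra.
have jk := ler_wpM2l (ltW k'0) jb.
have kk : k' * (cH * i * (1 + G * i)) <= expR (t - c) * (1 + 2 * B * i) * (cH * i * (1 + G * i)).
  rewrite ler_wpM2r// mulr_ge0//; first by rewrite mulr_ge0// ltW.
  by rewrite addr_ge0// mulr_ge0// ltW.
have kkk : expR (t - c) * (1 + 2 * B * i) * (cH * i * (1 + G * i)) + 1 <= cH * expR (t - c) * i * (1 + K * i).
  have z0 : 0 < cH * expR (t - c) * i by rewrite mulr_gt0// mulr_gt0// expR_gt0.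
  have -> : expR (t - c) * (1 + 2 * B * i) * (cH * i * (1 + G * i)) = cH * expR (t - c) * i * (1 + (2 * B + G) * i + 2 * (B * G) * (i * i)) by ring.
  have ii : i * i <= i by rewrite ler_piMr// ltW.
  have i2 := ler_wpM2l (ltW (mulr_gt0 z0 BG)) ii.
  have KE : K = 2 * B + G + 2 * (B * G) + 1 by rewrite /K; ring.
  rewrite KE; move: k1 i2; move: (cH * expR _ * i) (B * G) => z w; clear; lra.
rewrite mulNr.
move: Hmm HFF; rewrite !ler_norml => /andP[_ q2] /andP[q3 _].
have q4 := ler_wpM2l (ltW k'0) q2.
move: q3 q4 jk kk kkk; move: (expR (t - c) * (1 + _) * _) (cH * expR (t - c) * i * _) (k' * (cH * i * _)) => x y z.
move: (Fc N k') (m N k') (ln U) => f mm l; clear; lra.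
Qed.

Lemma exponent_error {R : realType} (M K1 K2 t : R) (a : R) : 0 < M -> 0 < t -> 0 <= K1 -> 0 <= K2 ->
  expR (- M * (1 + K2 / t)) <= a -> a <= expR (- M * (1 - K1 / t)) ->
  exists E : R, `|E| <= (K1 + K2) / t /\ a = expR (- M * (1 + E)).
Proof.
move=> M0 t0 k1 k2 h1 h2; have a0 : 0 < a by apply: lt_le_trans h1; exact: expR_gt0.
exists (- ln a / M - 1); split; last first.
  by rewrite addrC subrK mulNr mulrCA mulfV ?gt_eqF// mulr1 opprK lnK.
have {}h1 : - ln a <= M * (1 + K2 / t) by rewrite lerNl -mulNr -ler_expR lnK.
have {}h2 : M * (1 - K1 / t) <= - ln a by rewrite lerNr -mulNr -ler_expR lnK.
have e1 : 0 <= K1 / t by rewrite divr_ge0// ltW.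
have e2 : 0 <= K2 / t by rewrite divr_ge0// ltW.
have g1 : - ln a / M <= 1 + K2 / t by rewrite ler_pdivrMr// mulrC.
have g2 : 1 - K1 / t <= - ln a / M by rewrite ler_pdivlMr// mulrC.
rewrite ler_norml mulrDl; move: g1 g2 e1 e2; move: (- ln a / M) (K1 / t) (K2 / t) => x y z; clear => *; apply/andP; split; lra.
Qed.

Lemma sqrt_ln {R : realType} (u : R) : 0 < u -> Num.sqrt u = expR (ln u / 2).
Proof.
move=> u0; have E : u = expR (ln u / 2) ^+ 2 by rewrite -expRM_natl mulrC divfK// lnK.
by rewrite [in LHS]E sqrtr_sqr ger0_norm ?expR_ge0.
Qed.

Section LargeDeviation.
Context {R : realType} {d : measure_display} {T : measurableType d}.
Variables (P : probability T R) (X : nat -> T -> R[i]).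
Hypothesis Xrange : forall p w, prime p -> X p w \in vals.
Hypothesis Xmeas : forall p v, prime p -> measurable (X p @^-1` [set v]).
Hypothesis Xindep : indep_primes P X.

(** The event [A t] enters only through a sandwich: whenever the later partial sums stay within e,
    membership is decided by the partial sum up to an error e in the threshold. Both tails of |L(1,
    X)| have this form. *)
Lemma large_dev (sg rho cH Gam Ca : R) (Hs Ls rs : nat -> R) (A : R -> set T) :
  0 < rho -> rho <= 2 -> 0 < cH -> 0 <= Ca ->
  (forall p, prime p -> adm rho p%:R^-1 (Hs p) (Ls p) (rs p)) ->
  (forall n, (24 <= n)%N -> `|\sum_(0 <= i < n.+1) Hp Hs i - cH * (ln (ll n) + Gam)| <= Ca * (ll n)^-1 ^+ 2) ->
  (forall p, prime p -> law rho (Hs p) (Ls p) (rs p) (qX P X p) (xi sg p)) ->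
  (forall t, measurable (A t)) ->
  (forall t n e w, 1 <= t -> (forall M, (n < M)%N -> `|SX X sg M w - SX X sg n.+1 w| <= e) ->
     (A t w -> cH * (ln t + Gam) - e <= SX X sg n.+1 w) /\ (cH * (ln t + Gam) + e < SX X sg n.+1 w -> A t w)) ->
  exists2 K : R, 0 <= K & exists2 t0 : R, 1 <= t0 & forall t, t0 <= t ->
    exists E : R, `|E| <= K / t /\ P (A t) = (expR (- (cH * expR (t - Crho rho) / t) * (1 + E)))%:E.
Proof.
move=> r0 r2 cH0 Ca0 Had HA Hlaw mA HAe.
have rr p : prime p -> 0 <= rs p by move=> pp; have [_ _ _ _ /andP[]] := Had p pp.
have [C1 C10 HF] := F_asym r0 r2 cH0 Ca0 Had HA.
have [C2 C20 Hm] := mean_asym r0 r2 cH0 Ca0 Had HA.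
pose C := C1 + C2; have C0 : 0 < C by rewrite addr_gt0.
have C1C : C1 <= C by rewrite lerDl ltW.
have C2C : C2 <= C by rewrite lerDr ltW.
have sq0 (k : R) : 0 <= (ln k ^+ 2)^-1 by rewrite invr_ge0 sqr_ge0.
pose m N k := \sum_(0 <= p < N | prime p) Tt rho (Hs p) (Ls p) (rs p) k.
pose v N k := \sum_(0 <= p < N | prime p) Vv rho (Hs p) (Ls p) (rs p) k.
have HF' k : expR 48 <= k -> forall N, k ^+ 2 <= N%:R ->
   `|Fcum rho Hs Ls rs N k - (cH * k * (ln (ln k) + Gam) + cH * (Crho rho - 1) * k / ln k)| <= C * k / ln k ^+ 2.
  move=> k48 N kN; apply: le_trans (HF k k48 N kN) _; rewrite ler_wpM2r// ler_wpM2r//.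
  by apply: le_trans k48; exact: expR_ge0.
have Hm' k : expR 48 <= k -> forall N, k ^+ 2 <= N%:R ->
   `|m N k - cH * (ln (ln k) + Gam + Crho rho / ln k)| <= C / ln k ^+ 2 /\ v N k <= C * expR (- (1 / 2) * ln k).
  move=> k48 N kN; have [h1 h2] := Hm k k48 N kN; split.
    by apply: le_trans h1 _; rewrite ler_wpM2r.
  by apply: le_trans h2 _; rewrite ler_wpM2r ?expR_ge0.
have [K1 K10 [t1 t11 HU]] := upper_exp cH0 C0 HF'.
have [K2 K20 [t2 t21 HL]] := lower_exp cH0 C0 HF' Hm'.
exists (K1 + K2); first by rewrite addr_ge0// ltW.
exists (Num.max t1 t2) => [|t]; first by rewrite le_max t11.
rewrite ge_max => /andP[tt1 tt2]; have t1' : 1 <= t by exact: le_trans tt1.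
have t0 : 0 < t by lra.
have {}HU := HU t tt1; have [k k0 {}HL] := HL t tt2.
set y := cH * (ln t + Gam) in HL HU; set M := cH * expR (t - Crho rho) / t.
have M0 : 0 < M by rewrite divr_gt0// mulr_gt0// expR_gt0.
pose i2 := t^-1 ^+ 2; have i20 : 0 < i2 by rewrite exprn_gt0// invr_gt0.
pose eta := i2 / 4; have eta0 : 0 < eta by rewrite divr_gt0.
have PA : P (A t) = (fine (P (A t)))%:E by rewrite fineK// fin_num_measure//.
set pa := fine (P (A t)) in PA.
(* The cut n depends on an arbitrary e that bounds the probability of the exceptional event. The
   exponential estimates do not involve n, so e can be let go to 0 afterwards. *)
have pick e : 0 < e -> exists n, [/\ (0 < n)%N, expR (t - Crho rho) ^+ 2 <= n.+1%:R, k ^+ 2 <= n.+1%:R, 6 * n%:R^-1 <= eta &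
    300 * n%:R^-1 / eta ^+ 2 <= e].
  move=> e0; pose z := expR (t - Crho rho) ^+ 2 + k ^+ 2 + 6 / eta + 300 / eta ^+ 2 / e.
  have z1 : 0 <= expR (t - Crho rho) ^+ 2 by exact: sqr_ge0.
  have z2 : 0 <= k ^+ 2 by exact: sqr_ge0.
  have z3 : 0 <= 6 / eta by rewrite divr_ge0// ltW.
  have z4 : 0 <= 300 / eta ^+ 2 / e.
    by apply: divr_ge0; [apply: divr_ge0; [exact: ler0n|exact: sqr_ge0]|exact: ltW].
  have zE : z = expR (t - Crho rho) ^+ 2 + k ^+ 2 + 6 / eta + 300 / eta ^+ 2 / e by [].
  have z0 : 0 <= z by rewrite zE !addr_ge0.
  pose n := (Num.truncn z).+1.
  have zn : z <= n%:R by rewrite ltW//; have := truncn_itv z0 => /andP[].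
  have n0 : (0 : R) < n%:R by rewrite ltr0n.
  have nS : (n%:R : R) <= n.+1%:R by rewrite ler_nat.
  exists n; move: zn nS; rewrite zE => zn nS; split => //.
  - by move: zn nS z1 z2 z3 z4; move: (_ ^+ 2) (k ^+ 2) (6 / _) (_ / e) => *; lra.
  - by move: zn nS z1 z2 z3 z4; move: (expR _ ^+ 2) (k ^+ 2) (6 / _) (_ / e) => *; lra.
  - rewrite ler_pdivrMr// mulrC -ler_pdivrMr//.
    by move: zn z1 z2 z3 z4; move: (expR _ ^+ 2) (k ^+ 2) (6 / _) (_ / e) => *; lra.
  - rewrite mulrAC ler_pdivrMr// [e * _]mulrC -ler_pdivrMr//.
    by move: zn z1 z2 z3 z4; move: (expR _ ^+ 2) (k ^+ 2) (6 / _) (_ / e) => *; lra.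
have ev n : (0 < n)%N -> 6 * n%:R^-1 <= eta -> exists D : set T, [/\ measurable D, (P D <= (300 * n%:R^-1 / eta ^+ 2)%:E)%E,
    A t `<=` [set w | y - i2 < SX X sg n.+1 w] `|` D & [set w | y + i2 < SX X sg n.+1 w] `<=` A t `|` D].
  move=> n0 n6; have [D [mD PD HD]] := tail_event Xrange Xmeas Xindep r0 r2 eta0 n0 Had Hlaw.
  have sm w : ~ D w -> forall M, (n < M)%N -> `|SX X sg M w - SX X sg n.+1 w| <= i2 / 2.
    move=> /HD h M' /h /le_trans; apply; have e4 : i2 = 4 * eta by rewrite /eta mulrCA mulfV// mulr1.
    by rewrite e4; move: n6; move: (6 * _) => q; lra.
  exists D; split=> // w; have [?|/sm h] := pselect (D w); try by right.
    have [h1 _] := HAe t n (i2 / 2) w t1' h; move=> /h1; rewrite -/y => h2; left => /=.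
    by apply: lt_le_trans h2; rewrite ltrD2l ltrN2; lra.
  have [_ h1] := HAe t n (i2 / 2) w t1' h; rewrite /= => h2; left; apply: h1; rewrite -/y.
  by apply: le_lt_trans h2; rewrite lerD2l; lra.
have sumE n (f : nat -> R) : \sum_(p <- prs 0 n) f p = \sum_(0 <= p < n | prime p) f p by exact: big_prs.
have up : pa <= expR (- M * (1 - K1 / t)).
  apply/ler_addgt0Pr => e e0; have [n [n0 kn _ n6 ne]] := pick e e0.
  have [D [mD PD AD _]] := ev n n0 n6.
  have [mE PE] := SX_event Xrange Xmeas Xindep sg n.+1 (y - i2).
  have ps := prs_prime 0 n.+1; have k0' : 0 <= expR (t - Crho rho) by exact: expR_ge0.
  have h : (P [set w | (y - i2 < SX X sg n.+1 w)%R] <= (expR (- M * (1 - K1 / t)))%:E)%E.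
    rewrite PE lee_fin.
    apply: le_trans (@Ex_chernoff R rho Hs Ls rs _ _ r0 rr Hlaw (expR (t - Crho rho)) (prs 0 n.+1) (y - i2) k0' ps) _.
    by rewrite ler_expR sumE; exact: HU.
  rewrite -lee_fin -PA; apply: (@le_trans _ _ (P ([set w | y - i2 < SX X sg n.+1 w] `|` D))).
    by apply: le_measure; rewrite ?inE//; exact: measurableU.
  apply: le_trans (measureU2 _ mE mD) _; rewrite EFinD; apply: leeD; first exact: h.
  by apply: le_trans PD _; rewrite lee_fin.
have dn : expR (- M * (1 + K2 / t)) <= pa.
  apply/ler_addgt0Pr => e e0; have [n [n0 _ kn n6 ne]] := pick e e0.
  have [D [mD PD _ AD]] := ev n n0 n6.
  have [mE PE] := SX_event Xrange Xmeas Xindep sg n.+1 (y + i2).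
  have [v1 m1 F1] := HL n.+1 kn; have ps := prs_prime 0 n.+1.
  rewrite -lee_fin EFinD -PA.
  apply: (@le_trans _ _ (P [set w | y + i2 < SX X sg n.+1 w])); last first.
    apply: (@le_trans _ _ (P (A t `|` D))); first by apply: le_measure; rewrite ?inE//; exact: measurableU.
    apply: le_trans (measureU2 _ (mA t) mD) _; apply: leeD => //.
    by apply: le_trans PD _; rewrite lee_fin.
  rewrite PE lee_fin.
  apply: (@le_trans _ _ (Ex (qX P X) (prs 0 n.+1) (fun l => (\sum_(p <- prs 0 n.+1) tm rho Hs Ls rs k p - i2 < Ss (xi sg) (prs 0 n.+1) l)%R%:R))); last first.
    have m1' : y + i2 <= \sum_(p <- prs 0 n.+1) tm rho Hs Ls rs k p - i2 by rewrite sumE; exact: m1.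
    apply: (Ex_le Hlaw ps) => l.
    have [h|h] := ltP (\sum_(p <- prs 0 n.+1) tm rho Hs Ls rs k p - i2) (Ss (xi sg) (prs 0 n.+1) l); last exact: ler0n.
    by rewrite (le_lt_trans m1' h).
  have vv : \sum_(p <- prs 0 n.+1) tv rho Hs Ls rs k p <= i2 ^+ 2 / 2 by rewrite sumE.
  apply: le_trans (@Ex_tilt R rho Hs Ls rs _ _ r0 rr Hlaw k (prs 0 n.+1) i2 (ltW k0) i20 ps vv).
  rewrite !sumE ler_pdivlMr//; apply: le_trans (_ : _ <= expR (- M * (1 + K2 / t)) * expR 1) _.
    by rewrite ler_wpM2l ?expR_ge0//; have := @expR_ge1Dx R 1; lra.
  rewrite -expRD ler_expR -lerBrDr; exact: F1.
have [E [E1 E2]] := exponent_error M0 t0 (ltW K10) (ltW K20) dn up.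
by exists E; split => //; rewrite PA E2.
Qed.

End LargeDeviation.

Unset Implicit Arguments. Set Strict Implicit. Set Printing Implicit Defensive.

Theorem theorem1p2 (R : realType) (d : measure_display) (T : measurableType d)
  (P : probability T R) (X : nat -> T -> R[i])
  (Xrange : forall p w, prime p ->
     X p w \in [:: 0; 1; omega3; omega3 ^+ 2])
  (Xmeas : forall p v, prime p -> measurable (X p @^-1` [set v]))
  (Xlaw23 : forall p, prime p -> (p %% 3 = 2)%N \/ p = 3%N ->
     P (X p @^-1` [set 0]) = 0%E /\
     forall v, v \in [:: 1; omega3; omega3 ^+ 2] ->
       P (X p @^-1` [set v]) = (3^-1 : R)%:E)
  (Xlaw1 : forall p, prime p -> (p %% 3 = 1)%N ->
     P (X p @^-1` [set 0]) = (2 / (p%:R + 2) : R)%:E /\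
     forall v, v \in [:: 1; omega3; omega3 ^+ 2] ->
       P (X p @^-1` [set v]) = (p%:R / (3 * (p%:R + 2)) : R)%:E)
  (Xindep : indep_primes P X) :
  (exists K tau0 : R, 0 < tau0 /\ forall tau : R, tau0 <= tau ->
     exists E : R, `|E| <= K / tau /\
       P [set w | ((expR euler_gamma * tau)%:E < absL X w)%E] =
       (expR (- (2 * expR (tau - Cmax) / tau) * (1 + E)))%:E) /\
  (exists K tau0 : R, 0 < tau0 /\ forall tau : R, tau0 <= tau ->
     exists E : R, `|E| <= K / tau /\
       P [set w | (absL X w < (Num.sqrt (zeta3 / expR euler_gamma) / tau)%:E)%E] =
       (expR (- (expR (tau ^+ 2 - Cmin) / tau ^+ 2) * (1 + E)))%:E).
Proof.
have Xr p w : prime p -> X p w \in vals by exact: Xrange.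
(* As sg is 1 or - 1, the sums for sg and for 1 have equal deviations in absolute value, and both
   tails share this enclosure of |L(1, X)|. *)
have between sg n e w : (forall M, (n < M)%N -> `|SX X sg M w - SX X sg n.+1 w| <= e) -> sg ^+ 2 = 1 ->
    ((expR ((SX X 1 n.+1 w - e) / 2))%:E <= absL X w)%E /\ (absL X w <= (expR ((SX X 1 n.+1 w + e) / 2))%:E)%E.
  move=> h s2; apply: (@absL_between _ _ _ _ w n) => M nM; rewrite (partialL_SX Xr) !ler_expR.
  have : `|SX X 1 M w - SX X 1 n.+1 w| <= e.
    have := h M nM; have sgE N : SX X sg N w = sg * SX X 1 N w.
      by rewrite /SX mulr_sumr; apply: eq_bigr => p _; rewrite /xi mul1r !mulrA.
    have sg1 : `|sg| = 1 by apply/eqP; rewrite -sqrp_eq1// real_normK ?num_real// s2.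
    by rewrite !sgE -mulrBr normrM sg1 mul1r.
  rewrite ler_norml => /andP[h1 h2]; apply/andP; split; lra.
have rho2 : (0 : R) < 2 by [].
split.
- have [Ca Ca0 HA] := @mertens_max R.
  pose A (t : R) := [set w | ((expR euler_gamma * t)%:E < absL X w)%E].
  have mA t : measurable (A t).
    by rewrite /A -[X in measurable X]setTI; apply: emeasurable_fun_o_infty => //; exact: (absL_meas Xr Xmeas Xindep).
  have had p : prime p -> adm 2 (p%:R^-1 : R) (2 * Lp p) (Mp p) (rq p) by move=> pp; apply: adm_max => //; exact: rq_bound.
  have hlaw p : prime p -> law 2 (2 * Lp p) (Mp p) (rq p) (qX P X p) (xi 1 p) by exact: law_max.
  have hev t n e w : 1 <= t -> (forall M, (n < M)%N -> `|SX X 1 M w - SX X 1 n.+1 w| <= e) ->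
     (A t w -> 2 * (ln t + euler_gamma) - e <= SX X 1 n.+1 w) /\ (2 * (ln t + euler_gamma) + e < SX X 1 n.+1 w -> A t w).
    move=> t1 h; have [l u] := between 1 n e w h (expr1n _ _).
    have tp : 0 < t by lra.
    have E : expR euler_gamma * t = expR ((2 * (ln t + euler_gamma)) / 2).
      by rewrite mulrAC mulfV// mul1r expRD lnK// mulrC.
    rewrite /A /= E; split => [h1|h1].
      by have := lt_le_trans h1 u; rewrite lte_fin ltr_expR; move: (SX X 1 n.+1 w) (2 * _) => x y; lra.
    by apply: lt_le_trans l; rewrite lte_fin ltr_expR; move: h1; move: (SX X 1 n.+1 w) (2 * _) => x y; lra.
  have [K K0 [t0 t01 H]] := large_dev Xr Xmeas Xindep rho2 (lexx _) rho2 Ca0 had HA hlaw mA hev.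
  exists K, t0; split => [|tau tt]; first by lra.
  by have [E [E1 E2]] := H tau tt; exists E; split => //; rewrite [LHS]E2 CmaxE.
have [Ca Ca0 HA] := @mertens_min R; have [z0 _] := @zeta3_ad R.
have g0 := expR_gt0 (@euler_gamma R).
(* Parametrised by t = tau^2: the event reads - 2 ln |L| > ln t + gamma - ln zeta(3), the threshold
   of [large_dev] with cH = 1. *)
pose A (t : R) := [set w | (absL X w < (Num.sqrt (zeta3 / expR euler_gamma) / Num.sqrt t)%:E)%E].
have mA t : measurable (A t).
  by rewrite /A -[X in measurable X]setTI; apply: emeasurable_fun_infty_o => //; exact: (absL_meas Xr Xmeas Xindep).
have h2 : (0 : R) < 2^-1 by rewrite invr_gt0.
have h22 : (2^-1 : R) <= 2 by lra.
have had p : prime p -> adm 2^-1 (p%:R^-1 : R) (Mp p) (2 * Lp p) (rq p / 2).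
  move=> pp; apply: (adm_min (r := fun p => rq p / 2)) => //.
  by have := @rq_bound R p; move: (rq p) (6 * _) => x y /andP[? ?]; apply/andP; split; lra.
have hlaw p : prime p -> law 2^-1 (Mp p) (2 * Lp p) (rq p / 2) (qX P X p) (xi (-1) p) by exact: law_min.
have hev t n e w : 1 <= t -> (forall M, (n < M)%N -> `|SX X (-1) M w - SX X (-1) n.+1 w| <= e) ->
   (A t w -> 1 * (ln t + (euler_gamma - ln zeta3)) - e <= SX X (-1) n.+1 w) /\
   (1 * (ln t + (euler_gamma - ln zeta3)) + e < SX X (-1) n.+1 w -> A t w).
  have s1 : (-1 : R) ^+ 2 = 1 by rewrite sqrrN expr1n.
  move=> t1 h; have [l u] := between (-1) n e w h s1.
  have tp : 0 < t by lra.
  have E : Num.sqrt (zeta3 / expR euler_gamma) / Num.sqrt t = expR (- (1 * (ln t + (euler_gamma - ln zeta3))) / 2).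
    rewrite (sqrt_ln tp) sqrt_ln ?divr_gt0// -[(expR (ln t / 2))^-1]expRN -expRD; congr expR.
    by rewrite lnM ?posrE ?invr_gt0// lnV ?posrE// expRK; field.
  rewrite /A /= E !SX_opp; split => [h1|h1].
    by have := le_lt_trans l h1; rewrite lte_fin ltr_expR; move: (SX X 1 n.+1 w) (1 * _) => x y; lra.
  by apply: le_lt_trans u _; rewrite lte_fin ltr_expR; move: h1; move: (SX X 1 n.+1 w) (1 * _) => x y; lra.
have [K K0 [t0 t01 H]] := large_dev Xr Xmeas Xindep h2 h22 ltr01 Ca0 had HA hlaw mA hev.
exists K, t0; split => [|tau tt]; first by lra.
have tau1 : 1 <= tau by lra.
have tau2 : tau <= tau ^+ 2 by rewrite expr2 ler_peMr//; lra.
have [E [E1 E2]] := H (tau ^+ 2) (le_trans tt tau2); exists E; split.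
  (* The error obtained at t = tau^2 is O(1 / tau^2), stronger than the one stated. *)
  apply: le_trans E1 _; rewrite ler_wpM2l// lef_pV2 ?posrE ?exprn_gt0//; lra.
move: E2; rewrite /A sqrtr_sqr ger0_norm; last by lra.
by rewrite mul1r CminE.
Qed.
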